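(* Let the delay problem $$u'(t)+Au(t)=g(t,u(t),u^\tau(t)),\ t>0,\qquad u(t)=\phi(t),\ t\le 0,$$ satisfy the assumptions listed in the context, let $u$ be its exact solution and $f(t)=g(t,u(t),u^\tau(t))$. Let $c_1,\dots,c_s\in[0,1]$ be distinct collocation parameters whose underlying quadrature rule is of order $s+1$, i.e. $\sum_{i=1}^sb_i(0)c_i^s=\frac1{s+1}$ with $b_i(0)=\int_0^1\ell_i(\xi)\,\mathrm d\xi$. Fix $\varrho>1$. Assume that $f:\mathcal I^\mu\to V$ is $s+1$ times differentiable for $\mu=1,\dots,m+1$, with $f^{(s)}\in L^\infty(0,T;V)$ and $f^{(s+1)}\in L^1(0,T;V)$. Then there exist constants $h_0>0$, $R_0>0$ and $C>0$, where $C$ depends on $T$ but $h_0,R_0,C$ are independent of the step size sequence, such that for every admissible mesh $0=t_0<\dots<t_N=T$ with $h_j\le\varrho h_{j+1}$ for all $j$ and $h=\max_{1\le j\le N}h_j\le h_0$ there is a number $C_{\mathrm S}$ with $$1\le C_{\mathrm S}\le\varrho\ln\frac{T}{\min_{1\le j\le N}h_j}+2$$ for which the numerical solution $W$ of the ERKC-C method (the one with stages satisfying $\|W_{n,i}-u(t_{n,i})\|_V\le R_0$) fulfils $$\max_{t\in[0,T]}\|W(t)-u(t)\|_V\le CC_{\mathrm S}h^{s+1}\Big(\int_0^T\|f^{(s+1)}(\sigma)\|_V\,\mathrm d\sigma+\sup_{\sigma\in[0,T]}\|f^{(s)}(\sigma)\|_V\Big).$$ Moreover, if the step sizes are constant ($h_j=h$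 for all $j$), or if $X$ is a separable Hilbert space and $A$ is linear, self-adjoint and positive definite with compact inverse, then the estimate holds with a number $C_{\mathrm S}$ that is independent of the step size sequence.
   Context: Setting. $(X,\|\cdot\|)$ is a Banach space, $T>0$. $A:D(A)\to X$ is a sectorial operator with $\overline{D(A)}=X$ and $\mathrm{Re}\,\sigma(A)>0$; thus $-A$ generates an analytic semigroup $\{\mathrm e^{-tA}\}_{t\ge0}$ and the fractional powers of $A$ are defined. For a fixed $0\le\alpha<1$, $V=\{v\in X:A^\alpha v\in X\}$ (i.e. $V=D(A^\alpha)$) with $\|v\|_V=\|A^\alpha v\|$. Delay. $\tau:[0,\infty)\to\mathbb R^+$ is continuous, there is $\tau_0>0$ with $\tau(t)\ge\tau_0$ for all $t\ge0$, and $t-\tau(t)$ is strictly increasing for $t\ge 0$. For a function $v$ of time, $v^\tau(t)=v(t-\tau(t))$. The initial function $\phi$ is $V$-valued. Exact solution. The problem has a solution $u$ with values in $V$ on $[0,T]$, $u=\phi$ for $t\le0$, satisfying the variation-of-constants formula $u(t)=\mathrm e^{-(t-r)A}u(r)+\int_r^t\mathrm e^{-(t-\sigma)A}g(\sigma,u(\sigma),u^\tau(\sigma))\,\mathrm d\sigma$ for $0\le r\le t\le T$. Nonlinearity. $g:[0,T]\times V\times V\to X$ is locally Lipschitz in a strip along $u$: there are $R>0$ and $L=L(R,T)$ with $\|g(t,v_1,w_1)-g(t,v_2,w_2)\|\le L(\|v_1-v_2\|_V+\|w_1-w_2\|_V)$ for all $t\in[0,T]$ and all $v_1,v_2,w_1,w_2\in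 V$ with $\max(\|v_1-u(t)\|_V,\|v_2-u(t)\|_V,\|w_1-u^\tau(t)\|_V,\|w_2-u^\tau(t)\|_V)\le R$. Discontinuity points. $\xi_0=0$, and $\xi_{\mu+1}-\tau(\xi_{\mu+1})=\xi_\mu$; $J=\{\xi_\mu:\xi_\mu<T\}=\{\xi_0,\dots,\xi_m\}$ and $\mathcal I^\mu=[\xi_{\mu-1},\min\{\xi_\mu,T\}]$ for $\mu=1,\dots,m+1$. Derivatives of functions that are only piecewise smooth are understood separately on each $\mathcal I^\mu$ (one-sided at endpoints), and suprema over $[0,T]$ of such derivatives are taken over all segments $\mathcal I^\mu$. Mesh. An admissible mesh is $0=t_0<t_1<\dots<t_N=T$ containing $J$. Put $I_{n+1}=[t_n,t_{n+1}]$, $h_{n+1}=t_{n+1}-t_n$, $h=\max_n h_n$. $s\ge1$ and $t_{n,i}=t_n+c_ih_{n+1}$. Coefficients. $\ell_j(\rho)=\prod_{m\ne j}\frac{\rho-c_m}{c_j-c_m}$, $b_i(\theta;-hA)=\int_0^\theta\mathrm e^{-(\theta-\xi)hA}\ell_i(\xi)\,\mathrm d\xi$, $b_i(-hA)=b_i(1;-hA)$, $a_{ij}(-hA)=b_j(c_i;-hA)$. ERKC-C method. $W_0=\phi(0)$ and, for $n=0,\dots,N-1$, $$W_{n+1}=\mathrm e^{-h_{n+1}A}W_n+h_{n+1}\sum_{i=1}^sb_i(-h_{n+1}A)G_{n,i},\qquad W_{n,i}=\mathrm e^{-c_ih_{n+1}A}W_n+h_{n+1}\sum_{j=1}^sa_{ij}(-h_{n+1}A)G_{n,j},$$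 $$G_{n,j}=g(t_{n,j},W_{n,j},W^\tau(t_{n,j})),\qquad 1\le i,j\le s,$$ where $W(t)=\phi(t)$ for $t\le0$ and, for $t=t_k+\theta h_{k+1}$ with $0\le k\le N-1$, $\theta\in(0,1]$, $$W(t_k+\theta h_{k+1})=\mathrm e^{-\theta h_{k+1}A}W_k+h_{k+1}\sum_{i=1}^sb_i(\theta;-h_{k+1}A)G_{k,i}.$$ For $h\le\tau_0$ the delayed arguments only involve previously computed intervals. *)

(* Defs.v *)
From Stdlib Require Import Reals List.
From mathcomp Require all_boot all_order all_algebra all_classical all_reals.
From mathcomp Require Rstruct measure lebesgue_measure lebesgue_integral.
From Coquelicot Require Import Coquelicot.
Open Scope R_scope.

(* Coquelicot has Banach-valued Riemann integrals but no Lebesgue integral,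
   so L^1 and L^oo come from MathComp-Analysis.  The imports are confined to
   this module because many names clash with Coquelicot's. *)
Module Lebesgue.
Import all_boot all_order all_algebra all_classical all_reals.
Import Rstruct measure lebesgue_measure lebesgue_integral.
Local Open Scope classical_set_scope.
Local Open Scope ring_scope.

Definition simple_fun (Y : Type) (s : R -> Y) : Prop :=
  (exists l : list Y, forall t : R, List.In (s t) l) /\
  (forall v : Y, measurable ([set t | s t = v] : set (measurableTypeR R))).

Definition ae_on (a b : R) (P : R -> Prop) : Prop :=
  {ae (@lebesgue_measure R), forall t : R, `[a, b]%classic t -> P t}.

Definition integrable_on (a b : R) (h : R -> R) : Prop :=
  (@lebesgue_measure R).-integrable `[a, b]%classic (fun t : R => (h t)%:E).

Definition integral_on (a b : R) (h : R -> R) : R :=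
  \int[@lebesgue_measure R]_(t in `[a, b]%classic) h t.
End Lebesgue.

(* The Riemann integral [RInt] needs a normed module over R: restrict the
   scalars of a complex Banach space. *)
Section Realify.
Variable X : CompleteNormedModule C_AbsRing.

Definition rscal (r : R) (x : X) : X := scal (RtoC r : C_AbsRing) x.

Lemma rscal_assoc (x y : R) (u : X) : rscal x (rscal y u) = rscal (mult x y) u.
Proof.
unfold rscal; rewrite scal_assoc; apply (f_equal (fun z : C => scal (z : C_AbsRing) u)).
symmetry; exact (RtoC_mult x y).
Qed.

Lemma rscal_one (u : X) : rscal one u = u.
Proof. exact (scal_one u). Qed.

Lemma rscal_distr_l (x : R) (u v : X) :
  rscal x (plus u v) = plus (rscal x u) (rscal x v).
Proof. exact (scal_distr_l _ u v). Qed.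

Lemma rscal_distr_r (x y : R) (u : X) :
  rscal (plus x y) u = plus (rscal x u) (rscal y u).
Proof.
etransitivity; [| exact (scal_distr_r (RtoC x : C_AbsRing) (RtoC y) u)].
apply (f_equal (fun z : C => scal (z : C_AbsRing) u)).
exact (RtoC_plus x y).
Qed.

Lemma norm_rscal_le (r : R) (x : X) : norm (rscal r x) <= Rabs r * norm x.
Proof.
rewrite <- (Cmod_R r); exact (norm_scal (RtoC r : C_AbsRing) x).
Qed.

Definition real_ModuleSpace_mixin :=
  ModuleSpace.Mixin R_Ring X rscal
    rscal_assoc rscal_one rscal_distr_l rscal_distr_r.

Definition real_NormedModuleAux : NormedModuleAux R_AbsRing :=
  NormedModuleAux.Pack R_AbsRing X
    (NormedModuleAux.Class R_AbsRing X
      (ModuleSpace.Class R_Ring X (AbelianGroup.class X) real_ModuleSpace_mixin)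
      (UniformSpace.class X)) X.

Definition real_NormedModule_mixin :=
  NormedModule.Mixin R_AbsRing real_NormedModuleAux
    (@norm _ X) (@norm_factor _ X)
    (@norm_triangle _ X) norm_rscal_le
    (@norm_compat1 _ X) (@norm_compat2 _ X) (@norm_eq_zero _ X).

Definition realify : CompleteNormedModule R_AbsRing :=
  CompleteNormedModule.Pack R_AbsRing X
    (CompleteNormedModule.Class R_AbsRing X
      (NormedModule.Class R_AbsRing X _ real_NormedModule_mixin)
      (CompleteSpace.class X)) X.

End Realify.
Arguments rscal {X} r x.

(* [op x] is meaningful only for [x] in [dom]. *)
Record unbounded_operator (X : Type) := UnboundedOperator {
  dom : X -> Prop;
  op : X -> X }.
Arguments dom {X} _ _.
Arguments op {X} _ _.

Section Operators.
Variable X : CompleteNormedModule C_AbsRing.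
Implicit Types (A : unbounded_operator X) (lam : C).

Definition linear_op A : Prop :=
  dom A zero /\
  (forall x y, dom A x -> dom A y ->
     dom A (plus x y) /\ op A (plus x y) = plus (op A x) (op A y)) /\
  (forall (k : C_AbsRing) x, dom A x ->
     dom A (scal k x) /\ op A (scal k x) = scal k (op A x)).

Definition closed_op A : Prop :=
  forall (xs : nat -> X) (x y : X),
    (forall n, dom A (xs n)) ->
    filterlim xs eventually (locally x) ->
    filterlim (fun n => op A (xs n)) eventually (locally y) ->
    dom A x /\ op A x = y.

Definition dense_dom A : Prop :=
  forall (x : X) (eps : R), 0 < eps ->
    exists y, dom A y /\ norm (minus x y) < eps.

Definition is_resolvent A lam (B : X -> X) : Prop :=
  is_linear B /\
  (forall x, dom A (B x) /\
     minus (scal (lam : C_AbsRing) (B x)) (op A (B x)) = x) /\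
  (forall x, dom A x ->
     B (minus (scal (lam : C_AbsRing) x) (op A x)) = x).

Definition spectrum A lam : Prop := ~ exists B, is_resolvent A lam B.

(* Henry's definition: the sector { lam <> a : theta <= |arg (lam - a)| <= PI }
   is parametrized by lam = a + r exp(i psi), r = |lam - a| > 0. *)
Definition sectorial A : Prop :=
  linear_op A /\ closed_op A /\ dense_dom A /\
  exists theta M a : R, 0 < theta < PI / 2 /\ 1 <= M /\
    forall r psi : R, 0 < r -> theta <= Rabs psi <= PI ->
      exists B, is_resolvent A (a + r * cos psi, r * sin psi) B /\
        forall x, norm (B x) <= M / r * norm x.

(* [eA t] is exp(-tA) for t >= 0: a strongly continuous semigroup of bounded
   operators with infinitesimal generator -A, which determines it uniquely.
   Its values at negative t are irrelevant. *)
Definition semigroup_generated_by_opp A (eA : R -> X -> X) : Prop :=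
  (forall t, 0 <= t -> is_linear (eA t)) /\
  (forall x, eA 0 x = x) /\
  (forall t r x, 0 <= t -> 0 <= r -> eA (t + r) x = eA t (eA r x)) /\
  (forall x, filterlim (fun t => eA t x) (at_right 0) (locally x)) /\
  (forall x y : X, (dom A x /\ op A x = opp y) <->
     filterlim (fun t => rscal (/ t) (minus (eA t x) x))
       (at_right 0) (locally y)).

Definition Gamma (alpha : R) : R :=
  RInt_gen (fun t => Rpower t (alpha - 1) * exp (- t))
    (at_right 0) (Rbar_locally p_infty).

(* A^(-alpha) x
   = 1 / Gamma(alpha) int_0^oo t^(alpha-1) exp(-tA) x dt for alpha > 0,
   and A^0 = I. *)
Definition neg_power (eA : R -> X -> X) (alpha : R) (x : X) : X :=
  if Req_EM_T alpha 0 then x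
  else rscal (/ Gamma alpha)
         (RInt_gen (V := realify X)
            (fun t => rscal (Rpower t (alpha - 1)) (eA t x))
            (at_right 0) (Rbar_locally p_infty)).

(* A^alpha is the inverse of A^(-alpha), with domain the range of A^(-alpha). *)
Definition frac_power (eA : R -> X -> X) (alpha : R) : unbounded_operator X :=
  UnboundedOperator X
    (fun v => exists w, neg_power eA alpha w = v)
    (fun v => iota (fun w : X => neg_power eA alpha w = v)).

Definition V_dom (eA : R -> X -> X) (alpha : R) : X -> Prop :=
  dom (frac_power eA alpha).

(* Meaningful only on [V_dom]. *)
Definition V_norm (eA : R -> X -> X) (alpha : R) (v : X) : R :=
  norm (op (frac_power eA alpha) v).

Definition hilbert_product (ip : X -> X -> C) : Prop :=
  (forall x y z, ip (plus x y) z = Cplus (ip x z) (ip y z)) /\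
  (forall (k : C) x y, ip (scal (k : C_AbsRing) x) y = Cmult k (ip x y)) /\
  (forall x y, ip y x = Cconj (ip x y)) /\
  (forall x, ip x x = RtoC (norm x ^ 2)).

Definition separable : Prop :=
  exists d : nat -> X, forall (x : X) (eps : R), 0 < eps ->
    exists n, norm (minus x (d n)) < eps.

(* The graphs of A and of its adjoint coincide. *)
Definition self_adjoint (ip : X -> X -> C) A : Prop :=
  forall y z, (dom A y /\ op A y = z) <->
    (forall x, dom A x -> ip (op A x) y = ip x z).

Definition positive_definite (ip : X -> X -> C) A : Prop :=
  forall x, dom A x -> x <> zero -> 0 < Re (ip (op A x) x).

Definition compact_map (B : X -> X) : Prop :=
  forall (xs : nat -> X) (M : R), (forall n, norm (xs n) <= M) ->
    exists (sub : nat -> nat) (y : X),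
      (forall n, (sub n < sub (S n))%nat) /\
      filterlim (fun n => B (xs (sub n))) eventually (locally y).

Definition compact_inverse A : Prop :=
  exists B, is_linear B /\ compact_map B /\
    (forall x, dom A (B x) /\ op A (B x) = x) /\
    (forall x, dom A x -> B (op A x) = x).

Definition hilbert_setting A : Prop :=
  exists ip, hilbert_product ip /\ separable /\ linear_op A /\
    self_adjoint ip A /\ positive_definite ip A /\ compact_inverse A.

Section VValued.
Variables (eA : R -> X -> X) (alpha : R).

Definition V_derivative (a b : R) (F F' : R -> X) : Prop :=
  forall t, a <= t <= b ->
    V_dom eA alpha (F t) /\ V_dom eA alpha (F' t) /\
    filterlim
      (fun y => V_norm eA alpha
         (minus (rscal (/ (y - t)) (minus (F y) (F t))) (F' t)))
      (within (fun y => a <= y <= b /\ y <> t) (locally t)) (locally 0).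

(* Bochner's strong measurability: a.e. limit of simple functions. *)
Definition V_measurable (a b : R) (F : R -> X) : Prop :=
  exists sf : nat -> R -> X,
    (forall n, Lebesgue.simple_fun X (sf n)) /\
    (forall n t, V_dom eA alpha (sf n t)) /\
    Lebesgue.ae_on a b (fun t => V_dom eA alpha (F t) /\
      is_lim_seq (fun n => V_norm eA alpha (minus (sf n t) (F t))) 0).

Definition V_L1 (a b : R) (F : R -> X) : Prop :=
  V_measurable a b F /\
  Lebesgue.integrable_on a b (fun t => V_norm eA alpha (F t)).

Definition V_Linfty (a b : R) (F : R -> X) : Prop :=
  V_measurable a b F /\
  exists M : R, Lebesgue.ae_on a b (fun t => V_norm eA alpha (F t) <= M).

End VValued.

(* Sums and products over i = 1, ..., s run over i = 0, ..., s - 1 here. *)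
Definition lagrange (s : nat) (c : nat -> R) (j : nat) (x : R) : R :=
  prod_f_R0 (fun q => if Nat.eqb q j then 1 else (x - c q) / (c j - c q))
    (pred s).

(* b_i(theta; -hA) x *)
Definition coef_b (eA : R -> X -> X) (s : nat) (c : nat -> R)
    (i : nat) (theta h : R) (x : X) : X :=
  RInt (V := realify X)
    (fun xi => rscal (lagrange s c i xi) (eA ((theta - xi) * h) x)) 0 theta.

(* a_ij(-hA) x *)
Definition coef_a (eA : R -> X -> X) (s : nat) (c : nat -> R)
    (i j : nat) (h : R) (x : X) : X :=
  coef_b eA s c j (c i) h x.

(* h_{n+1} *)
Definition step (t : nat -> R) (n : nat) : R := t (S n) - t n.

Definition node (t : nat -> R) (c : nat -> R) (n i : nat) : R :=
  t n + c i * step t n.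

(* [Wn n], [Ws n i] and [W] are W_n, W_{n,i} and the continuous output. *)
Record ERKCC_solution (eA : R -> X -> X) (g : R -> X -> X -> X)
    (tau : R -> R) (phi : R -> X) (s : nat) (c : nat -> R)
    (N : nat) (t : nat -> R)
    (Wn : nat -> X) (Ws : nat -> nat -> X) (W : R -> X) : Prop := {
  ERKCC_init : Wn 0%nat = phi 0;
  ERKCC_step : forall n, (n < N)%nat ->
    Wn (S n) =
      plus (eA (step t n) (Wn n))
        (rscal (step t n)
           (sum_n (fun i => coef_b eA s c i 1 (step t n)
              (g (node t c n i) (Ws n i)
                 (W (node t c n i - tau (node t c n i))))) (pred s)));
  ERKCC_stage : forall n i, (n < N)%nat -> (i < s)%nat ->
    Ws n i =
      plus (eA (c i * step t n) (Wn n))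
        (rscal (step t n)
           (sum_n (fun j => coef_a eA s c i j (step t n)
              (g (node t c n j) (Ws n j)
                 (W (node t c n j - tau (node t c n j))))) (pred s)));
  ERKCC_past : forall r, r <= 0 -> W r = phi r;
  ERKCC_output : forall k theta, (k < N)%nat -> 0 < theta <= 1 ->
    W (t k + theta * step t k) =
      plus (eA (theta * step t k) (Wn k))
        (rscal (step t k)
           (sum_n (fun i => coef_b eA s c i theta (step t k)
              (g (node t c k i) (Ws k i)
                 (W (node t c k i - tau (node t c k i))))) (pred s))) }.

Definition stages_near (eA : R -> X -> X) (alpha : R) (u : R -> X)
    (s : nat) (c : nat -> R) (N : nat) (t : nat -> R) (R0 : R)
    (Ws : nat -> nat -> X) : Prop :=
  forall n i, (n < N)%nat -> (i < s)%nat ->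
    V_dom eA alpha (Ws n i) /\
    V_norm eA alpha (minus (Ws n i) (u (node t c n i))) <= R0.

End Operators.
Arguments linear_op {X} A.
Arguments dense_dom {X} A.
Arguments spectrum {X} A lam.
Arguments sectorial {X} A.
Arguments semigroup_generated_by_opp {X} A eA.
Arguments V_dom {X} eA alpha _.
Arguments V_norm {X} eA alpha v.
Arguments hilbert_setting {X} A.
Arguments V_derivative {X} eA alpha a b F F'.
Arguments V_L1 {X} eA alpha a b F.
Arguments V_Linfty {X} eA alpha a b F.
Arguments ERKCC_solution {X} eA g tau phi s c N t Wn Ws W.
Arguments stages_near {X} eA alpha u s c N t R0 Ws.

Definition admissible_delay (tau : R -> R) (tau0 : R) : Prop :=
  0 < tau0 /\
  (forall t, 0 <= t -> tau0 <= tau t) /\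
  (forall t, 0 <= t ->
     filterlim tau (within (fun r => 0 <= r) (locally t)) (locally (tau t))) /\
  (forall r t, 0 <= r -> r < t -> r - tau r < t - tau t).

(* xi_0, ..., xi_m are all the discontinuity points below T: the next one is
   >= T or, when t - tau(t) stays below xi_m, does not exist. *)
Definition discontinuity_points (tau : R -> R) (T : R)
    (xi : nat -> R) (m : nat) : Prop :=
  xi 0%nat = 0 /\
  (forall mu, (mu < m)%nat ->
     0 <= xi (S mu) /\ xi (S mu) - tau (xi (S mu)) = xi mu) /\
  (forall mu, (mu <= m)%nat -> xi mu < T) /\
  (forall t, 0 <= t < T -> t - tau t <> xi m).

(* The segment I^(mu+1), mu = 0, ..., m, is [seg T xi m mu, seg T xi m (S mu)]. *)
Definition seg (T : R) (xi : nat -> R) (m mu : nat) : R :=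
  if Nat.leb mu m then xi mu else T.

Definition max_step (N : nat) (t : nat -> R) : R :=
  fold_right Rmax 0 (map (step t) (List.seq 0 N)).

Definition min_step (N : nat) (t : nat -> R) : R :=
  fold_right Rmin (step t 0) (map (step t) (List.seq 0 N)).

Definition admissible_mesh (T : R) (xi : nat -> R) (m N : nat)
    (t : nat -> R) : Prop :=
  t 0%nat = 0 /\ t N = T /\
  (forall n, (n < N)%nat -> t n < t (S n)) /\
  (forall mu, (mu <= m)%nat -> exists n, (n <= N)%nat /\ t n = xi mu).

(* int_0^T of [v mu] and sup over [0, T] of [v mu], where [v mu] lives on
   I^(mu+1); the values at the breakpoints may depend on the segment. *)
Definition pw_integral (T : R) (xi : nat -> R) (m : nat)
    (v : nat -> R -> R) : R :=
  sum_n (fun mu =>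
    Lebesgue.integral_on (seg T xi m mu) (seg T xi m (S mu)) (v mu)) m.

Definition pw_sup (T : R) (xi : nat -> R) (m : nat)
    (v : nat -> R -> R) : R :=
  real (Lub_Rbar (fun y => exists mu t, (mu <= m)%nat /\
    seg T xi m mu <= t <= seg T xi m (S mu) /\ y = v mu t)).

(* h_j <= rho h_{j+1} for j = 1, ..., N - 1 *)
Definition step_ratio_le (rho : R) (N : nat) (t : nat -> R) : Prop :=
  forall n, (S n < N)%nat -> step t n <= rho * step t (S n).

Definition constant_steps (N : nat) (t : nat -> R) : Prop :=
  forall n, (n < N)%nat -> step t n = step t 0.

(* Main.v *)
(** Everything is written in the coordinate w = A^alpha v. Discrete Fourier inversion over
    roots of unity turns the resolvent bound on a half-plane into bounds for the powers of
    (1 + hA)^-1; letting h -> 0 gives |E(t)| <= M and |A E(t)| <= M/t for E(t) = exp(-tA),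
    whence |A^alpha E(t)| <= C t^-alpha. Stability holds because the weights exp(kappa t)
    make the weakly singular kernel contractive. For consistency, f^(s) has bounded variation
    and, by the quadrature condition, the interpolation error of xi^s has mean zero on each
    step; what is left are the sums of h_{k+1}^(s+1) (E(a_k) - E(a_k + theta h_{k+1})) f^(s)(t_k)
    with a_k = t_n - t_{k+1}. Bounding |E(a) - E(b)| by M (b - a) / a costs the logarithm. For
    constant steps the sum telescopes after Abel summation, and for self-adjoint A the
    operators E(a) - E(b) are positive for a <= b and have telescoping sums, so that Abel
    summation applies again. *)
Require Import Defs.
From mathcomp Require all_boot all_order all_algebra all_classical all_reals.
From mathcomp Require Rstruct Rstruct_topology topology ereal measurable_realfun measure lebesgue_measure lebesgue_integral normedtype sequences.

(** Finite averages over roots of unity stand in for contour integrals. Their price is a remainder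
    containing a high power of B = (1 + hA)^-1, negligible only once geometric decay of the powers
    is known; this qualitative decay is obtained by continuation in the radius r from 0 to 1. The
    cube of the resolvent is expanded because two factors are averaged by a discrete Poisson kernel,
    while the third is either bounded by 1/(1 - r) or absorbed by 1 - B. Derivatives are never
    integrated. One supremum argument, comparing increments around each point with those of a real
    function, carries the Euler error, the Taylor formulas, the inversion of fractional powers and
    the variation of f^(s). For the last of these the integrable f^(s+1) needs a monotone majorant
    that works at every point and not only almost everywhere. Solvability of the implicit stages and
    local uniqueness belong to the claim. They rest on a crude defect bound of order h without
    logarithm, so that the threshold for h does not depend on the smallest step; the sharp bounds
    enter only afterwards, for the error. *)

Module LebesgueFacts.
Import all_boot all_order all_algebra all_classical all_reals.
Import Rstruct Rstruct_topology topology normedtype ereal sequences measurable_realfun measure lebesgue_measure lebesgue_integral.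
Import Order.TTheory GRing.Theory Num.Theory numFieldNormedType.Exports.
Local Open Scope classical_set_scope.
Local Open Scope ring_scope.

(** * Monotone majorants of integrable functions *)

Section Majorant.
Context (R : realType).
Local Notation mu := (@lebesgue_measure R).

(** [W] is the distribution function of a measure with density sum of (k+2) 1_(O_k), where O_k is an
    open neighbourhood, of small excess measure, of the level set k <= g < k+1. Openness makes the
    density at least k+2 > g t + 1 on a whole neighbourhood of each [t] of that level set;
    summability of (k+2) |O_k| makes [W] finite. The surplus 1 is room for the first-order error of
    a derivative. *)
Lemma integrable_majorant_realType (a b : R) (g : R -> R) :
  (forall t, 0 <= g t) ->
  (@lebesgue_measure R).-integrable `[a, b]%classic (EFin \o g) ->
  exists W : R -> R, (forall x y, x <= y -> W x <= W y) /\
   forall t, a <= t <= b -> exists d, 0 < d /\ forall y z, t - d < y -> y <= t -> t <= z -> z < t + d ->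
    (g t + 1) * (z - y) <= W z - W y.
Proof.
move=> g0.
have le_mu (A B : set R) : measurable A -> measurable B -> A `<=` B -> (mu A <= mu B)%E.
  move=> mA mB AB; apply: le_measure => //; rewrite inE; [exact: mA|exact: mB].
set D : set R := `[a, b]%classic => gi.
have mD : measurable D by exact: measurable_itv.
have muD : (mu D < +oo)%E.
  by rewrite /D lebesgue_measure_itv /=; case: ifP => // _; rewrite ltry.
have mg : measurable_fun D g.
  by have /integrableP[/measurable_EFinP] := gi.
pose E (k : nat) : set R := D `&` [set t | k%:R <= g t < k.+1%:R].
have mE k : measurable (E k).
  have -> : E k = D `&` (g @^-1` `[k%:R, k.+1%:R[%classic).
    by congr setI; apply/funext => t /=; rewrite in_itv.
  by apply: mg => //; exact: measurable_itv.
have ED k : E k `<=` D by move=> x [].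
have trE : trivIset setT E.
  move=> i j _ _ [x [[_ +] [_ +]]] /=.
  move=> /andP[i1 i2] /andP[j1 j2].
  have := le_lt_trans i1 j2; have := le_lt_trans j1 i2.
  rewrite !ltr_nat !ltnS => h1 h2; apply/eqP; by rewrite eqn_leq h1 h2.
have exE t : D t -> exists k, E k t.
  move=> Dt; exists (Num.truncn (g t)); split => //=.
  by have /andP[-> ->] := truncn_itv (g0 t).
have UE : \bigcup_k E k = D.
  rewrite eqEsubset; split => [x [k _]|x Dx]; first exact: ED.
  by have [k Ek] := exE x Dx; exists k.
have muE k : (mu (E k) < +oo)%E.
  by apply: le_lt_trans muD; exact: le_mu.
pose g2 : R -> \bar R := fun t => (g t + 2%:R)%:E.
have g2i : mu.-integrable D g2.
  have -> : g2 = (fun t => (g t)%:E + (2%:R : R)%:E)%E by apply/funext => t; rewrite /g2 EFinD.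
  apply: integrableD => //.
  apply: (@measurable_bounded_integrable _ _ _ mu (fun=> 2%:R)) => //.
  exact: bounded_cst.
have g2fin : (\int[mu]_(x in D) g2 x < +oo)%E by exact: integrable_lty g2i.
have mg2 : measurable_fun D g2 by case/integrableP: g2i.
(* On the k-th level set the weight k+2 is at most g + 2. *)
have sumE : (\sum_(k <oo) ((k.+2%:R : R)%:E * mu (E k)) <= \int[mu]_(x in D) g2 x)%E.
  rewrite -UE ge0_integral_bigcup //; last 2 first.
  - by rewrite UE.
  - move=> x _; rewrite /g2 lee_fin addr_ge0 //.
  apply: lee_nneseries => [i _ _|k _].
    by rewrite mule_ge0 // lee_fin.
  rewrite -integral_cst; last exact: mE.
  apply: ge0_le_integral => //; first exact: mE.
  - by move=> x _; rewrite lee_fin.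
  - by apply: measurable_funS mg2 => //; exact: ED.
  - move=> x [_ /= /andP[h _]].
    by rewrite /cst /= /g2 lee_fin -addn2 natrD lerD2r.
have epos k : (0 < (k.+2%:R)^-1 * (1 / (2 ^ k.+1)%:R) :> R).
  by rewrite mulr_gt0 // ?invr_gt0 ?ltr0n // divr_gt0 // ltr0n expn_gt0.
(* The allowed excess is divided by the weight k+2, so that the weighted excesses sum to at most
   1. *)
have /choice[O HO] : forall k, exists U : set R, [/\ open U , E k `<=` U & (mu (U `\` E k) < (((k.+2%:R)^-1 * (1 / (2 ^ k.+1)%:R)) : R)%:E)%E].
  by move=> k; apply: lebesgue_regularity_outer; [exact: mE|exact: muE|exact: epos].
have mO k : measurable (O k) by apply: open_measurable; have [] := HO k.
have termle k : ((k.+2%:R : R)%:E * mu (O k) <= (k.+2%:R : R)%:E * mu (E k) + (1 / (2 ^ k.+1)%:R : R)%:E)%E.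
  have [_ EO small] := HO k.
  have mOE : measurable (O k `\` E k) by exact: measurableD.
  have -> : O k = E k `|` (O k `\` E k) by rewrite setDUK.
  rewrite measureU; [|exact: mE|exact: mOE|by rewrite setDIK].
  rewrite ge0_muleDr //; apply: leeD2l.
  apply: (@le_trans _ _ ((k.+2%:R : R)%:E * ((k.+2%:R)^-1 * (1 / (2 ^ k.+1)%:R) : R)%:E)%E).
    by rewrite lee_pmul2l //; exact: ltW small.
  by rewrite -EFinM mulVKf // pnatr_eq0.
have sumO : (\sum_(k <oo) ((k.+2%:R : R)%:E * mu (O k)) < +oo)%E.
  apply: (@le_lt_trans _ _ (\sum_(k <oo) ((k.+2%:R : R)%:E * mu (E k) + (1 / (2 ^ k.+1)%:R : R)%:E))%E).
    by apply: lee_nneseries => // i _ _; rewrite mule_ge0.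
  apply: le_lt_trans (epsilon_trick _ _ _) _ => //.
  - by move=> n; rewrite mule_ge0.
  - rewrite lte_add_pinfty ?ltry //.
    exact: le_lt_trans sumE g2fin.
pose f (x : R) (k : nat) : \bar R := ((k.+2%:R : R)%:E * mu (O k `&` `]-oo, x]%classic))%E.
have mOx k x : measurable (O k `&` `]-oo, x]%classic).
  by apply: measurableI => //; exact: measurable_itv.
have f0 x k : (0 <= f x k)%E by rewrite /f mule_ge0.
have fle x y k : x <= y -> (f x k <= f y k)%E.
  move=> xy; rewrite /f lee_pmul2l //.
  apply: le_mu => //; apply: setIS => z /=; rewrite !in_itv /= => /le_trans; exact.
pose w (x : R) : \bar R := (\sum_(k <oo) f x k)%E.
have wfin x : w x \is a fin_num.
  rewrite ge0_fin_numE; last exact: nneseries_ge0.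
  apply: le_lt_trans sumO; apply: lee_nneseries => // k _.
  rewrite /f lee_pmul2l //; exact: le_mu.
have wle x y : x <= y -> (w x <= w y)%E.
  by move=> xy; apply: lee_nneseries => // k _; exact: fle.
exists (fun x => fine (w x)); split.
  by move=> x y xy; apply: fine_le => //; exact: wle.
move=> t abt.
have Dt : D t by rewrite /D /= in_itv.
have [k Ek] := exE t Dt.
have [oO EO _] := HO k.
have : nbhs t (O k) by apply: open_nbhs_nbhs; split => //; exact: EO.
rewrite -nbhs_ballE => -[d /= d0 Hd].
exists d; split => // y z dy yt tz zd.
have yz : y <= z by exact: le_trans yt tz.
have sub : `]y, z]%classic `<=` O k.
  move=> p /=; rewrite in_itv /= => /andP[yp pz]; apply: Hd; rewrite /ball /= ltr_distlC.
  by rewrite (lt_trans dy yp) (le_lt_trans pz zd).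
(* The growth comes from the k-th term alone; the other terms only need to be monotone. *)
have key : (f y k + (k.+2%:R * (z - y))%:E <= f z k)%E.
  rewrite /f EFinM.
  have -> : ((z - y)%:E = mu `]y, z]%classic)%E.
    rewrite lebesgue_measure_itv /= lte_fin; move: yz; rewrite le_eqVlt => /orP[/eqP ->|->].
    by rewrite ltxx subrr.
    by rewrite EFinB.
  rewrite -ge0_muleDr // lee_pmul2l // -measureU //.
  - apply: le_mu => //; first by apply: measurableU => //; exact: measurable_itv.
    move=> p [[Op]|/= pi]; rewrite /= !in_itv /=.
    + by move=> py; split => //=; exact: le_trans py yz.
    + split; first exact: sub.
    by move: pi; rewrite !in_itv /= => /andP[].
  - exact: mOx.
  - rewrite -subset0 => p /= [[_]]; rewrite !in_itv /= => py /andP[yp _].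
    by move: (le_lt_trans py yp); rewrite ltxx.
have wk x : w x = (f x k + \sum_(0 <= j <oo | true && (j != k)) f x j)%E.
  by rewrite /w (nneseriesD1 (n := k)).
have : (w y + (k.+2%:R * (z - y))%:E <= w z)%E.
  rewrite !wk addeAC; apply: leeD => //.
  by apply: lee_nneseries => // j _; exact: fle.
rewrite -[w y]fineK // -[w z]fineK // -EFinD lee_fin => h.
rewrite lerBrDl; apply: le_trans h; rewrite lerD2l.
apply: ler_wpM2r; first by rewrite subr_ge0.
case: Ek => _ /= /andP[_ /ltW h].
by apply: (@le_trans _ _ (k.+1%:R + 1)); [rewrite lerD2r | rewrite -(natrD _ k.+1 1) addn1].
Qed.
End Majorant.

Lemma integral_on_bool_ge0 (a b : Rdefinitions.R) (h : Rdefinitions.R -> Rdefinitions.R) :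
  (forall t, 0 <= h t) -> 0 <= Lebesgue.integral_on a b h.
Proof. by move=> h0; apply: Rintegral_ge0 => t _; exact: h0. Qed.

Definition integrable_majorant_bool (a b : Rdefinitions.R)
  (g : Rdefinitions.R -> Rdefinitions.R) := @integrable_majorant_realType _ a b g.

End LebesgueFacts.

From Stdlib Require Import Reals Arith List Lra Lia Psatz ClassicalChoice Classical.
From Coquelicot Require Import Coquelicot.
Open Scope R_scope.

Lemma integral_on_ge0 (a b : R) (h : R -> R) :
  (forall t, 0 <= h t) -> 0 <= Lebesgue.integral_on a b h.
Proof.
intros h0. apply (ssrbool.elimT Rstruct.RleP).
apply LebesgueFacts.integral_on_bool_ge0.
intros t. apply (ssrbool.introT Rstruct.RleP). apply h0.
Qed.

(* Vitali-Caratheodory in integrated form. *)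
Lemma integrable_majorant (a b : R) (g : R -> R) :
  (forall t, 0 <= g t) -> Lebesgue.integrable_on a b g ->
  exists W : R -> R, (forall x y, x <= y -> W x <= W y) /\
   forall t, a <= t <= b -> exists d, 0 < d /\
    forall y z, t - d < y -> y <= t -> t <= z -> z < t + d ->
    (g t + 1) * (z - y) <= W z - W y.
Proof.
intros g0 gi.
destruct (LebesgueFacts.integrable_majorant_bool a b g) as [W [W1 W2]].
intros t. apply (ssrbool.introT Rstruct.RleP). apply g0. exact gi.
exists W. split.
intros x y xy. apply (ssrbool.elimT Rstruct.RleP). apply W1.
now apply (ssrbool.introT Rstruct.RleP).
intros t [at_ tb]. destruct (W2 t) as [d [d0 Hd]].
apply (ssrbool.introT ssrbool.andP); split; now apply (ssrbool.introT Rstruct.RleP).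
exists d. split. now apply (ssrbool.elimT Rstruct.RltP).
intros y z h1 h2 h3 h4.
apply (ssrbool.elimT Rstruct.RleP). apply Hd;
 first [now apply (ssrbool.introT Rstruct.RltP) | now apply (ssrbool.introT Rstruct.RleP)].
Qed.

(** * Reflection for linear identities in modules *)

Inductive mexp (K : Ring) :=
| MVar (n : nat) | MZero | MPlus (a b : mexp K) | MOpp (a : mexp K)
| MScal (k : K) (a : mexp K).
Arguments MVar {K} n. Arguments MZero {K}. Arguments MPlus {K} a b.
Arguments MOpp {K} a. Arguments MScal {K} k a.

Section ModuleReflection.
Variables (K : Ring) (V : ModuleSpace K).

Fixpoint meval (vs : list V) (e : mexp K) : V :=
  match e with
  | MVar n => nth n vs zero
  | MZero => zero
  | MPlus a b => plus (meval vs a) (meval vs b)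
  | MOpp a => opp (meval vs a)
  | MScal k a => scal k (meval vs a)
  end.

Fixpoint mcoef (e : mexp K) (n : nat) : K :=
  match e with
  | MVar p => if Nat.eqb p n then one else zero
  | MZero => zero
  | MPlus a b => plus (mcoef a n) (mcoef b n)
  | MOpp a => opp (mcoef a n)
  | MScal k a => mult k (mcoef a n)
  end.

Fixpoint mlin (f : nat -> K) (vs : list V) : V :=
  match vs with
  | nil => zero
  | v :: vs' => plus (scal (f 0%nat) v) (mlin (fun n => f (S n)) vs')
  end.

Lemma mlin_zero vs : mlin (fun _ => zero) vs = zero.
Proof. induction vs as [|v vs IH]; simpl; auto. rewrite IH, scal_zero_l, plus_zero_l; auto. Qed.

Lemma mlin_plus f1 f2 vs : mlin (fun n => plus (f1 n) (f2 n)) vs = plus (mlin f1 vs) (mlin f2 vs).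
Proof.
revert f1 f2; induction vs as [|v vs IH]; intros; simpl.
now rewrite plus_zero_l.
rewrite IH, scal_distr_r, <- !plus_assoc. f_equal.
rewrite !plus_assoc. f_equal. apply plus_comm.
Qed.

Lemma mlin_scal k f vs : mlin (fun n => mult k (f n)) vs = scal k (mlin f vs).
Proof.
revert f; induction vs as [|v vs IH]; intros; simpl.
now rewrite scal_zero_r.
now rewrite IH, scal_distr_l, scal_assoc.
Qed.

Lemma mlin_opp f vs : mlin (fun n => opp (f n)) vs = opp (mlin f vs).
Proof.
revert f; induction vs as [|v vs IH]; intros; simpl.
symmetry; exact (@opp_zero V).
rewrite IH, scal_opp_l. symmetry. exact (@opp_plus V _ _).
Qed.

Lemma mlin_var p vs : mlin (fun n => if Nat.eqb p n then one else zero) vs = nth p vs zero.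
Proof.
revert p; induction vs as [|v vs IH]; intros p; simpl.
destruct p; auto.
destruct p; simpl.
rewrite mlin_zero, scal_one, plus_zero_r; auto.
rewrite IH, scal_zero_l, plus_zero_l; auto.
Qed.

Lemma meval_mlin e vs : meval vs e = mlin (mcoef e) vs.
Proof.
induction e as [n| |a IHa b IHb|a IHa|k a IHa]; simpl.
symmetry; apply mlin_var.
symmetry; apply mlin_zero.
now rewrite IHa, IHb, <- mlin_plus.
now rewrite IHa, <- mlin_opp.
now rewrite IHa, <- mlin_scal.
Qed.

(** The equations between coefficients are enumerated instead of quantified, so that [cbn] turns
    them into a finite conjunction of plain scalar equations. *)
Fixpoint mall (n k : nat) (f g : nat -> K) : Prop :=
  match n with
  | O => True
  | S n' => f k = g k /\ mall n' (S k) f g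
  end.

Lemma mall_lt n k f g : mall n k f g -> forall p, (k <= p < k + n)%nat -> f p = g p.
Proof.
revert k; induction n as [|n IH]; simpl; intros k H p Hp. lia.
destruct H as [H1 H2]. destruct (Nat.eq_dec p k) as [->|Hn]; auto.
apply (IH (S k)); auto. lia.
Qed.

Lemma mlin_ext f g vs : (forall p, (p < length vs)%nat -> f p = g p) -> mlin f vs = mlin g vs.
Proof.
revert f g; induction vs as [|v vs IH]; intros f g H; simpl; auto.
rewrite (H 0%nat). 2: simpl; lia.
f_equal. apply IH. intros p Hp. apply H. simpl; lia.
Qed.

(** Basis of [rmodule] and [cmodule]: both sides of a vector identity are reified over their
    non-linear subterms as atoms, and one scalar equation per atom is left to [ring] or [field]. *)
Lemma meval_eq e1 e2 vs :
  mall (length vs) 0 (mcoef e1) (mcoef e2) -> meval vs e1 = meval vs e2.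
Proof.
intros H; rewrite !meval_mlin. apply mlin_ext. intros p Hp.
apply (mall_lt _ _ _ _ H). lia.
Qed.
End ModuleReflection.

Ltac madd x vs :=
  let rec go l := match l with
    | nil => constr:(cons x vs)
    | cons x _ => vs
    | cons _ ?l' => go l' end in go vs.
Ltac mvars vs e :=
  match e with
  | @plus _ ?a ?b => let vs1 := mvars vs a in mvars vs1 b
  | @minus _ ?a ?b => let vs1 := mvars vs a in mvars vs1 b
  | @opp _ ?a => mvars vs a
  | @scal _ _ ?k ?a => mvars vs a
  | @zero _ => vs
  | _ => madd e vs
  end.
Ltac mindex x vs :=
  match vs with
  | cons x _ => constr:(0%nat)
  | cons _ ?l => let n := mindex x l in constr:(S n)
  end.
Ltac mreify K vs e :=
  match e with
  | @plus _ ?a ?b => let a' := mreify K vs a in let b' := mreify K vs b in constr:(@MPlus K a' b')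
  | @minus _ ?a ?b => let a' := mreify K vs a in let b' := mreify K vs b in constr:(@MPlus K a' (@MOpp K b'))
  | @opp _ ?a => let a' := mreify K vs a in constr:(@MOpp K a')
  | @scal _ _ ?k ?a => let a' := mreify K vs a in constr:(@MScal K k a')
  | @zero _ => constr:(@MZero K)
  | _ => let n := mindex e vs in constr:(@MVar K n)
  end.
Ltac scalar_unfold :=
  cbv [plus opp mult one zero minus AbelianMonoid.plus AbelianMonoid.zero AbelianGroup.opp
    Ring.mult Ring.one AbelianMonoid.class AbelianGroup.class Ring.class AbsRing.class
    AbelianMonoid.sort AbelianGroup.sort Ring.sort AbsRing.sort
    AbelianGroup.base AbelianGroup.mixin Ring.base Ring.mixin AbsRing.base AbsRing.mixin
    AbsRing.Ring AbsRing.AbelianGroup AbsRing.AbelianMonoid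
    Ring.AbelianGroup Ring.AbelianMonoid AbelianGroup.AbelianMonoid
    R_AbsRing R_Ring R_AbelianGroup R_AbelianMonoid
    R_AbelianMonoid_mixin R_AbelianGroup_mixin R_Ring_mixin
    C_AbsRing C_Ring C_AbelianGroup C_AbelianMonoid
    C_AbelianMonoid_mixin C_AbelianGroup_mixin C_Ring_mixin].
Ltac module_with K V tac :=
  match goal with |- @eq _ ?l ?r =>
    let vs0 := mvars (@nil V) l in
    let vs := mvars vs0 r in
    let l' := mreify K vs l in
    let r' := mreify K vs r in
    change (@meval K V vs l' = @meval K V vs r');
    apply meval_eq; cbn [length mall mcoef Nat.eqb];
    repeat (apply conj); try exact I; tac
  end.
Ltac rmodule V := module_with (AbsRing.Ring R_AbsRing) (NormedModule.ModuleSpace R_AbsRing V)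
  ltac:(scalar_unfold; try ring; try (field; auto; lra)).
Ltac cmodule V := module_with (AbsRing.Ring C_AbsRing) (NormedModule.ModuleSpace C_AbsRing V)
  ltac:(scalar_unfold; try ring; try (field; auto)).

Ltac Rmin_bounds a b := pose proof (Rmin_l a b); pose proof (Rmin_r a b).
Ltac Rmax_bounds a b := pose proof (Rmax_l a b); pose proof (Rmax_r a b).
(** Equations between numbers are often typed at a carrier that is only convertible with [R] or [C];
    restating the type lets [ring] and [field] recognize it. *)
Ltac as_R := match goal with |- @eq _ ?a ?b => change (@eq R a b) end.
Ltac as_C := match goal with |- @eq _ ?a ?b => change (@eq C a b) end.

(** * Finite sums *)

Fixpoint bsum {G : AbelianMonoid} (n : nat) (f : nat -> G) : G :=
  match n with O => zero | S k => plus (bsum k f) (f k) end.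

Lemma bsum_ext {G : AbelianMonoid} n (f g : nat -> G) :
  (forall k, (k < n)%nat -> f k = g k) -> bsum n f = bsum n g.
Proof. induction n; simpl; intros H; auto. rewrite IHn, H; auto. Qed.

(** [sum_n f k] has k + 1 terms and is never empty; [bsum n] has n terms, which suits inductions
    over steps that start from the empty sum. *)
Lemma bsum_sum_n {G : AbelianMonoid} n (f : nat -> G) : (0 < n)%nat -> sum_n f (pred n) = bsum n f.
Proof.
destruct n as [|n]. lia. intros _. simpl pred.
induction n as [|n IH]. rewrite sum_O. simpl. now rewrite plus_zero_l.
rewrite sum_Sn, IH. reflexivity.
Qed.

Lemma bsum_plus {G : AbelianMonoid} n (f g : nat -> G) :
  bsum n (fun k => plus (f k) (g k)) = plus (bsum n f) (bsum n g).
Proof.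
induction n; simpl. now rewrite plus_zero_l.
rewrite IHn, <- !plus_assoc. f_equal. rewrite !plus_assoc. f_equal. apply plus_comm.
Qed.

Lemma bsum_zero {G : AbelianMonoid} n (f : nat -> G) :
  (forall k, (k < n)%nat -> f k = zero) -> bsum n f = zero.
Proof. induction n; simpl; intros H; auto. rewrite IHn, H, plus_zero_l; auto. Qed.

Lemma bsum_swap {G : AbelianMonoid} n p (f : nat -> nat -> G) :
  bsum n (fun k => bsum p (f k)) = bsum p (fun j => bsum n (fun k => f k j)).
Proof.
induction n; simpl. symmetry; now apply bsum_zero.
rewrite IHn. now rewrite bsum_plus.
Qed.

Lemma bsum_single {G : AbelianMonoid} n (f : nat -> G) p :
  (p < n)%nat -> (forall k, (k < n)%nat -> k <> p -> f k = zero) -> bsum n f = f p.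
Proof.
induction n; intros Hp H. lia. simpl.
destruct (Nat.eq_dec p n) as [->|Hn].
rewrite bsum_zero, plus_zero_l; auto. intros; apply H; lia.
rewrite IHn; try lia. rewrite (H n), plus_zero_r; auto. intros; apply H; lia.
Qed.

Lemma bsum_shift {G : AbelianMonoid} n (f : nat -> G) :
  bsum (S n) f = plus (f 0%nat) (bsum n (fun k => f (S k))).
Proof.
induction n. simpl. now rewrite plus_zero_l, plus_zero_r.
change (bsum (S (S n)) f) with (plus (bsum (S n) f) (f (S n))).
rewrite IHn. simpl. now rewrite plus_assoc.
Qed.

Section BsumNorm.
Context {K : AbsRing} {V W : NormedModule K}.

Lemma bsum_linear (l : V -> W) n f : is_linear l -> l (bsum n f) = bsum n (fun k => l (f k)).
Proof.
intros Hl; induction n; simpl. now apply linear_zero.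
rewrite <- IHn. apply Hl.
Qed.

Lemma bsum_scal n (k : K) (f : nat -> V) : bsum n (fun j => scal k (f j)) = scal k (bsum n f).
Proof.
induction n; simpl. symmetry; exact (scal_zero_r k).
rewrite IHn. symmetry; exact (scal_distr_l _ _ _).
Qed.

Lemma bsum_scal_l n (f : nat -> K) (x : V) : bsum n (fun j => scal (f j) x) = scal (bsum n f) x.
Proof.
induction n; simpl. symmetry; exact (scal_zero_l x).
rewrite IHn. symmetry; exact (scal_distr_r _ _ _).
Qed.

Lemma bsum_minus n (f g : nat -> V) :
  bsum n (fun k => minus (f k) (g k)) = minus (bsum n f) (bsum n g).
Proof.
etransitivity. apply (bsum_plus n f (fun k => opp (g k))).
unfold minus. apply f_equal. induction n. symmetry; exact (@opp_zero V).
etransitivity. apply (f_equal (fun w => plus w (opp (g n)))), IHn.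
symmetry; exact (@opp_plus V _ _).
Qed.

Lemma norm_minus_le (a b : V) : norm (minus a b) <= norm a + norm b.
Proof. eapply Rle_trans. apply norm_triangle. rewrite (norm_opp b). apply Rle_refl. Qed.

Lemma norm_bsum n (f : nat -> V) : norm (bsum n f) <= bsum n (fun k => norm (f k)).
Proof.
induction n. change (norm (@zero V) <= 0). rewrite norm_zero; lra.
eapply Rle_trans. apply norm_triangle. apply Rplus_le_compat_r, IHn.
Qed.
End BsumNorm.

Lemma norm_scal_Rabs {V : NormedModule R_AbsRing} r (x : V) : norm (scal r x) <= Rabs r * norm x.
Proof. exact (norm_scal (r : R_AbsRing) x). Qed.

Lemma bsum_R0 (f : nat -> R) : bsum 0 f = 0.
Proof. reflexivity. Qed.

Lemma bsum_RS n (f : nat -> R) : bsum (S n) f = bsum n f + f n.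
Proof. reflexivity. Qed.

Lemma bsum_le n (f g : nat -> R) :
  (forall k, (k < n)%nat -> f k <= g k) -> bsum n f <= bsum n g.
Proof.
induction n; intros H. apply Rle_refl. apply Rplus_le_compat. apply IHn; auto. auto.
Qed.

Lemma bsum_mult n (k : R) (f : nat -> R) : bsum n (fun j => k * f j) = k * bsum n f.
Proof. induction n; simpl. unfold zero; simpl; ring. rewrite IHn. unfold plus; simpl; ring. Qed.

Lemma bsum_const n (k : R) : bsum n (fun _ => k) = INR n * k.
Proof. induction n. simpl; unfold zero; simpl; ring. rewrite S_INR. simpl. rewrite IHn. unfold plus; simpl; ring. Qed.

Lemma bsum_nonneg n (f : nat -> R) : (forall k, (k < n)%nat -> 0 <= f k) -> 0 <= bsum n f.
Proof.
intros H. rewrite <- (Rmult_0_r (INR n)), <- bsum_const. now apply bsum_le.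
Qed.

Lemma Re_bsum n (f : nat -> C) : Re (bsum n f) = bsum n (fun k => Re (f k)).
Proof. induction n; simpl; auto. rewrite <- IHn. reflexivity. Qed.

(** * Roots of unity and the discrete Poisson kernel *)

Definition cis (t : R) : C := (cos t, sin t).

Lemma cis_plus a b : cis (a + b) = Cmult (cis a) (cis b).
Proof. unfold cis, Cmult; simpl. rewrite cos_plus, sin_plus. f_equal; ring. Qed.

Lemma Cmod_cis t : Cmod (cis t) = 1.
Proof.
unfold Cmod, cis; simpl. rewrite !Rmult_1_r.
replace (cos t * cos t + sin t * sin t) with 1. apply sqrt_1.
generalize (sin2_cos2 t); unfold Rsqr; lra.
Qed.

Lemma Cpow_cis r t j : Cpow (Cmult (RtoC r) (cis t)) j = Cmult (RtoC (r ^ j)) (cis (INR j * t)).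
Proof.
induction j as [|j IH].
- rewrite Rmult_0_l. unfold cis. rewrite cos_0, sin_0.
  now rewrite Cmult_1_l.
- rewrite S_INR. replace ((INR j + 1) * t) with (INR j * t + t) by ring.
  rewrite cis_plus. simpl Cpow. rewrite IH. simpl pow. rewrite RtoC_mult. ring.
Qed.

Lemma cis_neq_1 j n : (0 < j < n)%nat -> cis (2 * PI * INR j / INR n) <> RtoC 1.
Proof.
intros [Hj Hn] H. injection H as Hc Hs.
assert (H0 : 0 < INR j) by (apply lt_0_INR; lia).
assert (H1 : INR j < INR n) by (apply lt_INR; lia).
pose proof PI_RGT_0 as HPI.
set (a := PI * INR j / INR n).
assert (Ha : 0 < a < PI).
{ unfold a; split. apply Rdiv_lt_0_compat; nra.
  apply Rlt_div_l; nra. }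
replace (2 * PI * INR j / INR n) with (2 * a) in Hc by (unfold a; field; lra).
rewrite cos_2a_sin in Hc.
pose proof (sin_gt_0 a (proj1 Ha) (proj2 Ha)). nra.
Qed.

Lemma cis_minus_neq_1 j p n : (j < n)%nat -> (p < n)%nat -> j <> p ->
  cis (2 * PI * (INR j - INR p) / INR n) <> RtoC 1.
Proof.
intros Hj Hp Hne.
assert (HN : 0 < INR n) by (apply lt_0_INR; lia).
destruct (Nat.lt_ge_cases p j) as [H|H].
- rewrite <- minus_INR by lia. apply cis_neq_1; lia.
- replace (2 * PI * (INR j - INR p) / INR n) with (- (2 * PI * INR (p - j) / INR n)).
  2: rewrite minus_INR by lia; field; lra.
  intros H1. apply (cis_neq_1 (p - j) n). lia.
  unfold cis in *. rewrite cos_neg, sin_neg in H1.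
  injection H1 as H2 H3. unfold RtoC. f_equal; lra.
Qed.

Lemma cis_geom n a :
  Cmult (bsum n (fun k => cis (INR k * a))) (Cminus (cis a) 1) = Cminus (cis (INR n * a)) 1.
Proof.
induction n.
- simpl bsum. rewrite Rmult_0_l. unfold cis at 2. rewrite cos_0, sin_0.
  change (1, 0) with (RtoC 1). change zero with (RtoC 0). ring.
- rewrite S_INR. replace ((INR n + 1) * a) with (INR n * a + a) by ring.
  rewrite cis_plus. simpl bsum.
  rewrite Cmult_plus_distr_r, IHn. ring.
Qed.

Lemma cis_2PI n : cis (INR n * (2 * PI)) = RtoC 1.
Proof.
unfold cis, RtoC.
replace (INR n * (2 * PI)) with (0 + 2 * INR n * PI) by ring.
now rewrite cos_period, sin_period, cos_0, sin_0.
Qed.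

Definition angle (n k : nat) : R := INR k * (2 * PI / INR n).

Lemma cis_orthogonal j p n : (j < n)%nat -> (p < n)%nat -> j <> p ->
  bsum n (fun k => cis ((INR j - INR p) * angle n k)) = RtoC 0.
Proof.
intros Hj Hp Hne.
assert (HN : 0 < INR n) by (apply lt_0_INR; lia).
set (a := 2 * PI * (INR j - INR p) / INR n).
rewrite (bsum_ext n _ (fun k => cis (INR k * a))).
2:{ intros k _. f_equal. unfold a, angle. field. lra. }
assert (H := cis_geom n a).
assert (H1 : cis (INR n * a) = RtoC 1).
{ replace (INR n * a) with (INR j * (2 * PI) + - (INR p * (2 * PI))) by (unfold a; field; lra).
  rewrite cis_plus, cis_2PI.
  generalize (cis_2PI p). unfold cis. rewrite cos_neg, sin_neg. intros H1.
  injection H1 as H2 H3. rewrite H2, H3. unfold RtoC, Cmult; simpl. f_equal; ring. }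
rewrite H1 in H. replace (Cminus 1 1) with (RtoC 0) in H by ring.
assert (H2 : Cminus (cis a) 1 <> RtoC 0).
{ intros H2. apply (cis_minus_neq_1 j p n Hj Hp Hne). fold a.
  replace (cis a) with (Cplus (Cminus (cis a) 1) 1) by ring. rewrite H2. ring. }
revert H. generalize (bsum n (fun k => cis (INR k * a))). intros S H.
transitivity (Cmult (Cmult S (Cminus (cis a) 1)) (Cinv (Cminus (cis a) 1))).
rewrite <- Cmult_assoc, Cinv_r by exact H2. symmetry; apply Cmult_1_r.
rewrite H. apply Cmult_0_l.
Qed.

Definition root (r : R) (n k : nat) : C := Cmult (RtoC r) (cis (angle n k)).

Lemma Cmod_root r n k : 0 <= r -> Cmod (root r n k) = r.
Proof. intros Hr. unfold root. rewrite Cmod_mult, Cmod_cis, Cmod_R, Rabs_pos_eq by auto. ring. Qed.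

Lemma Cmod2_one_minus_root r n k :
  Cmod (Cminus 1 (root r n k)) ^ 2 = 1 - 2 * r * cos (angle n k) + r ^ 2.
Proof.
unfold Cmod. rewrite <- Rsqr_pow2, Rsqr_sqrt. 2: nra.
unfold root, cis, Cminus, Cplus, Copp, Cmult, RtoC; simpl.
generalize (sin2_cos2 (angle n k)); unfold Rsqr. nra.
Qed.

(** Real part of (1 - z^(n+1)) (1 - conj z) for z = r e^(it), that is, of the truncated geometric
    series times |1 - z|^2. The induction rests on cos((n+2)t) + cos(nt) = 2 cos t cos((n+1)t). *)
Lemma poisson_partial_sum r t n :
  bsum (S n) (fun j => r ^ j * cos (INR j * t)) * (1 - 2 * r * cos t + r ^ 2)
  = (1 - r * cos t) - r ^ (S n) * cos (INR (S n) * t) + r ^ (S (S n)) * cos (INR n * t).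
Proof.
induction n as [|n IH].
- rewrite bsum_RS, bsum_R0. simpl. rewrite Rmult_0_l, cos_0, (Rmult_1_l t). ring.
- rewrite bsum_RS.
  rewrite Rmult_plus_distr_r, IH.
  assert (H : cos (INR (S (S n)) * t) + cos (INR n * t) = 2 * cos t * cos (INR (S n) * t)).
  { rewrite !S_INR. replace ((INR n + 1 + 1) * t) with ((INR n + 1) * t + t) by ring.
    replace (INR n * t) with ((INR n + 1) * t - t) by ring.
    rewrite cos_plus, cos_minus. ring. }
  replace (cos (INR (S (S n)) * t)) with (2 * cos t * cos (INR (S n) * t) - cos (INR n * t)) by lra.
  simpl pow. ring.
Qed.

(** Two facts combine: (1 - r^2) / |1 - z|^2 = 2 Re(1/(1 - z)) - 1, and z^n = r^n at all n points,
    so that 1/(1 - z) is the geometric sum of n terms divided by 1 - r^n. Summation over the roots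
    keeps only its constant term. *)
Lemma poisson_kernel_sum r n : 0 <= r < 1 -> (0 < n)%nat ->
  bsum n (fun k => / (1 - 2 * r * cos (angle n k) + r ^ 2))
  = INR n * ((1 + r ^ n) / ((1 - r ^ 2) * (1 - r ^ n))).
Proof.
intros Hr Hn. destruct n as [|p]; [lia|]. set (n := S p).
assert (HN : 0 < INR n) by (apply lt_0_INR; unfold n; lia).
assert (Hrn : r ^ n < 1) by (apply pow_lt_1_compat; [lra|unfold n; lia]).
assert (Hr2 : r ^ 2 < 1) by nra.
assert (Hq : forall t, 0 < 1 - 2 * r * cos t + r ^ 2).
{ intros t. pose proof (COS_bound t). nra. }
set (P := fun k => 1 - 2 * r * cos (angle n k) + r ^ 2).
assert (E1 : bsum n (fun k => (1 - r * cos (angle n k)) / P k) = INR n / (1 - r ^ n)).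
{ rewrite (bsum_ext n _ (fun k => / (1 - r ^ n) * bsum n (fun j => r ^ j * cos (INR j * angle n k)))).
  2:{ intros k _. assert (H := poisson_partial_sum r (angle n k) p). fold n in H.
    assert (Hc : cos (INR n * angle n k) = 1).
    { replace (INR n * angle n k) with (0 + 2 * INR k * PI) by (unfold angle; field; lra).
    now rewrite cos_period, cos_0. }
    assert (Hc' : cos (INR p * angle n k) = cos (angle n k)).
    { replace (INR p * angle n k) with (- angle n k + 2 * INR k * PI).
    rewrite cos_period. apply cos_neg.
    replace (INR p) with (INR n - 1) by (unfold n; rewrite S_INR; ring).
    unfold angle; field; lra. }
    rewrite Hc, Hc' in H. fold (P k) in H.
    replace (bsum n (fun j : nat => r ^ j * cos (INR j * angle n k)))
    with ((1 - r ^ n) * (1 - r * cos (angle n k)) / P k).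
    as_R; field. split; [specialize (Hq (angle n k)); unfold P; lra| lra].
    apply (Rmult_eq_reg_r (P k)). 2: specialize (Hq (angle n k)); unfold P; lra.
    rewrite H. replace (r ^ S n) with (r * r ^ n) by reflexivity.
    field. specialize (Hq (angle n k)); unfold P; lra. }
  rewrite bsum_mult, (@bsum_swap R_AbelianMonoid n n).
  rewrite (@bsum_single R_AbelianMonoid n _ 0%nat). 2: unfold n; lia.
  - rewrite (bsum_ext n _ (fun _ => 1)).
    rewrite bsum_const. unfold Rdiv; as_R; ring.
    intros k _. simpl. rewrite Rmult_0_l, cos_0; ring.
  - intros j Hj Hj0. rewrite (bsum_mult n (r ^ j)).
    assert (H := cis_orthogonal j 0 n Hj ltac:(unfold n; lia) Hj0).
    apply (f_equal Re) in H. rewrite Re_bsum in H.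
    change (bsum n (fun k : nat => cos ((INR j - INR 0) * angle n k)) = 0) in H.
    rewrite (bsum_ext n _ (fun k : nat => cos ((INR j - INR 0) * angle n k))).
    2: { intros k _. f_equal. simpl. ring. }
    rewrite H. apply Rmult_0_r. }
apply (Rmult_eq_reg_l (1 - r ^ 2)). 2: lra.
rewrite <- (bsum_mult n (1 - r ^ 2)).
rewrite (bsum_ext n _ (fun k => 2 * ((1 - r * cos (angle n k)) / P k) + (-1))).
2:{ intros k _. unfold P. as_R; field. specialize (Hq (angle n k)). lra. }
rewrite (@bsum_plus R_AbelianMonoid). change plus with Rplus.
rewrite bsum_mult, E1, bsum_const. as_R; field. lra.
Qed.

(** Discrete counterpart of the mean 1/(1 - r^2) of |1 - z|^-2 over the circle of radius r. The
    condition r^n <= 1/3 bounds the discretization factor (1 + r^n)/(1 - r^n) by 2. *)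
Lemma poisson_kernel_average r n : 0 <= r < 1 -> (0 < n)%nat -> r ^ n <= 1 / 3 ->
  / INR n * bsum n (fun k => / Cmod (Cminus 1 (root r n k)) ^ 2) <= 2 / (1 - r).
Proof.
intros Hr Hn Hrn.
assert (HN : 0 < INR n) by (apply lt_0_INR; lia).
rewrite (bsum_ext n _ (fun k => / (1 - 2 * r * cos (angle n k) + r ^ 2))).
2: intros; now rewrite Cmod2_one_minus_root.
rewrite poisson_kernel_sum by auto.
rewrite <- Rmult_assoc, Rinv_l, Rmult_1_l by lra.
assert (H1 : (1 + r ^ n) / (1 - r ^ n) <= 2) by (apply Rle_div_l; lra).
replace ((1 + r ^ n) / ((1 - r ^ 2) * (1 - r ^ n))) with ((1 + r ^ n) / (1 - r ^ n) * / (1 + r) * / (1 - r)).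
2: field; repeat split; nra.
apply Rmult_le_compat_r. left; apply Rinv_0_lt_compat; lra.
assert (H2 : / (1 + r) <= 1). { rewrite <- Rinv_1. apply Rinv_le_contravar; lra. }
assert (0 < / (1 + r)) by (apply Rinv_0_lt_compat; lra).
nra.
Qed.

Lemma is_linear_iter {K : AbsRing} {V : NormedModule K} (B : V -> V) n :
  is_linear B -> is_linear (Nat.iter n B).
Proof.
intros HB; induction n; simpl. apply is_linear_id.
apply (is_linear_comp (Nat.iter n B) B IHn HB).
Qed.

Lemma norm_bound_limit (a b : R) : (forall eps, 0 < eps -> a <= b + eps) -> a <= b.
Proof. intros H. apply Rnot_lt_le; intros h. specialize (H ((a - b) / 2)). lra. Qed.

(* The gain from [beta] to [q (1 + beta)] has fixed point [q / (1 - q)]. *)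
Lemma bound_bootstrap (V : Type) (a nx : V -> R) (q : R) :
  0 <= q < 1 -> (forall x, 0 <= nx x) ->
  (exists b, 0 <= b /\ forall x, a x <= b * nx x) ->
  (forall b, 0 <= b -> (forall x, a x <= b * nx x) -> forall x, a x <= q * (1 + b) * nx x) ->
  forall x, a x <= q / (1 - q) * nx x.
Proof.
intros Hq Hn [b [Hb0 Hb]] Hstep.
set (s := q / (1 - q)).
assert (Hs : q * (1 + s) = s) by (unfold s; field; lra).
assert (Hs0 : 0 <= s) by (unfold s; apply Rdiv_le_0_compat; lra).
assert (H : forall n x, a x <= (s + q ^ n * b) * nx x).
{ induction n; intros x.
  - eapply Rle_trans. apply Hb. apply Rmult_le_compat_r; auto. simpl; lra.
  - assert (0 <= q ^ n) by (apply pow_le; lra).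
    eapply Rle_trans. apply (Hstep (s + q ^ n * b)); auto. nra.
    apply Rmult_le_compat_r; auto. simpl.
    lra. }
intros x. apply norm_bound_limit. intros eps He.
destruct (pow_lt_1_zero q) with (y := eps / (b * nx x + 1)) as [N HN].
rewrite Rabs_pos_eq; lra.
specialize (Hn x). apply Rdiv_lt_0_compat; nra.
specialize (HN N (le_n _)). specialize (H N x). specialize (Hn x).
rewrite Rabs_pos_eq in HN by (apply pow_le; lra).
apply Rlt_div_r in HN. 2: nra.
assert (0 <= q ^ N) by (apply pow_le; lra).
nra.
Qed.

(** The norm axioms give only one inequality; the other one comes from scaling back by 1/c. *)
Lemma norm_scal_RtoC (V : NormedModule C_AbsRing) (c : R) (v : V) :
  0 <= c -> norm (scal (RtoC c : C_AbsRing) v) = c * norm v.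
Proof.
intros Hc.
assert (Hle : forall d (w : V), 0 <= d -> norm (scal (RtoC d : C_AbsRing) w) <= d * norm w).
{ intros d w Hd. eapply Rle_trans. apply (norm_scal (RtoC d : C_AbsRing)).
  rewrite Cmod_R, Rabs_pos_eq by auto. lra. }
apply Rle_antisym; auto.
destruct (Req_dec c 0) as [->|E]. rewrite Rmult_0_l. apply norm_ge_0.
assert (E2 : v = scal (RtoC (/ c) : C_AbsRing) (scal (RtoC c : C_AbsRing) v)).
{ rewrite scal_assoc. etransitivity. symmetry; exact (scal_one v).
  f_equal. change (RtoC 1 = Cmult (RtoC (/ c)) (RtoC c)). rewrite <- RtoC_mult. f_equal. field; auto. }
rewrite E2 at 1.
apply (Rmult_le_reg_l (/ c)). apply Rinv_0_lt_compat; lra.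
rewrite <- Rmult_assoc, Rinv_l, Rmult_1_l by auto. apply Hle. left; apply Rinv_0_lt_compat; lra.
Qed.

(** * Power bounds by discrete Fourier inversion *)

Section DiscreteFourier.
Variable X : NormedModule C_AbsRing.
Variable B : X -> X.
Hypothesis HB : is_linear B.
Variable D : C -> X -> X.
Hypothesis HD : forall z, Cmod z <= 1 -> is_linear (D z).
Hypothesis HDB : forall z x, Cmod z <= 1 -> B (D z x) = D z (B x).
Hypothesis HDe : forall z x, Cmod z <= 1 -> D z x = plus x (scal (z : C_AbsRing) (B (D z x))).

Notation T n := (@Nat.iter n X B).

(** [D z] plays the role of (1 - zB)^-1. The Neumann series is stopped after [J] terms with its
    exact remainder, so no convergence is involved. *)
Lemma resolvent_series1 z x J : Cmod z <= 1 ->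
  D z x = plus (bsum J (fun j => scal (Cpow z j : C_AbsRing) (T j x)))
    (scal (Cpow z J : C_AbsRing) (T J (D z x))).
Proof.
intros Hz; induction J.
- simpl. cmodule X.
- etransitivity; [exact IHJ|].
  assert (HT := is_linear_iter B J HB).
  simpl bsum. simpl Nat.iter.
  rewrite (HDe z x Hz) at 1. rewrite (linear_plus _ HT), (linear_scal _ HT).
  rewrite <- !Nat.iter_succ, Nat.iter_succ_r.
  simpl Cpow. cmodule X.
Qed.

(** Expansion of (1 - zB)^-3, with coefficients (j+1)(j+2)/2. The remainder carries D^3, D^2 and D
    with weights of order 1, J and J^2, so the decay of B^J will have to beat J^2. *)
Lemma resolvent_series3 z x J : Cmod z <= 1 ->
  D z (D z (D z x)) = plus (bsum J (fun j => scal (Cmult (RtoC ((INR j + 1) * (INR j + 2) / 2)) (Cpow z j) : C_AbsRing) (T j x)))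
    (scal (Cpow z J : C_AbsRing) (T J (plus (D z (D z (D z x)))
    (plus (scal (RtoC (INR J) : C_AbsRing) (D z (D z x)))
    (scal (RtoC (INR J * (INR J + 1) / 2) : C_AbsRing) (D z x)))))).
Proof.
intros Hz; induction J.
- simpl. replace (0 * (0 + 1) / 2) with 0 by field. cmodule X.
- etransitivity; [exact IHJ|].
  assert (HT := is_linear_iter B J HB).
  simpl bsum. rewrite Nat.iter_succ_r.
  rewrite S_INR. set (p := RtoC (INR J)).
  replace (RtoC ((INR J + 1) * (INR J + 1 + 1) / 2)) with (RtoC ((INR J + 1) * (INR J + 2) / 2)) by (f_equal; field).
  set (a := RtoC ((INR J + 1) * (INR J + 2) / 2)).
  replace (RtoC (INR J * (INR J + 1) / 2)) with (Cminus a (Cplus p 1)).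
  2:{ unfold a, p. rewrite <- RtoC_plus, <- RtoC_minus. f_equal. field. }
  rewrite (RtoC_plus (INR J) 1). fold p.
  (* One step of the remainder: its bracket equals a x plus zB applied to the bracket for J + 1. *)
  assert (E : plus (D z (D z (D z x))) (plus (scal (p : C_AbsRing) (D z (D z x)))
    (scal (Cminus a (Cplus p 1) : C_AbsRing) (D z x)))
    = plus (scal (a : C_AbsRing) x) (scal (z : C_AbsRing)
    (B (plus (D z (D z (D z x))) (plus (scal (Cplus p 1 : C_AbsRing) (D z (D z x)))
    (scal (a : C_AbsRing) (D z x))))))).
  { rewrite !(linear_plus _ HB), !(linear_scal _ HB).
    set (b3 := B (D z (D z (D z x)))). set (b2 := B (D z (D z x))). set (b1 := B (D z x)).
    rewrite (HDe z (D z (D z x)) Hz). fold b3.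
    rewrite (HDe z (D z x) Hz). fold b2.
    rewrite (HDe z x Hz). fold b1. cmodule X. }
  rewrite E, (linear_plus _ HT), !(linear_scal _ HT). simpl Cpow. cmodule X.
Qed.

(** [n] and all [j] lie below [N], so orthogonality isolates the coefficient of B^n without
    aliasing. *)
Lemma fourier_coefficient (a : nat -> R) r N n x : (n < N)%nat ->
  bsum N (fun k => scal (cis (- INR n * angle N k) : C_AbsRing)
    (bsum N (fun j => scal (Cmult (RtoC (a j)) (Cpow (root r N k) j) : C_AbsRing) (T j x))))
  = scal (RtoC (INR N * (a n * r ^ n)) : C_AbsRing) (T n x).
Proof.
intros Hn.
rewrite (bsum_ext N _ (fun k => bsum N (fun j => scal (Cmult (RtoC (a j * r ^ j))
    (cis ((INR j - INR n) * angle N k)) : C_AbsRing) (T j x)))).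
2:{ intros k _. etransitivity. symmetry; apply bsum_scal. apply bsum_ext. intros j _.
    etransitivity. apply scal_assoc. f_equal. unfold root. rewrite Cpow_cis.
    replace ((INR j - INR n) * angle N k) with (- INR n * angle N k + INR j * angle N k) by ring.
    rewrite cis_plus, RtoC_mult. change mult with Cmult. as_C. ring. }
rewrite bsum_swap. rewrite (bsum_single N _ n Hn).
- etransitivity. apply bsum_scal_l. f_equal.
  rewrite (bsum_ext N _ (fun _ => RtoC (a n * r ^ n))).
  2:{ intros k _. replace ((INR n - INR n) * angle N k) with 0 by ring.
    unfold cis. rewrite cos_0, sin_0. apply Cmult_1_r. }
  induction N. lia. clear. induction (S N).
  rewrite Rmult_0_l. reflexivity.
  rewrite S_INR. simpl bsum. rewrite IHn0. rewrite <- RtoC_plus. as_C. f_equal. ring.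
- intros j Hj Hne. etransitivity. apply bsum_scal_l.
  rewrite (bsum_ext N _ (fun k => scal (RtoC (a j * r ^ j) : C_AbsRing) (cis ((INR j - INR n) * angle N k) : C_AbsRing))).
  2: reflexivity.
  assert (H := cis_orthogonal j n N Hj Hn Hne).
  assert (H2 := @bsum_scal C_AbsRing (AbsRing_NormedModule C_AbsRing) N (RtoC (a j * r ^ j)) (fun k => cis ((INR j - INR n) * angle N k))).
  etransitivity. apply (f_equal (fun w => scal (w : C_AbsRing) (T j x))). exact H2.
  etransitivity. apply (f_equal (fun w => scal (scal (RtoC (a j * r ^ j) : C_AbsRing) (w : C_AbsRing)) (T j x))). exact H.
  etransitivity. apply (f_equal (fun w => scal (w : C_AbsRing) (T j x))). exact (Cmult_0_r (RtoC (a j * r ^ j))).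
  exact (scal_zero_l _).
Qed.

(** Triangle inequality in the inversion formula: a coefficient is at most the mean of the norms
    over the circle plus the size of the remainder. *)
Lemma fourier_bound (a : nat -> R) r N n x (F tail : nat -> X) (phi : nat -> R) eps :
  (n < N)%nat -> 0 <= a n * r ^ n ->
  (forall k, (k < N)%nat -> F k = plus (bsum N (fun j => scal (Cmult (RtoC (a j)) (Cpow (root r N k) j) : C_AbsRing) (T j x))) (tail k)) ->
  (forall k, (k < N)%nat -> norm (F k) <= phi k) ->
  (forall k, (k < N)%nat -> norm (tail k) <= eps) ->
  a n * r ^ n * norm (T n x) <= / INR N * bsum N phi + eps.
Proof.
intros Hn Ha HF Hphi Htail.
assert (HN : 0 < INR N) by (apply lt_0_INR; lia).
assert (H := fourier_coefficient a r N n x Hn).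
rewrite (bsum_ext N _ (fun k => scal (cis (- INR n * angle N k) : C_AbsRing) (minus (F k) (tail k)))) in H.
2:{ intros k Hk. f_equal. rewrite (HF k Hk). cmodule X. }
apply (f_equal norm) in H.
rewrite norm_scal_RtoC in H. 2: nra.
assert (H2 : INR N * (a n * r ^ n) * norm (T n x) <= bsum N phi + INR N * eps).
{ rewrite <- H. eapply Rle_trans. apply norm_bsum.
  rewrite <- bsum_const. eapply Rle_trans. 2: apply Req_le; exact (@bsum_plus R_AbelianMonoid N phi (fun _ => eps)).
  apply bsum_le. intros k Hk. eapply Rle_trans. apply (norm_scal (cis (- INR n * angle N k) : C_AbsRing)).
  rewrite Cmod_cis, Rmult_1_l. eapply Rle_trans. apply norm_triangle.
  rewrite norm_opp. apply Rplus_le_compat; auto. }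
apply (Rmult_le_reg_l (INR N)); auto.
replace (INR N * (/ INR N * bsum N phi + eps)) with (bsum N phi + INR N * eps).
lra. as_R. field. lra.
Qed.

Section Decay.
Variable kap : R.
Hypothesis Hkap : forall z x, Cmod z <= 1 -> norm (D z x) <= kap * norm x.

(** Qualitative stability of rB: all its sufficiently high powers have norm at most 1/2. This makes
    the remainders of the truncated series negligible. *)
Definition power_halved r := exists N0, forall N (x : X), (N0 <= N)%nat -> r ^ N * norm (T N x) <= / 2 * norm x.

Lemma power_halved_iter r : 0 <= r -> power_halved r -> forall j, exists N0, forall N (x : X), (N0 <= N)%nat ->
  r ^ N * norm (T N x) <= (/ 2) ^ j * norm x.
Proof.
intros Hr [N0 H0] j; induction j as [|j [N1 H1]].
- exists N0. intros N x HN. eapply Rle_trans. apply H0; auto. pose proof (norm_ge_0 x). lra.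
- exists (N0 + N1)%nat. intros N x HN.
  replace N with (N0 + (N - N0))%nat by lia. rewrite pow_add, Nat.iter_add.
  specialize (H1 (N - N0)%nat x ltac:(lia)).
  assert (0 <= r ^ (N - N0)) by (now apply pow_le).
  apply Rle_trans with (r ^ (N - N0) * (r ^ N0 * norm (T N0 (T (N - N0)%nat x)))). right; ring.
  apply Rle_trans with (r ^ (N - N0) * (/ 2 * norm (T (N - N0)%nat x))).
  apply Rmult_le_compat_l; auto. simpl. lra.
Qed.

Lemma kap_nonneg (x : X) : 0 <= kap * norm x.
Proof.
eapply Rle_trans. 2: apply (Hkap (RtoC 0)). apply norm_ge_0.
rewrite Cmod_0; lra.
Qed.

Lemma D_difference z w x : Cmod z <= 1 -> Cmod w <= 1 ->
  minus (D z x) (D w x) = scal (Cminus z w : C_AbsRing) (B (D z (D w x))).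
Proof.
intros Hz Hw. assert (Lz := HD z Hz).
assert (E1 : D z x = minus (D z (D w x)) (scal (w : C_AbsRing) (B (D z (D w x))))).
{ assert (E : x = minus (D w x) (scal (w : C_AbsRing) (B (D w x)))).
  { rewrite (HDe w x Hw) at 1. cmodule X. }
  rewrite E at 1. rewrite (linear_minus _ _ _ Lz), (linear_scal _ Lz), <- HDB by auto. reflexivity. }
rewrite E1. rewrite (HDe z (D w x) Hz) at 1. cmodule X.
Qed.

(** The mean of (1 - r w B)^-1 over the N-th roots of unity w is (1 - r^N B^N)^-1. It sees only the
    power B^N, yet it inherits the bound [kap] of the resolvents. *)
Definition averaged r N (x : X) := scal (RtoC (/ INR N) : C_AbsRing) (bsum N (fun k => D (root r N k) x)).

Lemma norm_average (N : nat) (F : nat -> X) c : (0 < N)%nat ->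
  (forall k, (k < N)%nat -> norm (F k) <= c) ->
  norm (scal (RtoC (/ INR N) : C_AbsRing) (bsum N F)) <= c.
Proof.
intros HN H. assert (0 < INR N) by (apply lt_0_INR; lia).
eapply Rle_trans. apply (norm_scal (RtoC (/ INR N) : C_AbsRing)).
rewrite Cmod_R, Rabs_pos_eq by (left; now apply Rinv_0_lt_compat).
apply (Rmult_le_reg_l (INR N)); auto. rewrite <- Rmult_assoc, Rinv_r, Rmult_1_l by lra.
eapply Rle_trans. apply norm_bsum. rewrite <- bsum_const. now apply bsum_le.
Qed.

Lemma averaged_identity r N (x : X) : 0 <= r <= 1 -> (0 < N)%nat ->
  averaged r N x = plus x (scal (RtoC (r ^ N) : C_AbsRing) (T N (averaged r N x))).
Proof.
intros Hr HN. unfold averaged. assert (0 < INR N) by (apply lt_0_INR; lia).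
assert (HT := is_linear_iter B N HB).
rewrite (linear_scal _ HT), (bsum_linear _ N _ HT).
rewrite (bsum_ext N (fun k => D (root r N k) x)
  (fun k => plus (bsum N (fun j => scal (Cpow (root r N k) j : C_AbsRing) (T j x)))
    (scal (RtoC (r ^ N) : C_AbsRing) (T N (D (root r N k) x))))).
2:{ intros k _. rewrite (resolvent_series1 (root r N k) x N) at 1. 2: rewrite Cmod_root; lra.
    f_equal. f_equal. unfold root. rewrite Cpow_cis.
    unfold angle. replace (INR N * (INR k * (2 * PI / INR N))) with (INR k * (2 * PI)) by (field; lra).
    rewrite cis_2PI. apply Cmult_1_r. }
rewrite bsum_plus.
assert (H0 := bsum_scal (V := X) N (RtoC (r ^ N) : C_AbsRing) (fun k => T N (D (root r N k) x))).
etransitivity. apply f_equal, f_equal, H0.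
assert (H1 := fourier_coefficient (fun _ => 1) r N 0 x HN).
rewrite (bsum_ext N _ (fun k => bsum N (fun j => scal (Cpow (root r N k) j : C_AbsRing) (T j x)))) in H1.
2:{ intros k _. simpl (INR 0). replace (- 0 * angle N k) with 0 by ring.
    unfold cis. rewrite cos_0, sin_0. etransitivity. exact (scal_one _). apply bsum_ext. intros j _.
    f_equal. apply Cmult_1_l. }
etransitivity. apply f_equal, (f_equal (fun w => plus w _)), H1.
assert (E : forall S S' : X, scal (RtoC (/ INR N) : C_AbsRing) (plus (scal (RtoC (INR N * (1 * r ^ 0)) : C_AbsRing) x) (scal (RtoC (r ^ N) : C_AbsRing) S))
   = plus x (scal (RtoC (r ^ N) : C_AbsRing) (scal (RtoC (/ INR N) : C_AbsRing) S))).
{ intros S _. replace (RtoC (INR N * (1 * r ^ 0))) with (Cinv (RtoC (/ INR N))).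
  assert (RtoC (/ INR N) <> RtoC 0).
  { intros E. injection E as E. apply Rinv_neq_0_compat in E; lra. }
  cmodule X.
  rewrite <- RtoC_inv. f_equal. rewrite Rinv_inv. simpl; ring.
  apply Rinv_neq_0_compat; lra. }
apply E. exact x.
Qed.

(** Let G = (1 - r'^N B^N)^-1. The mean over roots of unity depends on r in a Lipschitz way with a
    constant free of N, so closeness to the identity passes from r to r' and gives |G - I| <= 1/4.
    Then r'^N B^N = (G - I) - r'^N B^N (G - I) feeds [bound_bootstrap] with q = 1/4, and q/(1 - q) =
    1/3 is below 1/2. *)
Lemma power_halved_step r r' b : 0 <= r <= r' -> r' <= 1 -> 0 <= b ->
  (forall x, norm (B x) <= b * norm x) ->
  (r' - r) * (b * (kap * kap)) <= / 8 -> power_halved r -> power_halved r'.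
Proof.
intros Hr Hr' Hb HBb Hstep Hdec.
destruct (pow_lt_1_zero (/ 2)) with (y := / (8 * (Rabs kap + 1))) as [j Hj].
rewrite Rabs_pos_eq; lra.
apply Rinv_0_lt_compat. pose proof (Rabs_pos kap); lra.
specialize (Hj j (le_n _)).
destruct (power_halved_iter r (proj1 Hr) Hdec j) as [N1 HN1].
exists (S N1). intros N x HN.
assert (HN0 : (0 < N)%nat) by lia.
set (G := averaged r' N).
assert (HG : forall y, norm (minus (G y) y) <= / 4 * norm y).
{ intros y.
  assert (A1 : norm (minus (averaged r N y) y) <= / 8 * norm y).
  { rewrite (averaged_identity r N y ltac:(lra) HN0).
    replace (minus (plus y _) y) with (scal (RtoC (r ^ N) : C_AbsRing) (T N (averaged r N y))) by cmodule X.
    eapply Rle_trans. apply (norm_scal (RtoC (r ^ N) : C_AbsRing)).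
    rewrite Cmod_R, Rabs_pos_eq by (apply pow_le; lra).
    eapply Rle_trans. apply HN1; lia.
    assert (norm (averaged r N y) <= kap * norm y).
    { apply norm_average; auto. intros k _. apply Hkap. rewrite Cmod_root; lra. }
    pose proof (norm_ge_0 y).
    rewrite Rabs_pos_eq in Hj by (apply pow_le; lra).
    pose proof (Rabs_pos kap). pose proof (Rle_abs kap).
    assert (0 <= (/2) ^ j) by (apply pow_le; lra).
    apply Rle_trans with ((/2)^j * ((Rabs kap + 1) * norm y)).
    apply Rmult_le_compat_l; auto. nra.
    rewrite <- Rmult_assoc. apply Rmult_le_compat_r; auto.
    apply Rmult_lt_compat_r with (r := Rabs kap + 1) in Hj. 2: lra.
    replace (/ (8 * (Rabs kap + 1)) * (Rabs kap + 1)) with (/ 8) in Hj by (field; lra). lra. }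
  assert (A2 : norm (minus (G y) (averaged r N y)) <= / 8 * norm y).
  { unfold G, averaged.
    replace (minus _ _) with (scal (RtoC (/ INR N) : C_AbsRing)
    (bsum N (fun k => minus (D (root r' N k) y) (D (root r N k) y)))).
    2:{ etransitivity. apply f_equal, (bsum_minus (V := X)). cmodule X. }
    apply norm_average; auto. intros k _.
    rewrite D_difference by (rewrite Cmod_root; lra).
    eapply Rle_trans. apply (norm_scal (Cminus (root r' N k) (root r N k) : C_AbsRing)).
    replace (Cminus (root r' N k) (root r N k)) with (Cmult (RtoC (r' - r)) (cis (angle N k))).
    2: unfold root; rewrite RtoC_minus; ring.
    rewrite Cmod_mult, Cmod_cis, Cmod_R, Rabs_pos_eq, Rmult_1_r by lra.
    assert (A : norm (B (D (root r' N k) (D (root r N k) y))) <= b * (kap * (kap * norm y))).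
    { eapply Rle_trans. apply HBb. apply Rmult_le_compat_l; auto.
    eapply Rle_trans. apply Hkap. rewrite Cmod_root; lra.
    destruct (Rle_dec 0 kap).
    apply Rmult_le_compat_l; auto. apply Hkap. rewrite Cmod_root; lra.
    assert (norm y = 0). { pose proof (kap_nonneg y). pose proof (norm_ge_0 y). nra. }
    assert (norm (D (root r N k) y) = 0).
    { apply Rle_antisym. 2: apply norm_ge_0. eapply Rle_trans. apply Hkap. rewrite Cmod_root; lra. rewrite H; lra. }
    rewrite H, H0. lra. }
    pose proof (norm_ge_0 y).
    apply Rle_trans with ((r' - r) * (b * (kap * (kap * norm y)))).
    apply Rmult_le_compat_l; lra.
    replace ((r' - r) * (b * (kap * (kap * norm y)))) with ((r' - r) * (b * (kap * kap)) * norm y) by ring.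
    apply Rmult_le_compat_r; auto. }
  replace (minus (G y) y) with (plus (minus (G y) (averaged r N y)) (minus (averaged r N y) y)) by cmodule X.
  eapply Rle_trans. apply norm_triangle. lra. }
assert (HT := is_linear_iter B N HB).
assert (HG1 : forall y, T N y = T N y /\ r' ^ N * norm (T N y) <= norm (minus (G y) y) + r' ^ N * norm (T N (minus (G y) y))).
{ intros y; split; auto.
  assert (0 <= r' ^ N) by (apply pow_le; lra).
  assert (E : scal (RtoC (r' ^ N) : C_AbsRing) (T N y)
    = minus (minus (G y) y) (scal (RtoC (r' ^ N) : C_AbsRing) (T N (minus (G y) y)))).
  { rewrite (linear_minus _ _ _ HT).
    assert (E2 : minus (G y) y = scal (RtoC (r' ^ N) : C_AbsRing) (T N (G y))).
    { unfold G. rewrite (averaged_identity r' N y ltac:(lra) HN0) at 1. cmodule X. }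
    rewrite E2. cmodule X. }
  rewrite <- norm_scal_RtoC by auto. rewrite E. eapply Rle_trans. apply norm_minus_le.
  rewrite norm_scal_RtoC by auto. apply Rle_refl. }
apply Rle_trans with (/ 4 / (1 - / 4) * norm x). 2: pose proof (norm_ge_0 x); lra.
apply (bound_bootstrap X (fun y => r' ^ N * norm (T N y)) norm (/ 4)).
- lra.
- intros; apply norm_ge_0.
- destruct (linear_norm _ HT) as [M [HM0 HM]].
  exists M; split; [lra|]. intros y. specialize (HM y).
  assert (0 <= r' ^ N <= 1). { split. apply pow_le; lra. rewrite <- (pow1 N). apply pow_incr; lra. }
  pose proof (norm_ge_0 (T N y)). nra.
- intros c Hc HcT y. destruct (HG1 y) as [_ H]. specialize (HcT (minus (G y) y)). specialize (HG y).
  nra.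
Qed.

(** The admissible increment [eta] of the radius does not depend on r, so finitely many increments
    lead from 0, where r^N = 0, to 1. *)
Lemma power_halved_one : power_halved 1.
Proof.
destruct (linear_norm _ HB) as [b [Hb0 Hb]].
set (eta := / (8 * (b * (kap * kap) + 1))).
assert (Heta : 0 < eta). { apply Rinv_0_lt_compat. nra. }
assert (Hst : forall d, d <= eta -> 0 <= d -> d * (b * (kap * kap)) <= / 8).
{ intros d H1 H0. apply Rle_trans with (eta * (b * (kap * kap) + 1)).
  apply Rmult_le_compat; nra. unfold eta. right; field. nra. }
assert (H : forall i, power_halved (Rmin 1 (INR i * eta))).
{ induction i.
  - rewrite Rmult_0_l, Rmin_right by lra. exists 1%nat. intros N x HN.
    rewrite pow_i by lia. pose proof (norm_ge_0 x). lra.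
  - rewrite S_INR.
    assert (0 <= INR i) by apply pos_INR.
    apply (power_halved_step (Rmin 1 (INR i * eta)) _ b); auto; try lra.
    + unfold Rmin; repeat destruct Rle_dec; nra.
    + apply Rmin_l.
    + apply Hst; unfold Rmin; repeat destruct Rle_dec; nra. }
destruct (nfloor_ex (/ eta)) as [n [_ Hn]]. left; now apply Rinv_0_lt_compat.
specialize (H (S n)). rewrite Rmin_left in H; auto.
rewrite S_INR. apply Rmult_lt_compat_r with (r := eta) in Hn; auto. rewrite Rinv_l in Hn; lra.
Qed.

(** Once |B^N1| <= 1/2 the powers decay geometrically. With N = 3 i N1 the bound 8^-i is split into
    three factors 2^-i: two absorb i^2 and the third makes the product small. *)
Lemma power_decay (M : nat) eps : 0 < eps -> exists N, (M <= N)%nat /\ (1 <= N)%nat /\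
  forall x : X, INR N ^ 2 * norm (T N x) <= eps * norm x.
Proof.
intros He. destruct power_halved_one as [N0 H0].
set (N1 := S N0).
assert (H1 : forall j x, norm (T (j * N1)%nat x) <= (/ 2) ^ j * norm x).
{ induction j; intros x. simpl; lra.
  replace (S j * N1)%nat with (N1 + j * N1)%nat by lia. rewrite Nat.iter_add.
  specialize (H0 N1 (T (j * N1)%nat x) ltac:(unfold N1; lia)). rewrite pow1, Rmult_1_l in H0.
  specialize (IHj x). simpl pow. lra. }
assert (Hi : forall i, INR i * (/ 2) ^ i <= 1).
{ induction i. simpl; lra. rewrite S_INR. simpl pow.
  assert (0 <= (/ 2) ^ i <= 1). { split. apply pow_le; lra. rewrite <- (pow1 i). apply pow_incr; lra. }
  nra. }
destruct (pow_lt_1_zero (/ 2)) with (y := eps / (9 * INR N1 ^ 2)) as [i0 Hi0].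
rewrite Rabs_pos_eq; lra.
assert (HN1 : 0 < INR N1) by (apply lt_0_INR; unfold N1; lia).
apply Rdiv_lt_0_compat; nra.
set (i := S (max i0 M)).
assert (HN1 : 1 <= INR N1) by (apply (le_INR 1); unfold N1; lia).
exists (3 * i * N1)%nat. split; [unfold i, N1; nia|]. split; [unfold i, N1; nia|].
intros x. specialize (H1 (3 * i)%nat x).
specialize (Hi0 i ltac:(unfold i; lia)). rewrite Rabs_pos_eq in Hi0 by (apply pow_le; lra).
specialize (Hi i). set (y := (/ 2) ^ i) in *.
assert (Hy : 0 <= y) by (apply pow_le; lra).
assert (E : (/ 2) ^ (3 * i) = y * y * y).
{ replace (3 * i)%nat with (i + i + i)%nat by lia. now rewrite !pow_add. }
rewrite E in H1. rewrite !mult_INR.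
pose proof (norm_ge_0 x). set (q := INR i) in *. assert (0 <= q) by apply pos_INR.
apply Rle_trans with (9 * INR N1 ^ 2 * (q * y) ^ 2 * y * norm x).
{ apply Rle_trans with (((2 + 1) * q * INR N1) ^ 2 * (y * y * y * norm x)).
  apply Rmult_le_compat_l; auto. apply pow2_ge_0. right; ring. }
apply Rmult_le_compat_r; auto.
apply Rle_trans with (9 * INR N1 ^ 2 * 1 * y).
{ apply Rmult_le_compat_r; auto. apply Rmult_le_compat_l. nra.
  rewrite <- (pow1 2). apply pow_incr. split; auto. apply Rmult_le_pos; auto. }
apply Rlt_le. apply (Rmult_lt_compat_l (9 * INR N1 ^ 2)) in Hi0. 2: nra.
replace (9 * INR N1 ^ 2 * (eps / (9 * INR N1 ^ 2))) with eps in Hi0 by (field; lra). lra.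
Qed.
End Decay.

Section PowerBounds.
Variables (h kap : R).
Hypothesis Hh : 0 < h <= 1.
Hypothesis Hkap : 0 <= kap.
Hypothesis HDn : forall z x, Cmod z <= 1 -> norm (D z x) <= kap / (h + Cmod (Cminus 1 z)) * norm x.
Hypothesis HDc : forall z x, Cmod z <= 1 -> norm (minus (D z x) (B (D z x))) <= kap * norm x.

Lemma Cmod_one_minus_root_pos q N k : 0 <= q < 1 -> 0 < Cmod (Cminus 1 (root q N k)).
Proof.
intros Hq. assert (H := Cmod2_one_minus_root q N k). pose proof (COS_bound (angle N k)).
pose proof (Cmod_ge_0 (Cminus 1 (root q N k))).
nra.
Qed.

Lemma D_uniform z x : Cmod z <= 1 -> norm (D z x) <= kap / h * norm x.
Proof.
intros Hz. eapply Rle_trans. now apply HDn. apply Rmult_le_compat_r. apply norm_ge_0.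
apply Rmult_le_compat_l; auto. pose proof (Cmod_ge_0 (Cminus 1 z)). apply Rinv_le_contravar; lra.
Qed.

Lemma D_pointwise r N k x : 0 <= r < 1 ->
  norm (D (root r N k) x) <= kap * / Cmod (Cminus 1 (root r N k)) * norm x.
Proof.
intros Hr. pose proof (Cmod_one_minus_root_pos r N k Hr).
eapply Rle_trans. apply HDn. rewrite Cmod_root; lra. apply Rmult_le_compat_r. apply norm_ge_0.
apply Rmult_le_compat_l; auto. apply Rinv_le_contravar; lra.
Qed.

(** One order N serves three purposes: it exceeds n, it bounds the discrete Poisson mean, and it
    makes the remainder smaller than [eps]. *)
Lemma large_order (r : R) (n : nat) (x : X) c eps : 0 <= r < 1 -> 0 <= c -> 0 < eps -> exists N,
  (n < N)%nat /\ r ^ N <= 1 / 3 /\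
  forall y : X, norm y <= INR N ^ 2 * c * norm x -> norm (T N y) <= eps.
Proof.
intros Hr Hc He.
destruct (pow_lt_1_zero r) with (y := 1/3) as [M HM]. rewrite Rabs_pos_eq; lra. lra.
set (e := eps / (c * norm x + 1)).
assert (Hx := norm_ge_0 x). assert (Hcx : 0 <= c * norm x) by nra.
destruct (power_decay (kap / h) D_uniform (max (S n) M) e) as [N [HN1 [HN2 HN]]].
{ apply Rdiv_lt_0_compat; lra. }
exists N. split; [lia|]. split.
{ specialize (HM N ltac:(lia)). rewrite Rabs_pos_eq in HM by (apply pow_le; lra). lra. }
intros y Hy. specialize (HN y).
assert (H0 : 0 < INR N ^ 2). { apply pow_lt. apply lt_0_INR; lia. }
apply (Rmult_le_reg_l (INR N ^ 2)); auto.
eapply Rle_trans. exact HN.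
apply Rle_trans with (e * (INR N ^ 2 * c * norm x)).
apply Rmult_le_compat_l; auto. left; apply Rdiv_lt_0_compat; lra.
replace (e * (INR N ^ 2 * c * norm x)) with (INR N ^ 2 * (e * (c * norm x))) by ring.
apply Rmult_le_compat_l; [lra|]. unfold e.
replace (eps / (c * norm x + 1) * (c * norm x)) with (eps * (c * norm x) / (c * norm x + 1)) by (field; lra).
apply Rle_div_l; nra.
Qed.

Lemma norm_pow_scal_le z J (y : X) : Cmod z <= 1 -> norm (scal (Cpow z J : C_AbsRing) y) <= norm y.
Proof.
intros Hz. eapply Rle_trans. apply (norm_scal (Cpow z J : C_AbsRing)).
rewrite Cmod_pow.
rewrite <- (Rmult_1_l (norm y)) at 2. apply Rmult_le_compat_r. apply norm_ge_0.
rewrite <- (pow1 J). apply pow_incr. split; auto. apply Cmod_ge_0.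
Qed.

(** Two resolvent factors are averaged by the Poisson kernel, at the cost 1/(1 - r); [b] records
    what the third factor and the vector contribute. *)
Lemma cube_bound r n y b : 0 <= r < 1 -> 0 <= b ->
  (forall N k, let z := root r N k in norm (D z (D z (D z y))) <= b * / Cmod (Cminus 1 z) ^ 2) ->
  (INR n + 1) * (INR n + 2) / 2 * r ^ n * norm (T n y) <= 2 * b / (1 - r).
Proof.
intros Hr Hb Hy3. apply norm_bound_limit. intros eps He.
set (K := kap / h). assert (HK : 0 <= K) by (apply Rdiv_le_0_compat; lra).
destruct (large_order r n y (K * K * K + K * K + K) eps Hr ltac:(nra) He) as [N [HnN [HqN HN]]].
assert (HN1 : 1 <= INR N) by (apply (le_INR 1); lia).
assert (Hroot : forall k, Cmod (root r N k) <= 1) by (intros; rewrite Cmod_root; lra).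
assert (Hy := norm_ge_0 y).
eapply Rle_trans.
- apply (fourier_bound (fun j => (INR j + 1) * (INR j + 2) / 2) r N n y (fun k => D (root r N k) (D (root r N k) (D (root r N k) y)))
    (fun k => scal (Cpow (root r N k) N : C_AbsRing) (T N (plus (D (root r N k) (D (root r N k) (D (root r N k) y)))
    (plus (scal (RtoC (INR N) : C_AbsRing) (D (root r N k) (D (root r N k) y)))
    (scal (RtoC (INR N * (INR N + 1) / 2) : C_AbsRing) (D (root r N k) y))))))
    (fun k => b * / Cmod (Cminus 1 (root r N k)) ^ 2) eps HnN).
  + apply Rmult_le_pos. pose proof (pos_INR n); nra. apply pow_le; lra.
  + intros k _. apply resolvent_series3. auto.
  + intros k _. apply Hy3.
  + intros k _. eapply Rle_trans. now apply norm_pow_scal_le. apply HN.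
    eapply Rle_trans. apply norm_triangle. eapply Rle_trans. apply Rplus_le_compat_l, norm_triangle.
    rewrite !norm_scal_RtoC by nra. set (z := root r N k). assert (Hz : Cmod z <= 1) by apply Hroot.
    assert (D1 := D_uniform z y Hz). assert (D2 := D_uniform z (D z y) Hz).
    assert (D3 := D_uniform z (D z (D z y)) Hz). fold K in D1, D2, D3.
    assert (P2 : norm (D z (D z y)) <= K * (K * norm y)) by nra.
    assert (P4 : 0 <= K * (K * norm y)) by nra. assert (P5 : 0 <= K * (K * (K * norm y))) by nra.
    apply Rle_trans with (INR N ^ 2 * (K * (K * (K * norm y))) + (INR N ^ 2 * (K * (K * norm y)) + INR N ^ 2 * (K * norm y))).
    2: right; ring.
    assert (0 <= INR N * (INR N + 1) / 2 <= INR N ^ 2) by nra.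
    pose proof (norm_ge_0 (D z y)). pose proof (norm_ge_0 (D z (D z y))).
    repeat apply Rplus_le_compat. nra. apply Rmult_le_compat; lra. apply Rmult_le_compat; lra.
- apply Rplus_le_compat_r. rewrite bsum_mult.
  assert (H := poisson_kernel_average r N Hr ltac:(lia) HqN).
  set (S := bsum N _) in *.
  replace (/ INR N * (b * S)) with (b * (/ INR N * S)) by ring.
  replace (2 * b / (1 - r)) with (b * (2 / (1 - r))) by (field; lra).
  apply Rmult_le_compat_l; auto.
Qed.

Lemma exp_pow_INR x n : exp x ^ n = exp (INR n * x).
Proof.
induction n. simpl; now rewrite Rmult_0_l, exp_0.
rewrite S_INR, Rmult_plus_distr_r, Rmult_1_l, exp_plus. simpl. rewrite IHn. ring.
Qed.

(** The radius n/(n+1) balances 1/(1 - r) = n + 1 against r^n, which stays above 1/3 because (1 +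
    1/n)^n <= e <= 3. *)
Lemma radius_bound n : (1 <= n)%nat -> / 3 <= (INR n / (INR n + 1)) ^ n.
Proof.
intros Hn. assert (0 < INR n) by (apply lt_0_INR; lia).
replace (INR n / (INR n + 1)) with (/ (1 + / INR n)) by (field; lra).
rewrite pow_inv. apply Rinv_le_contravar.
apply pow_lt. pose proof (Rinv_0_lt_compat _ H); lra.
apply Rle_trans with (exp (/ INR n) ^ n).
apply pow_incr. split. pose proof (Rinv_0_lt_compat _ H); lra. left; apply exp_ineq1. apply Rinv_neq_0_compat; lra.
rewrite exp_pow_INR, Rinv_r by lra. apply exp_le_3.
Qed.

(** At radius n/(n+1) the third resolvent factor is at most kap (n+1). The right-hand side is then
    of order (n+1)^2, like the coefficient (n+1)(n+2)/2. *)
Lemma power_bounded n x : (1 <= n)%nat -> norm (T n x) <= 12 * kap ^ 3 * norm x.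
Proof.
intros Hn. assert (0 < INR n) by (apply lt_0_INR; lia).
set (r := INR n / (INR n + 1)). assert (Hr : 0 <= r < 1).
{ unfold r; split. apply Rdiv_le_0_compat; lra. apply Rlt_div_l; lra. }
assert (Hx := norm_ge_0 x). assert (Hk3 : 0 <= kap ^ 3 * norm x) by (apply Rmult_le_pos; auto; now apply pow_le).
assert (Hir : 0 < / (1 - r)) by (apply Rinv_0_lt_compat; lra).
assert (H1 := cube_bound r n x (kap ^ 3 * norm x * / (1 - r)) Hr ltac:(nra)).
assert (H2 := radius_bound n Hn). fold r in H2.
replace (2 * (kap ^ 3 * norm x * / (1 - r)) / (1 - r)) with (2 * kap ^ 3 * norm x * (INR n + 1) ^ 2) in H1 by (unfold r; field; lra).
assert (H3 : (INR n + 1) * (INR n + 2) / 2 * r ^ n * norm (T n x) <= 2 * kap ^ 3 * norm x * (INR n + 1) ^ 2).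
{ apply H1. intros N k z. assert (Hz := Cmod_one_minus_root_pos r N k Hr).
  assert (Hz1 : 1 - r <= Cmod (Cminus 1 z)).
  { assert (Ht := Cmod_triangle (Cminus 1 z) z). replace (Cplus (Cminus 1 z) z) with (RtoC 1) in Ht by ring.
    rewrite Cmod_1 in Ht. unfold z in Ht at 2. rewrite Cmod_root in Ht; lra. }
  assert (D1 := D_pointwise r N k x Hr). assert (D2 := D_pointwise r N k (D z x) Hr). assert (D3 := D_pointwise r N k (D z (D z x)) Hr).
  set (c := / Cmod (Cminus 1 z)) in *. assert (0 < c) by now apply Rinv_0_lt_compat.
  assert (c <= / (1 - r)) by (apply Rinv_le_contravar; lra). assert (0 <= kap * c) by nra.
  rewrite <- pow_inv. fold c. eapply Rle_trans. exact D3.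
  apply Rle_trans with (kap * c * (kap * c * (kap * c * norm x))).
  apply Rmult_le_compat_l; auto. eapply Rle_trans. exact D2. now apply Rmult_le_compat_l.
  replace (kap * c * (kap * c * (kap * c * norm x))) with (kap ^ 3 * norm x * c ^ 2 * c) by ring.
  replace (kap ^ 3 * norm x * / (1 - r) * c ^ 2) with (kap ^ 3 * norm x * c ^ 2 * / (1 - r)) by ring.
  apply Rmult_le_compat_l; auto. apply Rmult_le_pos; auto. apply pow2_ge_0. }
set (t := norm (T n x)) in *. assert (0 <= t) by apply norm_ge_0.
assert ((INR n + 1) ^ 2 / 6 * t <= (INR n + 1) ^ 2 * (2 * kap ^ 3 * norm x)).
{ eapply Rle_trans. 2: eapply Rle_trans; [exact H3|right; ring].
  apply Rmult_le_compat_r; auto.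
  apply Rle_trans with ((INR n + 1) * (INR n + 2) / 2 * / 3). nra. apply Rmult_le_compat_l; nra. }
apply Rmult_le_reg_l with ((INR n + 1) ^ 2 / 6); nra.
Qed.

(** The third factor is absorbed, since (1 - B) D is bounded uniformly on the disc. The right-hand
    side is then only of order n + 1, one power less than the coefficient. *)
Lemma power_difference_rate n x : (1 <= n)%nat ->
  INR n * norm (T n (minus x (B x))) <= 12 * kap ^ 3 * norm x.
Proof.
intros Hn. assert (0 < INR n) by (apply lt_0_INR; lia).
set (r := INR n / (INR n + 1)). assert (Hr : 0 <= r < 1).
{ unfold r; split. apply Rdiv_le_0_compat; lra. apply Rlt_div_l; lra. }
assert (Hx := norm_ge_0 x). assert (Hk3 : 0 <= kap ^ 3 * norm x) by (apply Rmult_le_pos; auto; now apply pow_le).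
assert (H1 := cube_bound r n (minus x (B x)) (kap ^ 3 * norm x) Hr Hk3).
assert (H2 := radius_bound n Hn). fold r in H2.
set (t := norm (T n (minus x (B x)))) in *. assert (0 <= t) by apply norm_ge_0.
assert (H3 : (INR n + 1) * (INR n + 2) / 2 * r ^ n * t <= (INR n + 1) * (2 * kap ^ 3 * norm x)).
{ replace ((INR n + 1) * (2 * kap ^ 3 * norm x)) with (2 * (kap ^ 3 * norm x) / (1 - r)) by (unfold r; field; lra).
  apply H1. intros N k z. assert (Hz0 := Cmod_one_minus_root_pos r N k Hr).
  assert (Hz : Cmod z <= 1) by (unfold z; rewrite Cmod_root; lra).
  assert (E : D z (minus x (B x)) = minus (D z x) (B (D z x))) by (rewrite (linear_minus _ _ _ (HD z Hz)), HDB by auto; reflexivity).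
  rewrite E.
  assert (H3 := HDc z x Hz). set (w := minus (D z x) (B (D z x))) in *.
  assert (D1 := D_pointwise r N k w Hr). assert (D2 := D_pointwise r N k (D z w) Hr).
  set (c := / Cmod (Cminus 1 z)) in *. assert (0 < c) by now apply Rinv_0_lt_compat.
  rewrite <- pow_inv. fold c. eapply Rle_trans. exact D2.
  apply Rle_trans with (kap * c * (kap * c * (kap * norm x))). 2: right; ring.
  apply Rmult_le_compat_l. nra. eapply Rle_trans. exact D1. apply Rmult_le_compat_l; nra. }
replace ((INR n + 1) * (INR n + 2) / 2 * r ^ n * t) with ((INR n + 1) * ((INR n + 2) / 2 * r ^ n * t)) in H3 by field.
apply Rmult_le_reg_l in H3; [|lra].
assert (INR n / 2 * / 3 * t <= (INR n + 2) / 2 * r ^ n * t).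
{ apply Rmult_le_compat_r; auto. apply Rmult_le_compat; lra. }
lra.
Qed.

(* [D 1] inverts [1 - B] with norm at most [kap / h]. *)
Lemma power_decay_rate n x : (1 <= n)%nat -> INR n * h * norm (T n x) <= 12 * kap ^ 4 * norm x.
Proof.
intros Hn. assert (H1 : Cmod 1 <= 1) by (rewrite Cmod_1; lra).
assert (E : T n x = D 1 (T n (minus x (B x)))).
{ rewrite (linear_minus _ _ _ (is_linear_iter B n HB)), <- Nat.iter_succ_r, Nat.iter_succ, (linear_minus _ _ _ (HD 1 H1)), <- HDB by auto.
  rewrite (HDe 1 (T n x) H1) at 1. cmodule X. }
rewrite E. assert (H2 := D_uniform 1 (T n (minus x (B x))) H1). assert (H3 := power_difference_rate n x Hn).
set (y := T n (minus x (B x))) in *. pose proof (pos_INR n).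
apply Rle_trans with (INR n * h * (kap / h * norm y)). apply Rmult_le_compat_l; auto. apply Rmult_le_pos; lra.
replace (INR n * h * (kap / h * norm y)) with (kap * (INR n * norm y)) by (field; lra).
replace (12 * kap ^ 4 * norm x) with (kap * (12 * kap ^ 3 * norm x)) by ring. now apply Rmult_le_compat_l.
Qed.
End PowerBounds.
End DiscreteFourier.

(** * Limits in norm and the straddle lemma *)

Section NormLimits.
Context {K : AbsRing} {V : NormedModule K}.

Lemma filterlim_norm {T : Type} (F : (T -> Prop) -> Prop) {FF : Filter F} (f : T -> V) (y : V) :
  filterlim f F (locally y) <-> forall eps, 0 < eps -> F (fun t => norm (minus (f t) y) < eps).
Proof.
split; intros H.
- intros eps He. apply (H (fun v => norm (minus v y) < eps)).
  apply (locally_le_locally_norm y). exists (mkposreal eps He). intros v Hv; exact Hv.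
- intros P HP. apply (locally_norm_le_locally y) in HP. destruct HP as [eps HP].
  unfold filtermap. generalize (H eps (cond_pos eps)). apply filter_imp. intros t Ht. apply HP, Ht.
Qed.

Lemma norm_minus_sym (a b : V) : norm (minus a b) = norm (minus b a).
Proof. rewrite <- (norm_opp (minus a b)), opp_minus. reflexivity. Qed.

Lemma norm_minus_triangle (a b c : V) : norm (minus a c) <= norm (minus a b) + norm (minus b c).
Proof. rewrite (minus_trans b a c). apply norm_triangle. Qed.

Lemma plus_minus_cancel (a b : V) : plus b (minus a b) = a.
Proof.
transitivity (plus a (plus (opp b) b)).
rewrite plus_assoc. apply plus_comm.
etransitivity. apply (f_equal (plus a)), (@plus_opp_l V b). apply plus_zero_r.
Qed.

Lemma norm_le_minus (a b : V) : norm a <= norm b + norm (minus a b).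
Proof.
rewrite <- (plus_minus_cancel a b) at 1. apply norm_triangle.
Qed.

Lemma norm_eq_zero_le (a : V) : norm a <= 0 -> a = zero.
Proof. intros H. apply norm_eq_zero. pose proof (norm_ge_0 a). lra. Qed.

Lemma minus_zero_eq (a b : V) : minus a b = zero -> a = b.
Proof.
intros H. rewrite <- (plus_minus_cancel a b), H. apply plus_zero_r.
Qed.

Lemma norm_minus_self (a : V) : norm (minus a a) = 0.
Proof. etransitivity. exact (f_equal norm (@minus_eq_zero V a)). apply (@norm_zero K V). Qed.

Lemma eq_of_norm_minus (a b : V) : (forall eps, 0 < eps -> norm (minus a b) <= eps) -> a = b.
Proof.
intros H. apply minus_zero_eq, norm_eq_zero_le.
apply Rnot_lt_le. intros h. specialize (H (norm (minus a b) / 2)). lra.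
Qed.

(** Supremum argument: the local inequality at the supremum of the points already reached carries
    past it. Only increments across [t] are compared, so differentiability at each single point
    verifies the hypothesis; the lemma acts as a mean value inequality without any integral. *)
Lemma straddle_bound (F : R -> V) (W : R -> R) a b : a <= b ->
  (forall t, a <= t <= b -> exists d, 0 < d /\ forall y z, a <= y <= t -> t <= z <= b ->
    t - d < y -> z < t + d -> norm (minus (F z) (F y)) <= W z - W y) ->
  norm (minus (F b) (F a)) <= W b - W a.
Proof.
intros Hab H.
set (S := fun x => a <= x <= b /\ norm (minus (F x) (F a)) <= W x - W a).
assert (Sa : S a).
{ split; [lra|]. rewrite norm_minus_self. lra. }
destruct (completeness S) as [c [Hc1 Hc2]].
{ exists b. intros x [Hx _]. lra. }
{ now exists a. }
assert (Hac : a <= c) by (now apply Hc1).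
assert (Hcb : c <= b) by (apply Hc2; intros x [Hx _]; lra).
destruct (H c (conj Hac Hcb)) as [d [Hd Hd2]].
assert (Hex : exists x, S x /\ c - d < x).
{ apply NNPP. intros Hn. assert (c <= c - d).
  apply Hc2. intros x Hx. apply Rnot_lt_le. intros h. apply Hn. now exists x. lra. }
destruct Hex as [x [Sx Hx]]. assert (Hxc : x <= c) by (now apply Hc1).
destruct Sx as [Hxab Sx].
assert (Hz : forall z, c <= z <= b -> z < c + d -> S z).
{ intros z Hz1 Hz2. split; [lra|].
  eapply Rle_trans. apply (norm_minus_triangle _ (F x)).
  specialize (Hd2 x z ltac:(lra) ltac:(lra) ltac:(lra) ltac:(lra)). lra. }
destruct (Req_dec c b) as [E|E].
- subst c. apply Hz; lra.
- assert (Hz2 : S (Rmin b (c + d / 2))).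
  { apply Hz; unfold Rmin; destruct Rle_dec; lra. }
  apply Hc1 in Hz2. unfold Rmin in Hz2; destruct Rle_dec in Hz2; lra.
Qed.

Lemma density_seq (P : V -> Prop) (x : V) :
  (forall eps, 0 < eps -> exists y, P y /\ norm (minus x y) < eps) ->
  exists xs : nat -> V, (forall n, P (xs n)) /\ forall n, norm (minus x (xs n)) < / (INR n + 1).
Proof.
intros H.
destruct (choice (fun n y => P y /\ norm (minus x y) < / (INR n + 1))) as [xs Hxs].
intros n. apply H. apply Rinv_0_lt_compat. pose proof (pos_INR n); lra.
exists xs. split; intros n; apply Hxs.
Qed.
End NormLimits.

Lemma inv_INR_small eps : 0 < eps -> exists N, forall n, (N <= n)%nat -> / (INR n + 1) < eps.
Proof.
intros He. destruct (nfloor_ex (/ eps)) as [N [_ HN]]. left; now apply Rinv_0_lt_compat.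
exists (S N). intros n Hn. apply le_INR in Hn. rewrite S_INR in Hn.
rewrite <- (Rinv_inv eps). apply Rinv_lt_contravar.
apply Rmult_lt_0_compat. now apply Rinv_0_lt_compat. pose proof (pos_INR n); lra. lra.
Qed.

Definition seq_complete {K : AbsRing} (V : NormedModule K) : Prop := forall xs : nat -> V,
  (forall eps, 0 < eps -> exists N, forall n m, (N <= n)%nat -> (N <= m)%nat -> norm (minus (xs n) (xs m)) < eps) ->
  exists l, filterlim xs eventually (locally l).

(* Most lemmas below take a plain normed module and this property: the coercion
   paths of [CompleteNormedModule] obstruct unification. *)
Lemma complete_seq_complete {K : AbsRing} (V : CompleteNormedModule K) :
  seq_complete (CompleteNormedModule.NormedModule K V).
Proof.
intros xs H. apply (proj1 (filterlim_locally_cauchy (U := V) (F := eventually) xs)). intros eps.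
destruct (H eps (cond_pos eps)) as [N HN].
exists (fun n => (N <= n)%nat). split. now exists N.
intros u v Hu Hv.
refine (@norm_compat1 K (CompleteNormedModule.NormedModule K V) _ _ _ _). now apply HN.
Qed.

(** * Uniform boundedness *)

Lemma operator_norm_attained {V : NormedModule C_AbsRing} (T : V -> V) :
  is_linear T -> exists N w, (forall x, norm (T x) <= N * norm x) /\ norm w <= 1 /\ 3 / 4 * N <= norm (T w).
Proof.
intros HT. destruct (linear_norm _ HT) as [M [HM0 HM]].
destruct (completeness (fun r => exists x, norm x <= 1 /\ r = norm (T x))) as [N [HN1 HN2]].
{ exists M. intros r [x [Hx ->]]. specialize (HM x). nra. }
{ exists (norm (T zero)), zero. split; auto. rewrite norm_zero; lra. }
assert (HN : forall x, norm (T x) <= N * norm x).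
{ intros x. destruct (Req_dec (norm x) 0) as [E|E].
  - specialize (HM x). rewrite E in *. lra.
  - pose proof (norm_ge_0 x). assert (0 < / norm x) by (apply Rinv_0_lt_compat; lra).
    assert (H1 : norm (T (scal (RtoC (/ norm x) : C_AbsRing) x)) <= N).
    { apply HN1. eexists; split; [|reflexivity]. rewrite norm_scal_RtoC by lra. right; field; auto. }
    rewrite (linear_scal _ HT), norm_scal_RtoC in H1 by lra.
    apply (Rmult_le_compat_r (norm x)) in H1; auto.
    replace (/ norm x * norm (T x) * norm x) with (norm (T x)) in H1 by (field; auto). lra. }
assert (N0 : 0 <= N). { eapply Rle_trans. apply (norm_ge_0 (T zero)). apply HN1. exists zero. rewrite norm_zero; split; auto; lra. }
destruct (classic (exists w, norm w <= 1 /\ 3 / 4 * N <= norm (T w))) as [[w [w1 w2]]|Hn].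
now exists N, w.
exists N, zero. split; auto. rewrite norm_zero. split; [lra|].
assert (N <= 3 / 4 * N). { apply HN2. intros r [x [Hx ->]]. apply Rnot_lt_le. intros h. apply Hn. exists x. lra. }
pose proof (norm_ge_0 (T zero)). lra.
Qed.

(* Gliding hump: the n-th correction of [x], of size 3^-n, keeps [T n x] large. *)
Lemma uniform_boundedness (V : NormedModule C_AbsRing) (T : nat -> V -> V) :
  seq_complete V ->
  (forall n, is_linear (T n)) ->
  (forall x, exists M, forall n, norm (T n x) <= M) ->
  ~ (forall n, exists x, norm x <= 1 /\ 4 ^ n <= norm (T n x)).
Proof.
intros HV HT Hpt Hbig.
destruct (choice (fun n N => exists w, (forall x, norm (T n x) <= N * norm x) /\ norm w <= 1 /\ 3 / 4 * N <= norm (T n w))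
  (fun n => operator_norm_attained (T n) (HT n))) as [N HN].
destruct (choice _ HN) as [w Hw].
assert (HN4 : forall n, 4 ^ n <= N n).
{ intros n. destruct (Hbig n) as [x [Hx1 Hx2]]. destruct (Hw n) as [H1 [H2 H3]].
  specialize (H1 x). pose proof (norm_ge_0 x). assert (0 < 4 ^ n) by (apply pow_lt; lra).
  destruct (Rle_dec 0 (N n)). nra. assert (N n * norm x <= 0) by nra. lra. }
assert (H3 : forall n, 0 < (/ 3) ^ n) by (intros; apply pow_lt; lra).
assert (H4 : forall n, 0 < 4 ^ n) by (intros; apply pow_lt; lra).
(* Since 2 T y = T(v + y) - T(v - y), one of v + y and v - y satisfies |T v'| >= |T y|. *)
assert (Hstep : forall p : nat * V, exists v', norm (minus v' (snd p)) <= (/ 3) ^ (fst p) /\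
    3 / 4 * (/ 3) ^ (fst p) * N (fst p) <= norm (T (fst p) v')).
{ intros [n v]; simpl. set (y := scal (RtoC ((/ 3) ^ n) : C_AbsRing) (w n)).
  destruct (Hw n) as [w1 [w2 w3]]. specialize (H3 n).
  assert (Hy : norm y <= (/ 3) ^ n).
  { unfold y. rewrite norm_scal_RtoC by lra. nra. }
  assert (HTy : 3 / 4 * (/ 3) ^ n * N n <= norm (T n y)).
  { unfold y. rewrite (linear_scal _ (HT n)), norm_scal_RtoC by lra. nra. }
  destruct (Rle_dec (3 / 4 * (/ 3) ^ n * N n) (norm (T n (plus v y)))) as [H|H].
  - exists (plus v y). split; auto. replace (minus (plus v y) v) with y by cmodule V. auto.
  - exists (minus v y). split.
    + replace (minus (minus v y) v) with (opp y) by cmodule V. apply Rle_trans with (norm y); auto. right; exact (norm_opp y).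
    + apply Rnot_le_lt in H.
    assert (E : 2 * norm (T n y) <= norm (T n (plus v y)) + norm (T n (minus v y))).
    { rewrite <- norm_scal_RtoC by lra.
    assert (E2 : scal (RtoC 2 : C_AbsRing) (T n y) = minus (T n (plus v y)) (T n (minus v y))).
    2:{ eapply Rle_trans. right; exact (f_equal norm E2). apply norm_minus_le. }
    rewrite (linear_minus _ _ _ (HT n)), (linear_plus _ (HT n)).
    cmodule V. }
    lra. }
destruct (choice _ Hstep) as [nxt Hnxt].
set (xs := nat_rect (fun _ => V) zero (fun n v => nxt (n, v))).
assert (Hxs : forall n, norm (minus (xs (S n)) (xs n)) <= (/ 3) ^ n).
{ intros n. apply (Hnxt (n, xs n)). }
assert (Hdist : forall k n, norm (minus (xs (n + k)%nat) (xs n)) <= 3 / 2 * ((/ 3) ^ n - (/ 3) ^ (n + k))).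
{ induction k; intros n.
  - rewrite Nat.add_0_r, norm_minus_self. lra.
  - eapply Rle_trans. apply (norm_minus_triangle _ (xs (n + k)%nat)).
    replace (n + S k)%nat with (S (n + k)) by lia.
    specialize (IHk n). specialize (Hxs (n + k)%nat). simpl pow. lra. }
destruct (HV xs) as [x Hx].
{ intros eps He. destruct (pow_lt_1_zero (/ 3)) with (y := eps / 4) as [M HM].
  rewrite Rabs_pos_eq; lra. lra.
  exists M. intros n m Hn Hm. eapply Rle_lt_trans. apply (norm_minus_triangle _ (xs M)).
  rewrite (norm_minus_sym (xs M)).
  replace n with (M + (n - M))%nat by lia. replace m with (M + (m - M))%nat by lia.
  pose proof (Hdist (n - M)%nat M). pose proof (Hdist (m - M)%nat M).
  specialize (HM M (le_n _)). rewrite Rabs_pos_eq in HM by (apply Rlt_le, H3).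
  pose proof (H3 (M + (n - M))%nat). pose proof (H3 (M + (m - M))%nat). lra. }
rewrite (filterlim_norm eventually) in Hx.
destruct (Hpt x) as [M HM].
(* The later corrections move the limit by at most 3/2 3^-(n+1), which costs half of 3^-n N n; of
   the hump 3/4 3^-n N n a quarter remains, and N n >= 4^n. *)
assert (Hn : forall n, / 4 * (4 / 3) ^ n <= M).
{ intros n. apply Rle_trans with (norm (T n x)); auto.
  assert (Hd : norm (minus x (xs (S n))) <= 3 / 2 * (/ 3) ^ (S n)).
  { apply norm_bound_limit. intros eps He. destruct (Hx eps He) as [M1 HM1].
    set (k := max M1 (S n)). specialize (HM1 k ltac:(unfold k; lia)).
    eapply Rle_trans. apply (norm_minus_triangle _ (xs k)). rewrite (norm_minus_sym x).
    assert (H := Hdist (k - S n)%nat (S n)). replace (S n + (k - S n))%nat with k in H by (unfold k; lia).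
    pose proof (H3 k). lra. }
  destruct (Hw n) as [w1 _]. specialize (w1 (minus x (xs (S n)))).
  destruct (Hnxt (n, xs n)) as [_ h]. simpl in h. change (nxt (n, xs n)) with (xs (S n)) in h.
  assert (h2 := norm_le_minus (T n (xs (S n))) (T n x)).
  rewrite norm_minus_sym, <- (linear_minus _ _ _ (HT n)) in h2.
  simpl pow in Hd. specialize (H3 n). specialize (HN4 n). specialize (H4 n).
  replace (4 / 3) with (/ 3 * 4) by field. rewrite Rpow_mult_distr. nra. }
destruct (Pow_x_infinity (4 / 3)) with (b := 4 * M + 1) as [n Hn2].
rewrite Rabs_pos_eq; lra.
specialize (Hn2 n (le_n _)). specialize (Hn n). rewrite Rabs_pos_eq in Hn2 by (apply pow_le; lra). lra.
Qed.

(** * Resolvents on the closed right half-plane *)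

Section Resolvent.
Variable X : CompleteNormedModule C_AbsRing.
Let NX := CompleteNormedModule.NormedModule C_AbsRing X.
Variable A : unbounded_operator X.
Hypothesis HA : linear_op A.

(* [resolvent_at lam B] says [B = (lam + A)^-1]. *)
Definition resolvent_at (lam : C) (B : X -> X) : Prop :=
  @is_linear C_AbsRing NX NX B /\
  (forall x, dom A (B x) /\ plus (scal (lam : C_AbsRing) (B x)) (op A (B x)) = x) /\
  (forall x, dom A x -> B (plus (scal (lam : C_AbsRing) x) (op A x)) = x).

Lemma resolvent_at_opp lam B : is_resolvent X A (Copp lam) B -> resolvent_at lam (fun x => opp (B x)).
Proof.
intros [H1 [H2 H3]]. split; [|split].
- apply (is_linear_comp (U := NX) (V := NX) (W := NX) B opp H1). apply is_linear_opp.
- intros x. destruct (H2 x) as [D E]. destruct HA as [_ [_ Hs]].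
  assert (E1 : opp (B x) = scal (RtoC (-1) : C_AbsRing) (B x)) by cmodule X.
  destruct (Hs (RtoC (-1)) (B x) D) as [D2 E2]. rewrite E1. split; auto.
  rewrite E2. rewrite <- E at 3. cmodule X.
- intros x D. specialize (H3 x D).
  assert (E : plus (scal (lam : C_AbsRing) x) (op A x) = scal (RtoC (-1) : C_AbsRing) (minus (scal (Copp lam : C_AbsRing) x) (op A x))) by cmodule X.
  rewrite E. rewrite (linear_scal (U := NX) (V := NX) _ H1), H3. cmodule X.
Qed.

Lemma resolvent_identity lam mu B1 B2 x : resolvent_at lam B1 -> resolvent_at mu B2 ->
  minus (B1 x) (B2 x) = scal (Cminus mu lam : C_AbsRing) (B1 (B2 x)).
Proof.
intros [L1 [_ I1]] [_ [R2 _]]. destruct (R2 x) as [D E].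
assert (E2 : B1 x = plus (B2 x) (scal (Cminus mu lam : C_AbsRing) (B1 (B2 x)))).
{ rewrite <- (I1 (B2 x) D) at 1. rewrite <- (linear_scal (U := NX) (V := NX) _ L1), <- (linear_plus (U := NX) (V := NX) _ L1).
  f_equal. rewrite <- E at 1. cmodule X. }
rewrite E2. cmodule X.
Qed.

(** At distinct points both products equal the same difference quotient of the resolvents; at equal
    points the resolvent identity forces B1 = B2. *)
Lemma resolvent_commute lam mu B1 B2 x : resolvent_at lam B1 -> resolvent_at mu B2 ->
  B1 (B2 x) = B2 (B1 x).
Proof.
intros H1 H2. assert (E1 := resolvent_identity lam mu B1 B2 x H1 H2).
assert (E2 := resolvent_identity mu lam B2 B1 x H2 H1).
destruct (Ceq_dec lam mu) as [->|Hne].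
- assert (E : forall y, B1 y = B2 y).
  { intros y. assert (E := resolvent_identity mu mu B1 B2 y H1 H2).
    apply (minus_zero_eq (V := NX)). etransitivity. exact E. cmodule X. }
  now rewrite !E.
- assert (E : scal (Cminus mu lam : C_AbsRing) (B1 (B2 x)) = scal (Cminus mu lam : C_AbsRing) (B2 (B1 x))).
  { rewrite <- E1. replace (minus (B1 x) (B2 x)) with (scal (RtoC (-1) : C_AbsRing) (minus (B2 x) (B1 x))) by cmodule X.
    rewrite E2. cmodule X. }
  apply (f_equal (fun y => scal (Cinv (Cminus mu lam) : C_AbsRing) y)) in E.
  assert (Cminus mu lam <> RtoC 0).
  { intros h. apply Hne. replace mu with (Cplus (Cminus mu lam) lam) by ring. rewrite h. ring. }
  rewrite !scal_assoc in E. rewrite Cinv_l in E by auto.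
  assert (S1 := scal_one (B1 (B2 x))). assert (S2 := scal_one (B2 (B1 x))).
  etransitivity. symmetry; exact S1. etransitivity. exact E. exact S2.
Qed.
End Resolvent.

Lemma polar_form (x y : R) : 0 < sqrt (x ^ 2 + y ^ 2) -> exists psi, Rabs psi <= PI /\
  x = sqrt (x ^ 2 + y ^ 2) * cos psi /\ y = sqrt (x ^ 2 + y ^ 2) * sin psi /\ Rabs psi = acos (x / sqrt (x ^ 2 + y ^ 2)).
Proof.
set (r := sqrt (x ^ 2 + y ^ 2)). intros Hr.
assert (Hr2 : r * r = x ^ 2 + y ^ 2) by (apply sqrt_sqrt; nra).
assert (Hb : -1 <= x / r <= 1).
{ split. apply Rle_div_r; auto. nra. apply Rle_div_l; auto. nra. }
assert (Hbd := acos_bound (x / r)).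
assert (Hc : cos (acos (x / r)) = x / r) by (now apply cos_acos).
assert (Hs : sin (acos (x / r)) = Rabs y / r).
{ rewrite sin_acos by auto. rewrite <- (sqrt_Rsqr (Rabs y / r)).
  f_equal. unfold Rsqr. assert (HH := Rsqr_abs y). unfold Rsqr in HH.
  replace (Rabs y / r * (Rabs y / r)) with ((Rabs y * Rabs y) / (r * r)) by (field; lra).
  rewrite <- HH, Hr2. replace (x / r * (x / r)) with (x * x / (r * r)) by (field; lra). rewrite Hr2. field. nra.
  apply Rdiv_le_0_compat; auto. apply Rabs_pos. }
destruct (Rle_dec 0 y) as [Hy|Hy].
- exists (acos (x / r)). rewrite (Rabs_pos_eq (acos _)) by lra. rewrite Hc, Hs, (Rabs_pos_eq y) by auto.
  repeat split; try lra; field; lra.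
- exists (- acos (x / r)). rewrite Rabs_Ropp, (Rabs_pos_eq (acos _)) by lra.
  rewrite cos_neg, sin_neg, Hc, Hs, (Rabs_left y) by lra.
  repeat split; try lra; field; lra.
Qed.

(** For large lambda the point -lambda lies in the sector, and the shift by [a] changes the decay
    1/|lambda| only by a constant. On the remaining compact half disc the spectral condition
    provides resolvents; a bound at one point persists, doubled, in a small ball, and compactness
    gives a common radius for these balls. *)
Lemma resolvent_half_plane (X : CompleteNormedModule C_AbsRing) (A : unbounded_operator X) :
  sectorial A -> (forall lam : C, spectrum A lam -> 0 < Re lam) ->
  exists (Rf : C -> X -> X) (C0 : R), 0 < C0 /\ forall lam : C, 0 <= Re lam ->
    resolvent_at X A lam (Rf lam) /\ forall x, norm (Rf lam x) <= C0 / (1 + Cmod lam) * norm x.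
Proof.
set (NX := CompleteNormedModule.NormedModule C_AbsRing X).
intros [HA [Hcl [_ [theta [M [a [Hth [HM Hsec]]]]]]]] Hspec.
assert (Hex : forall lam : C, exists B, 0 <= Re lam -> resolvent_at X A lam B).
{ intros lam. destruct (Rle_dec 0 (Re lam)) as [H|H].
  - destruct (classic (spectrum A (Copp lam))) as [Hs|Hs].
    apply Hspec in Hs. simpl in Hs. unfold Re in H. lra.
    apply NNPP in Hs. destruct Hs as [B HB]. exists (fun x => opp (B x)). intros _. now apply resolvent_at_opp.
  - exists (fun x => x). intros h. contradiction. }
destruct (choice _ Hex) as [Rf HRf].
assert (Hbd : forall lam : C, exists b, 0 < b /\ (0 <= Re lam -> forall x, norm (Rf lam x) <= b * norm x)).
{ intros lam. destruct (Rle_dec 0 (Re lam)) as [H|H].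
  - destruct (linear_norm (U := NX) (V := NX) _ (proj1 (HRf lam H))) as [b [Hb0 Hb]]. exists b. auto.
  - exists 1. split; [lra|]. intros h; contradiction. }
destruct (choice _ Hbd) as [bd Hbd'].
assert (Hct : 0 < cos theta) by (apply cos_gt_0; lra).
(* Beyond distance [q] from the vertex, r cos psi <= |a| implies cos psi <= cos theta, that is |psi|
   >= theta. *)
set (q := Rabs a / cos theta). assert (Hq : 0 <= q) by (apply Rdiv_le_0_compat; auto; apply Rabs_pos).
set (rho := 2 * Rabs a + 1 + q). assert (Ha0 := Rabs_pos a).
assert (Hlarge : forall lam : C, 0 <= Re lam -> rho <= Cmod lam -> forall x, norm (Rf lam x) <= (4 * M) / (1 + Cmod lam) * norm x).
{ intros lam Hre Hl x. destruct lam as [p w]. unfold Re in Hre; simpl in Hre.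
  set (r := sqrt ((- p - a) ^ 2 + (- w) ^ 2)).
  assert (Hr : Cmod (p, w) - Rabs a <= r).
  { change r with (Cmod (- p - a, - w)). replace (-p - a, -w) with (Copp (Cplus (p, w) (RtoC a))).
    2: unfold Copp, Cplus, RtoC; simpl; f_equal; ring.
    rewrite Cmod_opp. assert (Ht := Cmod_triangle (Cplus (p, w) (RtoC a)) (Copp (RtoC a))).
    replace (Cplus (Cplus (p, w) (RtoC a)) (Copp (RtoC a))) with (p, w) in Ht.
    2: unfold Copp, Cplus, RtoC; simpl; f_equal; ring.
    rewrite Cmod_opp, Cmod_R in Ht. lra. }
  unfold rho in Hl.
  assert (Hr0 : 0 < r) by lra.
  destruct (polar_form (- p - a) (- w) Hr0) as [psi [Hpsi [E1 [E2 E3]]]]. fold r in E1, E2, E3.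
  assert (Hcos : cos psi <= cos theta).
  { apply (Rmult_le_reg_l r); auto.
    assert (Rabs a = q * cos theta) by (unfold q; field; lra).
    pose proof (Rabs_maj2 a). assert (q * cos theta <= r * cos theta) by (apply Rmult_le_compat_r; lra). lra. }
  assert (Hth2 : theta <= Rabs psi).
  { apply Rnot_lt_le. intros h.
    assert (cos theta < cos (Rabs psi)). { apply cos_decreasing_1; try lra. apply Rabs_pos. }
    assert (cos (Rabs psi) = cos psi). { unfold Rabs. destruct Rcase_abs; auto. apply cos_neg. } lra. }
  destruct (Hsec r psi Hr0 (conj Hth2 Hpsi)) as [B [HB HBn]].
  assert (El : Copp (p, w) = (a + r * cos psi, r * sin psi)).
  { rewrite <- E1, <- E2. unfold Copp; simpl. f_equal; ring. }
  rewrite <- El in HB. apply (resolvent_at_opp X A HA) in HB.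
  assert (E : Rf (p, w) x = opp (B x)).
  { apply (minus_zero_eq (V := NX)). etransitivity. exact (resolvent_identity X A _ _ _ _ x (HRf (p, w) Hre) HB).
    cmodule X. }
  rewrite E. apply Rle_trans with (norm (B x)). right; exact (norm_opp (V := NX) (B x)).
  eapply Rle_trans. apply HBn. apply Rmult_le_compat_r. apply norm_ge_0.
  replace (4 * M / (1 + Cmod (p, w))) with (M * / ((1 + Cmod (p, w)) / 4)) by (field; lra).
  apply Rmult_le_compat_l. lra. apply Rinv_le_contravar; lra. }
(* Within 1/(4 b) in each coordinate the perturbation factor |lambda - mu| b is at most 1/2, so the
   norm of the resolvent at most doubles. *)
set (delta := fun u v => mkposreal (/ (4 * bd (u, v))) (Rinv_0_lt_compat _ (Rmult_lt_0_compat 4 _ ltac:(lra) (proj1 (Hbd' (u, v)))))).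
destruct (compactness_value_2d 0 rho (- rho) rho delta) as [d Hd].
set (K := / (2 * d)). assert (Hdp := cond_pos d). assert (HK : 0 < K) by (apply Rinv_0_lt_compat; lra).
assert (Hrho : 0 < rho) by (unfold rho; lra).
assert (Hsmall : forall lam : C, 0 <= Re lam -> Cmod lam <= rho -> forall x, norm (Rf lam x) <= K * norm x).
{ intros [p w] Hre Hl x. unfold Re in Hre; simpl in Hre.
  assert (Hmx := Rmax_Cmod (p, w)). simpl in Hmx.
  Rmax_bounds (Rabs p) (Rabs w).
  (* [compactness_value_2d] delivers its centre under a double negation, which can be opened once
     the goal is a contradiction. *)
  apply Rnot_lt_le. intros Hlt.
  apply (Hd p w).
  { pose proof (Rle_abs p). lra. }
  { pose proof (Rle_abs w). pose proof (Rabs_maj2 w). lra. }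
  intros [u [v [Hu [Hv [H1 [H2 H3]]]]]]. simpl in H1, H2, H3.
  destruct (Hbd' (u, v)) as [Hb Hb2]. set (b := bd (u, v)) in *.
  assert (Hn0 : norm (Rf (u, v) x) <= b * norm x) by (apply Hb2; simpl; lra).
  assert (Hn1 : norm (Rf (p, w) x) <= 2 * b * norm x).
  { assert (E := resolvent_identity X A _ _ _ _ x (HRf (u, v) (proj1 Hu)) (HRf (p, w) Hre)).
    assert (Hm := norm_le_minus (V := NX) (Rf (p, w) x) (Rf (u, v) x)).
    rewrite norm_minus_sym in Hm.
    assert (Hm2 : norm (minus (Rf (u, v) x) (Rf (p, w) x)) <= / 2 * norm (Rf (p, w) x)).
    { rewrite E. eapply Rle_trans. apply (norm_scal (V := NX) (Cminus (p, w) (u, v) : C_AbsRing)).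
    assert (Hc : Cmod (Cminus (p, w) (u, v)) <= / (2 * b)).
    { replace (Cminus (p, w) (u, v)) with (Cplus (RtoC (p - u)) (0, w - v)).
    eapply Rle_trans. apply Cmod_triangle. rewrite Cmod_R.
    replace (Cmod (0, w - v)) with (Rabs (w - v)).
    replace (/ (2 * b)) with (/ (4 * b) + / (4 * b)) by (field; lra). lra.
    unfold Cmod; simpl. replace (0 * (0 * 1) + (w - v) * ((w - v) * 1)) with (Rsqr (w - v)) by (unfold Rsqr; ring). now rewrite sqrt_Rsqr_abs.
    unfold Cminus, Cplus, Copp, RtoC; simpl. f_equal; ring. }
    assert (Hb3 : norm (Rf (u, v) (Rf (p, w) x)) <= b * norm (Rf (p, w) x)) by (apply Hb2; simpl; lra).
    apply Rle_trans with (/ (2 * b) * (b * norm (Rf (p, w) x))).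
    apply Rmult_le_compat; auto. apply Cmod_ge_0. apply norm_ge_0.
    right. field. lra. }
    apply Rle_trans with (2 * (norm (Rf (u, v) x))). 2: lra.
    assert (norm (Rf (p, w) x) <= norm (Rf (u, v) x) + / 2 * norm (Rf (p, w) x)).
    { eapply Rle_trans. exact Hm. apply Rplus_le_compat_l. exact Hm2. }
    lra. }
  assert (2 * b <= K).
  { replace (2 * b) with (/ (2 * / (4 * b))) by (field; lra). apply Rinv_le_contravar; lra. }
  pose proof (norm_ge_0 x). assert (2 * b * norm x <= K * norm x) by (apply Rmult_le_compat_r; auto). lra. }
exists Rf, (4 * M + K * (1 + rho)). split. assert (0 < K * (1 + rho)) by nra. lra.
intros lam Hre. split. now apply HRf. intros x.
pose proof (Cmod_ge_0 lam). pose proof (norm_ge_0 x).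
destruct (Rle_dec rho (Cmod lam)) as [H1|H1].
- eapply Rle_trans. now apply Hlarge. apply Rmult_le_compat_r; auto.
  apply Rmult_le_compat_r. left; apply Rinv_0_lt_compat; lra. nra.
- eapply Rle_trans. apply Hsmall; auto; lra. apply Rmult_le_compat_r; auto.
  apply Rle_div_r. lra. nra.
Qed.

(** * Powers of the implicit Euler operator *)

Section ImplicitEuler.
Variable V : NormedModule C_AbsRing.
Variables (Rf : C -> V -> V) (C0 : R).
Hypothesis HC0 : 0 < C0.
Hypothesis Rf_linear : forall lam : C, 0 <= Re lam -> is_linear (Rf lam).
Hypothesis Rf_identity : forall lam mu x, 0 <= Re lam -> 0 <= Re mu ->
  minus (Rf lam x) (Rf mu x) = scal (Cminus mu lam : C_AbsRing) (Rf lam (Rf mu x)).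
Hypothesis Rf_commute : forall lam mu x, 0 <= Re lam -> 0 <= Re mu -> Rf lam (Rf mu x) = Rf mu (Rf lam x).
Hypothesis Rf_bound : forall lam x, 0 <= Re lam -> norm (Rf lam x) <= C0 / (1 + Cmod lam) * norm x.

(** This is (1 + hA)^-1, where [Rf lam] stands for (lam + A)^-1. *)
Definition euler_op (h : R) (x : V) : V := scal (RtoC (/ h) : C_AbsRing) (Rf (RtoC (/ h)) x).

Definition shifted (h : R) (z : C) : C := Cmult (RtoC (/ h)) (Cminus 1 z).

Lemma shifted_Re h z : 0 < h -> Cmod z <= 1 -> 0 <= Re (shifted h z).
Proof.
intros Hh Hz. pose proof (Rinv_0_lt_compat _ Hh).
unfold shifted, Re, Cmult, Cminus, Cplus, Copp, RtoC; destruct z as [p q]; simpl.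
assert (Hm := Rmax_Cmod (p, q)). simpl in Hm. pose proof (Rmax_l (Rabs p) (Rabs q)). pose proof (Rle_abs p).
nra.
Qed.

Lemma Cmod_shifted h z : 0 < h -> Cmod (shifted h z) = / h * Cmod (Cminus 1 z).
Proof.
intros Hh. unfold shifted. rewrite Cmod_mult, Cmod_R, Rabs_pos_eq; auto. left; now apply Rinv_0_lt_compat.
Qed.

(** (1 - z (1 + hA)^-1)^-1 = (1 + hA)(1 - z + hA)^-1 = 1 + (z/h) ((1 - z)/h + A)^-1. For |z| <= 1
    the point (1 - z)/h lies in the closed right half-plane, where the resolvent bound holds. *)
Definition geometric_op (h : R) (z : C) (x : V) : V :=
  plus x (scal (Cmult z (RtoC (/ h)) : C_AbsRing) (Rf (shifted h z) x)).

Lemma Re_inv_nonneg h : 0 < h -> 0 <= Re (RtoC (/ h)).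
Proof. intros Hh. left; now apply Rinv_0_lt_compat. Qed.

Lemma euler_geometric h z x : 0 < h -> Cmod z <= 1 ->
  euler_op h (geometric_op h z x) = scal (RtoC (/ h) : C_AbsRing) (Rf (shifted h z) x) /\
  geometric_op h z (euler_op h x) = scal (RtoC (/ h) : C_AbsRing) (Rf (shifted h z) x).
Proof.
intros Hh Hz. assert (H1 := shifted_Re h z Hh Hz). assert (H2 := Re_inv_nonneg h Hh).
assert (H0 : RtoC (/ h) <> RtoC 0).
{ intros E. injection E as E. apply Rinv_neq_0_compat in E; lra. }
assert (E : Rf (RtoC (/ h)) x = minus (Rf (shifted h z) x) (scal (Cmult z (RtoC (/ h)) : C_AbsRing) (Rf (shifted h z) (Rf (RtoC (/ h)) x)))).
{ assert (E := Rf_identity (shifted h z) (RtoC (/ h)) x H1 H2).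
  assert (E2 : Cminus (RtoC (/ h)) (shifted h z) = Cmult z (RtoC (/ h))) by (unfold shifted; ring).
  rewrite E2 in E. rewrite <- E. cmodule V. }
split.
- unfold euler_op, geometric_op. rewrite (linear_plus _ (Rf_linear _ H2)), (linear_scal _ (Rf_linear _ H2)).
  rewrite (Rf_commute (RtoC (/ h)) (shifted h z)) by auto. rewrite E at 1. cmodule V.
- unfold euler_op, geometric_op. rewrite (linear_scal _ (Rf_linear _ H1)). rewrite E at 1. cmodule V.
Qed.

Lemma is_linear_scal_C (c : C) : is_linear (fun x : V => scal (c : C_AbsRing) x).
Proof. apply is_linear_scal_r. intros n m; apply Cmult_comm. Qed.

Lemma euler_linear h : 0 < h -> is_linear (euler_op h).
Proof.
intros Hh. apply (is_linear_comp (Rf (RtoC (/ h)))).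
apply Rf_linear. now apply Re_inv_nonneg. apply is_linear_scal_C.
Qed.

Lemma geometric_linear h z : 0 < h -> Cmod z <= 1 -> is_linear (geometric_op h z).
Proof.
intros Hh Hz. assert (H1 := shifted_Re h z Hh Hz). assert (L := Rf_linear _ H1).
split.
- intros x y. unfold geometric_op. rewrite (linear_plus _ L). cmodule V.
- intros k x. unfold geometric_op. rewrite (linear_scal _ L). cmodule V.
- exists (1 + Cmod (Cmult z (RtoC (/ h))) * (C0 / (1 + Cmod (shifted h z)))).
  pose proof (Cmod_ge_0 (Cmult z (RtoC (/ h)))). pose proof (Cmod_ge_0 (shifted h z)).
  assert (0 < C0 / (1 + Cmod (shifted h z))) by (apply Rdiv_lt_0_compat; lra).
  split. nra. intros x. eapply Rle_trans. apply norm_triangle.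
  rewrite Rmult_plus_distr_r, Rmult_1_l. apply Rplus_le_compat_l.
  eapply Rle_trans. apply (norm_scal (Cmult z (RtoC (/ h)) : C_AbsRing)).
  rewrite Rmult_assoc. apply Rmult_le_compat_l; auto.
Qed.

(** For |z| <= 1 and h <= 1 one has h + |1 - z| <= 3. The identity in [geometric_op] therefore costs
    3 and its resolvent part C0, which explains kap = 3 + C0. *)
Lemma euler_power_bounds : exists Cb, 0 < Cb /\ forall h n x, 0 < h <= 1 -> (1 <= n)%nat ->
  norm (Nat.iter n (euler_op h) x) <= Cb * norm x /\
  INR n * h * norm (Nat.iter n (euler_op h) x) <= Cb * norm x /\
  INR n * norm (Nat.iter n (euler_op h) (minus x (euler_op h x))) <= Cb * norm x.
Proof.
set (kap := 3 + C0). exists (12 * kap ^ 3 + 12 * kap ^ 4).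
assert (Hk : 0 < kap) by (unfold kap; lra).
assert (0 < kap ^ 3) by (apply pow_lt; lra). assert (0 < kap ^ 4) by (apply pow_lt; lra).
split. lra. intros h n x Hh Hn.
assert (Hih := Rinv_0_lt_compat h ltac:(lra)).
assert (HB := euler_linear h ltac:(lra)).
assert (HD := fun z => geometric_linear h z ltac:(lra)).
assert (HDB : forall z x, Cmod z <= 1 -> euler_op h (geometric_op h z x) = geometric_op h z (euler_op h x)).
{ intros z y Hz. destruct (euler_geometric h z y ltac:(lra) Hz) as [-> ->]. reflexivity. }
assert (HDe : forall z x, Cmod z <= 1 -> geometric_op h z x = plus x (scal (z : C_AbsRing) (euler_op h (geometric_op h z x)))).
{ intros z y Hz. destruct (euler_geometric h z y ltac:(lra) Hz) as [-> _]. unfold geometric_op. cmodule V. }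
assert (Hfrac : forall z y, Cmod z <= 1 -> norm (scal (RtoC (/ h) : C_AbsRing) (Rf (shifted h z) y)) <= C0 / (h + Cmod (Cminus 1 z)) * norm y).
{ intros z y Hz. rewrite norm_scal_RtoC by lra.
  assert (Hb := Rf_bound (shifted h z) y (shifted_Re h z ltac:(lra) Hz)). rewrite Cmod_shifted in Hb by lra.
  pose proof (Cmod_ge_0 (Cminus 1 z)).
  apply Rle_trans with (/ h * (C0 / (1 + / h * Cmod (Cminus 1 z)) * norm y)).
  apply Rmult_le_compat_l; lra. right. field; repeat split; lra. }
assert (HDn : forall z x, Cmod z <= 1 -> norm (geometric_op h z x) <= kap / (h + Cmod (Cminus 1 z)) * norm x).
{ intros z y Hz. eapply Rle_trans. apply norm_triangle.
  assert (Hf := Hfrac z y Hz). pose proof (Cmod_ge_0 (Cminus 1 z)).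
  replace (scal (Cmult z (RtoC (/ h)) : C_AbsRing) (Rf (shifted h z) y)) with (scal (z : C_AbsRing) (scal (RtoC (/ h) : C_AbsRing) (Rf (shifted h z) y))) by cmodule V.
  assert (Hs := norm_scal (z : C_AbsRing) (scal (RtoC (/ h) : C_AbsRing) (Rf (shifted h z) y))).
  change (abs (z : C_AbsRing)) with (Cmod z) in Hs.
  set (w := norm (scal (RtoC (/ h) : C_AbsRing) (Rf (shifted h z) y))) in *.
  assert (0 <= w) by apply norm_ge_0.
  assert (H1z : Cmod (Cminus 1 z) <= 2).
  { eapply Rle_trans. apply Cmod_triangle. rewrite Cmod_opp, Cmod_1. lra. }
  apply Rle_trans with (norm y + w). apply Rplus_le_compat_l. eapply Rle_trans. exact Hs. nra.
  pose proof (norm_ge_0 y).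
  apply Rle_trans with (3 / (h + Cmod (Cminus 1 z)) * norm y + C0 / (h + Cmod (Cminus 1 z)) * norm y).
  apply Rplus_le_compat; auto. rewrite <- (Rmult_1_l (norm y)) at 1. apply Rmult_le_compat_r; auto.
  apply Rle_div_r; lra.
  right. unfold kap. field. lra. }
assert (HDc : forall z x, Cmod z <= 1 -> norm (minus (geometric_op h z x) (euler_op h (geometric_op h z x))) <= kap * norm x).
{ intros z y Hz. destruct (euler_geometric h z y ltac:(lra) Hz) as [-> _].
  assert (Hf := Hfrac z y Hz). pose proof (Cmod_ge_0 (Cminus 1 z)).
  unfold geometric_op.
  replace (minus (plus y _) _) with (plus y (scal (Cminus z 1 : C_AbsRing) (scal (RtoC (/ h) : C_AbsRing) (Rf (shifted h z) y)))) by cmodule V.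
  eapply Rle_trans. apply norm_triangle.
  assert (Hs := norm_scal (Cminus z 1 : C_AbsRing) (scal (RtoC (/ h) : C_AbsRing) (Rf (shifted h z) y))).
  change (abs (Cminus z 1 : C_AbsRing)) with (Cmod (Cminus z 1)) in Hs.
  replace (Cmod (Cminus z 1)) with (Cmod (Cminus 1 z)) in Hs.
  2: rewrite <- (Cmod_opp (Cminus 1 z)); f_equal; ring.
  pose proof (norm_ge_0 y).
  apply Rle_trans with (norm y + C0 * norm y). 2: unfold kap; nra.
  apply Rplus_le_compat_l. eapply Rle_trans. exact Hs.
  eapply Rle_trans. apply Rmult_le_compat_l; [auto|exact Hf].
  rewrite <- Rmult_assoc. apply Rmult_le_compat_r; auto.
  replace (Cmod (Cminus 1 z) * (C0 / (h + Cmod (Cminus 1 z)))) with (C0 * (Cmod (Cminus 1 z) / (h + Cmod (Cminus 1 z)))) by (field; lra).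
  rewrite <- (Rmult_1_r C0) at 2. apply Rmult_le_compat_l. lra. apply Rle_div_l; lra. }
assert (Hx := norm_ge_0 x).
pose proof (power_bounded V _ HB _ HD HDB HDe h kap Hh ltac:(lra) HDn n x Hn).
pose proof (power_decay_rate V _ HB _ HD HDB HDe h kap Hh ltac:(lra) HDn HDc n x Hn).
pose proof (power_difference_rate V _ HB _ HD HDB HDe h kap Hh ltac:(lra) HDn HDc n x Hn).
repeat split; nra.
Qed.
End ImplicitEuler.

Lemma eventually_bounded (a : nat -> R) N c : (forall n, (N <= n)%nat -> a n <= c) -> exists M, forall n, a n <= M.
Proof.
revert c; induction N; intros c H.
- exists c. intros n. apply H. lia.
- apply (IHN (Rmax c (a N))). intros n Hn.
  destruct (Nat.eq_dec n N) as [->|]. apply Rmax_r.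
  eapply Rle_trans. apply H; lia. apply Rmax_l.
Qed.

(** * The semigroup as a limit of implicit Euler steps *)

Section Semigroup.
Variable V : NormedModule C_AbsRing.
Hypothesis HV : seq_complete V.
Variable eA : R -> V -> V.
Hypothesis eA_linear : forall t, 0 <= t -> is_linear (eA t).
Hypothesis eA_0 : forall x, eA 0 x = x.
Hypothesis eA_plus : forall t r x, 0 <= t -> 0 <= r -> eA (t + r) x = eA t (eA r x).
Hypothesis eA_cont0 : forall x eps, 0 < eps -> exists d, 0 < d /\ forall t, 0 < t < d -> norm (minus (eA t x) x) < eps.

(** Otherwise there are times t_n <= 1/(n+1) with operator norm at least 4^n, although strong
    continuity at 0 bounds every orbit along t_n. *)
Lemma semigroup_bounded_near_0 : exists d M, 0 < d /\ 1 <= M /\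
  forall t x, 0 <= t <= d -> norm (eA t x) <= M * norm x.
Proof.
apply NNPP. intros Hno.
assert (H : forall n, exists t, 0 <= t <= / (INR n + 1) /\ exists x, norm x <= 1 /\ 4 ^ n <= norm (eA t x)).
{ intros n. apply NNPP. intros Hn. apply Hno. exists (/ (INR n + 1)), (4 ^ n).
  split. apply Rinv_0_lt_compat. pose proof (pos_INR n); lra.
  split. apply pow_R1_Rle; lra.
  intros t x Ht. apply Rnot_lt_le. intros h. apply Hn. exists t. split; auto.
  assert (Hx : 0 < norm x).
  { destruct (Req_dec (norm x) 0) as [E|E].
    - apply norm_eq_zero in E. rewrite E, (linear_zero _ (eA_linear t ltac:(lra))), norm_zero in h. lra.
    - pose proof (norm_ge_0 x); lra. }
  pose proof (Rinv_0_lt_compat _ Hx).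
  exists (scal (RtoC (/ norm x) : C_AbsRing) x). split.
  rewrite norm_scal_RtoC by lra. right; field; lra.
  rewrite (linear_scal _ (eA_linear t ltac:(lra))), norm_scal_RtoC by lra.
  apply (Rmult_le_reg_r (norm x)); auto.
  replace (/ norm x * norm (eA t x) * norm x) with (norm (eA t x)) by (field; lra). lra. }
destruct (choice _ H) as [ts Hts].
apply (uniform_boundedness V (fun n => eA (ts n)) HV).
- intros n. apply eA_linear. apply Hts.
- intros x. destruct (eA_cont0 x 1 Rlt_0_1) as [d [Hd Hd2]].
  destruct (inv_INR_small d Hd) as [N HN].
  apply (eventually_bounded _ N (norm x + 1)). intros n Hn.
  destruct (Hts n) as [[h1 h2] _]. specialize (HN n Hn).
  destruct (Req_dec (ts n) 0) as [->|E]. rewrite eA_0. lra.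
  pose proof (norm_le_minus (eA (ts n) x) x). specialize (Hd2 (ts n) ltac:(lra)). lra.
- intros n. apply Hts.
Qed.

Lemma semigroup_bounded T : exists M, 1 <= M /\ forall t x, 0 <= t <= T -> norm (eA t x) <= M * norm x.
Proof.
destruct semigroup_bounded_near_0 as [d [M [Hd [HM Hb]]]].
assert (H : forall k, forall t x, 0 <= t <= INR k * d -> norm (eA t x) <= M ^ k * norm x).
{ induction k; intros t x Ht.
  - simpl in *. replace t with 0 by lra. rewrite eA_0. lra.
  - rewrite S_INR in Ht. pose proof (norm_ge_0 x).
    destruct (Rle_dec t d) as [h|h].
    + eapply Rle_trans. apply Hb; lra. apply Rmult_le_compat_r; auto. simpl.
    assert (1 <= M ^ k) by (apply pow_R1_Rle; lra). nra.
    + replace t with (d + (t - d)) by ring. rewrite eA_plus by lra.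
    eapply Rle_trans. apply Hb; lra. simpl. rewrite Rmult_assoc. apply Rmult_le_compat_l. lra. apply IHk. lra. }
destruct (Rle_dec 0 T) as [HT|HT].
- destruct (nfloor_ex (T / d)) as [n [_ Hn]]. apply Rdiv_le_0_compat; lra.
  exists (M ^ S n). split. apply pow_R1_Rle; lra.
  intros t x Ht. apply H. rewrite S_INR. apply (Rmult_lt_compat_r d) in Hn; auto.
  replace (T / d * d) with T in Hn by (field; lra). lra.
- exists 1. split. lra. intros; lra.
Qed.

(** Left and right increments are both written from the smaller time, E(a + b) - E(a) = E(a)(E(b) -
    I), so continuity at 0 and a local bound suffice. *)
Lemma semigroup_continuous x t eps : 0 <= t -> 0 < eps -> exists d, 0 < d /\
  forall s, 0 <= s -> Rabs (s - t) < d -> norm (minus (eA s x) (eA t x)) < eps.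
Proof.
intros Ht He. destruct (semigroup_bounded (t + 1)) as [M [HM Hb]].
destruct (eA_cont0 x (eps / M)) as [d [Hd Hd2]]. apply Rdiv_lt_0_compat; lra.
exists (Rmin 1 d). split. apply Rmin_pos; lra.
intros s Hs Hst. Rmin_bounds 1 d.
assert (Hkey : forall a b, 0 <= a <= t + 1 -> 0 < b < d -> norm (minus (eA (a + b) x) (eA a x)) < eps).
{ intros a b Ha Hbb. rewrite eA_plus, <- (linear_minus _ _ _ (eA_linear a ltac:(lra))) by lra.
  eapply Rle_lt_trans. apply Hb; lra. specialize (Hd2 b Hbb).
  apply (Rmult_lt_compat_l M) in Hd2; [|lra]. replace (M * (eps / M)) with eps in Hd2 by (field; lra). lra. }
destruct (Rtotal_order s t) as [h|[h|h]].
- rewrite norm_minus_sym. replace t with (s + (t - s)) at 1 by ring. rewrite Rabs_left in Hst by lra. apply Hkey; lra.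
- subst s. rewrite norm_minus_self. auto.
- replace s with (t + (s - t)) by ring. rewrite Rabs_right in Hst by lra. apply Hkey; lra.
Qed.

Variables (dA : V -> Prop) (opA : V -> V).
Hypothesis gen_limit : forall x, dA x -> forall eps, 0 < eps -> exists d, 0 < d /\
  forall t, 0 < t < d -> norm (plus (minus (eA t x) x) (scal (RtoC t : C_AbsRing) (opA x))) <= eps * t.
Hypothesis gen_converse : forall x y, (forall eps, 0 < eps -> exists d, 0 < d /\
  forall t, 0 < t < d -> norm (plus (minus (eA t x) x) (scal (RtoC t : C_AbsRing) y)) <= eps * t) ->
  dA x /\ opA x = y.

Lemma semigroup_domain x t : dA x -> 0 <= t -> dA (eA t x) /\ opA (eA t x) = eA t (opA x).
Proof.
intros Hx Ht. apply gen_converse. intros eps He.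
destruct (semigroup_bounded t) as [M [HM Hb]].
destruct (gen_limit x Hx (eps / M)) as [d [Hd Hd2]]. apply Rdiv_lt_0_compat; lra.
exists d. split; auto. intros s Hs.
rewrite <- eA_plus, (Rplus_comm s t), eA_plus by lra.
rewrite <- (linear_minus _ _ _ (eA_linear t Ht)), <- (linear_scal _ (eA_linear t Ht)), <- (linear_plus _ (eA_linear t Ht)).
eapply Rle_trans. apply Hb; lra. specialize (Hd2 s Hs).
apply (Rmult_le_compat_l M) in Hd2; [|lra].
replace (M * (eps / M * s)) with (eps * s) in Hd2 by (field; lra). exact Hd2.
Qed.

(** The generator limit at 0, transported by E(y), gives the straddle condition at every time; no
    integral formula is involved. *)
Lemma semigroup_first_order T M v t : (forall t x, 0 <= t <= T -> norm (eA t x) <= M * norm x) -> 0 <= M ->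
  dA v -> 0 <= t <= T -> norm (minus (eA t v) v) <= t * (M * norm (opA v)).
Proof.
intros Hb HM Hv Ht. apply norm_bound_limit. intros eps He.
set (e := eps / (M * T + 1)).
assert (HMT : 0 <= M * T) by nra.
assert (He' : 0 < e) by (apply Rdiv_lt_0_compat; lra).
assert (H : norm (minus (eA t v) (eA 0 v)) <= M * (norm (opA v) + e) * t - M * (norm (opA v) + e) * 0).
{ apply (straddle_bound (fun s => eA s v) (fun s => M * (norm (opA v) + e) * s)). lra.
  intros r Hr. destruct (gen_limit v Hv e He') as [d [Hd Hd2]].
  exists (d / 2). split. lra. intros y z Hy Hz H1 H2.
  destruct (Req_dec y z) as [->|Hyz]. rewrite norm_minus_self. lra.
  replace z with (y + (z - y)) at 1 by ring. rewrite eA_plus, <- (linear_minus _ _ _ (eA_linear y ltac:(lra))) by lra.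
  eapply Rle_trans. apply Hb; lra.
  replace (M * (norm (opA v) + e) * z - M * (norm (opA v) + e) * y) with (M * ((norm (opA v) + e) * (z - y))) by ring.
  apply Rmult_le_compat_l; auto. specialize (Hd2 (z - y) ltac:(lra)).
  replace (minus (eA (z - y) v) v) with (minus (plus (minus (eA (z - y) v) v) (scal (RtoC (z - y) : C_AbsRing) (opA v))) (scal (RtoC (z - y) : C_AbsRing) (opA v))) by cmodule V.
  eapply Rle_trans. apply norm_minus_le. rewrite norm_scal_RtoC by lra. lra. }
rewrite eA_0 in H. eapply Rle_trans. exact H.
assert (M * e * t <= eps).
{ apply Rle_trans with (e * (M * T + 1)). assert (M * t <= M * T) by (apply Rmult_le_compat_l; lra).
  replace (M * e * t) with (e * (M * t)) by ring. apply Rmult_le_compat_l; lra.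
  unfold e. right; field. lra. }
nra.
Qed.

(** The increment of F(s) = E(s)v - v + sAv from y to z is E(y) applied to a first-order error plus
    (z - y)(Av - E(y)Av). The second term is of size (z - y) y by the first-order estimate and is
    dominated by an increment of s^2. *)
Lemma semigroup_second_order T M v t : (forall t x, 0 <= t <= T -> norm (eA t x) <= M * norm x) -> 0 <= M ->
  dA v -> dA (opA v) -> 0 <= t <= T ->
  norm (plus (minus (eA t v) v) (scal (RtoC t : C_AbsRing) (opA v))) <= t ^ 2 * (M * norm (opA (opA v))).
Proof.
intros Hb HM Hv HAv Ht. apply norm_bound_limit. intros eps He.
set (e := eps / (M * T + 1)).
assert (HMT : 0 <= M * T) by nra.
assert (He' : 0 < e) by (apply Rdiv_lt_0_compat; lra).
set (c := M * norm (opA (opA v))).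
assert (Hc : 0 <= c) by (apply Rmult_le_pos; auto; apply norm_ge_0).
set (F := fun s => plus (minus (eA s v) v) (scal (RtoC s : C_AbsRing) (opA v))).
assert (H : norm (minus (F t) (F 0)) <= (M * e * t + c * t ^ 2) - (M * e * 0 + c * 0 ^ 2)).
{ apply (straddle_bound F (fun s => M * e * s + c * s ^ 2)). lra.
  intros r Hr. destruct (gen_limit v Hv e He') as [d [Hd Hd2]].
  exists (d / 2). split. lra. intros y z Hy Hz H1 H2.
  destruct (Req_dec y z) as [->|Hyz]. rewrite norm_minus_self. lra.
  specialize (Hd2 (z - y) ltac:(lra)).
  assert (E : minus (F z) (F y) = plus (eA y (plus (minus (eA (z - y) v) v) (scal (RtoC (z - y) : C_AbsRing) (opA v))))
    (scal (RtoC (z - y) : C_AbsRing) (minus (opA v) (eA y (opA v))))).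
  { unfold F. assert (Hy0 : 0 <= y) by lra.
    rewrite (linear_plus _ (eA_linear y Hy0)), (linear_minus _ _ _ (eA_linear y Hy0)), (linear_scal _ (eA_linear y Hy0)).
    rewrite <- eA_plus by lra. replace (y + (z - y)) with z by ring. rewrite RtoC_minus. cmodule V. }
  rewrite E. eapply Rle_trans. apply norm_triangle. rewrite norm_scal_RtoC by lra.
  assert (Hb1 := Hb y (plus (minus (eA (z - y) v) v) (scal (RtoC (z - y) : C_AbsRing) (opA v))) ltac:(lra)).
  assert (Hf := semigroup_first_order T M (opA v) y Hb HM HAv ltac:(lra)). fold c in Hf.
  rewrite norm_minus_sym in Hf.
  apply Rle_trans with (M * (e * (z - y)) + (z - y) * (y * c)).
  { apply Rplus_le_compat. eapply Rle_trans. exact Hb1. apply Rmult_le_compat_l; auto. apply Rmult_le_compat_l; lra. }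
  assert ((z - y) * (y * c) <= c * z ^ 2 - c * y ^ 2).
  { replace (c * z ^ 2 - c * y ^ 2) with (c * ((z - y) * (z + y))) by ring.
    replace ((z - y) * (y * c)) with (c * ((z - y) * y)) by ring.
    apply Rmult_le_compat_l; auto. apply Rmult_le_compat_l; lra. }
  lra. }
replace (F 0) with (zero : V) in H.
2:{ unfold F. rewrite eA_0. cmodule V. }
assert (E0 : minus (F t) (zero : V) = F t) by cmodule V.
apply (Rle_trans (norm (F t)) (norm (minus (F t) (zero : V)))). right; symmetry; exact (f_equal norm E0).
assert (M * e * t <= eps).
{ apply Rle_trans with (e * (M * T + 1)). assert (M * t <= M * T) by (apply Rmult_le_compat_l; lra).
  replace (M * e * t) with (e * (M * t)) by ring. apply Rmult_le_compat_l; lra.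
  unfold e. right; field. lra. }
eapply Rle_trans. exact H. lra.
Qed.

Variable Bh : R -> V -> V.
Hypothesis Bh_linear : forall h, 0 < h -> is_linear (Bh h).
Hypothesis Bh_left : forall h x, 0 < h -> dA x -> Bh h (plus x (scal (RtoC h : C_AbsRing) (opA x))) = x.
Variable Cb : R.
Hypothesis HCb : 0 < Cb.
Hypothesis Bh_bounds : forall h n x, 0 < h <= 1 -> (1 <= n)%nat ->
  norm (Nat.iter n (Bh h) x) <= Cb * norm x /\
  INR n * h * norm (Nat.iter n (Bh h) x) <= Cb * norm x /\
  INR n * norm (Nat.iter n (Bh h) (minus x (Bh h x))) <= Cb * norm x.

Lemma Bh_bound n h x : 0 < h <= 1 -> norm (Nat.iter n (Bh h) x) <= (Cb + 1) * norm x.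
Proof.
intros Hh. pose proof (norm_ge_0 x). destruct n. simpl. nra.
destruct (Bh_bounds h (S n) x Hh ltac:(lia)) as [H1 _]. lra.
Qed.

Lemma Bh_expand h v : 0 < h -> dA v -> Bh h v = minus v (scal (RtoC h : C_AbsRing) (Bh h (opA v))).
Proof.
intros Hh Hv. assert (E := Bh_left h v Hh Hv).
rewrite (linear_plus _ (Bh_linear h Hh)), (linear_scal _ (Bh_linear h Hh)) in E.
rewrite <- E at 2. cmodule V.
Qed.

(** Expanding twice gives B_h v = v - hAv + h^2 B_h A^2 v, which is compared with the second-order
    expansion of the semigroup. *)
Lemma euler_local_error T M h v : (forall t x, 0 <= t <= T -> norm (eA t x) <= M * norm x) -> 0 <= M ->
  0 < h <= 1 -> h <= T -> dA v -> dA (opA v) ->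
  norm (minus (Bh h v) (eA h v)) <= h ^ 2 * ((Cb + 1 + M) * norm (opA (opA v))).
Proof.
intros Hb HM Hh HT Hv HAv.
assert (E : minus (Bh h v) (eA h v) = minus (scal (RtoC (h ^ 2) : C_AbsRing) (Bh h (opA (opA v))))
   (plus (minus (eA h v) v) (scal (RtoC h : C_AbsRing) (opA v)))).
{ rewrite (Bh_expand h v) by (auto; lra). rewrite (Bh_expand h (opA v)) by (auto; lra).
  replace (RtoC (h ^ 2)) with (Cmult h h) by (rewrite <- RtoC_mult; f_equal; ring). cmodule V. }
rewrite E. eapply Rle_trans. apply norm_minus_le. rewrite norm_scal_RtoC by nra.
pose proof (semigroup_second_order T M v h Hb HM Hv HAv ltac:(lra)).
assert (H1 := Bh_bound 1 h (opA (opA v)) Hh). simpl Nat.iter in H1.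
assert (0 <= h ^ 2) by nra. apply (Rmult_le_compat_l (h ^ 2)) in H1; auto. lra.
Qed.

(** Telescoping with one semigroup step taken off: B^(n+1) v - E((n+1)h) v = B^n (B v - E(h) v) +
    (B^n - E(nh)) E(h) v. The induction moves the initial value along the orbit, which is why [K]
    bounds the whole orbit of A^2 v. *)
Lemma euler_error T M h K n v : (forall t x, 0 <= t <= T -> norm (eA t x) <= M * norm x) -> 0 <= M ->
  0 < h <= 1 -> INR n * h <= T -> dA v -> dA (opA v) ->
  (forall s, 0 <= s <= INR n * h -> norm (eA s (opA (opA v))) <= K) ->
  norm (minus (Nat.iter n (Bh h) v) (eA (INR n * h) v)) <= INR n * (h ^ 2 * ((Cb + 1) * (Cb + 1 + M) * K)).
Proof.
intros Hb HM Hh. revert v. induction n; intros v HT Hv HAv HK.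
- simpl. rewrite Rmult_0_l, eA_0, norm_minus_self. lra.
- rewrite Nat.iter_succ_r. rewrite S_INR in *. pose proof (pos_INR n).
  assert (Hnh : 0 <= INR n * h) by nra.
  replace ((INR n + 1) * h) with (INR n * h + h) by ring. rewrite eA_plus by lra.
  destruct (semigroup_domain v h Hv ltac:(lra)) as [D1 E1].
  destruct (semigroup_domain (opA v) h HAv ltac:(lra)) as [D2 E2].
  assert (IH : norm (minus (Nat.iter n (Bh h) (eA h v)) (eA (INR n * h) (eA h v))) <= INR n * (h ^ 2 * ((Cb + 1) * (Cb + 1 + M) * K))).
  { apply IHn; auto. nra. now rewrite E1.
    intros s Hs. rewrite E1, E2. rewrite <- eA_plus by lra. apply HK. lra. }
  eapply Rle_trans. apply (norm_minus_triangle _ (Nat.iter n (Bh h) (eA h v))).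
  rewrite <- (linear_minus _ _ _ (is_linear_iter (Bh h) n (Bh_linear h ltac:(lra)))).
  assert (H1 := Bh_bound n h (minus (Bh h v) (eA h v)) Hh).
  assert (H2 := euler_local_error T M h v Hb HM Hh ltac:(nra) Hv HAv).
  assert (H3 : norm (opA (opA v)) <= K). { rewrite <- (eA_0 (opA (opA v))). apply HK. lra. }
  assert (H4 : norm (minus (Bh h v) (eA h v)) <= h ^ 2 * ((Cb + 1 + M) * K)).
  { eapply Rle_trans. exact H2. apply Rmult_le_compat_l. nra. apply Rmult_le_compat_l; lra. }
  apply (Rmult_le_compat_l (Cb + 1)) in H4; [|lra]. lra.
Qed.

Lemma euler_convergence t v eps : 0 < t -> dA v -> dA (opA v) -> 0 < eps ->
  exists N, forall n, (N <= n)%nat -> (1 <= n)%nat /\ 0 < t / INR n <= 1 /\ INR n * (t / INR n) = t /\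
    t / INR n < eps /\
    norm (minus (Nat.iter n (Bh (t / INR n)) v) (eA t v)) < eps.
Proof.
intros Ht Hv HAv He. destruct (semigroup_bounded t) as [M [HM Hb]].
set (K := M * norm (opA (opA v))). set (c := (Cb + 1) * (Cb + 1 + M) * K).
assert (HK : 0 <= K) by (apply Rmult_le_pos; [lra|apply norm_ge_0]).
assert (Hc : 0 <= c) by (unfold c; apply Rmult_le_pos; auto; nra).
destruct (inv_INR_small (Rmin (/ t) (Rmin (eps / t) (eps / (t ^ 2 * c + 1))))) as [N HN].
{ repeat apply Rmin_pos. now apply Rinv_0_lt_compat. now apply Rdiv_lt_0_compat. apply Rdiv_lt_0_compat; nra. }
exists (S N). intros n Hn. destruct n as [|n]; [lia|].
specialize (HN n ltac:(lia)). rewrite <- S_INR in HN. set (m := INR (S n)) in *.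
assert (Hm : 0 < m) by (apply lt_0_INR; lia).
assert (R1 := Rmin_l (/ t) (Rmin (eps / t) (eps / (t ^ 2 * c + 1)))).
assert (R2 := Rmin_r (/ t) (Rmin (eps / t) (eps / (t ^ 2 * c + 1)))).
assert (R3 := Rmin_l (eps / t) (eps / (t ^ 2 * c + 1))). assert (R4 := Rmin_r (eps / t) (eps / (t ^ 2 * c + 1))).
assert (L1 : / m < / t) by lra. assert (L2 : / m < eps / t) by lra. assert (L3 : / m < eps / (t ^ 2 * c + 1)) by lra.
assert (Hmt : m * (t / m) = t) by (field; lra).
assert (Hh : 0 < t / m <= 1).
{ split. now apply Rdiv_lt_0_compat. apply (Rmult_lt_compat_l t) in L1; auto. rewrite Rinv_r in L1 by lra. unfold Rdiv; lra. }
split; [lia|]. split; auto. split; auto. split.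
{ apply (Rmult_lt_compat_l t) in L2; auto. replace (t * (eps / t)) with eps in L2 by (field; lra). exact L2. }
assert (He1 := euler_error t M (t / m) K (S n) v Hb ltac:(lra) Hh ltac:(fold m; lra) Hv HAv). fold m in He1.
rewrite Hmt in He1. eapply Rle_lt_trans. apply He1. intros s Hs. apply Hb. exact Hs.
fold c. replace (m * ((t / m) ^ 2 * c)) with (t ^ 2 * c * / m) by (field; lra).
assert (0 <= t ^ 2 * c) by (apply Rmult_le_pos; nra).
pose proof (Rinv_0_lt_compat m Hm).
apply (Rmult_lt_compat_l (t ^ 2 * c + 1)) in L3; [|lra].
replace ((t ^ 2 * c + 1) * (eps / (t ^ 2 * c + 1))) with eps in L3 by (field; lra). lra.
Qed.

Variable R0 : V -> V.
Hypothesis R0_linear : is_linear R0.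
Hypothesis R0_right : forall x, dA (R0 x) /\ opA (R0 x) = x.
Hypothesis dA_dense : forall x eps, 0 < eps -> exists y, dA y /\ norm (minus x y) < eps.
Hypothesis R0_left : forall x, dA x -> R0 (opA x) = x.
Hypothesis opA_closed : forall (xs : nat -> V) (x y : V), (forall n, dA (xs n)) ->
  filterlim xs eventually (locally x) -> filterlim (fun n => opA (xs n)) eventually (locally y) ->
  dA x /\ opA x = y.

Lemma iterated_range_dense k x eps : 0 < eps -> exists y, norm (minus x (Nat.iter k R0 y)) < eps.
Proof.
revert x eps; induction k; intros x eps He.
- exists x. now rewrite norm_minus_self.
- destruct (dA_dense x (eps / 2)) as [y [Hy Hxy]]. lra.
  destruct (linear_norm _ R0_linear) as [M [HM0 HM]].
  destruct (IHk (opA y) (eps / 2 / M)) as [z Hz]. apply Rdiv_lt_0_compat; lra.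
  exists z. simpl. eapply Rle_lt_trans. apply (norm_minus_triangle _ y).
  rewrite <- (R0_left y Hy) at 2. rewrite <- (linear_minus _ _ _ R0_linear).
  specialize (HM (minus (opA y) (Nat.iter k R0 z))).
  apply (Rmult_lt_compat_l M) in Hz; auto. replace (M * (eps / 2 / M)) with (eps / 2) in Hz by (field; lra). lra.
Qed.

Lemma dense_bound t c x : 0 <= t -> (forall y, norm (eA t (R0 (R0 y))) <= c * norm (R0 (R0 y))) -> 0 <= c ->
  norm (eA t x) <= c * norm x.
Proof.
intros Ht H Hc. destruct (linear_norm _ (eA_linear t Ht)) as [M [HM0 HM]].
apply norm_bound_limit. intros eps He.
destruct (iterated_range_dense 2 x (eps / (M + c))) as [y Hy]. apply Rdiv_lt_0_compat; lra.
simpl in Hy. set (v := R0 (R0 y)) in *.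
assert (H1 := norm_le_minus (eA t x) (eA t v)). rewrite <- (linear_minus _ _ _ (eA_linear t Ht)) in H1.
specialize (H y). fold v in H. specialize (HM (minus x v)).
assert (H2 := norm_le_minus v x). rewrite norm_minus_sym in H2.
apply (Rmult_lt_compat_l (M + c)) in Hy; [|lra]. replace ((M + c) * (eps / (M + c))) with eps in Hy by (field; lra).
nra.
Qed.

(** The Euler bounds pass to the limit on the range of A^-2, where Euler converges, and extend by
    density. *)
Lemma semigroup_uniform_bound t x : 0 <= t ->
  norm (eA t x) <= (Cb + 1) * norm x /\ t * norm (eA t x) <= Cb * norm x.
Proof.
intros Ht. destruct (Req_dec t 0) as [->|Hne].
{ rewrite eA_0. pose proof (norm_ge_0 x). split; nra. }
assert (Ht0 : 0 < t) by lra.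
assert (Hv : forall y, norm (eA t (R0 (R0 y))) <= (Cb + 1) * norm (R0 (R0 y)) /\ norm (eA t (R0 (R0 y))) <= (Cb / t) * norm (R0 (R0 y))).
{ intros y. set (v := R0 (R0 y)).
  assert (D1 : dA v) by apply R0_right. assert (D2 : dA (opA v)).
  { unfold v. rewrite (proj2 (R0_right _)). apply R0_right. }
  split; apply norm_bound_limit; intros eps He.
  - destruct (euler_convergence t v eps Ht0 D1 D2 He) as [N HN].
    destruct (HN (S N) ltac:(lia)) as [H1 [H2 [H3 [H4 H5]]]].
    assert (H6 := norm_le_minus (eA t v) (Nat.iter (S N) (Bh (t / INR (S N))) v)). rewrite norm_minus_sym in H6.
    pose proof (Bh_bound (S N) _ v H2). lra.
  - destruct (euler_convergence t v eps Ht0 D1 D2 He) as [N HN].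
    destruct (HN (S N) ltac:(lia)) as [H1 [H2 [H3 [H4 H5]]]].
    assert (H6 := norm_le_minus (eA t v) (Nat.iter (S N) (Bh (t / INR (S N))) v)). rewrite norm_minus_sym in H6.
    destruct (Bh_bounds _ (S N) v H2 ltac:(lia)) as [_ [H7 _]]. rewrite H3 in H7.
    apply (Rmult_le_compat_l (/ t)) in H7. 2: left; now apply Rinv_0_lt_compat.
    rewrite <- Rmult_assoc, Rinv_l, Rmult_1_l in H7 by lra. lra. }
split.
- apply dense_bound; auto. intros y; apply Hv. lra.
- assert (H : norm (eA t x) <= Cb / t * norm x).
  { apply dense_bound; auto. intros y; apply Hv. apply Rdiv_le_0_compat; lra. }
  apply (Rmult_le_compat_l t) in H; auto. replace (t * (Cb / t * norm x)) with (Cb * norm x) in H by (field; lra). exact H.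
Qed.

(** Since (1 - B_h) v = h B_h A v, the third Euler bound reads n h |B^(n+1) A v| <= Cb |v| and
    becomes t |E(t) A v| <= Cb |v|. Taking v in the range of A^-3 puts Av into D(A^2), where Euler
    converges; density and closedness of A reach every x. *)
Lemma semigroup_smoothing t x : 0 < t -> dA (eA t x) /\ t * norm (opA (eA t x)) <= Cb * norm x.
Proof.
intros Ht.
assert (Hv : forall y, t * norm (eA t (R0 (R0 y))) <= Cb * norm (R0 (R0 (R0 y)))).
{ intros y. set (w := R0 (R0 y)). set (v := R0 w).
  assert (D1 : dA w) by apply R0_right. assert (D2 : dA (opA w)).
  { unfold w. rewrite (proj2 (R0_right _)). apply R0_right. }
  assert (Dv : dA v /\ opA v = w) by apply R0_right. destruct Dv as [Dv Ev].
  apply norm_bound_limit; intros eps He.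
  set (b := (Cb + 1) * ((Cb + 1) * norm (opA w)) + 1).
  assert (Hb : 1 <= b). { unfold b. pose proof (norm_ge_0 (opA w)). assert (0 <= (Cb + 1) * ((Cb + 1) * norm (opA w))) by (repeat apply Rmult_le_pos; lra). lra. }
  assert (He' : 0 < eps / (t * b)) by (apply Rdiv_lt_0_compat; nra).
  destruct (euler_convergence t w (eps / (t * b) / 2) Ht D1 D2 ltac:(lra)) as [N HN].
  destruct (HN (S N) ltac:(lia)) as [H1 [H2 [H3 [H4 H5]]]]. set (n := S N) in *. set (h := t / INR n) in *.
  destruct (Bh_bounds h n v H2 ltac:(lia)) as [_ [_ H7]].
  assert (E : minus v (Bh h v) = scal (RtoC h : C_AbsRing) (Bh h w)).
  { rewrite (Bh_expand h v) by (auto; lra). rewrite Ev. cmodule V. }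
  assert (HL := is_linear_iter (Bh h) n (Bh_linear h ltac:(lra))).
  rewrite E, (linear_scal _ HL), norm_scal_RtoC in H7 by lra.
  rewrite <- Rmult_assoc, H3 in H7.
  (* Dropping one of the n + 1 Euler steps costs a factor h, as w lies in the domain. *)
  assert (H8 : norm (minus (Nat.iter n (Bh h) (Bh h w)) (Nat.iter n (Bh h) w)) <= h * ((Cb + 1) * ((Cb + 1) * norm (opA w)))).
  { rewrite <- (linear_minus _ _ _ HL). eapply Rle_trans. now apply Bh_bound.
    replace (h * ((Cb + 1) * ((Cb + 1) * norm (opA w)))) with ((Cb + 1) * (h * ((Cb + 1) * norm (opA w)))) by ring.
    apply Rmult_le_compat_l. lra.
    rewrite (Bh_expand h w) by (auto; lra).
    replace (minus (minus w _) w) with (scal (RtoC (-1) : C_AbsRing) (scal (RtoC h : C_AbsRing) (Bh h (opA w)))) by cmodule V.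
    eapply Rle_trans. apply (norm_scal (RtoC (-1) : C_AbsRing)).
    rewrite Cmod_R, Rabs_left, norm_scal_RtoC by lra.
    assert (H9 := Bh_bound 1 h (opA w) H2). simpl Nat.iter in H9. apply (Rmult_le_compat_l h) in H9; lra. }
  assert (H9 : h * ((Cb + 1) * ((Cb + 1) * norm (opA w))) <= eps / t / 2).
  { apply Rle_trans with (eps / (t * b) / 2 * b). apply Rmult_le_compat; try lra. unfold b in Hb; lra. unfold b; lra.
    right; field; split; lra. }
  assert (H10 : eps / (t * b) / 2 <= eps / t / 2).
  { apply Rmult_le_compat_r. lra. apply Rmult_le_compat_l. lra. apply Rinv_le_contravar; nra. }
  assert (H11 := norm_minus_triangle (eA t w) (Nat.iter n (Bh h) w) (Nat.iter n (Bh h) (Bh h w))).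
  rewrite norm_minus_sym in H5. rewrite norm_minus_sym in H8.
  assert (H12 := norm_le_minus (eA t w) (Nat.iter n (Bh h) (Bh h w))).
  assert (H13 : norm (eA t w) <= norm (Nat.iter n (Bh h) (Bh h w)) + eps / t) by lra.
  apply (Rmult_le_compat_l t) in H13; [|lra]. replace (t * (norm (Nat.iter n (Bh h) (Bh h w)) + eps / t)) with (t * norm (Nat.iter n (Bh h) (Bh h w)) + eps) in H13 by (field; lra). lra. }
destruct (density_seq (fun v => exists y, v = R0 (R0 (R0 y))) x) as [xs [Hxs1 Hxs2]].
{ intros eps He. destruct (iterated_range_dense 3 x eps He) as [y Hy]. exists (R0 (R0 (R0 y))). split; auto. now exists y. }
assert (Hdiff : forall a b, (exists y, a = R0 (R0 (R0 y))) -> (exists y, b = R0 (R0 (R0 y))) ->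
   t * norm (minus (opA (eA t a)) (opA (eA t b))) <= Cb * norm (minus a b)).
{ intros a b [ya ->] [yb ->].
  rewrite !(fun y => proj2 (semigroup_domain (R0 y) t (proj1 (R0_right y)) ltac:(lra))).
  rewrite !(fun y => proj2 (R0_right (R0 (R0 y)))).
  rewrite <- (linear_minus _ _ _ (eA_linear t ltac:(lra))).
  rewrite <- !(linear_minus _ _ _ R0_linear). apply Hv. }
assert (HxsD : forall n, dA (xs n)).
{ intros n. destruct (Hxs1 n) as [y ->]. apply R0_right. }
assert (Hlx : forall eps, 0 < eps -> exists N, forall n, (N <= n)%nat -> norm (minus (xs n) x) < eps).
{ intros eps He. destruct (inv_INR_small eps He) as [N HN]. exists N. intros n Hn.
  rewrite norm_minus_sym. eapply Rlt_trans. apply Hxs2. auto. }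
destruct (HV (fun n => opA (eA t (xs n)))) as [y Hy].
{ intros eps He. destruct (Hlx (eps * t / (2 * Cb))) as [N HN]. apply Rdiv_lt_0_compat; nra.
  exists N. intros n m Hn Hm. assert (N1 := HN n Hn). assert (N2 := HN m Hm). rewrite norm_minus_sym in N2.
  pose proof (norm_minus_triangle (xs n) x (xs m)). specialize (Hdiff _ _ (Hxs1 n) (Hxs1 m)).
  apply (Rmult_lt_reg_l t); auto. eapply Rle_lt_trans. exact Hdiff.
  assert (norm (minus (xs n) (xs m)) < eps * t / Cb).
  { replace (eps * t / Cb) with (eps * t / (2 * Cb) + eps * t / (2 * Cb)) by (field; lra). lra. }
  apply (Rmult_lt_compat_l Cb) in H0; auto. replace (Cb * (eps * t / Cb)) with (eps * t) in H0 by (field; lra). lra. }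
destruct (linear_norm _ (eA_linear t ltac:(lra))) as [M [HM0 HM]].
destruct (opA_closed (fun n => eA t (xs n)) (eA t x) y) as [D E].
- intros n. apply semigroup_domain; auto. lra.
- apply (filterlim_norm eventually). intros eps He.
  destruct (Hlx (eps / M)) as [N HN]. now apply Rdiv_lt_0_compat.
  exists N. intros n Hn. rewrite <- (linear_minus _ _ _ (eA_linear t ltac:(lra))).
  eapply Rle_lt_trans. apply HM. specialize (HN n Hn). apply (Rmult_lt_compat_l M) in HN; auto.
  replace (M * (eps / M)) with eps in HN by (field; lra). exact HN.
- exact Hy.
- split; auto. rewrite E. apply norm_bound_limit. intros eps He.
  apply (proj1 (filterlim_norm eventually _ _)) with (eps := eps / (2 * t)) in Hy. 2: apply Rdiv_lt_0_compat; lra.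
  destruct Hy as [N1 HN1]. destruct (Hlx (eps / (2 * Cb))) as [N2 HN2]. apply Rdiv_lt_0_compat; lra.
  set (n := max N1 N2). specialize (HN1 n ltac:(unfold n; lia)). specialize (HN2 n ltac:(unfold n; lia)).
  rewrite norm_minus_sym in HN1. assert (H1 := norm_le_minus y (opA (eA t (xs n)))).
  destruct (Hxs1 n) as [z Hz].
  assert (H2 : t * norm (opA (eA t (xs n))) <= Cb * norm (xs n)).
  { destruct (semigroup_domain (xs n) t (HxsD n) ltac:(lra)) as [_ ->]. rewrite Hz, (proj2 (R0_right _)). apply Hv. }
  assert (H3 := norm_le_minus (xs n) x).
  assert (H4 : t * norm y <= t * norm (opA (eA t (xs n))) + eps / 2).
  { replace (eps / 2) with (t * (eps / (2 * t))) by (field; lra). rewrite <- Rmult_plus_distr_l. apply Rmult_le_compat_l; lra. }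
  assert (H5 : Cb * norm (xs n) <= Cb * norm x + eps / 2).
  { replace (eps / 2) with (Cb * (eps / (2 * Cb))) by (field; lra). rewrite <- Rmult_plus_distr_l. apply Rmult_le_compat_l; lra. }
  lra.
Qed.
End Semigroup.

(* [AE t] stands for [A exp(-tA)]. *)
Record analytic_semigroup (V : NormedModule R_AbsRing) (E AE : R -> V -> V) (M : R) : Prop := {
  as_const : 1 <= M;
  as_linear : forall t, 0 <= t -> is_linear (E t);
  as_zero : forall x, E 0 x = x;
  as_add : forall t r x, 0 <= t -> 0 <= r -> E (t + r) x = E t (E r x);
  as_continuous : forall x t eps, 0 <= t -> 0 < eps -> exists d, 0 < d /\
    forall s, 0 <= s -> Rabs (s - t) < d -> norm (minus (E s x) (E t x)) < eps;
  as_bound : forall t x, 0 <= t -> norm (E t x) <= M * norm x;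
  as_decay : forall t x, 0 <= t -> t * norm (E t x) <= M * norm x;
  as_deriv_linear : forall t, 0 < t -> is_linear (AE t);
  as_deriv_bound : forall t x, 0 < t -> t * norm (AE t x) <= M * norm x;
  as_deriv_add : forall t r x, 0 < t -> 0 <= r -> AE (t + r) x = E r (AE t x);
  as_deriv_add_r : forall t r x, 0 < t -> 0 <= r -> AE (t + r) x = AE t (E r x);
  as_deriv_lipschitz : forall t r x, 0 < t -> 0 <= r ->
    t ^ 2 * norm (minus (AE (t + r) x) (AE t x)) <= M * r * norm x;
  as_taylor : forall t r x, 0 < t -> 0 <= r ->
    t ^ 2 * norm (plus (minus (E (t + r) x) (E t x)) (scal r (AE t x))) <= M * r ^ 2 * norm x }.

Lemma at_right_0 (P : R -> Prop) : at_right 0 P <-> exists d, 0 < d /\ forall t, 0 < t < d -> P t.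
Proof.
split.
- intros [d Hd]. exists d. split. apply cond_pos. intros t Ht. apply Hd. 2: lra.
  change (Rabs (t - 0) < d). rewrite Rabs_pos_eq; lra.
- intros [d [Hd H]]. exists (mkposreal d Hd). intros t Ht Ht0. apply H.
  change (Rabs (t - 0) < d) in Ht. apply Rabs_def2 in Ht. lra.
Qed.

(** * The analytic semigroup generated by -A *)

Section Generation.
Variables (X : CompleteNormedModule C_AbsRing) (A : unbounded_operator X) (eA : R -> X -> X).
Hypothesis hsect : sectorial A.
Hypothesis hspec : forall lam : C, spectrum A lam -> 0 < Re lam.
Hypothesis hgen : semigroup_generated_by_opp A eA.
Let NX := CompleteNormedModule.NormedModule C_AbsRing X.

(** The division by t is cleared, so that the generator limit can be used inside norm estimates with
    an error of order eps t. *)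
Lemma generator_rate (x y : X) :
  filterlim (fun t => rscal (/ t) (minus (eA t x) x)) (at_right 0) (locally (opp y)) <->
  forall eps, 0 < eps -> exists d, 0 < d /\
    forall t, 0 < t < d -> norm (plus (minus (eA t x) x) (scal (RtoC t : C_AbsRing) y)) <= eps * t.
Proof.
assert (E : forall t, 0 < t -> norm (plus (minus (eA t x) x) (scal (RtoC t : C_AbsRing) y))
   = t * norm (minus (rscal (/ t) (minus (eA t x) x)) (opp y))).
{ intros t Ht. etransitivity. 2: apply (norm_scal_RtoC NX); lra. apply f_equal. unfold rscal.
  assert (RtoC t <> RtoC 0) by (intros E; injection E as E; lra).
  rewrite RtoC_inv by lra.
  cmodule X. }
split; intros H.
- intros eps He. apply (proj1 (filterlim_norm (V := NX) (at_right 0) _ _)) with (eps := eps) in H; auto.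
  apply at_right_0 in H. destruct H as [d [Hd H]]. exists d. split; auto. intros t Ht.
  rewrite E by lra. rewrite Rmult_comm. apply Rmult_le_compat_r. lra. left. now apply H.
- apply (filterlim_norm (V := NX) (at_right 0)). intros eps He.
  apply at_right_0. destruct (H (eps / 2)) as [d [Hd Hd2]]. lra. exists d. split; auto. intros t Ht.
  specialize (Hd2 t Ht). rewrite E in Hd2 by lra. rewrite Rmult_comm in Hd2.
  apply Rmult_le_reg_r in Hd2; [|lra]. eapply Rle_lt_trans. exact Hd2. lra.
Qed.

Lemma is_linear_realify (f : X -> X) : @is_linear C_AbsRing NX NX f ->
  @is_linear R_AbsRing (realify X) (realify X) f.
Proof.
intros H. split.
- exact (linear_plus (U := NX) (V := NX) f H).
- intros k x. exact (linear_scal (U := NX) (V := NX) f H (RtoC k) x).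
- exact (linear_norm (U := NX) (V := NX) f H).
Qed.

Lemma analytic_semigroup_realify :
  exists M, analytic_semigroup (realify X) eA (fun t x => op A (eA t x)) M.
Proof.
destruct (resolvent_half_plane X A hsect hspec) as [Rf [C0 [HC0 HRf]]].
destruct hsect as [HA [Hclosed [Hdense _]]].
destruct hgen as [G1 [G2 [G3 [G4 G5]]]].
assert (Rid : forall lam mu x, 0 <= Re lam -> 0 <= Re mu ->
  minus (Rf lam x) (Rf mu x) = scal (Cminus mu lam : C_AbsRing) (Rf lam (Rf mu x))).
{ intros lam mu x H1 H2. apply (resolvent_identity X A). apply HRf; auto. apply HRf; auto. }
assert (Rco : forall lam mu x, 0 <= Re lam -> 0 <= Re mu -> Rf lam (Rf mu x) = Rf mu (Rf lam x)).
{ intros lam mu x H1 H2. apply (resolvent_commute X A lam mu). apply HRf; auto. apply HRf; auto. }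
assert (Rli : forall lam, 0 <= Re lam -> @is_linear C_AbsRing NX NX (Rf lam)) by (intros; apply HRf; auto).
assert (Rbd : forall lam x, 0 <= Re lam -> norm (Rf lam x) <= C0 / (1 + Cmod lam) * norm x) by (intros; apply HRf; auto).
destruct (euler_power_bounds NX Rf C0 HC0 Rli Rid Rco Rbd) as [Cb [HCb Hb]].
assert (HV := complete_seq_complete X).
assert (Ecl : forall h, 0 < h -> @is_linear C_AbsRing NX NX (euler_op NX Rf h)) by (intros; eapply euler_linear; eauto).
assert (G4' : forall (x : NX) eps, 0 < eps -> exists d, 0 < d /\ forall t, 0 < t < d -> norm (minus (eA t x) x) < eps).
{ intros x eps He. apply at_right_0. apply (proj1 (filterlim_norm (V := NX) (at_right 0) _ _) (G4 x)); auto. }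
assert (Gl : forall x, dom A x -> forall eps, 0 < eps -> exists d, 0 < d /\
  forall t, 0 < t < d -> norm (plus (minus (eA t x) x) (scal (RtoC t : C_AbsRing) (op A x))) <= eps * t).
{ intros x Hx. apply generator_rate. apply G5. split; auto. cmodule X. }
assert (Gc : forall x y, (forall eps, 0 < eps -> exists d, 0 < d /\
  forall t, 0 < t < d -> norm (plus (minus (eA t x) x) (scal (RtoC t : C_AbsRing) y)) <= eps * t) ->
  dom A x /\ op A x = y).
{ intros x y H. apply generator_rate in H. apply G5 in H. destruct H as [H1 H2]. split; auto. rewrite H2. cmodule X. }
assert (Bl : forall h x, 0 < h -> dom A x -> euler_op NX Rf h (plus x (scal (RtoC h : C_AbsRing) (op A x))) = x).
{ intros h x Hh Hx. destruct (HRf (RtoC (/ h))) as [[L [_ I]] _]. left; now apply Rinv_0_lt_compat.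
  unfold euler_op. rewrite <- (linear_scal (U := NX) (V := NX) _ L).
  etransitivity; [|exact (I x Hx)]. apply f_equal. rewrite RtoC_inv by lra. assert (RtoC h <> RtoC 0) by (intros E; injection E as E; lra).
  cmodule X. }
destruct (HRf (RtoC 0)) as [[L0 [R0r R0l]] _]. simpl; lra.
assert (R0r' : forall x, dom A (Rf (RtoC 0) x) /\ op A (Rf (RtoC 0) x) = x).
{ intros x. destruct (R0r x) as [D E]. split; auto. rewrite <- E at 2. cmodule X. }
assert (R0l' : forall x, dom A x -> Rf (RtoC 0) (op A x) = x).
{ intros x D. rewrite <- (R0l x D) at 2. apply f_equal. cmodule X. }
assert (Hbound := semigroup_uniform_bound NX HV eA G1 G2 G3 G4' (dom A) (op A) Gl Gc (euler_op NX Rf) Ecl Bl Cb HCb Hb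
  (Rf (RtoC 0)) L0 R0r' Hdense R0l').
assert (Hsm := semigroup_smoothing NX HV eA G1 G2 G3 G4' (dom A) (op A) Gl Gc (euler_op NX Rf) Ecl Bl Cb HCb Hb
  (Rf (RtoC 0)) L0 R0r' Hdense R0l' Hclosed).
assert (Hdom := semigroup_domain NX HV eA G1 G2 G3 G4' (dom A) (op A) Gl Gc).
assert (Hcomm : forall t r x, 0 < t -> 0 <= r -> op A (eA (t + r) x) = eA r (op A (eA t x))).
{ intros t r x Ht Hr. rewrite Rplus_comm, G3 by lra. apply Hdom; auto. now apply Hsm. }
set (M1 := Cb + 1).
assert (HM1 : forall T, forall t x, 0 <= t <= T -> norm (eA t x) <= M1 * norm x).
{ intros T t x Ht. apply Hbound. lra. }
(* A^2 E(t) is the square of A E(t/2), whence the factor 4. *)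
assert (HA2 : forall t x, 0 < t -> dom A (op A (eA t x)) /\ t ^ 2 * norm (op A (op A (eA t x))) <= 4 * Cb ^ 2 * norm x).
{ intros t x Ht. replace t with (t / 2 + t / 2) at 1 3 by field. rewrite Hcomm by lra.
  destruct (Hsm (t / 2) (op A (eA (t / 2) x)) ltac:(lra)) as [D H1]. split; auto.
  destruct (Hsm (t / 2) x ltac:(lra)) as [_ H2].
  apply Rle_trans with (4 * (t / 2 * (t / 2 * norm (op A (eA (t / 2) (op A (eA (t / 2) x))))))). right; field.
  apply Rle_trans with (4 * (t / 2 * (Cb * norm (op A (eA (t / 2) x))))).
  repeat apply Rmult_le_compat_l; try lra. exact H1.
  apply Rle_trans with (4 * Cb * (t / 2 * norm (op A (eA (t / 2) x)))). right; ring.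
  replace (4 * Cb ^ 2 * norm x) with (4 * Cb * (Cb * norm x)) by ring. apply Rmult_le_compat_l; auto. lra. }
(* One constant for all fields: M1 bounds the semigroup, M1 times 4 Cb^2 the expansions that involve
   A^2 E(t). *)
set (M := M1 + M1 * (4 * Cb ^ 2)).
assert (HMM : M1 <= M) by (unfold M, M1; nra).
exists M. split.
- unfold M1 in HMM. lra.
- intros t Ht. apply is_linear_realify, G1, Ht.
- exact G2.
- exact G3.
- intros x t eps Ht He. exact (semigroup_continuous NX HV eA G1 G2 G3 G4' x t eps Ht He).
- intros t x Ht. destruct (Hbound t x Ht) as [H _]. eapply Rle_trans. exact H.
  apply Rmult_le_compat_r. apply (norm_ge_0 (V := NX)). exact HMM.
- intros t x Ht. destruct (Hbound t x Ht) as [_ H]. eapply Rle_trans. exact H.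
  apply Rmult_le_compat_r. apply (norm_ge_0 (V := NX)). unfold M1 in HMM; lra.
- intros t Ht. apply is_linear_realify. destruct HA as [_ [Hp Hs]]. assert (L := G1 t ltac:(lra)).
  split.
  + intros x y. rewrite (linear_plus (U := NX) (V := NX) _ L). apply Hp; apply Hsm; auto.
  + intros k x. rewrite (linear_scal (U := NX) (V := NX) _ L). apply Hs. apply Hsm; auto.
  + exists (Cb / t). split. now apply Rdiv_lt_0_compat. intros x. destruct (Hsm t x Ht) as [_ H].
    apply (Rmult_le_reg_l t); auto. eapply Rle_trans. exact H. right. field. lra.
- intros t x Ht. destruct (Hsm t x Ht) as [_ H]. eapply Rle_trans. exact H.
  apply Rmult_le_compat_r. apply (norm_ge_0 (V := NX)). unfold M1 in HMM; lra.
- exact Hcomm.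
- intros t r x Ht Hr. now rewrite G3 by lra.
- intros t r x Ht Hr. rewrite Hcomm by lra. destruct (HA2 t x Ht) as [D H].
  assert (H1 := semigroup_first_order NX eA G1 G2 G3 (dom A) (op A) Gl r M1 (op A (eA t x)) r (HM1 r) ltac:(unfold M1; lra) D ltac:(lra)).
  apply Rle_trans with (t ^ 2 * (r * (M1 * norm (op A (op A (eA t x)))))).
  apply Rmult_le_compat_l. nra. exact H1.
  apply Rle_trans with (r * (M1 * (t ^ 2 * norm (op A (op A (eA t x)))))). right; ring.
  assert (Hx := norm_ge_0 (V := NX) x).
  apply Rle_trans with (r * (M1 * (4 * Cb ^ 2 * norm x))).
  apply Rmult_le_compat_l; auto. apply Rmult_le_compat_l; auto. unfold M1; lra.
  replace (M * r * norm x) with (r * (M * norm x)) by ring. apply Rmult_le_compat_l; auto.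
  rewrite <- Rmult_assoc. apply Rmult_le_compat_r; auto. unfold M, M1; lra.
- intros t r x Ht Hr. rewrite (Rplus_comm t r), G3 by lra. destruct (HA2 t x Ht) as [D H].
  assert (H1 := semigroup_second_order NX eA G1 G2 G3 (dom A) (op A) Gl r M1 (eA t x) r (HM1 r) ltac:(unfold M1; lra) (proj1 (Hsm t x Ht)) D ltac:(lra)).
  apply Rle_trans with (t ^ 2 * (r ^ 2 * (M1 * norm (op A (op A (eA t x)))))).
  apply Rmult_le_compat_l. nra. exact H1.
  apply Rle_trans with (r ^ 2 * (M1 * (t ^ 2 * norm (op A (op A (eA t x)))))). right; ring.
  assert (Hx := norm_ge_0 (V := NX) x).
  apply Rle_trans with (r ^ 2 * (M1 * (4 * Cb ^ 2 * norm x))).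
  apply Rmult_le_compat_l. nra. apply Rmult_le_compat_l; auto. unfold M1; lra.
  replace (M * r ^ 2 * norm x) with (r ^ 2 * (M * norm x)) by ring. apply Rmult_le_compat_l. nra.
  rewrite <- Rmult_assoc. apply Rmult_le_compat_r; auto. unfold M, M1; lra.
Qed.
End Generation.

(** * Riemann integrals of vector functions *)

Lemma is_RInt_linear {V W : NormedModule R_AbsRing} (L : V -> W) (f : R -> V) a b I :
  is_linear L -> is_RInt f a b I -> is_RInt (fun t => L (f t)) a b (L I).
Proof.
intros HL H.
apply (filterlim_ext (fun ptd => L (scal (sign (b - a)) (Riemann_sum f ptd)))).
- intros ptd. rewrite (linear_scal L HL). f_equal.
  induction ptd as [x0|h ptd IH] using SF_cons_ind.
  + exact (linear_zero (U := V) (V := W) L HL).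
  + rewrite !Riemann_sum_cons, (linear_plus L HL), (linear_scal L HL), IH. reflexivity.
- apply (filterlim_comp _ _ _ _ L _ (locally I)); auto. now apply linear_cont.
Qed.

Lemma continuous_norm {V : NormedModule R_AbsRing} (f : R -> V) t :
  (forall eps, 0 < eps -> exists d, 0 < d /\ forall s, Rabs (s - t) < d -> norm (minus (f s) (f t)) < eps) ->
  continuous f t.
Proof.
intros H. apply (filterlim_norm (locally t)). intros eps He. destruct (H eps He) as [d [Hd Hd2]].
exists (mkposreal d Hd). intros s Hs. apply Hd2, Hs.
Qed.

Lemma continuous_norm_inv {V : NormedModule R_AbsRing} (f : R -> V) t : continuous f t ->
  forall eps, 0 < eps -> exists d, 0 < d /\ forall s, Rabs (s - t) < d -> norm (minus (f s) (f t)) < eps.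
Proof.
intros H eps He. apply (proj1 (filterlim_norm (locally t) f (f t)) H) in He. destruct He as [d Hd].
exists d. split. apply cond_pos. intros s Hs. apply Hd, Hs.
Qed.

Lemma is_linear_R_continuous {V W : NormedModule R_AbsRing} (L : V -> W) (f : R -> V) t :
  is_linear L -> continuous f t -> continuous (fun s => L (f s)) t.
Proof. intros HL Hf. apply (continuous_comp f L); auto. now apply linear_cont. Qed.

Lemma continuous_affine u v (x : R) : continuous (fun y => u * y + v) x.
Proof.
apply (continuous_plus (fun y => u * y) (fun _ => v)).
apply (continuous_mult (fun _ => u) (fun y => y)). apply continuous_const. apply continuous_id. apply continuous_const.
Qed.

Lemma continuous_Rpower_l p (t : R) : 0 < t -> continuous (fun s => Rpower s p) t.
Proof.
intros Ht. apply (ex_derive_continuous (V := R_NormedModule)). unfold Rpower. auto_derive. auto.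
Qed.

Notation nm V := (CompleteNormedModule.NormedModule R_AbsRing V).

(* [RInt] retyped so that its values live in the underlying normed module. *)
Definition rint {V : CompleteNormedModule R_AbsRing} (f : R -> nm V) (a b : R) : nm V :=
  RInt (V := V) f a b.

Section Rint.
Context {V : CompleteNormedModule R_AbsRing}.
Implicit Types f g : R -> nm V.

Lemma rint_correct f a b : ex_RInt f a b -> is_RInt f a b (rint f a b).
Proof. exact (RInt_correct (V := V) f a b). Qed.

Lemma rint_unique f a b l : is_RInt f a b l -> rint f a b = l.
Proof. exact (is_RInt_unique (V := V) f a b l). Qed.

Lemma ex_rint_continuous f a b : (forall z, Rmin a b <= z <= Rmax a b -> continuous f z) -> ex_RInt f a b.
Proof. exact (ex_RInt_continuous (V := V) f a b). Qed.

Lemma rint_ext f g a b : (forall x, Rmin a b < x < Rmax a b -> f x = g x) -> rint f a b = rint g a b.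
Proof. exact (RInt_ext (V := V) f g a b). Qed.

Lemma rint_plus f g a b : ex_RInt f a b -> ex_RInt g a b ->
  rint (fun x => plus (f x) (g x)) a b = plus (rint f a b) (rint g a b).
Proof. exact (RInt_plus (V := V) f g a b). Qed.

Lemma rint_Chasles f a b c : ex_RInt f a b -> ex_RInt f b c ->
  plus (rint f a b) (rint f b c) = rint f a c.
Proof. exact (RInt_Chasles (V := V) f a b c). Qed.

Lemma rint_swap f a b : ex_RInt f a b -> rint f b a = opp (rint f a b).
Proof. intros H. symmetry. exact (opp_RInt_swap (V := V) f a b H). Qed.

Lemma rint_comp_lin f u v a b : ex_RInt f (u * a + v) (u * b + v) ->
  rint (fun y => scal u (f (u * y + v))) a b = rint f (u * a + v) (u * b + v).
Proof. exact (RInt_comp_lin (V := V) f u v a b). Qed.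

Lemma rint_linear {W : CompleteNormedModule R_AbsRing} (L : nm V -> nm W) f a b :
  is_linear L -> ex_RInt f a b -> rint (fun t => L (f t)) a b = L (rint f a b).
Proof.
intros HL Hf. apply (is_RInt_unique (V := W)). apply is_RInt_linear; auto. now apply rint_correct.
Qed.
End Rint.

(** * Improper integrals over the positive half-line *)

Section Improper.
Variable V : CompleteNormedModule R_AbsRing.

Definition continuous_pos (f : R -> nm V) := forall t, 0 < t -> continuous f t.

Lemma continuous_pos_ex_RInt f a b : continuous_pos f -> 0 < a -> 0 < b -> ex_RInt f a b.
Proof.
intros Hf Ha Hb. apply ex_rint_continuous. intros z Hz. apply Hf.
eapply Rlt_le_trans. 2: apply Hz. now apply Rmin_pos.
Qed.

Lemma continuous_pos_rint f a b : continuous_pos f -> 0 < a -> 0 < b -> is_RInt f a b (rint f a b).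
Proof. intros. apply rint_correct. now apply continuous_pos_ex_RInt. Qed.

(** Both ends converge jointly. In this metric form uniqueness, linear images and substitutions are
    elementary, and [improper_RInt_gen] leads back to [RInt_gen]. The threshold [N] may be negative,
    hence the recurring [Rmax N 0]. *)
Definition improper (f : R -> nm V) (l : nm V) := forall eps, 0 < eps -> exists d N, 0 < d /\
  forall a b, 0 < a < d -> N < b -> norm (minus (rint f a b) l) < eps.

Lemma improper_unique f l1 l2 : improper f l1 -> improper f l2 -> l1 = l2.
Proof.
intros H1 H2. apply (eq_of_norm_minus). intros eps He.
destruct (H1 (eps / 2)) as [d1 [N1 [Hd1 K1]]]. lra. destruct (H2 (eps / 2)) as [d2 [N2 [Hd2 K2]]]. lra.
assert (0 < Rmin d1 d2) by now apply Rmin_pos.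
Rmin_bounds d1 d2. Rmax_bounds N1 N2.
specialize (K1 (Rmin d1 d2 / 2) (Rmax N1 N2 + 1) ltac:(lra) ltac:(lra)).
specialize (K2 (Rmin d1 d2 / 2) (Rmax N1 N2 + 1) ltac:(lra) ltac:(lra)).
eapply Rle_trans. apply (norm_minus_triangle _ (rint f (Rmin d1 d2 / 2) (Rmax N1 N2 + 1))).
rewrite (norm_minus_sym l1). lra.
Qed.

Lemma improper_ext f g l : (forall t, 0 < t -> f t = g t) -> improper f l -> improper g l.
Proof.
intros E H eps He. destruct (H eps He) as [d [N [Hd K]]]. exists d, (Rmax N 0). split; auto.
intros a b Ha Hb. Rmax_bounds N 0.
rewrite <- (rint_ext f g). apply K; lra.
intros x Hx. apply E. assert (0 < Rmin a b) by (apply Rmin_pos; lra). lra.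
Qed.

Lemma improper_RInt_gen f l : continuous_pos f -> improper f l ->
  RInt_gen (V := V) f (at_right 0) (Rbar_locally p_infty) = l.
Proof.
intros Hf H. apply (is_RInt_gen_unique (V := V)).
intros P HP. apply (locally_norm_le_locally) in HP. destruct HP as [eps HP].
destruct (H eps (cond_pos eps)) as [d [N [Hd K]]].
apply (Filter_prod _ _ _ (fun a => 0 < a < d) (fun b => Rmax N 0 < b)).
- exists (mkposreal d Hd). intros t Ht Ht0. change (Rabs (t - 0) < d) in Ht. apply Rabs_def2 in Ht. lra.
- exists (Rmax N 0). auto.
- intros a b Ha Hb. Rmax_bounds N 0.
  exists (rint f a b). split.
  apply continuous_pos_rint; auto; simpl; lra.
  apply HP. apply K; lra.
Qed.

Lemma improper_plus f g l1 l2 : continuous_pos f -> continuous_pos g -> improper f l1 -> improper g l2 ->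
  improper (fun t => plus (f t) (g t)) (plus l1 l2).
Proof.
intros Hf Hg H1 H2 eps He.
destruct (H1 (eps / 2)) as [d1 [N1 [Hd1 K1]]]. lra. destruct (H2 (eps / 2)) as [d2 [N2 [Hd2 K2]]]. lra.
exists (Rmin d1 d2), (Rmax 0 (Rmax N1 N2)). split. now apply Rmin_pos. intros a b Ha Hb.
Rmin_bounds d1 d2. Rmax_bounds N1 N2.
Rmax_bounds 0 (Rmax N1 N2).
rewrite rint_plus by (apply continuous_pos_ex_RInt; auto; lra).
specialize (K1 a b ltac:(lra) ltac:(lra)). specialize (K2 a b ltac:(lra) ltac:(lra)).
assert (E : minus (plus (rint f a b) (rint g a b)) (plus l1 l2)
  = plus (minus (rint f a b) l1) (minus (rint g a b) l2)) by rmodule (nm V).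
eapply Rle_lt_trans. right; exact (f_equal norm E). eapply Rle_lt_trans. apply (norm_triangle). lra.
Qed.

Lemma improper_norm_limit f l c : improper f l -> (forall a b, 0 < a -> a < b -> norm (rint f a b) <= c) ->
  norm l <= c.
Proof.
intros H Hc. apply norm_bound_limit. intros eps He. destruct (H eps He) as [d [N [Hd K]]].
Rmax_bounds N d.
specialize (K (d / 2) (Rmax N d + 1) ltac:(lra) ltac:(lra)).
specialize (Hc (d / 2) (Rmax N d + 1) ltac:(lra) ltac:(lra)).
assert (P1 := norm_le_minus l (rint f (d / 2) (Rmax N d + 1))).
rewrite norm_minus_sym in P1. lra.
Qed.

(** [Phi] is a bounded primitive of a majorant of |f|. It is monotone, so its values near 0 and near
    infinity cluster at the infimum and the supremum. The limit is constructed along a = 1/(n+1), b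
    = n+1 and then shown to be the joint limit. *)
Lemma improper_cauchy f (Phi : R -> R) c : continuous_pos f ->
  (forall a b, 0 < a <= b -> norm (rint f a b) <= Phi b - Phi a) ->
  (forall a, 0 < a -> 0 <= Phi a <= c) ->
  exists l, improper f l /\ norm l <= c.
Proof.
intros Hf HPhi Hc.
assert (Hmono : forall a b, 0 < a <= b -> Phi a <= Phi b).
{ intros a b Hab. specialize (HPhi a b Hab). pose proof (norm_ge_0 (rint f a b)). lra. }
destruct (completeness (fun y => exists a, 0 < a /\ y = Phi a)) as [S [HS1 HS2]].
{ exists c. intros y [a [Ha ->]]. now apply Hc. } { exists (Phi 1), 1. split; auto; lra. }
destruct (completeness (fun y => exists a, 0 < a /\ y = - Phi a)) as [I [HI1 HI2]].
{ exists 0. intros y [a [Ha ->]]. specialize (Hc a Ha). lra. } { exists (- Phi 1), 1. split; auto; lra. }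
assert (Htail : forall eps, 0 < eps -> exists d N, 0 < d /\ 0 < N /\ forall a a', 0 < a < d -> 0 < a' < d -> forall b b', N < b -> N < b' ->
   Rabs (Phi a - Phi a') <= eps /\ Rabs (Phi b - Phi b') <= eps).
{ intros eps He.
  assert (H1 : exists N, 0 < N /\ S - eps < Phi N).
  { apply NNPP. intros Hn. assert (S <= S - eps). { apply HS2. intros y [a [Ha ->]]. apply Rnot_lt_le. intros h. apply Hn. now exists a. } lra. }
  assert (H2 : exists d, 0 < d /\ I - eps < - Phi d).
  { apply NNPP. intros Hn. assert (I <= I - eps). { apply HI2. intros y [a [Ha ->]]. apply Rnot_lt_le. intros h. apply Hn. now exists a. } lra. }
  destruct H1 as [N [HN0 HN]]. destruct H2 as [d [Hd0 Hd]]. exists d, N. split; auto. split; auto.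
  intros a a' Ha Ha' b b' Hb Hb'.
  assert (- Phi a <= I) by (apply HI1; exists a; split; auto; lra). assert (- Phi a' <= I) by (apply HI1; exists a'; split; auto; lra).
  assert (Phi b <= S) by (apply HS1; exists b; split; auto; lra). assert (Phi b' <= S) by (apply HS1; exists b'; split; auto; lra).
  pose proof (Hmono a d ltac:(lra)). pose proof (Hmono a' d ltac:(lra)). pose proof (Hmono N b ltac:(lra)). pose proof (Hmono N b' ltac:(lra)).
  split; apply Rabs_le; lra. }
assert (Hdiff : forall a a' b b', 0 < a -> 0 < a' -> 0 < b -> 0 < b' ->
  norm (minus (rint f a b) (rint f a' b')) <= Rabs (Phi a - Phi a') + Rabs (Phi b - Phi b')).
{ assert (Hn : forall a b, 0 < a -> 0 < b -> norm (rint f a b) <= Rabs (Phi a - Phi b)).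
  { intros a b Ha Hb. destruct (Rle_dec a b) as [h|h].
    - rewrite Rabs_minus_sym. eapply Rle_trans. apply HPhi; lra. apply Rle_abs.
    - rewrite rint_swap by (apply continuous_pos_ex_RInt; auto).
    eapply Rle_trans. right; exact (norm_opp (rint f b a)). eapply Rle_trans. apply HPhi; lra. apply Rle_abs. }
  intros a a' b b' Ha Ha' Hb Hb'.
  assert (E : minus (rint f a b) (rint f a' b') = plus (rint f a a') (rint f b' b)).
  { rewrite <- (rint_Chasles f a a' b) by (apply continuous_pos_ex_RInt; auto).
    rewrite <- (rint_Chasles f a' b' b) by (apply continuous_pos_ex_RInt; auto). rmodule (nm V). }
  eapply Rle_trans. right; exact (f_equal norm E). eapply Rle_trans. apply (norm_triangle).
  apply Rplus_le_compat. apply Hn; auto. rewrite Rabs_minus_sym. apply Hn; auto. }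
destruct (complete_seq_complete V (fun n => rint f (/ (INR n + 1)) (INR n + 1))) as [l Hl].
{ intros eps He. destruct (Htail (eps / 3)) as [d [N [Hd [HN H]]]]. lra.
  destruct (inv_INR_small d Hd) as [N1 HN1]. destruct (inv_INR_small (/ N)) as [N2 HN2]. now apply Rinv_0_lt_compat.
  assert (Hok : forall n, (max N1 N2 <= n)%nat -> 0 < / (INR n + 1) < d /\ N < INR n + 1).
  { intros n Hn. specialize (HN1 n ltac:(lia)). specialize (HN2 n ltac:(lia)). pose proof (pos_INR n).
    split. split; auto. apply Rinv_0_lt_compat; lra. apply Rinv_lt_cancel; lra. }
  exists (max N1 N2). intros n m Hn Hm. destruct (Hok n Hn) as [A1 A2]. destruct (Hok m Hm) as [B1 B2].
  destruct (H _ _ A1 B1 _ _ A2 B2) as [C1 C2].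
  eapply Rle_lt_trans. apply Hdiff; lra. lra. }
assert (Himp : improper f l).
{ intros eps He. destruct (Htail (eps / 4)) as [d [N [Hd [HN H]]]]. lra. exists d, N. split; auto. intros a b Ha Hb.
  apply (proj1 (filterlim_norm eventually _ _)) with (eps := eps / 4) in Hl. 2: lra.
  destruct Hl as [N0 HN0]. destruct (inv_INR_small d Hd) as [N1 HN1]. destruct (inv_INR_small (/ N)) as [N2 HN2]. now apply Rinv_0_lt_compat.
  set (n := max N0 (max N1 N2)). specialize (HN0 n ltac:(unfold n; lia)). specialize (HN1 n ltac:(unfold n; lia)). specialize (HN2 n ltac:(unfold n; lia)).
  pose proof (pos_INR n). assert (A1 : 0 < / (INR n + 1)) by (apply Rinv_0_lt_compat; lra).
  assert (A2 : N < INR n + 1) by (apply Rinv_lt_cancel; lra).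
  destruct (H a _ Ha (conj A1 HN1) b _ Hb A2) as [C1 C2].
  eapply Rle_lt_trans. apply (norm_minus_triangle _ (rint f (/ (INR n + 1)) (INR n + 1))).
  specialize (Hdiff a (/ (INR n + 1)) b (INR n + 1) ltac:(lra) ltac:(lra) ltac:(lra) ltac:(lra)).
  eapply Rle_lt_trans. apply Rplus_le_compat_r. exact Hdiff. lra. }
exists l. split; auto. apply (improper_norm_limit f); auto.
intros a b Ha Hb. eapply Rle_trans. apply HPhi; lra. pose proof (Hc a Ha). pose proof (Hc b ltac:(lra)). lra.
Qed.

Lemma improper_scale f l s : continuous_pos f -> 0 < s -> improper f l ->
  improper (fun q => scal s (f (s * q))) l.
Proof.
intros Hf Hs H eps He. destruct (H eps He) as [d [N [Hd K]]].
exists (d / s), (Rmax N 0 / s). split. now apply Rdiv_lt_0_compat.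
intros a b Ha Hb. Rmax_bounds N 0.
assert (A1 : 0 < s * a < d). { split. nra. destruct Ha as [_ Ha]. apply (Rmult_lt_compat_l s) in Ha; auto. replace (s * (d / s)) with d in Ha by (field; lra). auto. }
assert (B1 : Rmax N 0 < s * b). { apply (Rmult_lt_compat_l s) in Hb; auto. replace (s * (Rmax N 0 / s)) with (Rmax N 0) in Hb by (field; lra). auto. }
assert (E : rint (fun q => scal s (f (s * q))) a b = rint f (s * a) (s * b)).
{ transitivity (rint (fun y => scal s (f (s * y + 0))) a b).
  apply rint_ext. intros; now rewrite Rplus_0_r.
  rewrite rint_comp_lin by (apply continuous_pos_ex_RInt; auto; lra). now rewrite !Rplus_0_r. }
rewrite E. apply K; lra.
Qed.
End Improper.
Arguments improper {V} f l.
Arguments continuous_pos {V} f.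

Lemma improper_is_linear {V W : CompleteNormedModule R_AbsRing} (L : nm V -> nm W) f l :
  is_linear L -> continuous_pos f -> improper f l -> improper (fun t => L (f t)) (L l).
Proof.
intros HL Hf H eps He.
destruct (linear_norm L HL) as [M [HM0 HM]].
destruct (H (eps / M)) as [d [N [Hd K]]]. now apply Rdiv_lt_0_compat.
exists d, (Rmax N 0). split; auto. intros a b Ha Hb. Rmax_bounds N 0.
rewrite rint_linear, <- (linear_minus L _ _ HL); auto. 2: apply continuous_pos_ex_RInt; auto; lra.
specialize (K a b Ha ltac:(lra)).
eapply Rle_lt_trans. apply HM. apply (Rmult_lt_compat_l M) in K; auto. replace (M * (eps / M)) with eps in K by (field; lra). exact K.
Qed.

(* [2 Phi'(q) >= q^-a / (R + q)] for [Phi(q) = R^-a phi(q / R)], where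
   [phi(q) = (q / (1 + q))^(1 - a) / (1 - a) + (1 - (1 + q)^-a) / a]. *)
Definition power_primitive a q :=
  Rpower (q / (1 + q)) (1 - a) / (1 - a) + (1 - Rpower (1 + q) (- a)) / a.
Definition power_majorant a q :=
  Rpower q (- a) * Rpower (1 + q) (a - 2) + Rpower (1 + q) (- a - 1).

Lemma power_primitive_derive a q : 0 < a < 1 -> 0 < q ->
  is_derive (power_primitive a) q (power_majorant a q).
Proof.
intros Ha Hq. unfold power_primitive, power_majorant, Rpower.
assert (0 < q / (1 + q)) by (apply Rdiv_lt_0_compat; lra).
auto_derive.
- repeat split; try lra; auto.
- change (q * / (1 + q)) with (q / (1 + q)). rewrite ln_div by lra.
  replace (exp ((1 - a) * (ln q - ln (1 + q)))) with (exp (- a * ln q) * exp ((a - 2) * ln (1 + q)) * (q * (1 + q))).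
  replace (exp (- a * ln (1 + q))) with (exp ((- a - 1) * ln (1 + q)) * (1 + q)).
  field. repeat split; lra.
  assert (E1 : 1 + q = exp (ln (1 + q))) by (rewrite exp_ln; lra).
  rewrite E1 at 2. rewrite <- exp_plus. f_equal. ring.
  replace (q * (1 + q)) with (exp (ln q) * exp (ln (1 + q))) by (rewrite !exp_ln; lra).
  rewrite <- !exp_plus. f_equal. ring.
Qed.

Lemma Rpower_pos x y : 0 < Rpower x y.
Proof. apply exp_pos. Qed.

Lemma Rpower_le_neg x y p : 0 < x <= y -> p <= 0 -> Rpower y p <= Rpower x p.
Proof.
intros Hxy Hp. unfold Rpower. destruct (Req_dec x y) as [->|]. lra.
assert (ln x < ln y) by (apply ln_increasing; lra).
destruct (Req_dec (p * ln y) (p * ln x)) as [->|]. lra. left. apply exp_increasing. nra.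
Qed.

Lemma Rpower_minus1 x : 0 < x -> Rpower x (-1) = / x.
Proof. intros Hx. replace (-1) with (- (1)) by ring. now rewrite Rpower_Ropp, Rpower_1. Qed.

(** For q <= 1 the first term of the majorant suffices, for q > 1 the second; both cases use that
    2^p >= 1/2 for p >= -1. *)
Lemma power_majorant_ge a q : 0 < a < 1 -> 0 < q -> Rpower q (- a) / (1 + q) <= 2 * power_majorant a q.
Proof.
intros Ha Hq. unfold power_majorant.
pose proof (Rpower_pos q (- a)). pose proof (Rpower_pos (1 + q) (a - 2)). pose proof (Rpower_pos (1 + q) (- a - 1)).
assert (E1 : Rpower (1 + q) (-1) = / (1 + q)) by (apply Rpower_minus1; lra).
assert (H2 : / 2 <= Rpower 2 (a - 1)).
{ rewrite <- Rpower_minus1 by lra. apply Rle_Rpower; lra. }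
assert (H2' : / 2 <= Rpower 2 (- a)).
{ rewrite <- Rpower_minus1 by lra. apply Rle_Rpower; lra. }
assert (0 < / (1 + q)) by (apply Rinv_0_lt_compat; lra).
destruct (Rle_dec q 1) as [h|h].
- replace (Rpower (1 + q) (a - 2)) with (/ (1 + q) * Rpower (1 + q) (a - 1)).
  2:{ rewrite <- E1, <- Rpower_plus. f_equal. ring. }
  assert (Rpower 2 (a - 1) <= Rpower (1 + q) (a - 1)) by (apply Rpower_le_neg; lra).
  assert (0 < Rpower q (- a) * / (1 + q)) by (apply Rmult_lt_0_compat; auto). nra.
- replace (Rpower (1 + q) (- a - 1)) with (/ (1 + q) * Rpower (1 + q) (- a)).
  2:{ rewrite <- E1, <- Rpower_plus. f_equal. ring. }
  assert (Rpower (2 * q) (- a) <= Rpower (1 + q) (- a)) by (apply Rpower_le_neg; lra).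
  rewrite <- Rpower_mult_distr in H4 by lra.
  assert (/ 2 * Rpower q (- a) <= Rpower (1 + q) (- a)) by nra. nra.
Qed.

(** An elementary upper bound of int_0^oo q^-a / (1 + q) dq = pi / sin(pi a). *)
Definition power_const a := 2 * (/ (1 - a) + / a).

Lemma power_const_pos a : 0 < a < 1 -> 0 < power_const a.
Proof. intros Ha. unfold power_const. assert (0 < / (1 - a)) by (apply Rinv_0_lt_compat; lra). assert (0 < / a) by (apply Rinv_0_lt_compat; lra). lra. Qed.

Lemma power_primitive_bounds a q : 0 < a < 1 -> 0 < q -> 0 <= power_primitive a q <= power_const a / 2.
Proof.
intros Ha Hq. unfold power_primitive, power_const.
assert (Rpower (q / (1 + q)) (1 - a) <= 1).
{ apply Rle_trans with (Rpower 1 (1 - a)). apply Rle_Rpower_l. lra.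
  split. apply Rdiv_lt_0_compat; lra. apply Rle_div_l; lra. right. unfold Rpower. rewrite ln_1, Rmult_0_r. apply exp_0. }
pose proof (Rpower_pos (q / (1 + q)) (1 - a)).
assert (Rpower (1 + q) (- a) <= 1).
{ apply Rle_trans with (Rpower 1 (- a)). apply Rpower_le_neg; lra. right. unfold Rpower. rewrite ln_1, Rmult_0_r. apply exp_0. }
pose proof (Rpower_pos (1 + q) (- a)).
assert (0 < / (1 - a)) by (apply Rinv_0_lt_compat; lra). assert (0 < / a) by (apply Rinv_0_lt_compat; lra).
split; nra.
Qed.

(** The common convergence test for weakly singular integrals. The substitution q = b p reduces to b
    = 1 and yields the factor b^-a, whose decay for large b is exploited in [average_near_zero]. *)
Lemma improper_majorized (V : CompleteNormedModule R_AbsRing) (f : R -> nm V) c a b :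
  0 < a < 1 -> 0 < b -> 0 <= c -> continuous_pos f ->
  (forall q, 0 < q -> norm (f q) <= c * (Rpower q (- a) / (b + q))) ->
  exists l, improper f l /\ norm l <= c * (Rpower b (- a) * power_const a).
Proof.
intros Ha HR Hc Hf Hfb.
set (k := c * Rpower b (- a)). pose proof (Rpower_pos b (- a)).
assert (Hk : 0 <= k) by (unfold k; apply Rmult_le_pos; lra).
destruct (improper_cauchy V f (fun q => 2 * k * power_primitive a (/ b * q)) (k * power_const a) Hf) as [l [H1 H2]].
- intros x y Hxy. assert (HiR := Rinv_0_lt_compat b HR).
  apply (norm_RInt_le f (fun q => 2 * k * (/ b * power_majorant a (/ b * q))) x y).
  + lra.
  + intros q Hq. assert (0 < / b * q) by (apply Rmult_lt_0_compat; lra).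
    eapply Rle_trans. apply Hfb; lra.
    assert (H1 := power_majorant_ge a (/ b * q) Ha H0).
    apply Rle_trans with (k * / b * (Rpower (/ b * q) (- a) / (1 + / b * q))).
    * right. rewrite <- Rpower_mult_distr by lra.
    replace (Rpower (/ b) (- a)) with (/ Rpower b (- a)).
    2:{ rewrite <- Rpower_Ropp. unfold Rpower. rewrite ln_Rinv by auto. f_equal. ring. }
    unfold k. field. repeat split; try lra.
    * replace (2 * k * (/ b * power_majorant a (/ b * q))) with (k * / b * (2 * power_majorant a (/ b * q))) by ring.
    apply Rmult_le_compat_l; auto. apply Rmult_le_pos; lra.
  + apply continuous_pos_rint; auto; lra.
  + apply (is_RInt_derive (V := R_CompleteNormedModule) (fun q => 2 * k * power_primitive a (/ b * q))).
    * intros q Hq. rewrite Rmin_left in Hq by lra.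
    assert (0 < / b * q) by (apply Rmult_lt_0_compat; lra).
    apply (is_derive_scal (fun q => power_primitive a (/ b * q)) q (2 * k) (/ b * power_majorant a (/ b * q))).
    apply (is_derive_comp (power_primitive a) (fun q => / b * q) q (power_majorant a (/ b * q)) (/ b)).
    now apply power_primitive_derive. auto_derive; auto. ring.
    * intros q Hq. rewrite Rmin_left in Hq by lra.
    assert (0 < / b * q) by (apply Rmult_lt_0_compat; lra).
    apply (ex_derive_continuous (V := R_NormedModule)). unfold power_majorant, Rpower. auto_derive. repeat split; lra.
- intros q Hq. assert (0 < / b * q) by (apply Rmult_lt_0_compat; auto; now apply Rinv_0_lt_compat).
  destruct (power_primitive_bounds a (/ b * q) Ha H0). split. apply Rmult_le_pos; lra.
  apply Rle_trans with (2 * k * (power_const a / 2)). apply Rmult_le_compat_l; lra. right; field.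
- exists l. split; auto. unfold k in H2. lra.
Qed.

Lemma improper_positive (f : R -> nm R_CompleteNormedModule) (l : R) : continuous_pos f ->
  (forall t, 0 < t -> 0 < (f t : R)) -> improper f l -> 0 < l.
Proof.
intros Hf Hp H.
assert (Hex : forall a b, 0 < a -> 0 < b -> ex_RInt f a b) by (intros; now apply continuous_pos_ex_RInt).
assert (Hge : forall a b, 0 < a <= b -> 0 <= (rint f a b : R)).
{ intros a b Hab. apply (RInt_ge_0 f a b). lra. apply Hex; lra. intros x Hx. left; apply Hp; lra. }
set (c := (rint f 1 2 : R)).
assert (Hc : 0 < c). { apply (RInt_gt_0 f 1 2). lra. intros x Hx. apply Hp; lra. intros x Hx. apply Hf; lra. }
destruct (H (c / 2)) as [d [N [Hd K]]]. lra.
set (a := Rmin 1 (d / 2)). set (b := Rmax 2 (N + 1)).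
assert (Ha : 0 < a <= 1 /\ a <= d / 2). { unfold a, Rmin; destruct Rle_dec; lra. }
assert (Hb : 2 <= b /\ N < b). { unfold b, Rmax; destruct Rle_dec; lra. }
specialize (K a b ltac:(lra) ltac:(lra)).
assert (E : (rint f a b : R) = (rint f a 1 : R) + (c + (rint f 2 b : R))).
{ etransitivity. symmetry. apply (rint_Chasles f a 1 b); apply Hex; lra.
  apply (f_equal (fun w => Rplus (rint f a 1) w)). symmetry. apply (rint_Chasles f 1 2 b); apply Hex; lra. }
change (Rabs ((rint f a b : R) - l) < c / 2) in K. apply Rabs_def2 in K.
pose proof (Hge a 1 ltac:(lra)). pose proof (Hge 2 b ltac:(lra)). lra.
Qed.

(** [K] stands for A^-alpha and [Q t] for A^alpha exp(-tA): the unbounded A^alpha appears only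
    behind the smoothing semigroup, with the singularity t^-alpha in its bound. *)
Record fractional_power (V : NormedModule R_AbsRing) (E : R -> V -> V) (K : V -> V) (Q : R -> V -> V)
    (alpha C : R) : Prop := {
  fp_const : 0 < C;
  fp_linear : is_linear K;
  fp_commute : forall t x, 0 <= t -> K (E t x) = E t (K x);
  fp_inverse_linear : forall t, 0 < t -> is_linear (Q t);
  fp_inverse : forall t x, 0 < t -> K (Q t x) = E t x;
  fp_inverse_bound : forall t x, 0 < t -> norm (Q t x) <= C * Rpower t (- alpha) * norm x;
  fp_inverse_add : forall t r x, 0 < t -> 0 <= r -> Q (t + r) x = E r (Q t x);
  fp_injective : forall x, K x = zero -> x = zero }.

(** * Fractional powers and their inversion *)

Section Fractional.
Variable V : CompleteNormedModule R_AbsRing.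
Variables (E AE : R -> nm V -> nm V) (M : R).
Hypothesis HE : analytic_semigroup (nm V) E AE M.
Variable alpha : R.
Hypothesis Halpha : 0 < alpha < 1.

Let HM : 1 <= M := as_const _ _ _ _ HE.

(** For r <= t the Taylor estimate applies; for r > t the two values are bounded separately. *)
Lemma semigroup_increment t r x : 0 < t -> 0 <= r -> t * norm (minus (E (t + r) x) (E t x)) <= 2 * M * r * norm x.
Proof.
intros Ht Hr. assert (Hx := norm_ge_0 x).
destruct (Rle_dec r t) as [h|h].
- assert (H1 := as_taylor _ _ _ _ HE t r x Ht Hr). assert (H2 := as_deriv_bound _ _ _ _ HE t x Ht).
  set (u := plus (minus (E (t + r) x) (E t x)) (scal r (AE t x))) in *.
  assert (Eq : minus (E (t + r) x) (E t x) = minus u (scal r (AE t x))) by (unfold u; rmodule (nm V)).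
  rewrite Eq.
  assert (H3 : norm (minus u (scal r (AE t x))) <= norm u + r * norm (AE t x)).
  { eapply Rle_trans. apply norm_minus_le. apply Rplus_le_compat_l. eapply Rle_trans. apply norm_scal_Rabs. rewrite Rabs_pos_eq; lra. }
  assert (H4 : t * norm u <= M * r * norm x).
  { apply (Rmult_le_reg_l t); auto. replace (t * (t * norm u)) with (t ^ 2 * norm u) by ring.
    eapply Rle_trans. exact H1. apply Rle_trans with (r * (M * r * norm x)). right; ring.
    apply Rmult_le_compat_r; auto. repeat apply Rmult_le_pos; lra. }
  apply (Rmult_le_compat_l t) in H3; [|lra].
  apply (Rmult_le_compat_l r) in H2; auto. nra.
- pose proof (as_bound _ _ _ _ HE t x ltac:(lra)). pose proof (as_bound _ _ _ _ HE (t + r) x ltac:(lra)).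
  pose proof (norm_minus_le (E (t + r) x) (E t x)).
  apply Rle_trans with (t * (2 * (M * norm x))). apply Rmult_le_compat_l; lra.
  assert (0 <= M * norm x) by nra. nra.
Qed.

Lemma semigroup_continuous_pos x t : 0 < t -> continuous (fun s => E s x) t.
Proof.
intros Ht. apply continuous_norm. intros eps He.
destruct (as_continuous _ _ _ _ HE x t eps ltac:(lra) He) as [d [Hd H]].
exists (Rmin d t). split. now apply Rmin_pos. intros s Hs.
Rmin_bounds d t. apply H. apply Rabs_def2 in Hs. lra. lra.
Qed.

Lemma derivative_continuous_pos x t : 0 < t -> continuous (fun s => AE s x) t.
Proof.
intros Ht. apply (continuous_ext_loc _ (fun s => E (s + - (t / 2)) (AE (t / 2) x))).
- exists (mkposreal (t / 2) ltac:(lra)). intros s Hs. change (Rabs (s - t) < t / 2) in Hs. apply Rabs_def2 in Hs.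
  rewrite <- (as_deriv_add _ _ _ _ HE) by lra. f_equal. ring.
- apply (continuous_comp (fun s => s + - (t / 2)) (fun s => E s (AE (t / 2) x))).
  + apply (continuous_plus (fun s => s) (fun _ => - (t / 2))). apply continuous_id. apply continuous_const.
  + apply semigroup_continuous_pos. lra.
Qed.

Lemma weighted_continuous (w : R -> R) (G : R -> nm V) : (forall t, 0 < t -> continuous w t) -> continuous_pos G ->
  continuous_pos (fun t => scal (w t) (G t)).
Proof. intros Hw HG t Ht. apply (continuous_scal (K := R_AbsRing) w G); auto. Qed.

Lemma norm_weight (w : R) (x : nm V) : 0 <= w -> norm (scal w x) <= w * norm x.
Proof. intros Hw. eapply Rle_trans. apply norm_scal_Rabs. rewrite Rabs_pos_eq; auto. lra. Qed.

Definition power_weight q := Rpower q (- alpha) / (1 + q).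

Lemma power_weight_pos q : 0 < q -> 0 < power_weight q.
Proof. intros Hq. apply Rdiv_lt_0_compat. apply Rpower_pos. lra. Qed.

Lemma power_weight_continuous q : 0 < q -> continuous power_weight q.
Proof.
intros Hq. apply (ex_derive_continuous (V := R_NormedModule)). unfold power_weight, Rpower. auto_derive. repeat split; lra.
Qed.

(** The bounds M and M/q of the semigroup combine to 2M/(1 + q), which supplies the decay at
    infinity. *)
Lemma negative_power_exists : exists k : nm V -> nm V, forall x,
  improper (fun t => scal (Rpower t (alpha - 1)) (E t x)) (k x) /\
  norm (k x) <= 2 * M * power_const (1 - alpha) * norm x.
Proof.
apply (choice (fun x l => improper (fun t => scal (Rpower t (alpha - 1)) (E t x)) l /\
  norm l <= 2 * M * power_const (1 - alpha) * norm x)). intros x.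
destruct (improper_majorized V (fun t => scal (Rpower t (alpha - 1)) (E t x)) (2 * M * norm x) (1 - alpha) 1) as [l [H1 H2]].
- lra.
- lra.
- pose proof (norm_ge_0 x). nra.
- apply weighted_continuous. intros; now apply continuous_Rpower_l. intros t Ht; now apply semigroup_continuous_pos.
- intros q Hq. pose proof (Rpower_pos q (alpha - 1)). eapply Rle_trans. apply norm_weight. lra.
  replace (- (1 - alpha)) with (alpha - 1) by ring.
  replace (2 * M * norm x * (Rpower q (alpha - 1) / (1 + q))) with (Rpower q (alpha - 1) * (2 * M * norm x / (1 + q))) by (field; lra).
  apply Rmult_le_compat_l. lra. apply Rle_div_r. lra.
  pose proof (as_bound _ _ _ _ HE q x ltac:(lra)). pose proof (as_decay _ _ _ _ HE q x ltac:(lra)). lra.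
- exists l. split; auto. replace (Rpower 1 (- (1 - alpha))) with 1 in H2. lra.
  unfold Rpower. now rewrite ln_1, Rmult_0_r, exp_0.
Qed.

(** The integral represents Gamma(1 - alpha) A^alpha E(t) x. The shift by [t] keeps A E away from
    time 0, and the bound M/(t + r) turns into the factor t^-alpha. *)
Lemma resolving_integral_exists : exists q : R -> nm V -> nm V, forall t x, 0 < t ->
  improper (fun r => scal (Rpower r (- alpha)) (AE (t + r) x)) (q t x) /\
  norm (q t x) <= M * power_const alpha * Rpower t (- alpha) * norm x.
Proof.
destruct (choice (fun (p : R * nm V) l => 0 < fst p ->
  improper (fun r => scal (Rpower r (- alpha)) (AE (fst p + r) (snd p))) l /\
  norm l <= M * power_const alpha * Rpower (fst p) (- alpha) * norm (snd p))) as [q Hq].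
2:{ exists (fun t x => q (t, x)). intros t x Ht. exact (Hq (t, x) Ht). }
intros [t x]; simpl. destruct (Rlt_dec 0 t) as [Ht|Ht]. 2: { exists zero. intros h; contradiction. }
destruct (improper_majorized V (fun r => scal (Rpower r (- alpha)) (AE (t + r) x)) (M * norm x) alpha t) as [l [H1 H2]]; auto.
- pose proof (norm_ge_0 x). nra.
- apply weighted_continuous. intros; now apply continuous_Rpower_l. intros r Hr.
  apply (continuous_comp (fun r => t + r) (fun s => AE s x)).
  apply (continuous_plus (fun _ => t) (fun s => s)). apply continuous_const. apply continuous_id.
  apply derivative_continuous_pos. lra.
- intros r Hr. pose proof (Rpower_pos r (- alpha)). eapply Rle_trans. apply norm_weight. lra.
  replace (M * norm x * (Rpower r (- alpha) / (t + r))) with (Rpower r (- alpha) * (M * norm x / (t + r))) by (field; lra).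
  apply Rmult_le_compat_l. lra. apply Rle_div_r. lra. rewrite Rmult_comm. apply (as_deriv_bound _ _ _ _ HE). lra.
- exists l. intros _. split; auto. lra.
Qed.

Section Inversion.
Variables (k : nm V -> nm V) (q : R -> nm V -> nm V) (kappa : R).
Hypothesis Hk : forall x, improper (fun t => scal (Rpower t (alpha - 1)) (E t x)) (k x).
Hypothesis Hq : forall t x, 0 < t -> improper (fun r => scal (Rpower r (- alpha)) (AE (t + r) x)) (q t x).
Hypothesis Hkappa : improper (V := R_CompleteNormedModule) power_weight kappa.

Lemma k_integrand_continuous x : continuous_pos (fun t => scal (Rpower t (alpha - 1)) (E t x)).
Proof. apply weighted_continuous. intros; now apply continuous_Rpower_l. intros t Ht; now apply semigroup_continuous_pos. Qed.

Lemma q_integrand_continuous t x s : 0 < t -> 0 < s -> continuous_pos (fun r => scal (Rpower r (- alpha)) (AE (t + s * r) x)).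
Proof.
intros Ht Hs. apply weighted_continuous. intros; now apply continuous_Rpower_l. intros r Hr.
apply (continuous_ext (fun r => AE (s * r + t) x)). intros; now rewrite Rplus_comm.
apply (continuous_comp (fun r => s * r + t) (fun s => AE s x)). apply continuous_affine.
apply derivative_continuous_pos. nra.
Qed.

Lemma E_integrand_continuous t x s : 0 < t -> 0 <= s -> continuous_pos (fun r => scal (power_weight r) (E (t + s * (1 + r)) x)).
Proof.
intros Ht Hs. apply weighted_continuous. apply power_weight_continuous. intros r Hr.
apply (continuous_ext (fun r => E (s * r + (t + s)) x)). intros; f_equal; ring.
apply (continuous_comp (fun r => s * r + (t + s)) (fun s => E s x)). apply continuous_affine.
apply semigroup_continuous_pos. nra.
Qed.

(** Substituting r = s p rewrites the integrand of k(q t x) at time s as an integral whose weight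
    p^-alpha no longer depends on s. *)
Lemma shifted_integral s t x : 0 < s -> 0 < t ->
  improper (fun p => scal (Rpower p (- alpha)) (AE (t + s * (1 + p)) x)) (scal (Rpower s (alpha - 1)) (E s (q t x))).
Proof.
intros Hs Ht.
assert (H1 : improper (fun r => E s (scal (Rpower r (- alpha)) (AE (t + r) x))) (E s (q t x))).
{ apply improper_is_linear. apply (as_linear _ _ _ _ HE); lra.
  apply (fun H => H). intros r Hr. generalize (q_integrand_continuous t x 1 Ht ltac:(lra) r Hr).
  apply continuous_ext. intros; now rewrite Rmult_1_l. now apply Hq. }
apply (improper_scale V _ _ s) in H1; auto.
2:{ intros r Hr. apply (is_linear_R_continuous (E s)). apply (as_linear _ _ _ _ HE); lra.
  generalize (q_integrand_continuous t x 1 Ht ltac:(lra) r Hr). apply continuous_ext. intros; now rewrite Rmult_1_l. }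
assert (Hsc : @is_linear R_AbsRing (nm V) (nm V) (fun y => scal (Rpower s (alpha - 1)) y)).
{ exact (is_linear_scal_r (V := nm V) (Rpower s (alpha - 1)) (fun n m => Rmult_comm n m)). }
apply (improper_is_linear (fun y : nm V => scal (Rpower s (alpha - 1)) y)) in H1; auto.
- revert H1. apply improper_ext. intros p Hp.
  assert (L := as_linear _ _ _ _ HE s ltac:(lra)). rewrite (linear_scal _ L).
  rewrite <- (as_deriv_add _ _ _ _ HE) by nra.
  rewrite !scal_assoc. replace (t + s * p + s) with (t + s * (1 + p)) by ring. f_equal.
  change (Rpower s (alpha - 1) * s * Rpower (s * p) (- alpha) = Rpower p (- alpha)).
  rewrite <- Rpower_mult_distr by auto. rewrite <- (Rpower_1 s) at 2 by auto.
  rewrite <- Rmult_assoc, <- !Rpower_plus. replace (alpha - 1 + 1 + - alpha) with 0 by ring. rewrite Rpower_O by auto. ring.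
- intros p Hp. apply (continuous_scal_r (K := R_AbsRing) s (fun p => E s (scal (Rpower (s * p) (- alpha)) (AE (t + s * p) x)))).
  apply (is_linear_R_continuous (E s)). apply (as_linear _ _ _ _ HE); lra.
  apply (continuous_scal (K := R_AbsRing) (fun p => Rpower (s * p) (- alpha)) (fun p => AE (t + s * p) x)).
  + apply (ex_derive_continuous (V := R_NormedModule)). unfold Rpower. auto_derive. nra.
  + apply (continuous_ext (fun r => AE (s * r + t) x)). intros; now rewrite Rplus_comm.
    apply (continuous_comp (fun r => s * r + t) (fun s => AE s x)). apply continuous_affine.
    apply derivative_continuous_pos. nra.
Qed.

Lemma average_exists t x s : 0 < t -> 0 <= s -> exists l,
  improper (fun p => scal (power_weight p) (E (t + s * (1 + p)) x)) l.
Proof.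
intros Ht Hs.
destruct (improper_majorized V (fun p => scal (power_weight p) (E (t + s * (1 + p)) x)) (M * norm x) alpha 1) as [l [Hl _]]; auto.
- lra.
- pose proof (norm_ge_0 x). nra.
- now apply E_integrand_continuous.
- intros p Hp. pose proof (power_weight_pos p Hp). eapply Rle_trans. apply norm_weight. lra.
  rewrite (Rmult_comm (M * norm x)). apply (Rmult_le_compat_l (power_weight p)). lra. apply (as_bound _ _ _ _ HE). nra.
- now exists l.
Qed.

Section Average.
Variables (t : R) (x : nm V) (Psi : R -> nm V).
Hypothesis Ht : 0 < t.
Hypothesis HPsi : forall s, 0 <= s -> improper (fun p => scal (power_weight p) (E (t + s * (1 + p)) x)) (Psi s).

Let psi s := scal (Rpower s (alpha - 1)) (E s (q t x)).

(** [Psi s] averages E(t + s(1 + p)) x with the weight p^-alpha / (1 + p). Differentiation in s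
    produces a factor 1 + p that cancels the denominator, so Psi' = - psi by [shifted_integral]; the
    second-order Taylor bound makes this quantitative. An explicit antiderivative thus takes the
    place of exchanging two improper integrals. *)
Lemma average_increment y h : 0 < y -> 0 < h ->
  norm (plus (minus (Psi (y + h)) (Psi y)) (scal h (psi y))) <= M * h ^ 2 / y ^ 2 * norm x * power_const alpha.
Proof.
intros Hy Hh.
set (f := fun p => plus (plus (scal (power_weight p) (E (t + (y + h) * (1 + p)) x))
    (scal (-1) (scal (power_weight p) (E (t + y * (1 + p)) x))))
    (scal h (scal (Rpower p (- alpha)) (AE (t + y * (1 + p)) x)))).
assert (C1 := E_integrand_continuous t x (y + h) Ht ltac:(lra)).
assert (C2 := E_integrand_continuous t x y Ht ltac:(lra)).
assert (C3 : continuous_pos (fun p => scal (Rpower p (- alpha)) (AE (t + y * (1 + p)) x))).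
{ intros p Hp. apply (continuous_ext (fun p => scal (Rpower p (- alpha)) (AE (t + y + y * p) x))).
  intros; f_equal; f_equal; ring. apply q_integrand_continuous; lra. }
assert (Hsc : forall c : R, @is_linear R_AbsRing (nm V) (nm V) (fun y => scal c y)).
{ intros c. exact (is_linear_scal_r (V := nm V) c (fun n m => Rmult_comm n m)). }
assert (Cs : forall (c : R) g, continuous_pos g -> continuous_pos (fun p => scal c (g p) : nm V)).
{ intros c g Hg p Hp. apply (continuous_scal_r (K := R_AbsRing) c g). auto. }
assert (Hf : improper f (plus (plus (Psi (y + h)) (scal (-1) (Psi y))) (scal h (psi y)))).
{ apply improper_plus.
  - intros p Hp. apply (continuous_plus (fun p => scal (power_weight p) (E (t + (y + h) * (1 + p)) x)) (fun p => scal (-1) (scal (power_weight p) (E (t + y * (1 + p)) x)))). auto. apply (Cs (-1)); auto.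
  - apply (Cs h); auto.
  - apply (improper_plus V _ _ _ _ C1 (Cs (-1) _ C2)). apply HPsi; lra.
    apply (improper_is_linear (fun y : nm V => scal (-1) y)); auto. apply HPsi; lra.
  - apply (improper_is_linear (fun y : nm V => scal h y)); auto. apply shifted_integral; auto. }
assert (Cf : continuous_pos f).
{ intros p Hp. apply (continuous_plus (fun p => plus (scal (power_weight p) (E (t + (y + h) * (1 + p)) x)) (scal (-1) (scal (power_weight p) (E (t + y * (1 + p)) x))))
    (fun p => scal h (scal (Rpower p (- alpha)) (AE (t + y * (1 + p)) x)))).
  apply (continuous_plus (fun p => scal (power_weight p) (E (t + (y + h) * (1 + p)) x)) (fun p => scal (-1) (scal (power_weight p) (E (t + y * (1 + p)) x)))). auto. apply (Cs (-1)); auto.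
  apply (Cs h); auto. }
assert (Hy2 : 0 < y ^ 2) by nra. assert (Hx := norm_ge_0 x).
destruct (improper_majorized V f (M * h ^ 2 / y ^ 2 * norm x) alpha 1) as [l [Hl1 Hl2]]; auto.
- lra.
- apply Rmult_le_pos; auto. apply Rdiv_le_0_compat; auto. nra.
- intros p Hp. pose proof (power_weight_pos p Hp).
  assert (Ef : f p = scal (power_weight p) (plus (minus (E (t + y * (1 + p) + h * (1 + p)) x) (E (t + y * (1 + p)) x)) (scal (h * (1 + p)) (AE (t + y * (1 + p)) x)))).
  { unfold f. replace (t + (y + h) * (1 + p)) with (t + y * (1 + p) + h * (1 + p)) by ring.
    replace (Rpower p (- alpha)) with (power_weight p * (1 + p)) by (unfold power_weight; field; lra). rmodule (nm V). }
  rewrite Ef. eapply Rle_trans. apply norm_weight; lra.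
  rewrite (Rmult_comm (M * h ^ 2 / y ^ 2 * norm x)). apply (Rmult_le_compat_l (power_weight p)). lra.
  assert (Hu : 0 < t + y * (1 + p)) by nra.
  assert (H1 := as_taylor _ _ _ _ HE (t + y * (1 + p)) (h * (1 + p)) x Hu ltac:(nra)).
  set (u := t + y * (1 + p)) in *.
  apply (Rmult_le_reg_l (u ^ 2)). nra. eapply Rle_trans. exact H1.
  assert (H2 : y ^ 2 * (1 + p) ^ 2 <= u ^ 2).
  { rewrite <- Rpow_mult_distr. apply pow_incr. split. nra. unfold u; lra. }
  apply Rle_trans with (y ^ 2 * (1 + p) ^ 2 * (M * h ^ 2 / y ^ 2 * norm x)).
  right. field. lra. apply Rmult_le_compat_r; auto. apply Rmult_le_pos; auto. apply Rdiv_le_0_compat; auto. nra.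
- assert (El := improper_unique V _ _ _ Hf Hl1).
  replace (plus (minus (Psi (y + h)) (Psi y)) (scal h (psi y))) with (plus (plus (Psi (y + h)) (scal (-1) (Psi y))) (scal h (psi y))) by rmodule (nm V).
  rewrite El. eapply Rle_trans. exact Hl2. right.
  replace (Rpower 1 (- alpha)) with 1. ring. unfold Rpower. now rewrite ln_1, Rmult_0_r, exp_0.
Qed.

Lemma psi_continuous : continuous_pos psi.
Proof.
apply weighted_continuous. intros; now apply continuous_Rpower_l. intros s Hs; now apply semigroup_continuous_pos.
Qed.

(** Psi plus the integral of psi has increments of second order, so the straddle lemma with
    arbitrarily small slope shows that it is constant. *)
Lemma average_integral a b : 0 < a -> a <= b -> rint psi a b = minus (Psi a) (Psi b).
Proof.
intros Ha Hab.
assert (Hex : forall c d, 0 < c -> 0 < d -> ex_RInt psi c d) by (intros; apply continuous_pos_ex_RInt; auto; apply psi_continuous).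
set (F := fun s => plus (Psi s) (rint psi a s)).
assert (H : forall eps, 0 < eps -> norm (minus (F b) (F a)) <= eps * b - eps * a).
{ intros eps He. apply (straddle_bound F (fun s => eps * s)); auto.
  intros r Hr. destruct (continuous_norm_inv psi r (psi_continuous r ltac:(lra)) (eps / 4)) as [d [Hd Hd2]]. lra.
  set (C := M / a ^ 2 * norm x * power_const alpha).
  assert (HC : 0 <= C). { pose proof (norm_ge_0 x). pose proof (power_const_pos alpha Halpha).
    apply Rmult_le_pos; [apply Rmult_le_pos; auto|lra]. apply Rdiv_le_0_compat; nra. }
  set (d' := Rmin d (eps / (4 * (C + 1)))).
  assert (Hd' : 0 < d'). { apply Rmin_pos; auto. apply Rdiv_lt_0_compat; lra. }
  assert (R1 := Rmin_l d (eps / (4 * (C + 1)))). assert (R2 := Rmin_r d (eps / (4 * (C + 1)))). fold d' in R1, R2.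
  exists d'. split; auto. intros y z Hy Hz H1 H2.
  destruct (Req_dec y z) as [->|Hyz]. rewrite norm_minus_self. lra.
  set (h := z - y). assert (Hh : 0 < h) by (unfold h; lra).
  assert (E1 : minus (F z) (F y) = plus (plus (minus (Psi (y + h)) (Psi y)) (scal h (psi y))) (minus (rint psi y z) (scal h (psi y)))).
  { unfold F. rewrite <- (rint_Chasles psi a y z) by (apply Hex; lra). replace (y + h) with z by (unfold h; ring). rmodule (nm V). }
  rewrite E1. eapply Rle_trans. apply norm_triangle.
  assert (H3 := average_increment y h ltac:(lra) Hh).
  assert (H4 : norm (minus (rint psi y z) (scal h (psi y))) <= h * (eps / 2)).
  { assert (Hc : is_RInt (fun _ : R => psi y) y z (scal h (psi y))) by apply is_RInt_const.
    assert (H4 := is_RInt_minus _ _ _ _ _ _ (rint_correct psi y z (Hex y z ltac:(lra) ltac:(lra))) Hc).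
    apply (norm_RInt_le_const (fun s => minus (psi s) (psi y)) y z). lra. 2: exact H4.
    intros s Hs. eapply Rle_trans. apply (norm_minus_triangle _ (psi r)).
    pose proof (Hd2 s ltac:(apply Rabs_def1; lra)). assert (H5 := Hd2 y ltac:(apply Rabs_def1; lra)).
    rewrite norm_minus_sym in H5. lra. }
  assert (H5 : M * h ^ 2 / y ^ 2 * norm x * power_const alpha <= h * (eps / 2)).
  { apply Rle_trans with (h * (C * h)).
    - pose proof (power_const_pos alpha Halpha).
    replace (M * h ^ 2 / y ^ 2 * norm x * power_const alpha) with (h ^ 2 * M * norm x * power_const alpha * / y ^ 2) by (field; lra).
    replace (h * (C * h)) with (h ^ 2 * M * norm x * power_const alpha * / a ^ 2) by (unfold C; field; lra).
    apply Rmult_le_compat_l. { apply Rmult_le_pos. apply Rmult_le_pos. apply Rmult_le_pos. apply pow_le. lra. lra. apply norm_ge_0. lra. } apply Rinv_le_contravar. apply pow_lt; lra. apply pow_incr; lra.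
    - apply Rmult_le_compat_l. lra.
    assert (h <= 2 * d') by (unfold h; lra).
    apply Rle_trans with ((C + 1) * (2 * d')). nra.
    apply Rle_trans with ((C + 1) * (2 * (eps / (4 * (C + 1))))). apply Rmult_le_compat_l; lra. right; field; lra. }
  apply Rle_trans with (h * (eps / 2) + h * (eps / 2)). lra. unfold h; lra. }
assert (E0 : F b = F a).
{ apply eq_of_norm_minus. intros eps He. eapply Rle_trans. apply (H (eps / (b - a + 1))). apply Rdiv_lt_0_compat; lra.
  replace (eps / (b - a + 1) * b - eps / (b - a + 1) * a) with (eps * (b - a) / (b - a + 1)) by (field; lra).
  apply Rle_div_l; nra. }
unfold F in E0.
assert (E1 : rint psi a a = zero) by exact (RInt_point (V := V) a psi).
rewrite E1 in E0.
assert (E2 : rint psi a b = minus (plus (Psi b) (rint psi a b)) (Psi b)) by rmodule (nm V).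
rewrite E2, E0. rmodule (nm V).
Qed.

Lemma average_at_zero : Psi 0 = scal kappa (E t x).
Proof.
apply (improper_unique V (fun p => scal (power_weight p) (E (t + 0 * (1 + p)) x))). apply HPsi; lra.
apply (improper_ext V (fun p => scal (power_weight p) (E t x))). intros p Hp; f_equal; f_equal; ring.
apply (improper_is_linear (V := R_CompleteNormedModule) (W := V) (fun c => scal c (E t x))).
- exact (is_linear_scal_l (V := nm V) (E t x)).
- intros p Hp. now apply power_weight_continuous.
- exact Hkappa.
Qed.

(** With r = s(1 + p) the increment bound c r/(t + r) turns the weight p^-alpha / (1 + p) into c
    p^-alpha / (b + p) for b = (t + s)/s. The integral is of order b^-alpha, and b grows without
    bound as s tends to 0. *)
Lemma average_near_zero eps : 0 < eps -> exists d, 0 < d /\ forall s, 0 < s < d -> norm (minus (Psi s) (Psi 0)) < eps.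
Proof.
intros He. assert (Hx := norm_ge_0 x). assert (Hpc := power_const_pos alpha Halpha).
set (c := 8 * M * norm x). assert (Hc : 0 <= c) by (unfold c; nra).
set (dl := eps / (2 * (c * power_const alpha + 1))).
assert (Hcp : 0 <= c * power_const alpha) by nra.
assert (Hdl : 0 < dl) by (apply Rdiv_lt_0_compat; lra).
exists (t * Rpower dl (/ alpha)). split. pose proof (Rpower_pos dl (/ alpha)). nra.
intros s Hs.
assert (Hsc : @is_linear R_AbsRing (nm V) (nm V) (fun y => scal (-1) y)).
{ exact (is_linear_scal_r (V := nm V) (-1) (fun n m => Rmult_comm n m)). }
assert (C1 := E_integrand_continuous t x s Ht ltac:(lra)). assert (C2 := E_integrand_continuous t x 0 Ht ltac:(lra)).
assert (C3 : continuous_pos (fun p => scal (-1) (scal (power_weight p) (E (t + 0 * (1 + p)) x)) : nm V)).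
{ intros p Hp. apply (continuous_scal_r (K := R_AbsRing) (-1) (fun p => scal (power_weight p) (E (t + 0 * (1 + p)) x))). auto. }
set (f := fun p => plus (scal (power_weight p) (E (t + s * (1 + p)) x)) (scal (-1) (scal (power_weight p) (E (t + 0 * (1 + p)) x)))).
assert (Hf : improper f (plus (Psi s) (scal (-1) (Psi 0)))).
{ apply improper_plus; auto. apply HPsi; lra. apply (improper_is_linear (fun y : nm V => scal (-1) y)); auto. apply HPsi; lra. }
assert (Cf : continuous_pos f).
{ intros p Hp. apply (continuous_plus (fun p => scal (power_weight p) (E (t + s * (1 + p)) x)) (fun p => scal (-1) (scal (power_weight p) (E (t + 0 * (1 + p)) x)))); auto. }
set (b := (t + s) / s). assert (Hb : 0 < b) by (apply Rdiv_lt_0_compat; lra).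
destruct (improper_majorized V f c alpha b) as [l [Hl1 Hl2]]; auto.
- intros p Hp.
  assert (Ef : f p = scal (power_weight p) (minus (E (t + s * (1 + p)) x) (E t x))).
  { unfold f. replace (t + 0 * (1 + p)) with t by ring. rmodule (nm V). }
  rewrite Ef. pose proof (power_weight_pos p Hp). eapply Rle_trans. apply norm_weight; lra.
  set (r := s * (1 + p)). assert (Hr : 0 < r) by (unfold r; nra).
  assert (Hn : norm (minus (E (t + r) x) (E t x)) <= c * (r / (t + r))).
  { set (v := norm _). assert (0 <= v) by apply norm_ge_0.
    assert (H2 := semigroup_increment t r x Ht ltac:(lra)). fold v in H2.
    pose proof (as_bound _ _ _ _ HE t x ltac:(lra)). pose proof (as_bound _ _ _ _ HE (t + r) x ltac:(lra)).
    assert (H5 := norm_minus_le (E (t + r) x) (E t x)). fold v in H5.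
    replace (c * (r / (t + r))) with (c * r / (t + r)) by (field; lra). apply Rle_div_r. lra.
    unfold c. nra. }
  apply Rle_trans with (power_weight p * (c * (r / (t + r)))). apply Rmult_le_compat_l; lra.
  right. unfold power_weight, r, b. field. repeat split; nra.
- assert (El := improper_unique V _ _ _ Hf Hl1).
  assert (E1 : minus (Psi s) (Psi 0) = l) by (rewrite <- El; rmodule (nm V)).
  rewrite E1. eapply Rle_lt_trans. exact Hl2.
  assert (Hbd : Rpower b (- alpha) <= dl).
  { assert (H1 : Rpower dl (- / alpha) <= b).
    { rewrite Rpower_Ropp. apply Rle_trans with (t / s).
    - pose proof (Rpower_pos dl (/ alpha)). apply (Rmult_le_reg_r (Rpower dl (/ alpha))); auto. rewrite Rinv_l by lra.
    replace (t / s * Rpower dl (/ alpha)) with (t * Rpower dl (/ alpha) / s) by (field; lra). apply Rle_div_r; lra.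
    - apply Rmult_le_compat_r. left; apply Rinv_0_lt_compat; lra. lra. }
    apply Rle_trans with (Rpower (Rpower dl (- / alpha)) (- alpha)).
    - apply Rpower_le_neg. split; auto. apply Rpower_pos. lra.
    - right. rewrite Rpower_mult. replace (- / alpha * - alpha) with 1 by (field; lra). now apply Rpower_1. }
  apply Rle_lt_trans with (c * power_const alpha * dl).
  { rewrite (Rmult_comm (Rpower b (- alpha))), <- Rmult_assoc. apply Rmult_le_compat_l; auto. }
  unfold dl. replace (c * power_const alpha * (eps / (2 * (c * power_const alpha + 1)))) with (eps * (c * power_const alpha) / (2 * (c * power_const alpha + 1))) by (field; lra).
  apply Rlt_div_l; nra.
Qed.

(** The decay M/t of the semigroup makes Psi vanish at infinity like 1/s. *)
Lemma average_large s : 0 < s -> s * norm (Psi s) <= M * norm x * power_const alpha.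
Proof.
intros Hs. assert (Hx := norm_ge_0 x).
destruct (improper_majorized V (fun p => scal (power_weight p) (E (t + s * (1 + p)) x)) (M * norm x / s) alpha 1) as [l [Hl1 Hl2]]; auto.
- lra.
- apply Rdiv_le_0_compat; nra.
- apply E_integrand_continuous; lra.
- intros p Hp. pose proof (power_weight_pos p Hp). eapply Rle_trans. apply norm_weight; lra. rewrite (Rmult_comm (M * norm x / s)).
  apply (Rmult_le_compat_l (power_weight p)). lra. apply Rle_div_r. lra. rewrite Rmult_comm.
  assert (H1 := as_decay _ _ _ _ HE (t + s * (1 + p)) x ltac:(nra)).
  eapply Rle_trans. 2: exact H1. apply Rmult_le_compat_r. apply norm_ge_0. nra.
- rewrite (improper_unique V _ _ _ (HPsi s ltac:(lra)) Hl1).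
  apply (Rmult_le_compat_l s) in Hl2; [|lra]. eapply Rle_trans. exact Hl2. right.
  replace (Rpower 1 (- alpha)) with 1. field; lra. unfold Rpower. now rewrite ln_1, Rmult_0_r, exp_0.
Qed.

(** The integral of psi is Psi(0) - Psi(oo) = kappa E(t) x, where kappa = int_0^oo p^-alpha / (1 +
    p) dp = Gamma(alpha) Gamma(1 - alpha). *)
Lemma inversion_at : k (q t x) = scal kappa (E t x).
Proof.
rewrite <- average_at_zero. apply (improper_unique V psi). apply Hk.
intros eps He. destruct (average_near_zero (eps / 2)) as [d [Hd Hd2]]. lra.
set (c := M * norm x * power_const alpha).
assert (Hc : 0 <= c). { pose proof (norm_ge_0 x). pose proof (power_const_pos alpha Halpha). apply Rmult_le_pos; nra. }
exists d, (Rmax d (2 * c / eps)). split; auto. intros a b Ha Hb.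
Rmax_bounds d (2 * c / eps).
rewrite average_integral by lra.
replace (minus (minus (Psi a) (Psi b)) (Psi 0)) with (minus (minus (Psi a) (Psi 0)) (Psi b)) by rmodule (nm V).
eapply Rle_lt_trans. apply norm_minus_le. specialize (Hd2 a Ha).
assert (H1 := average_large b ltac:(lra)). fold c in H1.
assert (norm (Psi b) <= eps / 2).
{ apply (Rmult_le_reg_l b). lra. eapply Rle_trans. exact H1.
  assert (2 * c / eps < b) by lra. apply (Rmult_lt_compat_r eps) in H2; auto.
  replace (2 * c / eps * eps) with (2 * c) in H2 by (field; lra). lra. }
lra.
Qed.
End Average.

Lemma inversion t x : 0 < t -> k (q t x) = scal kappa (E t x).
Proof.
intros Ht.
destruct (choice (fun s l => 0 <= s -> improper (fun p => scal (power_weight p) (E (t + s * (1 + p)) x)) l)) as [Psi HPsi].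
{ intros s. destruct (Rle_dec 0 s) as [Hs|Hs]. destruct (average_exists t x s Ht Hs) as [l Hl]. now exists l.
  exists zero. intros h; contradiction. }
now apply (inversion_at t x Psi).
Qed.
End Inversion.

(** [gamma] is the value Gamma(alpha) in the definition of A^-alpha; the factor gamma / kappa in [Q]
    compensates it, so that K inverts Q up to E(t). *)
Lemma fractional_power_exists (gamma : R) (K : nm V -> nm V) : 0 < gamma ->
  (forall x l, improper (fun t => scal (Rpower t (alpha - 1)) (E t x)) l -> K x = scal (/ gamma) l) ->
  exists Q C, fractional_power (nm V) E K Q alpha C.
Proof.
intros Hgam HK.
destruct negative_power_exists as [k Hk]. destruct resolving_integral_exists as [q Hq].
assert (Hk1 : forall x, improper (fun t => scal (Rpower t (alpha - 1)) (E t x)) (k x)) by apply Hk.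
assert (Hq1 : forall t x, 0 < t -> improper (fun r => scal (Rpower r (- alpha)) (AE (t + r) x)) (q t x)) by (intros; apply Hq; auto).
destruct (improper_majorized R_CompleteNormedModule power_weight 1 alpha 1) as [kappa [Hkap _]]; auto; try lra.
{ intros p Hp. now apply power_weight_continuous. }
{ intros p Hp. pose proof (power_weight_pos p Hp). change (Rabs (power_weight p) <= 1 * power_weight p). rewrite Rabs_pos_eq; lra. }
assert (Hkap0 : 0 < kappa).
{ apply (improper_positive power_weight); auto. intros p Hp. now apply power_weight_continuous. apply power_weight_pos. }
assert (HKk : forall x, K x = scal (/ gamma) (k x)) by (intros; now apply HK).
assert (Cq : forall t x, 0 < t -> continuous_pos (fun r => scal (Rpower r (- alpha)) (AE (t + r) x))).
{ intros t x Ht r Hr. apply (continuous_ext (fun r => scal (Rpower r (- alpha)) (AE (t + 1 * r) x))). intros; now rewrite Rmult_1_l. apply q_integrand_continuous; lra. }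
assert (Hsc : forall c : R, @is_linear R_AbsRing (nm V) (nm V) (fun y => scal c y)).
{ intros c. exact (is_linear_scal_r (V := nm V) c (fun n m => Rmult_comm n m)). }
assert (Lk : is_linear k).
{ split.
  - intros x y. apply (improper_unique V _ _ _ (Hk1 (plus x y))).
    apply (improper_ext V (fun t => plus (scal (Rpower t (alpha - 1)) (E t x)) (scal (Rpower t (alpha - 1)) (E t y)))).
    intros t Ht. rewrite (linear_plus _ (as_linear _ _ _ _ HE t ltac:(lra))). rmodule (nm V).
    apply improper_plus; auto; apply k_integrand_continuous.
  - intros c x. apply (improper_unique V _ _ _ (Hk1 (scal c x))).
    apply (improper_ext V (fun t => scal c (scal (Rpower t (alpha - 1)) (E t x)))).
    intros t Ht. rewrite (linear_scal _ (as_linear _ _ _ _ HE t ltac:(lra))). rmodule (nm V).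
    apply (improper_is_linear (fun y : nm V => scal c y)); auto. apply k_integrand_continuous.
  - exists (2 * M * power_const (1 - alpha)). split. pose proof (power_const_pos (1 - alpha) ltac:(lra)). nra. apply Hk. }
assert (Lq : forall t, 0 < t -> is_linear (q t)).
{ intros t Ht. split.
  - intros x y. apply (improper_unique V _ _ _ (Hq1 t (plus x y) Ht)).
    apply (improper_ext V (fun r => plus (scal (Rpower r (- alpha)) (AE (t + r) x)) (scal (Rpower r (- alpha)) (AE (t + r) y)))).
    intros r Hr. rewrite (linear_plus _ (as_deriv_linear _ _ _ _ HE (t + r) ltac:(lra))). rmodule (nm V).
    apply improper_plus; auto.
  - intros c x. apply (improper_unique V _ _ _ (Hq1 t (scal c x) Ht)).
    apply (improper_ext V (fun r => scal c (scal (Rpower r (- alpha)) (AE (t + r) x)))).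
    intros r Hr. rewrite (linear_scal _ (as_deriv_linear _ _ _ _ HE (t + r) ltac:(lra))). rmodule (nm V).
    apply (improper_is_linear (fun y : nm V => scal c y)); auto.
  - exists (M * power_const alpha * Rpower t (- alpha)). split. pose proof (power_const_pos alpha Halpha). pose proof (Rpower_pos t (- alpha)).
    apply Rmult_lt_0_compat; auto. apply Rmult_lt_0_compat; lra. intros x. apply Hq; auto. }
assert (Ek : forall s x, 0 <= s -> k (E s x) = E s (k x)).
{ intros s x Hs. apply (improper_unique V _ _ _ (Hk1 (E s x))).
  apply (improper_ext V (fun t => E s (scal (Rpower t (alpha - 1)) (E t x)))).
  intros t Ht. rewrite (linear_scal _ (as_linear _ _ _ _ HE s Hs)). rewrite <- !(as_add _ _ _ _ HE) by lra. now rewrite Rplus_comm.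
  apply improper_is_linear; auto. apply (as_linear _ _ _ _ HE); auto. apply k_integrand_continuous. }
assert (Ak : forall s x, 0 < s -> k (AE s x) = AE s (k x)).
{ intros s x Hs. apply (improper_unique V _ _ _ (Hk1 (AE s x))).
  apply (improper_ext V (fun t => AE s (scal (Rpower t (alpha - 1)) (E t x)))).
  intros t Ht. rewrite (linear_scal _ (as_deriv_linear _ _ _ _ HE s Hs)).
  rewrite <- (as_deriv_add _ _ _ _ HE), <- (as_deriv_add_r _ _ _ _ HE) by lra. reflexivity.
  apply improper_is_linear; auto. apply (as_deriv_linear _ _ _ _ HE); auto. apply k_integrand_continuous. }
assert (Qk : forall t x, 0 < t -> q t (k x) = k (q t x)).
{ intros t x Ht. apply (improper_unique V _ _ _ (Hq1 t (k x) Ht)).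
  apply (improper_ext V (fun r => k (scal (Rpower r (- alpha)) (AE (t + r) x)))).
  intros r Hr. rewrite (linear_scal _ Lk). now rewrite Ak by lra.
  apply improper_is_linear; auto. }
assert (Inv := fun t x Ht => inversion k q kappa Hk1 Hq1 Hkap t x Ht).
exists (fun t x => scal (gamma / kappa) (q t x)), (gamma / kappa * (M * power_const alpha)).
assert (Hpc := power_const_pos alpha Halpha).
assert (Hgk : 0 < gamma / kappa) by now apply Rdiv_lt_0_compat.
split.
- apply Rmult_lt_0_compat; auto. apply Rmult_lt_0_compat; [pose proof HM|]; lra.
- apply (is_linear_ext (fun x => scal (/ gamma) (k x))). intros; now rewrite HKk.
  apply (is_linear_comp k (fun y : nm V => scal (/ gamma) y)); auto.
- intros t x Ht. rewrite !HKk, (Ek t x Ht). now rewrite (linear_scal _ (as_linear _ _ _ _ HE t Ht)).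
- intros t Ht. apply (is_linear_comp (q t) (fun y : nm V => scal (gamma / kappa) y)); auto.
- intros t x Ht. rewrite HKk, (linear_scal _ Lk), (Inv t x Ht).
  rmodule (nm V).
- intros t x Ht. eapply Rle_trans. apply norm_weight. lra. destruct (Hq t x Ht) as [_ H].
  apply (Rmult_le_compat_l (gamma / kappa)) in H; lra.
- intros t r x Ht Hr. rewrite (linear_scal _ (as_linear _ _ _ _ HE r Hr)). f_equal.
  apply (improper_unique V _ _ _ (Hq1 (t + r) x ltac:(lra))).
  apply (improper_ext V (fun p => E r (scal (Rpower p (- alpha)) (AE (t + p) x)))).
  intros p Hp. rewrite (linear_scal _ (as_linear _ _ _ _ HE r Hr)), <- (as_deriv_add _ _ _ _ HE) by lra.
  f_equal. f_equal. ring.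
  apply improper_is_linear; auto. apply (as_linear _ _ _ _ HE); auto.
(* If k x = 0 then kappa E(t) x = k (q t x) = q t (k x) = 0 for every t > 0, and t -> 0 gives x =
   0. *)
- intros x Hx.
  assert (Hk0 : k x = zero).
  { transitivity (scal gamma (K x)). rewrite HKk.
    rmodule (nm V).
    rewrite Hx. rmodule (nm V). }
  assert (HE0 : forall t, 0 < t -> E t x = zero).
  { intros t Ht. transitivity (scal (/ kappa) (k (q t x))). rewrite (Inv t x Ht).
    rmodule (nm V).
    rewrite <- (Qk t x Ht), Hk0, (linear_zero _ (Lq t Ht)). rmodule (nm V). }
  apply eq_of_norm_minus. intros eps He.
  destruct (as_continuous _ _ _ _ HE x 0 eps ltac:(lra) He) as [d [Hd Hd2]].
  specialize (Hd2 (d / 2) ltac:(lra) ltac:(rewrite Rabs_pos_eq; lra)).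
  rewrite HE0, (as_zero _ _ _ _ HE), norm_minus_sym in Hd2 by lra. lra.
Qed.
End Fractional.

Lemma fractional_power_trivial (V : CompleteNormedModule R_AbsRing) E AE M :
  analytic_semigroup (nm V) E AE M -> fractional_power (nm V) E (fun x => x) E 0 M.
Proof.
intros HE. split; auto.
- pose proof (as_const _ _ _ _ HE). lra.
- apply is_linear_id.
- intros t Ht. apply (as_linear _ _ _ _ HE). lra.
- intros t x Ht. rewrite Ropp_0, Rpower_O, Rmult_1_r by auto. apply (as_bound _ _ _ _ HE). lra.
- intros t r x Ht Hr. rewrite Rplus_comm. apply (as_add _ _ _ _ HE); lra.
Qed.

(** The inequality exp(-t) <= 1/(1 + t) brings the integrand under the convergence test. *)
Lemma Gamma_positive alpha : 0 < alpha < 1 -> 0 < Gamma alpha.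
Proof.
intros Ha.
set (f := fun t => Rpower t (alpha - 1) * exp (- t)).
assert (Cf : continuous_pos (V := R_CompleteNormedModule) f).
{ intros t Ht. apply (ex_derive_continuous (V := R_NormedModule)). unfold f, Rpower. auto_derive. auto. }
destruct (improper_majorized R_CompleteNormedModule f 1 (1 - alpha) 1) as [l [Hl _]]; auto; try lra.
{ intros t Ht.
  pose proof (Rpower_pos t (alpha - 1)). pose proof (exp_pos (- t)).
  rewrite Rabs_pos_eq, Rmult_1_l by (apply Rmult_le_pos; lra).
  replace (- (1 - alpha)) with (alpha - 1) by ring. apply Rmult_le_compat_l. lra.
  rewrite exp_Ropp. apply Rinv_le_contravar. lra. left. apply exp_ineq1. lra. }
assert (E := improper_RInt_gen R_CompleteNormedModule f l Cf Hl). change (0 < RInt_gen (V := R_CompleteNormedModule) f (at_right 0) (Rbar_locally p_infty)). rewrite E.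
apply (improper_positive f); auto. intros t Ht. apply Rmult_lt_0_compat. apply Rpower_pos. apply exp_pos.
Qed.

Lemma neg_power_fractional (X : CompleteNormedModule C_AbsRing) (eA : R -> X -> X) AE M alpha :
  analytic_semigroup (realify X) eA AE M -> 0 <= alpha < 1 ->
  exists Q C, fractional_power (nm (realify X)) eA (neg_power X eA alpha) Q alpha C.
Proof.
intros HE Ha. destruct (Req_dec alpha 0) as [->|Hne].
- exists eA, M. assert (H := fractional_power_trivial (realify X) eA AE M HE).
  assert (E : neg_power X eA 0 = fun x => x).
  { unfold neg_power. destruct (Req_EM_T 0 0) as [_|n]; [reflexivity|now destruct n]. }
  rewrite E. exact H.
- assert (Ha' : 0 < alpha < 1) by lra.
  apply (fractional_power_exists (realify X) eA AE M HE alpha Ha' (Gamma alpha)).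
  now apply Gamma_positive.
  intros x l Hl. unfold neg_power. destruct (Req_EM_T alpha 0) as [e|_]; [contradiction|].
  apply (f_equal (fun w : nm (realify X) => scal (/ Gamma alpha) w)).
  apply (improper_RInt_gen (realify X)); auto.
  apply (k_integrand_continuous (realify X) eA AE M HE alpha).
Qed.

(* [r^beta] for [r >= 0]: [Rpower 0 beta] would be [1]. *)
Definition omega (beta r : R) : R := if Rle_dec r 0 then 0 else Rpower r beta.

Lemma omega_0 beta : omega beta 0 = 0.
Proof. unfold omega. destruct Rle_dec; lra. Qed.

Lemma omega_pos beta r : 0 < r -> omega beta r = Rpower r beta.
Proof. unfold omega. destruct Rle_dec; lra. Qed.

Lemma omega_nonneg beta r : 0 <= omega beta r.
Proof. unfold omega. destruct Rle_dec. lra. left; apply Rpower_pos. Qed.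

Lemma omega_le beta r s : 0 <= beta -> r <= s -> omega beta r <= omega beta s.
Proof.
intros Hb Hrs. unfold omega. destruct (Rle_dec r 0); destruct (Rle_dec s 0); try lra.
left; apply Rpower_pos. apply Rle_Rpower_l; lra.
Qed.

Lemma omega_small beta eps : 0 < beta -> 0 < eps -> exists d, 0 < d /\ forall r, r <= d -> omega beta r <= eps.
Proof.
intros Hb He. exists (Rpower eps (/ beta)). split. apply Rpower_pos. intros r Hr.
eapply Rle_trans. apply omega_le; [lra|exact Hr]. rewrite omega_pos by apply Rpower_pos.
rewrite Rpower_mult, Rinv_l, Rpower_1 by lra. lra.
Qed.

(** * Integrals of the semigroup in the domain of A^alpha *)

Section Lift.
Variable V : CompleteNormedModule R_AbsRing.
Variables (E AE : R -> nm V -> nm V) (M : R).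
Hypothesis HE : analytic_semigroup (nm V) E AE M.

(** Freezing the semigroup at time 0 for negative times makes the integrands continuous on the whole
    line, which frees integrability from conditions on the endpoints. *)
Definition clamped r x := E (Rmax 0 r) x.

Lemma clamped_eq r x : 0 <= r -> clamped r x = E r x.
Proof. intros Hr. unfold clamped. now rewrite Rmax_right. Qed.

Lemma clamped_linear r : is_linear (clamped r).
Proof. apply (as_linear _ _ _ _ HE). apply Rmax_l. Qed.

Lemma clamped_bound r x : norm (clamped r x) <= M * norm x.
Proof. apply (as_bound _ _ _ _ HE). apply Rmax_l. Qed.

Lemma clamped_continuous (rho : R -> R) (G : R -> nm V) t : continuous rho t -> continuous G t ->
  continuous (fun r => clamped (rho r) (G r)) t.
Proof.
intros Hrho HG. apply continuous_norm. intros eps He.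
assert (HM := as_const _ _ _ _ HE).
destruct (continuous_norm_inv G t HG (eps / (2 * M))) as [d1 [Hd1 K1]]. apply Rdiv_lt_0_compat; lra.
destruct (as_continuous _ _ _ _ HE (G t) (Rmax 0 (rho t)) (eps / 2) (Rmax_l _ _) ltac:(lra)) as [d2 [Hd2 K2]].
destruct (continuous_norm_inv (V := R_NormedModule) rho t Hrho d2 Hd2) as [d3 [Hd3 K3]].
exists (Rmin d1 d3). split. now apply Rmin_pos. intros s Hs.
Rmin_bounds d1 d3.
eapply Rle_lt_trans. apply (norm_minus_triangle _ (clamped (rho s) (G t))).
rewrite <- (linear_minus _ _ _ (clamped_linear (rho s))).
assert (H1 := clamped_bound (rho s) (minus (G s) (G t))).
specialize (K1 s ltac:(lra)). apply (Rmult_lt_compat_l M) in K1; [|lra].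
replace (M * (eps / (2 * M))) with (eps / 2) in K1 by (field; lra).
assert (H2 : norm (minus (clamped (rho s) (G t)) (clamped (rho t) (G t))) < eps / 2).
{ apply K2. apply Rmax_l. specialize (K3 s ltac:(lra)). change (Rabs (rho s - rho t) < d2) in K3.
  eapply Rle_lt_trans. 2: exact K3. unfold Rmax. repeat destruct Rle_dec; unfold Rabs; repeat destruct Rcase_abs; lra. }
lra.
Qed.

Lemma clamped_integrable (P rho : R -> R) (G : R -> nm V) a b :
  (forall r, continuous P r) -> (forall r, continuous rho r) -> (forall r, continuous G r) ->
  ex_RInt (fun r => scal (P r) (clamped (rho r) (G r))) a b.
Proof.
intros HP Hrho HG. apply ex_rint_continuous. intros r _.
apply (continuous_scal (K := R_AbsRing) P (fun r => clamped (rho r) (G r))). auto. now apply clamped_continuous.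
Qed.

Variables (K : nm V -> nm V) (Q : R -> nm V -> nm V) (alpha C : R).
Hypothesis HF : fractional_power (nm V) E K Q alpha C.
Hypothesis Halpha : 0 <= alpha < 1.
Let beta := 1 - alpha.

Lemma inverse_continuous x t : 0 < t -> continuous (fun r => Q r x) t.
Proof.
intros Ht. apply (continuous_ext_loc _ (fun r => clamped (r + - (t / 2)) (Q (t / 2) x))).
- exists (mkposreal (t / 2) ltac:(lra)). intros s Hs. change (Rabs (s - t) < t / 2) in Hs. apply Rabs_def2 in Hs.
  rewrite clamped_eq, <- (fp_inverse_add _ _ _ _ _ _ HF) by lra. f_equal. ring.
- apply (clamped_continuous (fun r => r + - (t / 2)) (fun _ => Q (t / 2) x)).
  apply (continuous_plus (fun s => s) (fun _ => - (t / 2))). apply continuous_id. apply continuous_const. apply continuous_const.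
Qed.

Lemma inverse_integrable (P : R -> R) x a b : (forall r, continuous P r) -> 0 < a -> 0 < b ->
  ex_RInt (fun r => scal (P r) (Q r x)) a b.
Proof.
intros HP Ha Hb. apply ex_rint_continuous. intros r Hr.
apply (continuous_scal (K := R_AbsRing) P (fun r => Q r x)). auto. apply inverse_continuous.
eapply Rlt_le_trans. 2: apply Hr. now apply Rmin_pos.
Qed.

Lemma lift_positive (P : R -> R) B x a b : (forall r, continuous P r) -> 0 < a <= b ->
  (forall r, a <= r <= b -> Rabs (P r) <= B) ->
  K (rint (fun r => scal (P r) (Q r x)) a b) = rint (fun r => scal (P r) (clamped r x)) a b /\
  norm (rint (fun r => scal (P r) (Q r x)) a b) <= B * (C / beta) * (omega beta b - omega beta a) * norm x.
Proof.
intros HP Hab HB. split.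
- rewrite <- rint_linear. 2: apply (fp_linear _ _ _ _ _ _ HF). 2: apply inverse_integrable; auto; lra.
  apply rint_ext. intros r Hr. rewrite Rmin_left in Hr by lra.
  rewrite (linear_scal _ (fp_linear _ _ _ _ _ _ HF)), (fp_inverse _ _ _ _ _ _ HF), clamped_eq by lra. reflexivity.
- assert (Hbeta : 0 < beta) by (unfold beta; lra).
  assert (HB0 : 0 <= B). { eapply Rle_trans. 2: apply (HB a); lra. apply Rabs_pos. }
  apply (norm_RInt_le (fun r => scal (P r) (Q r x)) (fun r => B * C * norm x * Rpower r (- alpha)) a b).
  + lra.
  + intros r Hr. eapply Rle_trans. apply norm_scal_Rabs.
    replace (B * C * norm x * Rpower r (- alpha)) with (B * (C * Rpower r (- alpha) * norm x)) by ring.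
    apply Rmult_le_compat. apply Rabs_pos. apply norm_ge_0. now apply HB. apply (fp_inverse_bound _ _ _ _ _ _ HF). lra.
  + apply rint_correct, inverse_integrable; auto; lra.
  + rewrite !omega_pos by lra.
    replace (B * (C / beta) * (Rpower b beta - Rpower a beta) * norm x)
    with (minus (B * C * norm x * (Rpower b beta / beta)) (B * C * norm x * (Rpower a beta / beta))).
    2:{ unfold minus, plus, opp; simpl. field. lra. }
    apply (is_RInt_derive (V := R_CompleteNormedModule) (fun r => B * C * norm x * (Rpower r beta / beta))).
    * intros r Hr. rewrite Rmin_left in Hr by lra. unfold Rpower. auto_derive. lra.
    replace (exp (beta * ln r)) with (r * exp (- alpha * ln r)).
    field. split; lra. rewrite <- (exp_ln r) at 1 by lra. rewrite <- exp_plus. f_equal. unfold beta; ring.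
    * intros r Hr. rewrite Rmin_left in Hr by lra. apply (ex_derive_continuous (V := R_NormedModule)). unfold Rpower. auto_derive. lra.
Qed.

(** Retyped so that it applies to [rint] without mention of the limit value. *)
Lemma norm_rint_bound (f : R -> nm V) a b B : a <= b -> ex_RInt f a b -> (forall r, a <= r <= b -> norm (f r) <= B) ->
  norm (rint f a b) <= (b - a) * B.
Proof. intros Hab Hf HB. apply (norm_RInt_le_const f a b); auto. now apply rint_correct. Qed.

(* The singularity of [Q] at 0 is removed by letting the lower limit tend to 0. *)
Lemma lift_integral (P : R -> R) B x a b : (forall r, continuous P r) -> 0 <= a <= b ->
  (forall r, a <= r <= b -> Rabs (P r) <= B) ->
  exists y, K y = rint (fun r => scal (P r) (clamped r x)) a b /\
    norm y <= B * (C / beta) * (omega beta b - omega beta a) * norm x.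
Proof.
intros HP Hab HB.
destruct (Req_dec a b) as [<-|Hne].
{ exists zero. rewrite (linear_zero _ (fp_linear _ _ _ _ _ _ HF)). split. symmetry. exact (RInt_point (V := V) a _).
  rewrite norm_zero. lra. }
destruct (Req_dec a 0) as [->|Ha].
2:{ exists (rint (fun r => scal (P r) (Q r x)) a b). apply lift_positive; auto; lra. }
assert (Hbeta : 0 < beta) by (unfold beta; lra). assert (HC := fp_const _ _ _ _ _ _ HF).
assert (HB0 : 0 <= B). { eapply Rle_trans. 2: apply (HB 0); lra. apply Rabs_pos. }
assert (Hx := norm_ge_0 x). assert (HM := as_const _ _ _ _ HE).
set (c := B * (C / beta) * norm x).
assert (Hc : 0 <= c). { apply Rmult_le_pos; auto. apply Rmult_le_pos; auto. apply Rdiv_le_0_compat; lra. }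
(* Lower limits tending to 0; the lifted integrals over [an n, b] are Cauchy because [omega] is
   small near 0. *)
set (an := fun n => b * / (INR n + 1)).
assert (Hinv : forall n, 0 < / (INR n + 1) <= 1).
{ intros n. pose proof (pos_INR n). split. apply Rinv_0_lt_compat; lra. rewrite <- Rinv_1. apply Rinv_le_contravar; lra. }
assert (Han : forall n, 0 < an n <= b). { intros n. specialize (Hinv n). unfold an. split; nra. }
set (ys := fun n => rint (fun r => scal (P r) (Q r x)) (an n) b).
assert (Hdiff : forall n m, an n <= an m -> norm (minus (ys n) (ys m)) <= c * omega beta (an m)).
{ intros n m Hnm. unfold ys. rewrite <- (rint_Chasles _ (an n) (an m) b) by (apply inverse_integrable; auto; apply Han || lra).
  replace (minus (plus _ _) _) with (rint (fun r => scal (P r) (Q r x)) (an n) (an m)) by rmodule (nm V).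
  destruct (lift_positive P B x (an n) (an m) HP) as [_ H]. split; auto. apply Han.
  intros r Hr. apply HB. destruct (Han n), (Han m). lra.
  eapply Rle_trans. exact H. pose proof (omega_nonneg beta (an n)).
  replace (B * (C / beta) * (omega beta (an m) - omega beta (an n)) * norm x) with (B * (C / beta) * norm x * (omega beta (an m) - omega beta (an n))) by ring.
  apply Rmult_le_compat_l; auto. lra. }
assert (Hsmall : forall eps, 0 < eps -> exists N, forall n, (N <= n)%nat -> an n < eps /\ c * omega beta (an n) < eps).
{ intros eps He. destruct (omega_small beta (eps / (2 * (c + 1))) Hbeta) as [d [Hd Hd2]]. apply Rdiv_lt_0_compat; lra.
  destruct (inv_INR_small (Rmin d eps / b)) as [N HN]. apply Rdiv_lt_0_compat; try lra. now apply Rmin_pos.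
  exists N. intros n Hn. specialize (HN n Hn). apply (Rmult_lt_compat_l b) in HN; [|lra].
  replace (b * (Rmin d eps / b)) with (Rmin d eps) in HN by (field; lra). fold (an n) in HN.
  Rmin_bounds d eps. split. lra.
  specialize (Hd2 (an n) ltac:(lra)). apply Rle_lt_trans with (c * (eps / (2 * (c + 1)))). apply Rmult_le_compat_l; auto.
  replace (c * (eps / (2 * (c + 1)))) with (eps * c / (2 * (c + 1))) by (field; lra). apply Rlt_div_l; nra. }
destruct (complete_seq_complete V ys) as [y Hy].
{ intros eps He. destruct (Hsmall eps He) as [N HN]. exists N. intros n m Hn Hm.
  destruct (HN n Hn), (HN m Hm). destruct (Rle_dec (an n) (an m)) as [h|h].
  eapply Rle_lt_trans. now apply Hdiff. lra.
  rewrite norm_minus_sym. eapply Rle_lt_trans. apply Hdiff; lra. lra. }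
rewrite (filterlim_norm eventually) in Hy.
exists y. split.
- apply eq_of_norm_minus. intros eps He.
  destruct (linear_norm _ (fp_linear _ _ _ _ _ _ HF)) as [MK [HMK0 HMK]].
  destruct (Hy (eps / (2 * MK))) as [N1 HN1]. apply Rdiv_lt_0_compat; lra.
  assert (HBM : 0 <= B * (M * norm x)) by (apply Rmult_le_pos; nra).
  destruct (Hsmall (eps / (2 * (B * (M * norm x) + 1)))) as [N2 HN2]. apply Rdiv_lt_0_compat; lra.
  set (n := max N1 N2). specialize (HN1 n ltac:(unfold n; lia)). destruct (HN2 n ltac:(unfold n; lia)) as [HN2' _].
  eapply Rle_trans. apply (norm_minus_triangle _ (K (ys n))).
  assert (H1 : norm (minus (K y) (K (ys n))) <= eps / 2).
  { rewrite <- (linear_minus _ _ _ (fp_linear _ _ _ _ _ _ HF)). eapply Rle_trans. apply HMK.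
    rewrite norm_minus_sym. apply (Rmult_lt_compat_l MK) in HN1; auto. replace (MK * (eps / (2 * MK))) with (eps / 2) in HN1 by (field; lra). lra. }
  assert (Hex : forall u v, ex_RInt (fun r => scal (P r) (clamped r x)) u v).
  { intros u v. apply (clamped_integrable P (fun r => r) (fun _ => x)); auto. intros; apply continuous_id. intros; apply continuous_const. }
  assert (H2 : norm (minus (K (ys n)) (rint (fun r => scal (P r) (clamped r x)) 0 b)) <= eps / 2).
  { unfold ys. destruct (Han n) as [Hn1 Hn2]. rewrite (proj1 (lift_positive P B x (an n) b HP ltac:(lra) ltac:(intros; apply HB; lra))).
    rewrite <- (rint_Chasles _ 0 (an n) b) by apply Hex.
    rewrite norm_minus_sym.
    replace (minus (plus _ _) _) with (rint (fun r => scal (P r) (clamped r x)) 0 (an n)) by rmodule (nm V).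
    eapply Rle_trans. apply (norm_rint_bound _ 0 (an n) (B * (M * norm x))). lra. apply Hex.
    intros r Hr. eapply Rle_trans. apply norm_scal_Rabs.
    apply Rmult_le_compat. apply Rabs_pos. apply norm_ge_0. apply HB; lra. apply clamped_bound.
    apply Rle_trans with (eps / (2 * (B * (M * norm x) + 1)) * (B * (M * norm x))). apply Rmult_le_compat_r; lra.
    replace (eps / (2 * (B * (M * norm x) + 1)) * (B * (M * norm x))) with (eps * (B * (M * norm x)) / (2 * (B * (M * norm x) + 1))) by (field; lra).
    apply Rle_div_l; nra. }
  lra.
- rewrite omega_0, Rminus_0_r. apply norm_bound_limit. intros eps He.
  destruct (Hy eps He) as [N HN]. specialize (HN N (le_n _)). rewrite norm_minus_sym in HN.
  assert (H1 := norm_le_minus y (ys N)). destruct (Han N) as [Hn1 Hn2].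
  destruct (lift_positive P B x (an N) b HP ltac:(lra) ltac:(intros; apply HB; lra)) as [_ H2]. fold (ys N) in H2.
  assert (H3 := omega_nonneg beta (an N)).
  assert (B * (C / beta) * (omega beta b - omega beta (an N)) * norm x <= B * (C / beta) * omega beta b * norm x).
  { apply Rmult_le_compat_r; auto. apply Rmult_le_compat_l; [|lra]. apply Rmult_le_pos; auto. apply Rdiv_le_0_compat; lra. }
  lra.
Qed.

(** With p a Lagrange polynomial this is h b_i(theta; -hA) x. *)
Definition stage_integral (p : R -> R) (theta h : R) (x : nm V) : nm V :=
  scal h (rint (fun xi => scal (p xi) (E ((theta - xi) * h) x)) 0 theta).

Lemma stage_integral_clamped (p : R -> R) theta h x : 0 <= theta -> 0 < h ->
  stage_integral p theta h x = scal h (rint (fun xi => scal (p xi) (clamped ((theta - xi) * h) x)) 0 theta).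
Proof.
intros Ht Hh. unfold stage_integral. f_equal. apply rint_ext. intros xi Hxi. rewrite Rmin_left, Rmax_right in Hxi by lra.
rewrite clamped_eq by nra. reflexivity.
Qed.

Lemma stage_integrable (p : R -> R) theta h x a b : (forall r, continuous p r) ->
  ex_RInt (fun xi => scal (p xi) (clamped ((theta - xi) * h) x)) a b.
Proof.
intros Hp. apply (clamped_integrable p (fun xi => (theta - xi) * h) (fun _ => x)); auto.
- intros r. apply (continuous_ext (fun xi => (- h) * xi + theta * h)). intros; simpl; ring. apply continuous_affine.
- intros; apply continuous_const.
Qed.

Lemma stage_integral_linear (p : R -> R) theta h : (forall r, continuous p r) -> 0 <= theta -> 0 < h ->
  forall x y, stage_integral p theta h (minus x y) = minus (stage_integral p theta h x) (stage_integral p theta h y).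
Proof.
intros Hp Ht Hh x y. rewrite !stage_integral_clamped by auto.
transitivity (scal h (minus (rint (fun xi => scal (p xi) (clamped ((theta - xi) * h) x)) 0 theta)
  (rint (fun xi => scal (p xi) (clamped ((theta - xi) * h) y)) 0 theta))). 2: rmodule (nm V).
f_equal. symmetry.
etransitivity. symmetry. exact (RInt_minus (V := V) _ _ 0 theta (stage_integrable p theta h x 0 theta Hp) (stage_integrable p theta h y 0 theta Hp)).
apply rint_ext. intros xi _. rewrite (linear_minus _ _ _ (clamped_linear _)).
rmodule (nm V).
Qed.

Lemma K_clamped r x : K (clamped r x) = clamped r (K x).
Proof. apply (fp_commute _ _ _ _ _ _ HF). apply Rmax_l. Qed.

Lemma stage_integral_K (p : R -> R) theta h x : (forall r, continuous p r) -> 0 <= theta -> 0 < h ->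
  stage_integral p theta h (K x) = K (stage_integral p theta h x).
Proof.
intros Hp Ht Hh. rewrite !stage_integral_clamped by auto.
rewrite (linear_scal _ (fp_linear _ _ _ _ _ _ HF)). f_equal.
rewrite <- rint_linear. 2: apply (fp_linear _ _ _ _ _ _ HF). 2: now apply stage_integrable.
apply rint_ext. intros xi _. rewrite (linear_scal _ (fp_linear _ _ _ _ _ _ HF)), K_clamped. reflexivity.
Qed.

(** The substitution r = s + (theta - xi) h turns the propagated stage integral into one over
    [s, s + theta h]. The bound keeps the increment of [omega] instead of its value, because
    increments telescope over a mesh. *)
Lemma stage_integral_lift (p : R -> R) B s theta h x : (forall r, continuous p r) ->
  (forall r, 0 <= r <= 1 -> Rabs (p r) <= B) -> 0 <= s -> 0 <= theta <= 1 -> 0 < h ->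
  exists y, K y = E s (stage_integral p theta h x) /\
    norm y <= B * (C / beta) * (omega beta (s + theta * h) - omega beta s) * norm x.
Proof.
intros Hp HB Hs Ht Hh.
destruct (lift_integral (fun r => p (theta - (r - s) / h)) B x s (s + theta * h)) as [y [H1 H2]].
- intros r. apply (continuous_comp (fun r => theta - (r - s) / h) p).
  apply (continuous_ext (fun r => (- / h) * r + (theta + s / h))). intros; simpl. field. lra. apply continuous_affine. apply Hp.
- split; nra.
- intros r Hr. apply HB.
  assert (0 <= (r - s) / h <= theta). { split. apply Rdiv_le_0_compat; lra. apply Rle_div_l; lra. } lra.
- exists y. split; auto. rewrite H1.
  rewrite stage_integral_clamped by lra.
  assert (Ls := as_linear _ _ _ _ HE s Hs).
  rewrite (linear_scal _ Ls), <- rint_linear; auto. 2: now apply stage_integrable.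
  set (f := fun r => scal (p (theta - (r - s) / h)) (clamped r x)).
  assert (Hex : forall u v, ex_RInt f u v).
  { intros u v. apply (clamped_integrable (fun r => p (theta - (r - s) / h)) (fun r => r) (fun _ => x)).
    intros r. apply (continuous_comp (fun r => theta - (r - s) / h) p).
    apply (continuous_ext (fun r => (- / h) * r + (theta + s / h))). intros; simpl. field. lra. apply continuous_affine. apply Hp.
    intros; apply continuous_id. intros; apply continuous_const. }
  assert (H3 := rint_comp_lin f (- h) (s + theta * h) 0 theta ltac:(apply Hex)).
  replace (- h * 0 + (s + theta * h)) with (s + theta * h) in H3 by ring.
  replace (- h * theta + (s + theta * h)) with s in H3 by ring.
  rewrite (rint_swap f s (s + theta * h)) in H3 by apply Hex.
  assert (H4 : rint f s (s + theta * h) = scal (-1) (rint (fun y0 => scal (- h) (f (- h * y0 + (s + theta * h)))) 0 theta)).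
  { rewrite H3. rmodule (nm V). }
  rewrite H4.
  assert (H5 : rint (fun y0 => scal (- h) (f (- h * y0 + (s + theta * h)))) 0 theta =
    scal (- h) (rint (fun xi => E s (scal (p xi) (clamped ((theta - xi) * h) x))) 0 theta)).
  { etransitivity. 2: apply (RInt_scal (V := V) (fun xi => E s (scal (p xi) (clamped ((theta - xi) * h) x)))).
    2:{ apply ex_rint_continuous. intros xi _. apply (is_linear_R_continuous (E s)); auto.
    apply (continuous_scal (K := R_AbsRing) p (fun xi => clamped ((theta - xi) * h) x)). apply Hp.
    apply (clamped_continuous (fun xi => (theta - xi) * h) (fun _ => x)).
    apply (continuous_ext (fun xi => (- h) * xi + theta * h)). intros; simpl; ring. apply continuous_affine. apply continuous_const. }
    apply rint_ext. intros xi Hxi. rewrite Rmin_left, Rmax_right in Hxi by lra. unfold f.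
    apply (f_equal (fun w : nm V => scal (- h) w)).
    rewrite (linear_scal _ Ls). f_equal. f_equal. field. lra.
    rewrite !clamped_eq by nra. rewrite <- (as_add _ _ _ _ HE) by nra. f_equal. ring. }
  rewrite H5. rmodule (nm V).
Qed.
End Lift.

(** * Weighted sums over a mesh *)

Lemma exp_1_le_3 r : r <= 1 -> exp r <= 3.
Proof. intros Hr. pose proof exp_le_3. destruct (Rle_lt_or_eq_dec _ _ Hr) as [h| ->]; auto. apply exp_increasing in h. lra. Qed.

Lemma exp_le_compat r q : r <= q -> exp r <= exp q.
Proof. intros H. destruct (Rle_lt_or_eq_dec _ _ H) as [h| ->]. left; now apply exp_increasing. lra. Qed.

Lemma bsum_telescope n (a : nat -> R) : bsum n (fun k => a k - a (S k)) = a 0%nat - a n.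
Proof. induction n. as_R; rewrite bsum_R0; ring. as_R; rewrite bsum_RS, IHn; ring. Qed.

(** Either r >= eta and the exponential is at most exp(-kappa eta), or r < eta and the increment
    belongs to the truncated function omega(min(r, eta)), whose total increase is only
    omega(eta). *)
Lemma omega_exp_increment beta kappa eta r q : 0 <= beta -> 0 <= kappa -> 0 <= q <= r ->
  exp (- kappa * r) * (omega beta r - omega beta q) <=
  exp (- kappa * eta) * (omega beta r - omega beta q) + (omega beta (Rmin r eta) - omega beta (Rmin q eta)).
Proof.
intros Hb Hk Hr. assert (H1 := omega_le beta q r Hb ltac:(lra)).
assert (H2 := exp_pos (- kappa * eta)).
destruct (Rle_dec eta r) as [h|h].
- assert (H3 := omega_le beta (Rmin q eta) (Rmin r eta) Hb).
  assert (Rmin q eta <= Rmin r eta) by (apply Rle_min_compat_r; lra).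
  assert (exp (- kappa * r) <= exp (- kappa * eta)) by (apply exp_le_compat; nra).
  nra.
- rewrite !Rmin_left by lra. assert (exp (- kappa * r) <= 1). { rewrite <- exp_0. apply exp_le_compat. nra. } nra.
Qed.

(* The weights [exp(kappa t_k)] make the weakly singular kernel contractive. *)
Lemma weighted_omega_sum beta kappa eta T tt n (t : nat -> R) : 0 <= beta -> 0 <= kappa -> 0 <= eta ->
  (forall k, (k < n)%nat -> t k <= t (S k)) -> 0 <= t 0%nat -> t n <= tt <= T ->
  bsum n (fun k => exp (kappa * t k) * (omega beta (tt - t k) - omega beta (tt - t (S k)))) <=
  exp (kappa * tt) * (exp (- kappa * eta) * omega beta T + omega beta eta).
Proof.
intros Hb Hk Heta Hinc H0 Htt.
assert (Hle : forall k, (k <= n)%nat -> t k <= t n).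
{ intros k Hkn. induction n as [|n IH]. replace k with 0%nat by lia; lra.
  destruct (Nat.eq_dec k (S n)) as [->|Hne]. lra.
  apply Rle_trans with (t n). apply IH; auto. specialize (Hinc n ltac:(lia)). lra. lia. apply Hinc; lia. }
eapply Rle_trans.
- apply (bsum_le n _ (fun k => exp (kappa * tt) * (exp (- kappa * eta) * (omega beta (tt - t k) - omega beta (tt - t (S k)))
    + (omega beta (Rmin (tt - t k) eta) - omega beta (Rmin (tt - t (S k)) eta))))).
  intros k Hkn. replace (exp (kappa * t k)) with (exp (kappa * tt) * exp (- kappa * (tt - t k))).
  2:{ rewrite <- exp_plus. f_equal. ring. }
  rewrite Rmult_assoc. apply Rmult_le_compat_l. left; apply exp_pos.
  pose proof (Hinc k Hkn). pose proof (Hle (S k) Hkn). apply omega_exp_increment; auto. lra.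
- rewrite bsum_mult. apply Rmult_le_compat_l. left; apply exp_pos.
  rewrite (bsum_plus (G := R_AbelianMonoid)). apply Rplus_le_compat.
  + rewrite bsum_mult. apply Rmult_le_compat_l. left; apply exp_pos.
    rewrite (bsum_telescope n (fun k => omega beta (tt - t k))).
    pose proof (omega_nonneg beta (tt - t n)). pose proof (omega_le beta (tt - t 0%nat) T Hb ltac:(lra)). lra.
  + rewrite (bsum_telescope n (fun k => omega beta (Rmin (tt - t k) eta))).
    pose proof (omega_nonneg beta (Rmin (tt - t n) eta)). pose proof (omega_le beta (Rmin (tt - t 0%nat) eta) eta Hb (Rmin_r _ _)). lra.
Qed.

Section Mesh.
Variables (t : nat -> R) (N : nat).
Hypothesis Ht0 : t 0%nat = 0.
Hypothesis Hinc : forall k, (k < N)%nat -> t k < t (S k).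

Lemma mesh_le j k : (j <= k)%nat -> (k <= N)%nat -> t j <= t k.
Proof.
intros Hjk HkN. induction k as [|k IH]. replace j with 0%nat by lia; lra.
destruct (Nat.eq_dec j (S k)) as [->|Hne]. lra.
pose proof (Hinc k ltac:(lia)). specialize (IH ltac:(lia) ltac:(lia)). lra.
Qed.

Lemma mesh_locate n r : (n <= N)%nat -> 0 < r <= t n ->
  exists k theta, (k < n)%nat /\ 0 < theta <= 1 /\ r = t k + theta * step t k.
Proof.
intros Hn Hr. induction n as [|n IH]. rewrite Ht0 in Hr; lra.
destruct (Rle_dec r (t n)) as [h|h].
- destruct IH as [k [th [H1 H2]]]. lia. lra. exists k, th. split; auto.
- pose proof (Hinc n ltac:(lia)). exists n, ((r - t n) / step t n). unfold step.
  split; [lia|]. split. split. apply Rdiv_lt_0_compat; lra. apply Rle_div_l; lra. field. lra.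
Qed.
End Mesh.

Ltac mesh_order t N := apply (mesh_le t N); auto; lia.

(** The maximum is taken together with 0, so that it exists for n = 0; the last clause remembers
    where it is attained. *)
Lemma finite_max n (f : nat -> R) : exists m, 0 <= m /\ (forall i, (i < n)%nat -> f i <= m) /\
  (m = 0 \/ exists i, (i < n)%nat /\ m = f i).
Proof.
induction n as [|n [m [H1 [H2 H3]]]].
- exists 0. split. lra. split. intros; lia. now left.
- destruct (Rle_dec (f n) m) as [h|h].
  + exists m. split; auto. split. intros i Hi. destruct (Nat.eq_dec i n) as [->|]; auto. apply H2; lia.
    destruct H3 as [H3|[i [Hi H3]]]; auto. right. exists i. split; auto; lia.
  + exists (f n). split. lra. split. intros i Hi. destruct (Nat.eq_dec i n) as [->|]. lra. specialize (H2 i ltac:(lia)). lra.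
    right. exists n. split; auto; lia.
Qed.

(** Banach iteration from the centre [u] in a product of [s] balls. Only the indices below [s] are
    meaningful, so fixed points are compared there and not as functions on [nat]. *)
Lemma ball_contraction_fixpoint {V : CompleteNormedModule R_AbsRing} s (Phi : (nat -> nm V) -> nat -> nm V) (u : nat -> nm V) r :
  0 < r ->
  (forall v, (forall j, (j < s)%nat -> norm (minus (v j) (u j)) <= r) -> forall i, (i < s)%nat -> norm (minus (Phi v i) (u i)) <= r) ->
  (forall v v' e, (forall j, (j < s)%nat -> norm (minus (v j) (u j)) <= r) -> (forall j, (j < s)%nat -> norm (minus (v' j) (u j)) <= r) ->
    0 <= e -> (forall j, (j < s)%nat -> norm (minus (v j) (v' j)) <= e) ->
    forall i, (i < s)%nat -> norm (minus (Phi v i) (Phi v' i)) <= e / 8) ->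
  (exists v, (forall j, (j < s)%nat -> norm (minus (v j) (u j)) <= r) /\ forall i, (i < s)%nat -> v i = Phi v i) /\
  (forall v v', (forall j, (j < s)%nat -> norm (minus (v j) (u j)) <= r) -> (forall j, (j < s)%nat -> norm (minus (v' j) (u j)) <= r) ->
    (forall i, (i < s)%nat -> v i = Phi v i) -> (forall i, (i < s)%nat -> v' i = Phi v' i) -> forall i, (i < s)%nat -> v i = v' i).
Proof.
intros Hr Hmap Hcon.
assert (Hpow : forall eps, 0 < eps -> exists n, 2 * r / 8 ^ n < eps).
{ intros eps He. destruct (pow_lt_1_zero (/ 8)) with (y := eps / (2 * r)) as [n Hn].
  rewrite Rabs_pos_eq; lra. apply Rdiv_lt_0_compat; lra. exists n. specialize (Hn n (le_n _)).
  rewrite Rabs_pos_eq in Hn by (apply pow_le; lra). rewrite pow_inv in Hn.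
  apply (Rmult_lt_compat_l (2 * r)) in Hn; [|lra]. replace (2 * r * (eps / (2 * r))) with eps in Hn by (field; lra).
  exact Hn. }
assert (Hpp : forall n, 0 < 8 ^ n) by (intros; apply pow_lt; lra).
split.
- set (vs := fun n => Nat.iter n Phi u).
  assert (Hball : forall n j, (j < s)%nat -> norm (minus (vs n j) (u j)) <= r).
  { induction n as [|n IH]; intros j Hj. rewrite norm_minus_self. lra. now apply Hmap. }
  assert (Hdiff : forall n k j, (j < s)%nat -> norm (minus (vs (n + k)%nat j) (vs n j)) <= r / 8 ^ n).
  { induction n as [|n IH]; intros k j Hj. rewrite Rdiv_1_r. now apply Hball.
    replace (r / 8 ^ S n) with (r / 8 ^ n / 8). apply Hcon; auto. apply Rdiv_le_0_compat; auto; lra.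
    simpl. field. specialize (Hpp n). lra. }
  assert (Hlim : forall j, exists y, (j < s)%nat -> forall n, norm (minus (vs n j) y) <= r / 8 ^ n).
  { intros j. destruct (lt_dec j s) as [Hj|Hj]. 2: exists zero; intros; contradiction.
    destruct (complete_seq_complete V (fun n => vs n j)) as [y Hy].
    { intros eps He. destruct (Hpow eps He) as [n Hn]. exists n. intros a b Ha Hb.
    replace a with (n + (a - n))%nat by lia. replace b with (n + (b - n))%nat by lia.
    eapply Rle_lt_trans. apply (norm_minus_triangle _ (vs n j)).
    assert (H1 := Hdiff n (a - n)%nat j Hj). assert (H2 := Hdiff n (b - n)%nat j Hj). rewrite norm_minus_sym in H2.
    lra. }
    rewrite (filterlim_norm eventually) in Hy. exists y. intros _ n. apply norm_bound_limit. intros eps He.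
    destruct (Hy eps He) as [k Hk]. specialize (Hk (n + k)%nat ltac:(lia)).
    assert (H1 := Hdiff n k j Hj). rewrite norm_minus_sym in H1.
    pose proof (norm_minus_triangle (vs n j) (vs (n + k)%nat j) y). lra. }
  destruct (choice _ Hlim) as [v Hv].
  assert (Hvb : forall j, (j < s)%nat -> norm (minus (v j) (u j)) <= r).
  { intros j Hj. specialize (Hv j Hj 0%nat). simpl in Hv. rewrite norm_minus_sym. lra. }
  exists v. split; auto. intros i Hi. apply eq_of_norm_minus. intros eps He.
  destruct (Hpow eps He) as [n Hn]. eapply Rle_trans. apply (norm_minus_triangle _ (vs (S n) i)).
  assert (H1 := Hv i Hi (S n)). rewrite norm_minus_sym in H1.
  assert (H2 : norm (minus (vs (S n) i) (Phi v i)) <= r / 8 ^ n / 8).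
  { apply (Hcon (vs n) v); auto. apply Rdiv_le_0_compat; auto; lra. }
  replace (r / 8 ^ S n) with (r / 8 ^ n / 8) in H1 by (simpl; field; specialize (Hpp n); lra).
  lra.
- intros v v' Hv Hv' Hf Hf' i Hi. apply eq_of_norm_minus. intros eps He. destruct (Hpow eps He) as [n Hn].
  apply Rlt_le. eapply Rle_lt_trans. 2: exact Hn. clear eps He Hn. revert i Hi. induction n as [|n IH]; intros i Hi.
  + eapply Rle_trans. apply (norm_minus_triangle _ (u i)). specialize (Hv i Hi). specialize (Hv' i Hi). rewrite norm_minus_sym in Hv'. lra.
  + rewrite Hf, Hf' by auto. replace (2 * r / 8 ^ S n) with (2 * r / 8 ^ n / 8) by (simpl; field; specialize (Hpp n); lra).
    apply Hcon; auto. apply Rdiv_le_0_compat; auto; lra.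
Qed.

(** * Solvability and stability of the scheme *)

Section Scheme.
Variable V : CompleteNormedModule R_AbsRing.
Variables (E AE : R -> nm V -> nm V) (M : R).
Hypothesis HE : analytic_semigroup (nm V) E AE M.
Variables (K : nm V -> nm V) (Q : R -> nm V -> nm V) (alpha C : R).
Hypothesis HF : fractional_power (nm V) E K Q alpha C.
Hypothesis Halpha : 0 <= alpha < 1.
Let beta := 1 - alpha.
Variables (s : nat) (c : nat -> R) (p : nat -> R -> R) (Lam : R).
Hypothesis Hc : forall i, (i < s)%nat -> 0 <= c i <= 1.
Hypothesis Hp : forall i r, continuous (p i) r.
Hypothesis HpL : forall i r, (i < s)%nat -> 0 <= r <= 1 -> Rabs (p i r) <= Lam.
Hypothesis HLam : 0 <= Lam.
Variables (T : R) (U : R -> nm V) (G : R -> nm V -> nm V -> nm V) (tau : R -> R) (tau0 Rg L : R).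
Hypothesis HRg : 0 < Rg.
Hypothesis HL : 0 <= L.
Hypothesis HLip : forall r v1 v2 w1 w2, 0 <= r <= T ->
  norm (minus v1 (U r)) <= Rg -> norm (minus v2 (U r)) <= Rg ->
  norm (minus w1 (U (r - tau r))) <= Rg -> norm (minus w2 (U (r - tau r))) <= Rg ->
  norm (minus (G r v1 w1) (G r v2 w2)) <= L * (norm (minus v1 v2) + norm (minus w1 w2)).
Hypothesis Htau0 : 0 < tau0.
Hypothesis Htau : forall r, 0 <= r -> tau0 <= tau r.
Variables (N : nat) (t : nat -> R) (hm : R).
Hypothesis Ht0 : t 0%nat = 0.
Hypothesis HtN : t N = T.
Hypothesis Hinc : forall k, (k < N)%nat -> t k < t (S k).
Hypothesis Hhm : forall k, (k < N)%nat -> step t k <= hm.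
Hypothesis Hhm0 : hm <= tau0.

Local Notation h k := (step t k).
Local Notation nd k i := (node t c k i).
Local Notation dl k i := (node t c k i - tau (node t c k i)).
Local Notation J k i theta := (stage_integral V E (p i) theta (step t k)).

(** The first [n] steps of the scheme, expressed through the continuous output alone: node and stage
    values are values of [w]. Applying [K] keeps the equations in X, where the source takes its
    values. Nearness of the stages is included because it singles out the solution. *)
Definition discrete_solution n (w : R -> nm V) : Prop :=
  (forall r, r <= 0 -> w r = U r) /\
  (forall k theta, (k < n)%nat -> 0 <= theta <= 1 ->
    K (w (t k + theta * h k)) = plus (E (theta * h k) (K (w (t k))))
    (bsum s (fun i => J k i theta (G (nd k i) (w (nd k i)) (w (dl k i)))))) /\
  (forall k i, (k < n)%nat -> (i < s)%nat -> norm (minus (w (nd k i)) (U (nd k i))) <= Rg).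

Variable d : nat -> R -> nm V.
Hypothesis Hd : forall k theta, (k < N)%nat -> 0 <= theta <= 1 ->
  K (U (t k + theta * h k)) = plus (plus (E (theta * h k) (K (U (t k))))
    (bsum s (fun i => J k i theta (G (nd k i) (U (nd k i)) (U (dl k i)))))) (K (d k theta)).

Let LK := fp_linear _ _ _ _ _ _ HF.
Let LE := as_linear _ _ _ _ HE.
Let Hbeta : 0 < beta.
Proof. unfold beta; lra. Qed.
Let HC := fp_const _ _ _ _ _ _ HF.
Let HLC : 0 <= Lam * (C / beta).
Proof. apply Rmult_le_pos; auto. apply Rdiv_le_0_compat; lra. Qed.

Lemma step_pos k : (k < N)%nat -> 0 < h k.
Proof. intros H. specialize (Hinc k H). unfold step. lra. Qed.

Lemma mesh_range k : (k <= N)%nat -> 0 <= t k <= T.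
Proof. intros H. rewrite <- Ht0, <- HtN. split; mesh_order t N. Qed.

Lemma node_range k i : (k < N)%nat -> (i < s)%nat -> t k <= nd k i <= t (S k).
Proof. intros Hk Hi. unfold node. assert (H := step_pos k Hk). specialize (Hc i Hi). unfold step in *. nra. Qed.

Lemma point_range k theta : (k < N)%nat -> 0 <= theta <= 1 -> t k <= t k + theta * h k <= t (S k).
Proof. intros Hk Hi. assert (H := step_pos k Hk). unfold step in *. nra. Qed.

Lemma delayed_node k i : (k < N)%nat -> (i < s)%nat -> dl k i <= t k.
Proof.
intros Hk Hi. pose proof (node_range k i Hk Hi). pose proof (mesh_range k ltac:(lia)).
specialize (Htau (nd k i) ltac:(lra)). specialize (Hhm k Hk). pose proof (step_pos k Hk).
specialize (Hc i Hi). unfold node in *. nra.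
Qed.

Lemma K_inj x y : K x = K y -> x = y.
Proof.
intros H. apply minus_zero_eq. apply (fp_injective _ _ _ _ _ _ HF).
rewrite (linear_minus _ _ _ LK), H. exact (minus_eq_zero (G := nm V) (K y)).
Qed.

Lemma K_bsum_lift n (f : nat -> nm V) (b : nat -> R) :
  (forall k, (k < n)%nat -> exists y, K y = f k /\ norm y <= b k) ->
  exists y, K y = bsum n f /\ norm y <= bsum n b.
Proof.
induction n as [|n IH]; intros H.
- exists zero. split. apply (linear_zero _ LK). rewrite norm_zero. apply Rle_refl.
- destruct IH as [y [H1 H2]]. intros; apply H; lia. destruct (H n) as [z [H3 H4]]. lia.
  exists (plus y z). split. rewrite (linear_plus _ LK), H1, H3. reflexivity.
  eapply Rle_trans. apply norm_triangle. rewrite bsum_RS. lra.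
Qed.

Lemma J_linear k i theta : (k < N)%nat -> 0 <= theta <= 1 -> forall x y,
  J k i theta (minus x y) = minus (J k i theta x) (J k i theta y).
Proof. intros Hk Hth. apply (stage_integral_linear V E AE M HE (p i) theta (h k)). apply Hp. lra. now apply step_pos. Qed.

Lemma J_lift k i r theta x : (k < N)%nat -> (i < s)%nat -> 0 <= r -> 0 <= theta <= 1 ->
  exists y, K y = E r (J k i theta x) /\
    norm y <= Lam * (C / beta) * (omega beta (r + theta * h k) - omega beta r) * norm x.
Proof.
intros Hk Hi Hr Hth. apply (stage_integral_lift V E AE M HE K Q alpha C HF Halpha (p i) Lam); auto. now apply step_pos.
Qed.

Lemma J_sum_lift k r theta (x : nat -> nm V) : (k < N)%nat -> 0 <= r -> 0 <= theta <= 1 ->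
  exists y, K y = E r (bsum s (fun i => J k i theta (x i))) /\
    norm y <= Lam * (C / beta) * (omega beta (r + theta * h k) - omega beta r) * bsum s (fun i => norm (x i)).
Proof.
intros Hk Hr Hth. rewrite (bsum_linear (E r)) by now apply LE. rewrite <- bsum_mult.
apply K_bsum_lift. intros i Hi. now apply J_lift.
Qed.

Section Error.
Variables (n : nat) (w : R -> nm V).
Hypothesis HnN : (n <= N)%nat.
Hypothesis Hw : discrete_solution n w.

Definition source_error k i := minus (G (nd k i) (w (nd k i)) (w (dl k i)))
  (G (nd k i) (U (nd k i)) (U (dl k i))).

Definition past_error k theta :=
  bsum k (fun l => E (t k + theta * h k - t (S l)) (bsum s (fun i => J l i 1 (source_error l i)))).
Definition past_defect k theta := bsum k (fun l => E (t k + theta * h k - t (S l)) (d l 1)).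
(** The local defects, propagated by the semigroup and accumulated up to a point of step k. The sum
    is estimated as a whole, since cancellation between the steps would be lost in a sum of
    norms. *)
Definition defect k theta := plus (past_defect k theta) (d k theta).

Lemma propagate_sum k theta (x : nat -> nm V) : (k < N)%nat -> 0 <= theta <= 1 ->
  E (theta * h k) (bsum k (fun l => E (t k + 0 * h k - t (S l)) (x l))) =
  bsum k (fun l => E (t k + theta * h k - t (S l)) (x l)).
Proof.
clear HnN Hw. intros Hk Hth. assert (Hh := step_pos k Hk).
rewrite (bsum_linear (E (theta * h k))) by (apply LE; nra).
apply bsum_ext. intros l Hl. assert (t (S l) <= t k) by (mesh_order t N).
rewrite <- (as_add _ _ _ _ HE) by nra. f_equal. ring.
Qed.

(** The equation of the exact solution with its defect is subtracted from the scheme, and the past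
    terms at t_k are propagated by E(theta h). *)
Lemma error_step k theta : (k < n)%nat -> 0 <= theta <= 1 ->
  K (minus (w (t k)) (U (t k))) = minus (past_error k 0) (K (past_defect k 0)) ->
  K (minus (w (t k + theta * h k)) (U (t k + theta * h k))) =
  minus (plus (past_error k theta) (bsum s (fun i => J k i theta (source_error k i)))) (K (defect k theta)).
Proof.
intros Hk Hth H. destruct Hw as [_ [Hw2 _]].
assert (HkN : (k < N)%nat) by lia. assert (Hh := step_pos k HkN).
assert (Lh : is_linear (E (theta * h k))) by (apply LE; nra).
rewrite (linear_minus _ _ _ LK), Hw2, Hd by auto.
unfold defect. rewrite (linear_plus _ LK).
unfold past_error, past_defect. rewrite <- !(propagate_sum k theta) by auto.
rewrite (fp_commute _ _ _ _ _ _ HF) by nra.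
assert (H1 : minus (E (theta * h k) (K (w (t k)))) (E (theta * h k) (K (U (t k)))) =
  minus (E (theta * h k) (past_error k 0)) (E (theta * h k) (K (past_defect k 0)))).
{ rewrite <- !(linear_minus _ _ _ Lh), <- (linear_minus _ _ _ LK), H. reflexivity. }
assert (H2 : bsum s (fun i => J k i theta (source_error k i)) =
  minus (bsum s (fun i => J k i theta (G (nd k i) (w (nd k i)) (w (dl k i)))))
   (bsum s (fun i => J k i theta (G (nd k i) (U (nd k i)) (U (dl k i)))))).
{ rewrite <- bsum_minus. apply bsum_ext. intros i Hi. now apply J_linear. }
rewrite H2. fold (past_error k 0) (past_defect k 0).
match goal with |- minus (plus ?a ?b) (plus (plus ?a' ?b') ?z) = _ =>
  transitivity (plus (minus a a') (minus (minus b b') z)); [rmodule (nm V)|] end.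
rewrite H1. rmodule (nm V).
Qed.

Lemma error_node k : (k <= n)%nat ->
  K (minus (w (t k)) (U (t k))) = minus (past_error k 0) (K (past_defect k 0)).
Proof.
induction k as [|k IH]; intros Hk.
- destruct Hw as [Hw1 _]. rewrite Hw1 by lra. unfold past_error, past_defect. simpl.
  rewrite (linear_zero _ LK), <- (linear_zero _ LK). rewrite <- (linear_minus _ _ _ LK). f_equal.
  transitivity (@zero (nm V)). exact (minus_eq_zero (G := nm V) _). symmetry. exact (minus_eq_zero (G := nm V) _).
-
  assert (H := error_step k 1 ltac:(lia) ltac:(lra) (IH ltac:(lia))).
  replace (t k + 1 * h k) with (t (S k)) in H by (unfold step; ring). rewrite H.
  assert (E0 : forall x : nat -> nm V, bsum (S k) (fun l => E (t (S k) + 0 * h (S k) - t (S l)) (x l)) =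
    plus (bsum k (fun l => E (t k + 1 * h k - t (S l)) (x l))) (x k)).
  { intros x. simpl. f_equal. apply bsum_ext. intros l Hl. f_equal. unfold step. ring.
    replace (t (S k) + 0 * h (S k) - t (S k)) with 0 by ring. apply (as_zero _ _ _ _ HE). }
  unfold past_error at 2, past_defect. rewrite !E0. reflexivity.
Qed.

Lemma error_formula k theta : (k < n)%nat -> 0 <= theta <= 1 ->
  K (minus (w (t k + theta * h k)) (U (t k + theta * h k))) =
  minus (plus (past_error k theta) (bsum s (fun i => J k i theta (source_error k i)))) (K (defect k theta)).
Proof. intros Hk Hth. apply error_step; auto. apply error_node. lia. Qed.

(** Lifting each propagated source error produces the kernel omega(r - t_l) - omega(r - t_(l+1)), a
    discrete form of (r - t)^-alpha. The current step enters implicitly with the small factor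
    omega(hm). *)
Lemma error_bound k theta (b : nat -> R) : (k < n)%nat -> 0 <= theta <= 1 ->
  (forall l, (l <= k)%nat -> bsum s (fun i => norm (source_error l i)) <= b l) ->
  norm (minus (w (t k + theta * h k)) (U (t k + theta * h k))) <=
  Lam * (C / beta) * (bsum k (fun l => (omega beta (t k + theta * h k - t l) - omega beta (t k + theta * h k - t (S l))) * b l)
    + omega beta hm * b k) + norm (defect k theta).
Proof.
intros Hk Hth Hb. assert (HkN : (k < N)%nat) by lia. assert (Hh := step_pos k HkN).
set (r := t k + theta * h k).
destruct (K_bsum_lift k (fun l => E (r - t (S l)) (bsum s (fun i => J l i 1 (source_error l i))))
  (fun l => Lam * (C / beta) * ((omega beta (r - t l) - omega beta (r - t (S l))) * b l))) as [y1 [Hy1 Hy1b]].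
{ intros l Hl. assert (HlN : (l < N)%nat) by lia. assert (t (S l) <= t k) by (mesh_order t N).
  assert (Hpr := point_range k theta HkN Hth). fold r in Hpr.
  destruct (J_sum_lift l (r - t (S l)) 1 (source_error l) HlN) as [y [H1 H2]]. lra. lra.
  exists y. split; auto. eapply Rle_trans. exact H2.
  replace (r - t (S l) + 1 * h l) with (r - t l) by (unfold step; ring).
  match goal with |- _ <= ?A * (?B * ?D) => replace (A * (B * D)) with (A * B * D) by ring end.
  apply Rmult_le_compat_l. 2: apply Hb; lia. apply Rmult_le_pos; auto.
  specialize (Hinc l HlN). pose proof (omega_le beta (r - t (S l)) (r - t l) ltac:(lra) ltac:(lra)). lra. }
destruct (J_sum_lift k 0 theta (source_error k) HkN) as [y2 [Hy2 Hy2b]]. lra. auto.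
rewrite (as_zero _ _ _ _ HE) in Hy2.
assert (Hz : minus (w r) (U r) = minus (plus y1 y2) (defect k theta)).
{ apply K_inj. rewrite (linear_minus _ (plus y1 y2) _ LK), (linear_plus _ LK), Hy1, Hy2. now apply error_formula. }
rewrite Hz. eapply Rle_trans. apply norm_minus_le. apply Rplus_le_compat_r.
eapply Rle_trans. apply norm_triangle. rewrite bsum_mult in Hy1b.
assert (norm y2 <= Lam * (C / beta) * (omega beta hm * b k)).
{ eapply Rle_trans. exact Hy2b. rewrite omega_0, Rminus_0_r, Rmult_assoc. apply Rmult_le_compat_l; auto.
  apply Rmult_le_compat. apply omega_nonneg. apply bsum_nonneg; intros; apply norm_ge_0. 2: apply Hb; lia.
  apply omega_le. lra. specialize (Hhm k HkN). nra. }
lra.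
Qed.

Variables (kappa eta D : R).
Hypothesis HD0 : 0 <= D.
Hypothesis Hkappa : 0 <= kappa.
Hypothesis Heta : 0 <= eta.
Hypothesis HD : forall k theta, (k < N)%nat -> 0 <= theta <= 1 -> norm (defect k theta) <= D.
Hypothesis HDRg : 4 * D * exp (kappa * T) <= Rg.
Hypothesis Hkh : kappa * hm <= 1.
Let B0 := Lam * (C / beta) * INR s * L.
Hypothesis Hsmall1 : B0 * omega beta hm <= 1 / 8.
Hypothesis Hsmall2 : 6 * B0 * (exp (- kappa * eta) * omega beta T + omega beta eta) <= 1 / 8.

Let HB0 : 0 <= B0.
Proof.
repeat apply Rmult_le_pos; auto. lra. left; now apply Rinv_0_lt_compat. apply pos_INR.
Qed.

Definition bound_until k := forall r, r <= t k -> norm (minus (w r) (U r)) <= 4 * D * exp (kappa * r).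

(** Since kappa hm <= 1, the weight grows at most by exp 1 <= 3 within one step. *)
Lemma exp_shift k r : (k < N)%nat -> r <= t (S k) -> exp (kappa * r) <= 3 * exp (kappa * t k).
Proof.
intros Hk Hr. specialize (Hhm k Hk). pose proof (step_pos k Hk). unfold step in *.
replace (kappa * r) with (kappa * (r - t k) + kappa * t k) by ring. rewrite exp_plus.
apply Rmult_le_compat_r. left; apply exp_pos. apply exp_1_le_3. nra.
Qed.

Lemma bound_within_Rg k r : (k <= n)%nat -> bound_until k -> r <= t k -> norm (minus (w r) (U r)) <= Rg.
Proof.
intros Hk Hb Hr. eapply Rle_trans. now apply Hb. eapply Rle_trans. 2: exact HDRg.
apply Rmult_le_compat_l. lra. apply exp_le_compat.
pose proof (mesh_range k ltac:(lia)). nra.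
Qed.

Lemma source_error_bound k i : (k < n)%nat -> (i < s)%nat -> bound_until k ->
  norm (source_error k i) <= L * (norm (minus (w (nd k i)) (U (nd k i))) + 4 * D * exp (kappa * t k)).
Proof.
intros Hk Hi Hb. assert (HkN : (k < N)%nat) by lia.
assert (Hnr := node_range k i HkN Hi). pose proof (mesh_range k ltac:(lia)). pose proof (mesh_range (S k) ltac:(lia)).
assert (Hdel := delayed_node k i HkN Hi).
eapply Rle_trans. apply HLip. lra. now apply Hw. rewrite norm_minus_self; lra.
now apply (bound_within_Rg k); auto; lia. rewrite norm_minus_self; lra.
apply Rmult_le_compat_l; auto. apply Rplus_le_compat_l. eapply Rle_trans. now apply Hb.
apply Rmult_le_compat_l. lra. apply exp_le_compat. nra.
Qed.

(** Induction over the steps. Earlier steps enter through the contractive weighted sum, and delayed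
    arguments lie before t_k, where the bound is known. The largest stage error m of the current
    step is absorbed: m <= 3 D ek / 2 + (m + 4 D ek)/8 + D implies m <= 4 D ek. *)
Lemma scheme_stability k : (k <= n)%nat -> bound_until k.
Proof.
induction k as [|k IH]; intros Hk.
{ intros r Hr. destruct Hw as [Hw1 _]. rewrite Hw1 by lra. rewrite norm_minus_self.
  pose proof (exp_pos (kappa * r)). nra. }
specialize (IH ltac:(lia)). assert (HkN : (k < N)%nat) by lia.
intros r Hr. destruct (Rle_dec r (t k)) as [Hrk0|Hrk0]. now apply IH.
assert (Hrk := mesh_range k ltac:(lia)). assert (HrSk := mesh_range (S k) ltac:(lia)).
set (ek := exp (kappa * t k)). assert (Hek := exp_pos (kappa * t k)). fold ek in Hek.
(* A stage error carries at most 3 times the weight at the left end of its step and a delayed error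
   at most once that weight; 4 D (3 + 1) stays below 24 D. *)
assert (Hprev : forall l, (l < k)%nat -> bsum s (fun i => norm (source_error l i)) <= INR s * (L * (24 * D * exp (kappa * t l)))).
{ intros l Hl. rewrite <- bsum_const. apply bsum_le. intros i Hi.
  assert (HlN : (l < N)%nat) by lia. assert (Hnr := node_range l i HlN Hi).
  assert (t (S l) <= t k) by (mesh_order t N).
  eapply Rle_trans. apply source_error_bound; auto. lia. intros q Hq; apply IH; lra.
  apply Rmult_le_compat_l; auto.
  assert (norm (minus (w (nd l i)) (U (nd l i))) <= 4 * D * (3 * exp (kappa * t l))).
  { eapply Rle_trans. apply IH. lra. apply Rmult_le_compat_l. lra. apply exp_shift; auto; lra. }
  pose proof (exp_pos (kappa * t l)). nra. }

assert (Hgen : forall m theta, 0 <= m -> (forall i, (i < s)%nat -> norm (minus (w (nd k i)) (U (nd k i))) <= m) -> 0 <= theta <= 1 ->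
  norm (minus (w (t k + theta * h k)) (U (t k + theta * h k))) <=
  exp (kappa * (t k + theta * h k)) * (D / 2) + (m + 4 * D * ek) / 8 + D).
{ intros m theta H0m Hm Hth. set (r' := t k + theta * h k). assert (Hpr := point_range k theta HkN Hth). fold r' in Hpr.
  set (b := fun l => if Nat.eqb l k then INR s * (L * (m + 4 * D * ek)) else INR s * (L * (24 * D * exp (kappa * t l)))).
  eapply Rle_trans. apply (error_bound k theta b); auto.
  { intros l Hl. unfold b. destruct (Nat.eqb_spec l k) as [->|Hne]. 2: apply Hprev; lia.
    rewrite <- bsum_const. apply bsum_le. intros i Hi. eapply Rle_trans. apply source_error_bound; auto.
    apply Rmult_le_compat_l; auto. apply Rplus_le_compat_r. now apply Hm. }
  apply Rplus_le_compat. 2: now apply HD.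
  rewrite (bsum_ext k _ (fun l => INR s * L * (24 * D) * (exp (kappa * t l) * (omega beta (r' - t l) - omega beta (r' - t (S l)))))).
  2:{ intros l Hl. unfold b, r'. destruct (Nat.eqb_spec l k). lia. as_R. ring. }
  rewrite bsum_mult. unfold b. rewrite Nat.eqb_refl.
  assert (Hsum := weighted_omega_sum beta kappa eta T r' k t ltac:(lra) Hkappa Heta ltac:(intros; left; apply Hinc; lia) ltac:(lra) ltac:(lra)).
  set (Sg := bsum k _) in Hsum |- *.
  set (Wt := exp (- kappa * eta) * omega beta T + omega beta eta) in Hsum, Hsmall2.
  assert (Her := exp_pos (kappa * r')).
  assert (H1 : Lam * (C / beta) * (INR s * L * (24 * D) * Sg) <= exp (kappa * r') * (D / 2)).
  { replace (Lam * (C / beta) * (INR s * L * (24 * D) * Sg)) with (B0 * (24 * D) * Sg) by (unfold B0; ring).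
    apply Rle_trans with (B0 * (24 * D) * (exp (kappa * r') * Wt)). apply Rmult_le_compat_l; auto. apply Rmult_le_pos; lra.
    replace (B0 * (24 * D) * (exp (kappa * r') * Wt)) with (exp (kappa * r') * D * 4 * (6 * B0 * Wt)) by ring.
    replace (exp (kappa * r') * (D / 2)) with (exp (kappa * r') * D * 4 * (1 / 8)) by field.
    apply Rmult_le_compat_l; auto. assert (0 <= exp (kappa * r') * D) by (apply Rmult_le_pos; lra). lra. }
  assert (H2 : Lam * (C / beta) * (omega beta hm * (INR s * (L * (m + 4 * D * ek)))) <= (m + 4 * D * ek) / 8).
  { replace (Lam * (C / beta) * (omega beta hm * (INR s * (L * (m + 4 * D * ek))))) with (B0 * omega beta hm * (m + 4 * D * ek)) by (unfold B0; ring).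
    assert (0 <= 4 * D * ek) by (apply Rmult_le_pos; lra).
    nra. }
  lra. }
destruct (finite_max s (fun i => norm (minus (w (nd k i)) (U (nd k i))))) as [m [Hm0 [Hm1 Hm2]]].
assert (Hm : m <= 4 * D * ek).
{ destruct Hm2 as [->|[i [Hi ->]]]. apply Rmult_le_pos; lra.
  set (m := norm (minus (w (nd k i)) (U (nd k i)))) in *.
  assert (H := Hgen m (c i) Hm0 Hm1 (Hc i Hi)).
  assert (H3 := exp_shift k (nd k i) HkN ltac:(apply node_range; auto)). fold ek in H3.
  change (t k + c i * h k) with (nd k i) in H. fold m in H.
  assert (exp (kappa * nd k i) * (D / 2) <= 3 * ek * (D / 2)) by (apply Rmult_le_compat_r; lra).
  assert (D <= D * ek). { assert (1 <= ek). { rewrite <- exp_0. apply exp_le_compat. apply Rmult_le_pos; lra. } nra. }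
  lra. }
destruct (mesh_locate t N Ht0 Hinc (S k) r ltac:(lia)) as [k' [th [Hk' [Hth ->]]]].
{ lra. }
assert (k' = k). { destruct (Nat.eq_dec k' k); auto. exfalso. assert (t (S k') <= t k) by (mesh_order t N).
  pose proof (point_range k' th ltac:(lia) ltac:(lra)). lra. }
subst k'. assert (H := Hgen m th Hm0 Hm1 ltac:(lra)).
assert (He : ek <= exp (kappa * (t k + th * h k))). { apply exp_le_compat. apply Rmult_le_compat_l; auto. lra. }
assert (He1 : 1 <= exp (kappa * (t k + th * h k))). { rewrite <- exp_0. apply exp_le_compat. apply Rmult_le_pos; lra. }
assert (D * ek <= D * exp (kappa * (t k + th * h k))) by (apply Rmult_le_compat_l; lra).
assert (D * 1 <= D * exp (kappa * (t k + th * h k))) by (apply Rmult_le_compat_l; lra).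
lra.
Qed.
End Error.

Section Existence.
Variables (kappa eta D : R).
Hypothesis HD0 : 0 <= D.
Hypothesis Hkappa : 0 <= kappa.
Hypothesis Heta : 0 <= eta.
Hypothesis HD : forall k theta, (k < N)%nat -> 0 <= theta <= 1 -> norm (defect k theta) <= D.
Hypothesis HDRg : 32 * M * D * exp (kappa * T) <= Rg.
Hypothesis Hkh : kappa * hm <= 1.
Let B0 := Lam * (C / beta) * INR s * L.
Hypothesis Hsmall1 : B0 * omega beta hm <= 1 / 8.
Hypothesis Hsmall2 : 6 * B0 * (exp (- kappa * eta) * omega beta T + omega beta eta) <= 1 / 8.
Variable lift : nat -> nat -> R -> nm V -> nm V.
Hypothesis Hlift : forall k i theta x, (k < N)%nat -> (i < s)%nat -> 0 <= theta <= 1 ->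
  K (lift k i theta x) = J k i theta x /\ norm (lift k i theta x) <= Lam * (C / beta) * omega beta hm * norm x.

Lemma defect_near_Rg : 4 * D * exp (kappa * T) <= Rg.
Proof.
pose proof (as_const _ _ _ _ HE). pose proof (exp_pos (kappa * T)).
assert (0 <= D * exp (kappa * T)) by (apply Rmult_le_pos; lra). nra.
Qed.

(** The past part at t_k is the total defect at the end of the preceding step, hence at most D;
    after propagation it is subtracted from the total. *)
Lemma local_defect_bound k theta : (k < N)%nat -> 0 <= theta <= 1 -> norm (d k theta) <= 2 * M * D.
Proof.
intros Hk Hth. assert (HM := as_const _ _ _ _ HE).
assert (H0 : norm (past_defect k 0) <= D).
{ destruct k as [|k]. unfold past_defect. simpl. rewrite norm_zero. auto.
  replace (past_defect (S k) 0) with (defect k 1). apply HD. lia. lra.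
  unfold defect, past_defect. simpl. f_equal. apply bsum_ext. intros l Hl. f_equal. unfold step. ring.
  replace (t (S k) + 0 * h (S k) - t (S k)) with 0 by ring. symmetry. apply (as_zero _ _ _ _ HE). }
assert (H1 : norm (past_defect k theta) <= M * D).
{ unfold past_defect. rewrite <- (propagate_sum k theta (fun l => d l 1)) by auto.
  eapply Rle_trans. apply (as_bound _ _ _ _ HE). pose proof (step_pos k Hk); nra.
  apply Rmult_le_compat_l. lra. exact H0. }
replace (d k theta) with (minus (defect k theta) (past_defect k theta)) by (unfold defect; rmodule (nm V)).
eapply Rle_trans. apply norm_minus_le. specialize (HD k theta Hk Hth). nra.
Qed.

Section OneStep.
Variables (k : nat) (w : R -> nm V).
Hypothesis HkN : (k < N)%nat.
Hypothesis Hw : discrete_solution k w.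

(** The right-hand side of the stage equations pulled back through [K] by chosen preimages [lift],
    so that the fixed point is sought in the coordinate space itself. *)
Definition stage_map (v : nat -> nm V) (theta : R) : nm V :=
  plus (E (theta * h k) (w (t k))) (bsum s (fun j => lift k j theta (G (nd k j) (v j) (w (dl k j))))).

Lemma stage_map_K v theta : 0 <= theta <= 1 -> K (stage_map v theta) =
  plus (E (theta * h k) (K (w (t k)))) (bsum s (fun j => J k j theta (G (nd k j) (v j) (w (dl k j))))).
Proof.
intros Hth. unfold stage_map. pose proof (step_pos k HkN).
rewrite (linear_plus _ LK), (fp_commute _ _ _ _ _ _ HF), (bsum_linear K) by (auto; nra).
f_equal. apply bsum_ext. intros j Hj. now apply Hlift.
Qed.

Lemma stage_map_0 v : stage_map v 0 = w (t k).
Proof.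
apply K_inj. rewrite stage_map_K by lra. rewrite bsum_zero.
- rewrite Rmult_0_l, (as_zero _ _ _ _ HE). apply plus_zero_r.
- intros j Hj. unfold stage_integral. transitivity (scal (h k) (@zero (nm V))). f_equal. exact (RInt_point (V := V) 0 _). exact (scal_zero_r (V := nm V) _).
Qed.

Lemma stable_until r : r <= t k -> norm (minus (w r) (U r)) <= 4 * D * exp (kappa * r).
Proof.
apply (scheme_stability k w ltac:(lia) Hw kappa eta D HD0 Hkappa Heta HD defect_near_Rg Hkh Hsmall1 Hsmall2 k (le_n _)).
Qed.

Lemma near_until r : r <= t k -> norm (minus (w r) (U r)) <= Rg / 8.
Proof.
intros Hr. eapply Rle_trans. now apply stable_until. assert (HM := as_const _ _ _ _ HE).
pose proof (mesh_range k ltac:(lia)). assert (exp (kappa * r) <= exp (kappa * T)) by (apply exp_le_compat, Rmult_le_compat_l; lra).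
pose proof (exp_pos (kappa * T)).
assert (0 <= D * exp (kappa * T)) by (apply Rmult_le_pos; lra). nra.
Qed.

Lemma stage_map_difference (x y : nat -> nm V) theta b : 0 <= theta <= 1 -> 0 <= b ->
  (forall j, (j < s)%nat -> norm (minus (x j) (y j)) <= L * b) ->
  exists z, K z = minus (bsum s (fun j => J k j theta (x j))) (bsum s (fun j => J k j theta (y j))) /\ norm z <= b / 8.
Proof.
intros Hth Hb Hxy. exists (bsum s (fun j => lift k j theta (minus (x j) (y j)))). split.
- rewrite (bsum_linear K) by exact LK. rewrite <- bsum_minus. apply bsum_ext. intros j Hj.
  rewrite <- J_linear by auto. now apply Hlift.
- eapply Rle_trans. apply norm_bsum.
  apply Rle_trans with (bsum s (fun _ => Lam * (C / beta) * omega beta hm * (L * b))).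
  + apply bsum_le. intros j Hj. eapply Rle_trans. apply Hlift; auto. apply Rmult_le_compat_l; auto.
    apply Rmult_le_pos. apply Rmult_le_pos; auto. apply Rdiv_le_0_compat; lra. apply omega_nonneg.
  + rewrite bsum_const. replace (INR s * (Lam * (C / beta) * omega beta hm * (L * b))) with (B0 * omega beta hm * b) by (unfold B0; ring). nra.
Qed.

Lemma delayed_near j : (j < s)%nat -> norm (minus (w (dl k j)) (U (dl k j))) <= Rg.
Proof. intros Hj. eapply Rle_trans. apply near_until. now apply delayed_node. lra. Qed.

Lemma node_in_T j : (j < s)%nat -> 0 <= nd k j <= T.
Proof. intros Hj. pose proof (node_range k j HkN Hj). pose proof (mesh_range k ltac:(lia)). pose proof (mesh_range (S k) ltac:(lia)). lra. Qed.

(** The distance to the exact value has three parts: at most Rg/8 from the error at t_k, Rg/4 from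
    the sources and Rg/16 from the local defect. The factor 32 M in the smallness condition is made
    for this count. *)
Lemma stage_map_ball v theta : 0 <= theta <= 1 -> (forall j, (j < s)%nat -> norm (minus (v j) (U (nd k j))) <= Rg) ->
  norm (minus (stage_map v theta) (U (t k + theta * h k))) <= Rg.
Proof.
intros Hth Hv. assert (HM := as_const _ _ _ _ HE). assert (Hh := step_pos k HkN).
assert (Lh : is_linear (E (theta * h k))) by (apply LE; nra).
destruct (stage_map_difference (fun j => G (nd k j) (v j) (w (dl k j)))
  (fun j => G (nd k j) (U (nd k j)) (U (dl k j))) theta (2 * Rg) Hth) as [z [Hz1 Hz2]]. lra.
{ intros j Hj. eapply Rle_trans. apply HLip. now apply node_in_T. now apply Hv. rewrite norm_minus_self; lra. now apply delayed_near. rewrite norm_minus_self; lra.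
  apply Rmult_le_compat_l; auto. specialize (Hv j Hj). pose proof (delayed_near j Hj). lra. }
assert (Heq : minus (stage_map v theta) (U (t k + theta * h k)) =
  minus (plus (E (theta * h k) (minus (w (t k)) (U (t k)))) z) (d k theta)).
{ apply K_inj. rewrite !(linear_minus _ _ _ LK), (linear_plus _ LK), Hz1, stage_map_K, Hd by auto.
  rewrite (fp_commute _ _ _ _ _ _ HF) by nra. rewrite (linear_minus _ _ _ LK), (linear_minus _ _ _ Lh). rmodule (nm V). }
rewrite Heq. eapply Rle_trans. apply norm_minus_le. assert (H1 := local_defect_bound k theta HkN Hth).
assert (H2 := norm_triangle (E (theta * h k) (minus (w (t k)) (U (t k)))) z).
assert (H3 := as_bound _ _ _ _ HE (theta * h k) (minus (w (t k)) (U (t k))) ltac:(nra)).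
assert (H4 := stable_until (t k) ltac:(lra)). pose proof (mesh_range k ltac:(lia)).
assert (H5 : exp (kappa * t k) <= exp (kappa * T)) by (apply exp_le_compat, Rmult_le_compat_l; lra).
assert (H6 : 1 <= exp (kappa * T)). { rewrite <- exp_0. apply exp_le_compat. apply Rmult_le_pos; lra. }
set (eT := exp (kappa * T)) in *.
assert (M * norm (minus (w (t k)) (U (t k))) <= M * (4 * D * eT)).
{ apply Rmult_le_compat_l. lra. eapply Rle_trans. exact H4. apply Rmult_le_compat_l; lra. }
assert (0 <= M * D) by (apply Rmult_le_pos; lra).
assert (M * D * 1 <= M * D * eT) by (apply Rmult_le_compat_l; lra).
lra.
Qed.

Lemma stage_map_contraction v v' theta e : 0 <= theta <= 1 -> 0 <= e ->
  (forall j, (j < s)%nat -> norm (minus (v j) (U (nd k j))) <= Rg) ->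
  (forall j, (j < s)%nat -> norm (minus (v' j) (U (nd k j))) <= Rg) ->
  (forall j, (j < s)%nat -> norm (minus (v j) (v' j)) <= e) ->
  norm (minus (stage_map v theta) (stage_map v' theta)) <= e / 8.
Proof.
intros Hth He Hv Hv' Hvv.
destruct (stage_map_difference (fun j => G (nd k j) (v j) (w (dl k j)))
  (fun j => G (nd k j) (v' j) (w (dl k j))) theta e Hth He) as [z [Hz1 Hz2]].
{ intros j Hj. eapply Rle_trans. apply HLip; auto. now apply node_in_T. now apply delayed_near. now apply delayed_near.
  apply Rmult_le_compat_l; auto. rewrite norm_minus_self. specialize (Hvv j Hj). lra. }
replace (minus (stage_map v theta) (stage_map v' theta)) with z; auto.
apply K_inj. rewrite (linear_minus _ _ _ LK), Hz1, !stage_map_K by auto. rmodule (nm V).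
Qed.

Lemma stage_fixpoint :
  (exists v, (forall j, (j < s)%nat -> norm (minus (v j) (U (nd k j))) <= Rg) /\ forall i, (i < s)%nat -> v i = stage_map v (c i)) /\
  (forall v v', (forall j, (j < s)%nat -> norm (minus (v j) (U (nd k j))) <= Rg) ->
    (forall j, (j < s)%nat -> norm (minus (v' j) (U (nd k j))) <= Rg) ->
    (forall i, (i < s)%nat -> v i = stage_map v (c i)) -> (forall i, (i < s)%nat -> v' i = stage_map v' (c i)) ->
    forall i, (i < s)%nat -> v i = v' i).
Proof.
apply (ball_contraction_fixpoint s (fun v i => stage_map v (c i)) (fun j => U (nd k j)) Rg HRg).
- intros v Hv i Hi. apply stage_map_ball; auto.
- intros v v' e Hv Hv' He Hvv i Hi. apply stage_map_contraction; auto.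
Qed.
End OneStep.

Lemma solution_restrict n k w : (k <= n)%nat -> discrete_solution n w -> discrete_solution k w.
Proof. intros Hk [H1 [H2 H3]]. repeat split; auto; intros; [apply H2|apply H3]; auto; lia. Qed.

Lemma solution_extend k w : (k < N)%nat -> discrete_solution k w -> exists w', discrete_solution (S k) w'.
Proof.
intros HkN Hw. destruct (proj1 (stage_fixpoint k w HkN Hw)) as [v [Hv1 Hv2]].
assert (Hh := step_pos k HkN).
(* Delayed arguments of step k lie at or before t_k, so the extension leaves them unchanged; the
   branches agree at t_k by [stage_map_0]. *)
set (w' := fun r => if Rle_dec r (t k) then w r else stage_map k w v ((r - t k) / h k)).
assert (Hold : forall r, r <= t k -> w' r = w r). { intros r Hr. unfold w'. now destruct Rle_dec. }
assert (Hnew : forall theta, 0 <= theta <= 1 -> w' (t k + theta * h k) = stage_map k w v theta).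
{ intros theta Hth. unfold w'. destruct Rle_dec.
  - assert (theta = 0) by nra. subst. rewrite stage_map_0; auto. f_equal. ring.
  - f_equal. field. lra. }
exists w'. destruct Hw as [Hw1 [Hw2 Hw3]]. pose proof (mesh_range k ltac:(lia)). repeat split.
- intros r Hr. rewrite Hold by lra. auto.
- intros j theta Hj Hth. destruct (Nat.eq_dec j k) as [->|Hne].
  + rewrite Hnew, stage_map_K, Hold by (auto; lra). f_equal. apply bsum_ext. intros i Hi.
    rewrite (Hold (dl k i)) by now apply delayed_node.
    assert (Hn : w' (nd k i) = v i) by (unfold node; rewrite Hnew, <- Hv2 by auto; reflexivity). rewrite Hn. reflexivity.
  + assert (HjN : (j < N)%nat) by lia. assert (t (S j) <= t k) by (mesh_order t N). pose proof (point_range j theta HjN Hth).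
    rewrite !Hold by lra. rewrite Hw2 by (auto; lia). f_equal. apply bsum_ext. intros i Hi.
    pose proof (node_range j i HjN Hi). pose proof (delayed_node j i HjN Hi). rewrite !Hold by lra. reflexivity.
- intros j i Hj Hi. destruct (Nat.eq_dec j k) as [->|Hne].
  + assert (Hn : w' (nd k i) = v i) by (unfold node; rewrite Hnew, <- Hv2 by auto; reflexivity). rewrite Hn. now apply Hv1.
  + assert (HjN : (j < N)%nat) by lia. assert (t (S j) <= t k) by (mesh_order t N).
    pose proof (node_range j i HjN Hi). rewrite Hold by lra. apply Hw3; auto; lia.
Qed.

Lemma solution_exists n : (n <= N)%nat -> exists w, discrete_solution n w.
Proof.
induction n as [|n IH]; intros Hn.
- exists U. repeat split; intros; lia.
- destruct IH as [w Hw]. lia. apply (solution_extend n w); auto.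
Qed.

(** By induction the delayed values agree, so the stages of both solutions are fixed points of the
    same stage map. *)
Lemma solution_unique w w' : discrete_solution N w -> discrete_solution N w' ->
  forall n, (n <= N)%nat -> forall r, r <= t n -> w r = w' r.
Proof.
intros Hw Hw'. induction n as [|k IH]; intros Hn r Hr.
- destruct Hw as [Hw _], Hw' as [Hw' _]. rewrite Hw, Hw' by lra. reflexivity.
- assert (HkN : (k < N)%nat) by lia. specialize (IH ltac:(lia)).
  destruct (Rle_dec r (t k)) as [Hrk|Hrk]. now apply IH.
  assert (HwK : forall theta, 0 <= theta <= 1 -> w (t k + theta * h k) = stage_map k w (fun j => w (nd k j)) theta).
  { intros theta Hth. apply K_inj. rewrite stage_map_K by auto. destruct Hw as [_ [Hw _]]. now apply Hw. }
  assert (Hw'K : forall theta, 0 <= theta <= 1 -> w' (t k + theta * h k) = stage_map k w (fun j => w' (nd k j)) theta).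
  { intros theta Hth. apply K_inj. rewrite stage_map_K by auto. rewrite IH by lra. destruct Hw' as [_ [Hw' _]]. rewrite Hw' by auto.
    f_equal. apply bsum_ext. intros j Hj. rewrite (IH (dl k j)). reflexivity. now apply delayed_node. }
  assert (Heq : forall i, (i < s)%nat -> w (nd k i) = w' (nd k i)).
  { apply (proj2 (stage_fixpoint k w HkN (solution_restrict N k w ltac:(lia) Hw)) (fun j => w (nd k j)) (fun j => w' (nd k j))).
    intros; now apply Hw. intros; now apply Hw'. intros; now apply HwK, Hc. intros; now apply Hw'K, Hc. }
  pose proof (mesh_range k ltac:(lia)).
  destruct (mesh_locate t N Ht0 Hinc (S k) r Hn) as [k' [th [Hk' [Hth ->]]]]. lra.
  assert (k' = k). { destruct (Nat.eq_dec k' k); auto. exfalso. assert (t (S k') <= t k) by (mesh_order t N).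
    pose proof (point_range k' th ltac:(lia) ltac:(lra)). lra. }
  subst k'. rewrite HwK, Hw'K by lra. unfold stage_map. f_equal. apply bsum_ext. intros j Hj. now rewrite Heq.
Qed.
End Existence.

Lemma lift_exists : exists lift : nat -> nat -> R -> nm V -> nm V,
  forall k i theta x, (k < N)%nat -> (i < s)%nat -> 0 <= theta <= 1 ->
  K (lift k i theta x) = J k i theta x /\ norm (lift k i theta x) <= Lam * (C / beta) * omega beta hm * norm x.
Proof.
assert (H : forall q : nat * nat * R * nm V, exists y, let '(k, i, theta, x) := q in
  (k < N)%nat -> (i < s)%nat -> 0 <= theta <= 1 -> K y = J k i theta x /\ norm y <= Lam * (C / beta) * omega beta hm * norm x).
{ intros [[[k i] theta] x]. destruct (classic ((k < N)%nat /\ (i < s)%nat /\ 0 <= theta <= 1)) as [[Hk [Hi Hth]]|Hn].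
  2: exists zero; intros; tauto.
  destruct (J_lift k i 0 theta x Hk Hi ltac:(lra) Hth) as [y [H1 H2]]. exists y. intros _ _ _.
  rewrite (as_zero _ _ _ _ HE) in H1. split; auto. eapply Rle_trans. exact H2.
    apply Rmult_le_compat_r. apply norm_ge_0. apply Rmult_le_compat_l. apply Rmult_le_pos; auto. apply Rdiv_le_0_compat; lra.
  rewrite omega_0, Rminus_0_r. apply omega_le. lra. specialize (Hhm k Hk). pose proof (step_pos k Hk). nra. }
destruct (choice _ H) as [f Hf]. exists (fun k i theta x => f (k, i, theta, x)). intros k i theta x. exact (Hf (k, i, theta, x)).
Qed.

(** [D] is a crude bound that only has to be small enough for solvability; [D'] is any sharper bound
    for the same defect, used for the error afterwards. This separation keeps logarithms out of the
    smallness condition on the steps. *)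
Lemma scheme_solvable (kappa eta D : R) : 0 <= D -> 0 <= kappa -> 0 <= eta ->
  (forall k theta, (k < N)%nat -> 0 <= theta <= 1 -> norm (defect k theta) <= D) ->
  32 * M * D * exp (kappa * T) <= Rg -> kappa * hm <= 1 ->
  Lam * (C / beta) * INR s * L * omega beta hm <= 1 / 8 ->
  6 * (Lam * (C / beta) * INR s * L) * (exp (- kappa * eta) * omega beta T + omega beta eta) <= 1 / 8 ->
  exists w, discrete_solution N w /\ (forall w', discrete_solution N w' -> forall r, r <= T -> w' r = w r) /\
   forall D', 0 <= D' -> D' <= D -> (forall k theta, (k < N)%nat -> 0 <= theta <= 1 -> norm (defect k theta) <= D') ->
    forall r, 0 <= r <= T -> norm (minus (w r) (U r)) <= 4 * D' * exp (kappa * T).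
Proof.
intros H1 H2 H3 H4 H5 H6 H7 H8. destruct lift_exists as [lift Hlift].
destruct (solution_exists kappa eta D H1 H2 H3 H4 H5 H6 H7 H8 lift Hlift N (le_n _)) as [w Hw].
exists w. split; auto. split.
- intros w' Hw' r Hr. symmetry. apply (solution_unique kappa eta D H1 H2 H3 H4 H5 H6 H7 H8 lift Hlift w w' Hw Hw' N). lia. lra.
- intros D' HD' HDD HDef r Hr.
  assert (Hs : norm (minus (w r) (U r)) <= 4 * D' * exp (kappa * r)).
  { apply (scheme_stability N w (le_n _) Hw kappa eta D' HD' H2 H3 HDef) with (k := N); auto; try lra.
    assert (HM := as_const _ _ _ _ HE). pose proof (exp_pos (kappa * T)).
    assert (D' * exp (kappa * T) <= D * exp (kappa * T)) by (apply Rmult_le_compat_r; lra).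
    assert (0 <= D' * exp (kappa * T)) by (apply Rmult_le_pos; lra).
    assert (1 * (D * exp (kappa * T)) <= M * (D * exp (kappa * T))) by (apply Rmult_le_compat_r; lra). lra. }
  eapply Rle_trans. exact Hs. apply Rmult_le_compat_l. lra. apply exp_le_compat, Rmult_le_compat_l; lra.
Qed.
End Scheme.

(** * Sums of semigroup differences *)

Lemma ln_le_compat x y : 0 < x -> x <= y -> ln x <= ln y.
Proof. intros Hx Hy. destruct (Rle_lt_or_eq_dec _ _ Hy) as [h| ->]. left; now apply ln_increasing. lra. Qed.

(** (a - b)/a is a lower Riemann sum of 1/x over [b, a]; the proof reduces to 1 + x <= exp x. *)
Lemma ratio_le_ln a b : 0 < b -> b <= a -> (a - b) / a <= ln a - ln b.
Proof.
intros Hb Hab. rewrite <- ln_div by lra.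
replace ((a - b) / a) with (1 - b / a) by (field; lra).
replace (a / b) with (/ (b / a)) by (field; lra). assert (0 < b / a) by (apply Rdiv_lt_0_compat; lra).
rewrite ln_Rinv by auto. assert (H1 := exp_ineq1_le (ln (b / a))). rewrite exp_ln in H1 by auto. lra.
Qed.

Lemma bsum_inv_square n : bsum n (fun j => / (INR j + 1) ^ 2) <= 2.
Proof.
assert (H : forall n, bsum (S n) (fun j => / (INR j + 1) ^ 2) <= 2 - / (INR n + 1)).
{ intros k; induction k as [|k IH]. rewrite bsum_RS, bsum_R0. simpl INR. lra.
  rewrite bsum_RS. rewrite S_INR in *. assert (Hk := pos_INR k).
  assert (/ (INR k + 1 + 1) ^ 2 <= / (INR k + 1) - / (INR k + 1 + 1)).
  { replace (/ (INR k + 1) - / (INR k + 1 + 1)) with (/ ((INR k + 1) * (INR k + 1 + 1))) by (field; lra).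
    apply Rinv_le_contravar; nra. }
  lra. }
destruct n as [|n]. rewrite bsum_R0; lra. specialize (H n). pose proof (pos_INR n).
assert (0 < / (INR n + 1)) by (apply Rinv_0_lt_compat; lra). lra.
Qed.

Section Sums.
Variable VV : CompleteNormedModule R_AbsRing.
Local Notation V := (nm VV).
Variables (E AE : R -> V -> V) (M : R).
Hypothesis HE : analytic_semigroup V E AE M.
Variables (t : nat -> R) (N : nat) (T : R).
Hypothesis Ht0 : t 0%nat = 0.
Hypothesis HtN : t N = T.
Hypothesis Hinc : forall k, (k < N)%nat -> t k < t (S k).
Local Notation h k := (step t k).

Definition semigroup_drop n theta k (x : V) : V :=
  minus (E (t n - t (S k)) x) (E (t n - t (S k) + theta * h k) x).

Lemma drop_linear n theta k : (k < n)%nat -> (n <= N)%nat -> 0 <= theta -> is_linear (semigroup_drop n theta k).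
Proof.
intros Hk Hn Hth. assert (t (S k) <= t n) by (mesh_order t N).
assert (0 <= theta * h k). { specialize (Hinc k ltac:(lia)). unfold step. apply Rmult_le_pos; lra. }
apply (is_linear_comp (fun x => (E (t n - t (S k)) x, opp (E (t n - t (S k) + theta * h k) x))) (fun q => plus (fst q) (snd q))).
apply (is_linear_prod (fun x => E (t n - t (S k)) x) (fun x => opp (E (t n - t (S k) + theta * h k) x))).
apply (as_linear _ _ _ _ HE). lra.
apply (is_linear_comp (fun x => E (t n - t (S k) + theta * h k) x) opp). apply (as_linear _ _ _ _ HE). lra. apply is_linear_opp.
apply is_linear_plus.
Qed.

Lemma drop_bound n theta k x : (k < n)%nat -> (n <= N)%nat -> 0 <= theta -> norm (semigroup_drop n theta k x) <= 2 * M * norm x.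
Proof.
intros Hk Hn Hth. assert (t (S k) <= t n) by (mesh_order t N).
assert (0 <= theta * h k). { specialize (Hinc k ltac:(lia)). unfold step. apply Rmult_le_pos; lra. }
eapply Rle_trans. apply norm_minus_le.
pose proof (as_bound _ _ _ _ HE (t n - t (S k)) x ltac:(lra)). pose proof (as_bound _ _ _ _ HE (t n - t (S k) + theta * h k) x ltac:(lra)). lra.
Qed.

Variables (q : nat) (hm Fbar : R) (F : nat -> V).
Hypothesis Hhm : forall k, (k < N)%nat -> h k <= hm.
Hypothesis Hhm0 : 0 <= hm.
Hypothesis HF : forall k, (k < N)%nat -> norm (F k) <= Fbar.

Lemma step_positive k : (k < N)%nat -> 0 < h k.
Proof. intros H. specialize (Hinc k H). unfold step. lra. Qed.

Definition drop_sum n theta : V := bsum n (fun k => scal (h k ^ q) (semigroup_drop n theta k (F k))).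

Lemma step_pow_bound k : (k < N)%nat -> 0 <= h k ^ q <= hm ^ q.
Proof. intros Hk. pose proof (step_positive k Hk). specialize (Hhm k Hk). split. apply pow_le; lra. apply pow_incr; lra. Qed.

Lemma norm_scal_pos r (x : V) : 0 <= r -> norm (scal r x) <= r * norm x.
Proof. intros Hr. eapply Rle_trans. apply norm_scal_Rabs. rewrite Rabs_pos_eq; lra. Qed.

(** Only boundedness of the semigroup is used, and one factor h is spent on the sum of the steps. A
    power of h is lost, but no logarithm appears. *)
Lemma drop_sum_crude n theta : (1 <= q)%nat -> (n <= N)%nat -> 0 <= theta -> 0 <= Fbar ->
  norm (drop_sum n theta) <= 2 * M * Fbar * T * hm ^ (q - 1).
Proof.
intros Hq Hn Hth HFb. assert (HM := as_const _ _ _ _ HE).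
refine (Rle_trans _ _ _ (norm_bsum (V := V) _ _) _).
apply Rle_trans with (bsum n (fun k => 2 * M * Fbar * hm ^ (q - 1) * (t (S k) - t k))).
- apply bsum_le. intros k Hk. assert (Hh := step_positive k ltac:(lia)). pose proof (step_pow_bound k ltac:(lia)).
  eapply Rle_trans. apply norm_scal_pos. lra.
  assert (H1 := drop_bound n theta k (F k) Hk Hn Hth). specialize (HF k ltac:(lia)).
  replace q with (S (q - 1)) at 1 by lia. change (t (S k) - t k) with (h k). simpl pow.
  assert (h k ^ (q - 1) <= hm ^ (q - 1)) by (apply pow_incr; specialize (Hhm k ltac:(lia)); lra).
  assert (0 <= h k ^ (q - 1)) by (apply pow_le; lra).
  replace (2 * M * Fbar * hm ^ (q - 1) * h k) with (h k * hm ^ (q - 1) * (2 * M * Fbar)) by ring.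
  apply Rmult_le_compat. apply Rmult_le_pos; lra. apply norm_ge_0. apply Rmult_le_compat_l; lra.
  eapply Rle_trans. exact H1. apply Rmult_le_compat_l; lra.
- rewrite bsum_mult.
  rewrite (bsum_ext n _ (fun k => (- t k) - (- t (S k)))) by (intros; as_R; ring). rewrite (bsum_telescope n (fun k => - t k)).
  assert (t n <= T) by (rewrite <- HtN; mesh_order t N).
  replace (2 * M * Fbar * T * hm ^ (q - 1)) with (2 * M * Fbar * hm ^ (q - 1) * T) by ring.
  apply Rmult_le_compat_l. 2: lra. apply Rmult_le_pos. apply Rmult_le_pos; lra. apply pow_le; lra.
Qed.

(** The k-th difference is controlled by h_(k+1)/a_k. The step ratio replaces h_(k+1) by [rho]
    h_(k+2), so that the quotients become lower Riemann sums of 1/x on adjacent intervals. The last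
    difference, with a = 0, is bounded trivially and gives the 1; the one before has quotient
    exactly 1 and gives the extra [rho]. *)
Lemma drop_sum_log n theta rho hmin : (n <= N)%nat -> 0 <= theta <= 1 -> 0 <= Fbar -> 0 <= rho ->
  (forall k, (S k < N)%nat -> h k <= rho * h (S k)) ->
  0 < hmin -> (forall k, (k < N)%nat -> hmin <= h k) -> hmin <= T ->
  norm (drop_sum n theta) <= 2 * M * Fbar * hm ^ q * (rho * ln (T / hmin) + rho + 1).
Proof.
intros Hn Hth HFb Hrho Hratio Hmin0 Hmin HminT. assert (HM := as_const _ _ _ _ HE).
assert (Hq0 : 0 <= hm ^ q) by (apply pow_le; lra).
assert (HM2 : 0 <= 2 * M * Fbar * hm ^ q). { apply Rmult_le_pos; auto. apply Rmult_le_pos; lra. }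
assert (Hln : 0 <= ln (T / hmin)). { rewrite <- ln_1. apply ln_le_compat. lra. apply Rle_div_r; lra. }
assert (Hterm : forall k, (k < n)%nat -> forall b, norm (semigroup_drop n theta k (F k)) <= 2 * M * Fbar * b -> 0 <= b ->
  norm (scal (h k ^ q) (semigroup_drop n theta k (F k))) <= 2 * M * Fbar * hm ^ q * b).
{ intros k Hk b Hb Hb0. assert (Hp := step_pow_bound k ltac:(lia)). eapply Rle_trans. apply norm_scal_pos. lra.
  replace (2 * M * Fbar * hm ^ q * b) with (hm ^ q * (2 * M * Fbar * b)) by ring.
  apply Rmult_le_compat; try lra. apply norm_ge_0. }
assert (Hinner : forall k, (S k < n)%nat -> norm (semigroup_drop n theta k (F k)) <= 2 * M * Fbar * (rho * (h (S k) / (t n - t (S k))))).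
{ intros k Hk. assert (Hh := step_positive (S k) ltac:(lia)). assert (Hh0 := step_positive k ltac:(lia)).
  assert (t (S (S k)) <= t n) by (mesh_order t N).
  set (a := t n - t (S k)). assert (Ha : 0 < a) by (unfold a, step in *; lra).
  assert (H1 := semigroup_increment VV E AE M HE a (theta * h k) (F k) ltac:(lra) ltac:(nra)).
  unfold semigroup_drop. rewrite norm_minus_sym.
  apply Rmult_le_reg_l with a; auto. eapply Rle_trans. exact H1.
  replace (a * (2 * M * Fbar * (rho * (h (S k) / a)))) with (2 * M * (rho * h (S k)) * Fbar) by (field; lra).
  specialize (Hratio k ltac:(lia)). specialize (HF k ltac:(lia)).
  apply Rmult_le_compat. apply Rmult_le_pos; nra. apply norm_ge_0. apply Rmult_le_compat_l; nra. auto. }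
refine (Rle_trans _ _ _ (norm_bsum (V := V) _ _) _).
destruct n as [|n]. apply Rmult_le_pos; auto. nra.
rewrite bsum_RS.
assert (Hlast : norm (scal (h n ^ q) (semigroup_drop (S n) theta n (F n))) <= 2 * M * Fbar * hm ^ q * 1).
{ apply Hterm. lia. eapply Rle_trans. apply drop_bound; auto; lra. specialize (HF n ltac:(lia)). nra. lra. }
assert (Hrest : bsum n (fun k => norm (scal (h k ^ q) (semigroup_drop (S n) theta k (F k)))) <= 2 * M * Fbar * hm ^ q * (rho * (ln (T / hmin) + 1))).
{ eapply Rle_trans. apply (bsum_le n _ (fun k => 2 * M * Fbar * hm ^ q * (rho * (h (S k) / (t (S n) - t (S k)))))).
  { intros k Hk. apply Hterm. lia. apply Hinner; lia. pose proof (step_positive (S k) ltac:(lia)).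
    assert (t (S (S k)) <= t (S n)) by (mesh_order t N).
    apply Rmult_le_pos; auto. apply Rdiv_le_0_compat. lra. unfold step in *; lra. }
  rewrite bsum_mult. apply Rmult_le_compat_l; auto. rewrite bsum_mult. apply Rmult_le_compat_l; auto.
  destruct n as [|n]. rewrite bsum_R0. lra.
  apply Rplus_le_compat.
  - eapply Rle_trans. apply (bsum_le n _ (fun k => ln (t (S (S n)) - t (S k)) - ln (t (S (S n)) - t (S (S k))))).
    { intros k Hk. assert (t (S (S k)) <= t (S n)) by (mesh_order t N).
    pose proof (step_positive (S k) ltac:(lia)). pose proof (step_positive (S n) ltac:(lia)). unfold step in *.
    eapply Rle_trans. 2: apply ratio_le_ln; lra. right. f_equal. ring. }
    rewrite (bsum_telescope n (fun k => ln (t (S (S n)) - t (S k)))).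
    assert (t 1%nat <= t (S n)) by (mesh_order t N).
    pose proof (step_positive 0 ltac:(lia)). pose proof (Hmin (S n) ltac:(lia)). unfold step in *.
    assert (t (S (S n)) <= T) by (rewrite <- HtN; mesh_order t N).
    rewrite ln_div by lra.
    apply Rplus_le_compat. apply ln_le_compat; lra. apply Ropp_le_contravar, ln_le_compat; lra.
  - right. unfold step. field. pose proof (step_positive (S n) ltac:(lia)). unfold step in *; lra. }
lra.
Qed.

(** The identity sum D_l F_l = S_n F_(n-1) - sum S_(l+1) (F_(l+1) - F_l), with S the partial sums of
    the operators, moves the differences onto the data. *)
Lemma drop_sum_abel n theta B Var : (n <= N)%nat -> 0 <= theta -> 0 <= B -> 0 <= Fbar ->
  (forall k x, (k <= n)%nat -> norm (bsum k (fun l => scal (h l ^ q) (semigroup_drop n theta l x))) <= B * norm x) ->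
  bsum (pred n) (fun k => norm (minus (F (S k)) (F k))) <= Var ->
  norm (drop_sum n theta) <= B * (Fbar + Var).
Proof.
intros Hn Hth HB HFb HS HVar.
set (Sk := fun k x => bsum k (fun l => scal (h l ^ q) (semigroup_drop n theta l x))).
assert (Hlin : forall k x y, (k <= n)%nat -> Sk k (minus x y) = minus (Sk k x) (Sk k y)).
{ intros k x y Hk. etransitivity; [|exact (bsum_minus (V := V) k _ _)]. apply bsum_ext. intros l Hl.
  rewrite (linear_minus _ _ _ (drop_linear n theta l ltac:(lia) Hn Hth)). rmodule (nm VV). }
assert (Habel : forall k, (S k <= n)%nat -> bsum (S k) (fun l => scal (h l ^ q) (semigroup_drop n theta l (F l))) =
   minus (Sk (S k) (F k)) (bsum k (fun l => Sk (S l) (minus (F (S l)) (F l))))).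
{ induction k as [|k IH]; intros Hk.
  - unfold Sk. simpl. rmodule (nm VV).
  - change (bsum (S (S k)) (fun l => scal (h l ^ q) (semigroup_drop n theta l (F l)))) with
    (plus (bsum (S k) (fun l => scal (h l ^ q) (semigroup_drop n theta l (F l)))) (scal (h (S k) ^ q) (semigroup_drop n theta (S k) (F (S k))))).
    rewrite IH by lia.
    change (Sk (S (S k)) (F (S k))) with (plus (Sk (S k) (F (S k))) (scal (h (S k) ^ q) (semigroup_drop n theta (S k) (F (S k))))).
    change (bsum (S k) (fun l => Sk (S l) (minus (F (S l)) (F l)))) with (plus (bsum k (fun l => Sk (S l) (minus (F (S l)) (F l)))) (Sk (S k) (minus (F (S k)) (F k)))).
    rewrite Hlin by lia. rmodule (nm VV). }
destruct n as [|n].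
- rewrite bsum_R0 in HVar. apply Rle_trans with 0. right. exact (norm_zero (V := V)). apply Rmult_le_pos; lra.
- unfold drop_sum. rewrite Habel by lia. refine (Rle_trans _ _ _ (norm_minus_le (V := V) _ _) _).
  assert (H1 : norm (Sk (S n) (F n)) <= B * Fbar). { eapply Rle_trans. apply HS; lia. apply Rmult_le_compat_l. auto. apply HF; lia. }
  assert (H2 : norm (bsum n (fun l => Sk (S l) (minus (F (S l)) (F l)))) <= B * Var).
  { refine (Rle_trans _ _ _ (norm_bsum (V := V) _ _) _). apply Rle_trans with (B * bsum n (fun k => norm (minus (F (S k)) (F k)))).
    rewrite <- bsum_mult. apply bsum_le. intros l Hl. apply HS; lia. apply Rmult_le_compat_l; auto. }
  lra.
Qed.
End Sums.

Lemma bsum_reverse n (f : nat -> R) : bsum n (fun l => f (n - 1 - l)%nat) = bsum n f.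
Proof.
induction n as [|n IH]. reflexivity.
etransitivity. exact (bsum_shift (G := R_AbelianMonoid) n _). rewrite (bsum_RS n f), <- IH.
replace (S n - 1 - 0)%nat with n by lia. etransitivity. exact (Rplus_comm _ _). apply (f_equal2 Rplus); auto.
apply bsum_ext. intros k Hk. f_equal. lia.
Qed.

Lemma bsum_le_more k n (f : nat -> R) : (k <= n)%nat -> (forall l, 0 <= f l) -> bsum k f <= bsum n f.
Proof. intros Hk Hf. induction Hk. lra. rewrite bsum_RS. specialize (Hf m). lra. Qed.

(** * Bounded partial sums of the differences *)

Section PartialSums.
Variable VV : CompleteNormedModule R_AbsRing.
Local Notation V := (nm VV).
Variables (E AE : R -> V -> V) (M : R).
Hypothesis HE : analytic_semigroup V E AE M.
Variables (t : nat -> R) (N : nat).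
Hypothesis Ht0 : t 0%nat = 0.
Hypothesis Hinc : forall k, (k < N)%nat -> t k < t (S k).
Local Notation h k := (step t k).
Local Notation drop := (semigroup_drop VV E t).

Lemma drop_telescope n k x : (k <= n)%nat ->
  bsum k (fun l => drop n 1 l x) = minus (E (t n - t k) x) (E (t n - t 0%nat) x).
Proof.
induction k as [|k IH]; intros Hk. symmetry. exact (minus_eq_zero (G := V) _).
change (plus (bsum k (fun l => drop n 1 l x)) (drop n 1 k x) = minus (E (t n - t (S k)) x) (E (t n - t 0%nat) x)).
rewrite IH by lia. unfold semigroup_drop. replace (t n - t (S k) + 1 * h k) with (t n - t k) by (unfold step; ring). rmodule (nm VV).
Qed.

(** For theta = 1 the sum telescopes. In drop(theta) - theta drop(1) the first-order Taylor terms
    cancel, so at a distance of j steps it is of order 1/j^2 and summable. The constant 18 is 2 from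
    the telescoped part plus 8 times the bound 2 of the sum of inverse squares. *)
Lemma constant_step_partial_sums q h0 n k theta x : 0 < h0 -> (forall l, (l < N)%nat -> h l = h0) ->
  (k <= n)%nat -> (n <= N)%nat -> 0 <= theta <= 1 ->
  norm (bsum k (fun l => scal (h l ^ q) (drop n theta l x))) <= 18 * M * h0 ^ q * norm x.
Proof.
intros Hh0 Hconst Hk Hn Hth. assert (HM := as_const _ _ _ _ HE). assert (Hx := norm_ge_0 x).
assert (Htk : forall l, (l <= N)%nat -> t l = INR l * h0).
{ induction l as [|l IH]; intros Hl. rewrite Ht0. simpl; ring. specialize (Hconst l ltac:(lia)). unfold step in Hconst.
  rewrite S_INR. specialize (IH ltac:(lia)). lra. }
set (r := fun l => minus (drop n theta l x) (scal theta (drop n 1 l x))).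
assert (Hr : forall l, (l < n)%nat -> norm (r l) <= 8 * M * norm x * / (INR (n - 1 - l) + 1) ^ 2).
{ intros l Hl. set (j := (n - 1 - l)%nat).
  destruct (Nat.eq_dec j 0) as [Hj|Hj].
  - rewrite Hj. simpl INR. replace (8 * M * norm x * / (0 + 1) ^ 2) with (8 * M * norm x) by field.
    refine (Rle_trans _ _ _ (norm_minus_le (V := V) _ _) _).
    assert (H1 := drop_bound VV E AE M HE t N Hinc n theta l x Hl Hn ltac:(lra)).
    assert (H2 := drop_bound VV E AE M HE t N Hinc n 1 l x Hl Hn ltac:(lra)).
    assert (H3 := norm_scal_pos VV theta (drop n 1 l x) ltac:(lra)). assert (H4 := norm_ge_0 (drop n 1 l x)).
    assert (theta * norm (drop n 1 l x) <= 2 * M * norm x) by nra. lra.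
  - assert (Ha : t n - t (S l) = INR j * h0). { rewrite !Htk by lia. unfold j. rewrite !minus_INR, S_INR by lia. simpl INR. ring. }
    assert (Hj1 : 1 <= INR j) by (apply (le_INR 1); lia).
    set (a := INR j * h0) in Ha. assert (Hapos : 0 < a) by (unfold a; nra).
    assert (H1 := as_taylor _ _ _ _ HE a (theta * h0) x Hapos ltac:(nra)).
    assert (H2 := as_taylor _ _ _ _ HE a h0 x Hapos ltac:(lra)).
    set (y1 := plus (minus (E (a + theta * h0) x) (E a x)) (scal (theta * h0) (AE a x))) in H1.
    set (y2 := plus (minus (E (a + h0) x) (E a x)) (scal h0 (AE a x))) in H2.
    assert (Heq : r l = minus (scal theta y2) y1).
    { unfold r, semigroup_drop, y1, y2. rewrite Ha, (Hconst l) by lia. rewrite Rmult_1_l. rmodule (nm VV). }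
    rewrite Heq. apply Rmult_le_reg_l with (a ^ 2). apply pow_lt; auto.
    assert (H3 := norm_minus_le (V := V) (scal theta y2) y1).
    assert (H4 := norm_scal_pos VV theta y2 ltac:(lra)). assert (H5 := norm_ge_0 y2).
    change (norm (minus (scal theta y2) y1) <= norm (scal theta y2 : V) + norm y1) in H3.
    assert (H6 : a ^ 2 * norm (minus (scal theta y2) y1) <= a ^ 2 * norm y2 + a ^ 2 * norm y1).
    { rewrite <- Rmult_plus_distr_l. apply Rmult_le_compat_l. apply pow2_ge_0. nra. }
    assert (H7 : M * (theta * h0) ^ 2 * norm x <= M * h0 ^ 2 * norm x).
    { apply Rmult_le_compat_r; auto. apply Rmult_le_compat_l. lra. apply pow_incr. nra. }
    eapply Rle_trans. exact H6.
    apply Rle_trans with (2 * (M * h0 ^ 2 * norm x)). lra.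
    (* The inequality (j + 1)^2 <= 4 j^2 converts 2/j^2 into 8/(j + 1)^2, a form that also covers j
       = 0. *)
    replace (a ^ 2 * (8 * M * norm x * / (INR j + 1) ^ 2)) with (2 * (M * h0 ^ 2 * norm x) * (4 * INR j ^ 2 / (INR j + 1) ^ 2)).
    2:{ unfold a. field. lra. }
    rewrite <- (Rmult_1_r (2 * (M * h0 ^ 2 * norm x))) at 1. apply Rmult_le_compat_l.
    + assert (0 <= h0 ^ 2) by apply pow2_ge_0. apply Rmult_le_pos. lra. apply Rmult_le_pos; auto. apply Rmult_le_pos; lra.
    + apply Rle_div_r; nra. }
assert (Hsum : bsum k (fun l => scal (h l ^ q) (drop n theta l x)) =
  scal (h0 ^ q) (plus (scal theta (bsum k (fun l => drop n 1 l x))) (bsum k r))).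
{ induction k as [|k IH]. simpl. rmodule (nm VV).
  change (plus (bsum k (fun l => scal (h l ^ q) (drop n theta l x))) (scal (h k ^ q) (drop n theta k x)) =
    scal (h0 ^ q) (plus (scal theta (plus (bsum k (fun l => drop n 1 l x)) (drop n 1 k x))) (plus (bsum k r) (r k)))).
  rewrite IH, Hconst by lia. unfold r. rmodule (nm VV). }
assert (Hr2 : norm (bsum k r) <= 16 * M * norm x).
{ refine (Rle_trans _ _ _ (norm_bsum (V := V) _ _) _).
  apply Rle_trans with (bsum k (fun l => 8 * M * norm x * / (INR (n - 1 - l) + 1) ^ 2)). apply bsum_le. intros l Hl. apply Hr. lia.
  rewrite bsum_mult. assert (H0 : 0 <= M * norm x) by (apply Rmult_le_pos; lra).
  assert (H1 : bsum k (fun l => / (INR (n - 1 - l) + 1) ^ 2) <= 2).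
  { eapply Rle_trans. apply (bsum_le_more k n). auto. intros l. left. apply Rinv_0_lt_compat, pow_lt. pose proof (pos_INR (n - 1 - l)). lra.
    rewrite (bsum_reverse n (fun j => / (INR j + 1) ^ 2)). apply bsum_inv_square. }
  nra. }
assert (Ht : norm (bsum k (fun l => drop n 1 l x)) <= 2 * M * norm x).
{ rewrite drop_telescope by auto. refine (Rle_trans _ _ _ (norm_minus_le (V := V) _ _) _).
  assert (t k <= t n) by (mesh_order t N). assert (t 0%nat <= t k) by (mesh_order t N).
  pose proof (as_bound _ _ _ _ HE (t n - t k) x ltac:(lra)). pose proof (as_bound _ _ _ _ HE (t n - t 0%nat) x ltac:(lra)).
  lra. }
rewrite Hsum. assert (Hq : 0 <= h0 ^ q) by (apply pow_le; lra).
eapply Rle_trans. apply (norm_scal_pos VV). auto.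
replace (18 * M * h0 ^ q * norm x) with (h0 ^ q * (18 * M * norm x)) by ring. apply Rmult_le_compat_l; auto.
refine (Rle_trans _ _ _ (norm_triangle (V := V) _ _) _).
assert (H1 := norm_scal_pos VV theta (bsum k (fun l => drop n 1 l x)) ltac:(lra)).
assert (H2 := norm_ge_0 (bsum k (fun l => drop n 1 l x) : V)).
assert (theta * norm (bsum k (fun l => drop n 1 l x) : V) <= 2 * M * norm x) by nra.
lra.
Qed.

Section InnerProduct.
Variable rip : V -> V -> R.
Hypothesis rip_plus : forall x y z, rip (plus x y) z = rip x z + rip y z.
Hypothesis rip_scal : forall r x y, rip (scal r x) y = r * rip x y.
Hypothesis rip_sym : forall x y, rip x y = rip y x.
Hypothesis rip_norm : forall x, rip x x = norm x ^ 2.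
Hypothesis rip_E : forall r x y, 0 <= r -> rip (E r x) y = rip x (E r y).

Lemma rip_minus x y z : rip (minus x y) z = rip x z - rip y z.
Proof.
replace (minus x y) with (plus x (scal (-1) y)) by rmodule (nm VV). rewrite rip_plus, rip_scal. ring.
Qed.

Lemma rip_minus_r x y z : rip z (minus x y) = rip z x - rip z y.
Proof. rewrite rip_sym, rip_minus, !(rip_sym z). reflexivity. Qed.

Lemma rip_young x y : rip x y <= (norm x ^ 2 + norm y ^ 2) / 2.
Proof.
assert (H := pow2_ge_0 (norm (minus x y))). rewrite <- rip_norm, rip_minus, !rip_minus_r, (rip_sym y x), !rip_norm in H. lra.
Qed.

Lemma symmetric_square r x : 0 <= r -> rip (E r x) x = norm (E (r / 2) x) ^ 2.
Proof.
intros Hr. rewrite <- rip_norm, <- rip_E by lra. rewrite <- (as_add _ _ _ _ HE) by lra.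
replace (r / 2 + r / 2) with r by field. reflexivity.
Qed.

(** |E(r)x|^2 = <E(2r)x, x> <= (|E(2r)x|^2 + |x|^2)/2: every doubling of the time halves the excess
    over |x|^2, so the constant M improves to 1. *)
Lemma symmetric_contraction r x : 0 <= r -> norm (E r x) <= norm x.
Proof.
intros Hr.
assert (H : forall n r x, 0 <= r -> norm (E r x) ^ 2 <= (1 + M ^ 2 / 2 ^ n) * norm x ^ 2).
{ induction n as [|n IH]; intros r' x' Hr'; assert (Hx := norm_ge_0 x').
  - assert (H1 := as_bound _ _ _ _ HE r' x' Hr'). pose proof (norm_ge_0 (E r' x')).
    nra.
  - replace r' with (2 * r' / 2) at 1 by field. rewrite <- symmetric_square by lra.
    eapply Rle_trans. apply rip_young. specialize (IH (2 * r') x' ltac:(lra)).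
    assert (0 < 2 ^ n) by (apply pow_lt; lra).
    replace (M ^ 2 / 2 ^ S n) with (M ^ 2 / 2 ^ n / 2) by (simpl; field; lra). nra. }
assert (H2 : norm (E r x) ^ 2 <= norm x ^ 2).
{ apply norm_bound_limit. intros eps He.
  destruct (pow_lt_1_zero (/ 2)) with (y := eps / (M ^ 2 * norm x ^ 2 + 1)) as [n Hn].
  rewrite Rabs_pos_eq; lra. apply Rdiv_lt_0_compat; nra.
  specialize (Hn n (le_n _)). rewrite Rabs_pos_eq in Hn by (apply pow_le; lra). rewrite pow_inv in Hn.
  specialize (H n r x Hr). assert (Hp := pow2_ge_0 (M * norm x)).
  apply (Rmult_lt_compat_r (M ^ 2 * norm x ^ 2 + 1)) in Hn; [|lra].
  replace (eps / (M ^ 2 * norm x ^ 2 + 1) * (M ^ 2 * norm x ^ 2 + 1)) with eps in Hn by (field; lra).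
  nra. }
apply Rnot_lt_le. intros Hlt. pose proof (norm_ge_0 x). nra.
Qed.

(** E(a) - E(b) = E(a/2)(I - E(b - a))E(a/2), and contractivity makes the middle factor positive. *)
Lemma symmetric_decreasing a b x : 0 <= a <= b -> 0 <= rip (minus (E a x) (E b x)) x.
Proof.
intros Hab. rewrite rip_minus, !symmetric_square by lra.
replace (b / 2) with ((b - a) / 2 + a / 2) by field. rewrite (as_add _ _ _ _ HE) by lra.
assert (H := symmetric_contraction ((b - a) / 2) (E (a / 2) x) ltac:(lra)).
pose proof (norm_ge_0 (E ((b - a) / 2) (E (a / 2) x))). nra.
Qed.

Lemma rip_bsum k (f : nat -> V) y : rip (bsum k f) y = bsum k (fun l => rip (f l) y).
Proof.
induction k as [|k IH]. simpl. replace (@zero V) with (scal 0 y) by rmodule (nm VV). rewrite rip_scal, Rmult_0_l. reflexivity.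
rewrite bsum_RS, <- IH. apply rip_plus.
Qed.

(** The differences are positive symmetric operators, so weights between 0 and cm affect the
    quadratic form only by the factor cm. Each form at theta is at most the one at theta = 1, and
    the latter telescope to at most |y|^2. Positivity bounds the mixed terms, and y = S x / cm turns
    the bound on the form into one on the norm. *)
Lemma symmetric_partial_sums q cm n k theta x : 0 < cm -> (forall l, (l < N)%nat -> 0 <= h l ^ q <= cm) ->
  (k <= n)%nat -> (n <= N)%nat -> 0 <= theta <= 1 ->
  norm (bsum k (fun l => scal (h l ^ q) (drop n theta l x))) <= cm * norm x.
Proof.
intros Hcm Hc Hk Hn Hth.
assert (Hpos : forall l, (l < n)%nat -> 0 <= t n - t (S l) /\ 0 < h l).
{ intros l Hl. assert (t (S l) <= t n) by (mesh_order t N). specialize (Hinc l ltac:(lia)). unfold step. lra. }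
assert (Hdiag : forall y, bsum k (fun l => rip (drop n theta l y) y) <= norm y ^ 2).
{ intros y. apply Rle_trans with (bsum k (fun l => rip (drop n 1 l y) y)).
  - apply bsum_le. intros l Hl. destruct (Hpos l ltac:(lia)). unfold semigroup_drop.
    assert (H1 := symmetric_decreasing (t n - t (S l) + theta * h l) (t n - t (S l) + 1 * h l) y ltac:(nra)).
    rewrite rip_minus in *. rewrite rip_minus. lra.
  - rewrite <- rip_bsum, drop_telescope, rip_minus by auto.
    assert (t k <= t n) by (mesh_order t N). assert (t 0%nat <= t k) by (mesh_order t N).
    rewrite !symmetric_square by lra.
    pose proof (symmetric_contraction ((t n - t k) / 2) y ltac:(lra)). pose proof (norm_ge_0 (E ((t n - t k) / 2) y)).
    nra. }
assert (Hnn : forall l y, (l < n)%nat -> 0 <= rip (drop n theta l y) y).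
{ intros l y Hl. destruct (Hpos l Hl). apply symmetric_decreasing. nra. }
assert (Hsym : forall l y z, (l < n)%nat -> rip (drop n theta l y) z = rip y (drop n theta l z)).
{ intros l y z Hl. destruct (Hpos l Hl). unfold semigroup_drop. rewrite rip_minus, rip_minus_r, !rip_E by nra. reflexivity. }
assert (Hcs : forall l y z, (l < n)%nat -> rip (drop n theta l y) z <= (rip (drop n theta l y) y + rip (drop n theta l z) z) / 2).
{ intros l y z Hl. assert (H1 := Hnn l (minus y z) Hl).
  rewrite (linear_minus _ _ _ (drop_linear VV E AE M HE t N Hinc n theta l Hl Hn ltac:(lra))) in H1.
  rewrite rip_minus, !rip_minus_r in H1. rewrite (Hsym l z y Hl), (rip_sym z) in H1. lra. }
set (Sx := bsum k (fun l => scal (h l ^ q) (drop n theta l x))).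
assert (Hform : forall y, rip Sx y <= cm / 2 * (norm x ^ 2 + norm y ^ 2)).
{ intros y. unfold Sx. rewrite rip_bsum.
  apply Rle_trans with (bsum k (fun l => cm / 2 * (rip (drop n theta l x) x + rip (drop n theta l y) y))).
  - apply bsum_le. intros l Hl. rewrite rip_scal. specialize (Hc l ltac:(lia)).
    pose proof (Hcs l x y ltac:(lia)). pose proof (Hnn l x ltac:(lia)). pose proof (Hnn l y ltac:(lia)). nra.
  - rewrite bsum_mult. apply Rmult_le_compat_l. lra. rewrite (bsum_plus (G := R_AbelianMonoid)).
    apply Rplus_le_compat; apply Hdiag. }
specialize (Hform (scal (/ cm) Sx)). rewrite rip_sym, rip_scal, rip_norm in Hform.
assert (Hn2 : norm (scal (/ cm) Sx) ^ 2 = (/ cm) ^ 2 * norm Sx ^ 2).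
{ rewrite <- !rip_norm, rip_scal, rip_sym, rip_scal. ring. }
rewrite Hn2 in Hform.
assert (norm Sx ^ 2 <= (cm * norm x) ^ 2).
{ apply (Rmult_le_compat_l (2 * cm)) in Hform; [|lra].
  replace (2 * cm * (/ cm * norm Sx ^ 2)) with (2 * norm Sx ^ 2) in Hform by (field; lra).
  replace (2 * cm * (cm / 2 * (norm x ^ 2 + (/ cm) ^ 2 * norm Sx ^ 2))) with (cm ^ 2 * norm x ^ 2 + norm Sx ^ 2) in Hform by (field; lra).
  lra. }
apply Rnot_lt_le. intros Hlt. pose proof (norm_ge_0 x). assert (0 <= cm * norm x) by (apply Rmult_le_pos; lra).
nra.
Qed.
End InnerProduct.
End PartialSums.

(** * Symmetry of the semigroup for a self-adjoint generator *)

Section Hilbert.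
Variables (X : CompleteNormedModule C_AbsRing) (A : unbounded_operator X) (eA : R -> X -> X) (M : R).
Local Notation V := (nm (realify X)).
Local Notation AE := (fun t x => op A (eA t x)).
Hypothesis HE : analytic_semigroup V eA AE M.
Hypothesis hgen : semigroup_generated_by_opp A eA.

(** The Taylor estimate yields the limit of the difference quotient at E(r)x, and the
    characterization of the generator turns this limit into membership in the domain. *)
Lemma analytic_semigroup_dom r x : 0 < r -> dom A (eA r x).
Proof.
intros Hr. destruct hgen as [_ [_ [_ [_ G5]]]].
apply (proj2 (G5 (eA r x) (opp (op A (eA r x))))).
assert (HM := as_const _ _ _ _ HE). assert (Hx := norm_ge_0 (x : V)).
apply (filterlim_norm (V := V) (at_right 0)). intros eps He. apply at_right_0.
set (Cst := M * norm (x : V) / r ^ 2 + 1).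
assert (HC : 0 < Cst). { unfold Cst. assert (0 <= M * norm (x : V) / r ^ 2). apply Rdiv_le_0_compat. nra. apply pow_lt; lra. lra. }
exists (eps / Cst). split. apply Rdiv_lt_0_compat; lra. intros q Hq.
assert (H := as_taylor _ _ _ _ HE r q x Hr ltac:(lra)).
assert (Heq : minus (scal (/ q) (minus (eA q (eA r x) : V) (eA r x : V) : V) : V) (opp (op A (eA r x) : V) : V) =
  scal (/ q) (plus (minus (eA (r + q) x : V) (eA r x : V) : V) (scal q (op A (eA r x) : V)))).
{ rewrite <- (as_add _ _ _ _ HE) by lra. rewrite (Rplus_comm q r).
  rmodule (nm (realify X)). }
change (norm (minus (scal (/ q) (minus (eA q (eA r x) : V) (eA r x : V) : V) : V) (opp (op A (eA r x) : V) : V)) < eps).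
rewrite Heq. eapply Rle_lt_trans. apply (norm_scal_pos (realify X)). left; apply Rinv_0_lt_compat; lra.
match goal with |- / q * norm ?z < _ => set (zz := z); change (r ^ 2 * norm zz <= M * q ^ 2 * norm (x : V)) in H end.
assert (Hz : norm zz <= Cst * q ^ 2).
{ apply Rmult_le_reg_l with (r ^ 2). apply pow_lt; lra. eapply Rle_trans. exact H. unfold Cst.
  replace (r ^ 2 * ((M * norm (x : V) / r ^ 2 + 1) * q ^ 2)) with (M * q ^ 2 * norm (x : V) + r ^ 2 * q ^ 2) by (field; lra).
  assert (0 <= r ^ 2 * q ^ 2) by (apply Rmult_le_pos; apply pow2_ge_0). lra. }
apply Rle_lt_trans with (/ q * (Cst * q ^ 2)). apply Rmult_le_compat_l; auto. left; apply Rinv_0_lt_compat; lra.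
replace (/ q * (Cst * q ^ 2)) with (q * Cst) by (field; lra). destruct Hq as [_ Hq]. apply Rlt_div_r in Hq; lra.
Qed.

Variable ip : X -> X -> C.
Hypothesis Hip : hilbert_product X ip.
Hypothesis HA : self_adjoint X ip A.

(** The norm estimates for the sums live over real scalars; the real part of the inner product
    induces the same norm. *)
Definition real_product (x y : V) : R := Re (ip x y).

Lemma real_product_plus x y z : real_product (plus x y) z = real_product x z + real_product y z.
Proof. destruct Hip as [H1 _]. etransitivity. apply (f_equal Re), H1. reflexivity. Qed.

Lemma real_product_scal r x y : real_product (scal r x) y = r * real_product x y.
Proof.
unfold real_product. destruct Hip as [_ [H2 _]]. etransitivity. apply (f_equal Re), (H2 (RtoC r)). unfold Re, Cmult, RtoC; simpl. as_R. ring.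
Qed.

Lemma real_product_sym x y : real_product x y = real_product y x.
Proof. unfold real_product. destruct Hip as [_ [_ [H3 _]]]. rewrite (H3 y x). reflexivity. Qed.

Lemma real_product_norm x : real_product x x = norm x ^ 2.
Proof. unfold real_product. destruct Hip as [_ [_ [_ H4]]]. rewrite H4. reflexivity. Qed.

Let rp_minus := rip_minus (realify X) real_product real_product_plus real_product_scal.
Let rp_minus_r := rip_minus_r (realify X) real_product real_product_plus real_product_scal real_product_sym.

Lemma real_product_cauchy_schwarz x y : Rabs (real_product x y) <= norm x * norm y.
Proof.
assert (H : forall x y, real_product x y <= norm x * norm y).
{ clear x y. intros x y. pose proof (norm_ge_0 x). pose proof (norm_ge_0 y).
  destruct (Req_dec (norm x) 0) as [Hx|Hx].
  { apply norm_eq_zero in Hx. subst. replace (@zero V) with (scal 0 y) at 1 by rmodule (nm (realify X)). rewrite real_product_scal. nra. }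
  destruct (Req_dec (norm y) 0) as [Hy|Hy].
  { apply norm_eq_zero in Hy. subst. rewrite real_product_sym. replace (@zero V) with (scal 0 x) at 1 by rmodule (nm (realify X)). rewrite real_product_scal. nra. }
  assert (H1 := pow2_ge_0 (norm (minus (scal (norm y) x) (scal (norm x) y)))).
  rewrite <- real_product_norm, rp_minus, !rp_minus_r, !real_product_scal in H1.
  rewrite !(real_product_sym _ (scal _ _)), !real_product_scal, (real_product_sym y x), !real_product_norm in H1.
  assert (0 < norm x * norm y) by (apply Rmult_lt_0_compat; lra). nra. }
unfold Rabs. destruct Rcase_abs. 2: apply H.
replace (- real_product x y) with (real_product (scal (-1) x) y) by (rewrite real_product_scal; ring).
eapply Rle_trans. apply H. apply Rmult_le_compat_r. apply norm_ge_0.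
assert (H1 := norm_opp x). replace (scal (-1) x) with (opp x) by rmodule (nm (realify X)). lra.
Qed.

Lemma generator_symmetric r q x y : 0 < r -> 0 < q ->
  real_product (AE r x) (eA q y) = real_product (eA r x) (AE q y).
Proof.
intros Hr Hq. unfold real_product. f_equal.
apply (proj1 (HA (eA q y) (op A (eA q y)))). split; auto. now apply analytic_semigroup_dom. now apply analytic_semigroup_dom.
Qed.

(* [r -> <exp(-rA) x, exp(-(t-r)A) y>] has zero derivative since A is symmetric. *)
Lemma semigroup_symmetric t x y : 0 <= t -> real_product (eA t x) y = real_product x (eA t y).
Proof.
intros Ht. assert (HM := as_const _ _ _ _ HE).
assert (Hx := norm_ge_0 (x : V)). assert (Hy := norm_ge_0 (y : V)).
set (P := fun r => real_product (eA r x) (eA (t - r) y)).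
destruct (Req_dec t 0) as [->|Ht0]. now rewrite !(as_zero _ _ _ _ HE).
(* On [r0, t - r0] both factors stay away from time 0, where the Taylor estimate degenerates; r0 ->
   0 follows at the end. *)
assert (Hmid : forall r0, 0 < r0 <= t / 2 -> P (t - r0) = P r0).
{ intros r0 Hr0. set (B := 2 * M ^ 2 * norm (x : V) * norm (y : V) / r0 ^ 2 + 1).
  assert (HB0 : 0 <= 2 * M ^ 2 * norm (x : V) * norm (y : V) / r0 ^ 2).
  { apply Rdiv_le_0_compat. 2: apply pow_lt; lra. apply Rmult_le_pos; auto. apply Rmult_le_pos; auto. nra. }
  assert (Hquad : forall r q, r0 <= r -> 0 <= q -> r0 <= t - (r + q) -> Rabs (P (r + q) - P r) <= B * q ^ 2).
  { intros r q Hr Hq Hw. unfold P. set (w := t - (r + q)) in *. replace (t - r) with (w + q) by (unfold w; ring).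
    assert (H1 := as_taylor _ _ _ _ HE r q x ltac:(lra) Hq). assert (H2 := as_taylor _ _ _ _ HE w q y ltac:(lra) Hq).
    set (d1 := plus (minus (eA (r + q) x : V) (eA r x : V) : V) (scal q (op A (eA r x) : V))) in H1.
    set (d2 := plus (minus (eA (w + q) y : V) (eA w y : V) : V) (scal q (op A (eA w y) : V))) in H2.
    (* The first-order terms q <A E(r)x, E(w)y> and q <E(r)x, A E(w)y> cancel by
       [generator_symmetric], which leaves remainders of order q^2. *)
    assert (Hd : real_product (eA (r + q) x) (eA w y) - real_product (eA r x) (eA (w + q) y) =
    real_product d1 (eA w y) - real_product (eA r x) d2).
    { unfold d1, d2. rewrite (real_product_sym (eA r x) (plus _ _)).
    rewrite !real_product_plus, !rp_minus, !real_product_scal.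
    rewrite !(real_product_sym _ (eA r x)). rewrite (generator_symmetric r w x y) by lra. ring. }
    rewrite Hd. assert (C1 := real_product_cauchy_schwarz d1 (eA w y)). assert (C2 := real_product_cauchy_schwarz (eA r x) d2).
    assert (B1 := as_bound _ _ _ _ HE w y ltac:(lra)). assert (B2 := as_bound _ _ _ _ HE r x ltac:(lra)).
    assert (Hdd : forall (d z : V) a, r0 <= a -> a ^ 2 * norm d <= M * q ^ 2 * norm z -> norm d <= M * q ^ 2 * norm z / r0 ^ 2).
    { intros d z a Ha Hdz. apply Rle_div_r. apply pow_lt; lra. eapply Rle_trans. 2: exact Hdz. rewrite Rmult_comm.
    apply Rmult_le_compat_r. apply norm_ge_0. apply pow_incr; lra. }
    assert (D1 := Hdd d1 x r Hr H1). assert (D2 := Hdd d2 y w Hw H2).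
    assert (E1 : norm d1 * norm (eA w y : V) <= M * q ^ 2 * norm (x : V) / r0 ^ 2 * (M * norm (y : V))) by (apply Rmult_le_compat; auto; apply norm_ge_0).
    assert (E2 : norm (eA r x : V) * norm d2 <= (M * norm (x : V)) * (M * q ^ 2 * norm (y : V) / r0 ^ 2)) by (apply Rmult_le_compat; auto; apply norm_ge_0).
    assert (Hsum : B * q ^ 2 = M * q ^ 2 * norm (x : V) / r0 ^ 2 * (M * norm (y : V)) + (M * norm (x : V)) * (M * q ^ 2 * norm (y : V) / r0 ^ 2) + q ^ 2).
    { unfold B. field. lra. }
    pose proof (pow2_ge_0 q).
    eapply Rle_trans. apply Rabs_triang. rewrite Rabs_Ropp. lra. }
  apply (eq_of_norm_minus (V := R_NormedModule)). intros eps He.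
  assert (Hst := straddle_bound (V := R_NormedModule) P (fun r => eps / t * r) r0 (t - r0) ltac:(lra)).
  eapply Rle_trans. apply Hst.
  - intros r Hr. exists (eps / t / B / 2). split. repeat apply Rdiv_lt_0_compat; unfold B; lra.
    intros a b Ha Hb Hra Hrb.
    replace b with (a + (b - a)) at 1 by ring. eapply Rle_trans. apply Hquad; lra.
    assert (Hba : (b - a) * B <= eps / t). { apply Rle_div_r. unfold B; lra. lra. }
    nra.
  - replace (eps / t * (t - r0) - eps / t * r0) with (eps * ((t - 2 * r0) / t)) by (field; lra).
    rewrite <- (Rmult_1_r eps) at 2. apply Rmult_le_compat_l. lra. apply Rle_div_l; lra. }
assert (Hcs2 : forall a b a' b' : V, Rabs (real_product a b - real_product a' b') <= norm (minus a a') * norm b + norm a' * norm (minus b b')).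
{ intros a b a' b'. replace (real_product a b - real_product a' b') with (real_product (minus a a') b + real_product a' (minus b b')).
  eapply Rle_trans. apply Rabs_triang. apply Rplus_le_compat; apply real_product_cauchy_schwarz. rewrite rp_minus, rp_minus_r. ring. }
apply (eq_of_norm_minus (V := R_NormedModule)). intros eps He.
set (b := eps / (8 * M * (norm (x : V) + norm (y : V) + 1))).
assert (Hb : 0 < b) by (unfold b; apply Rdiv_lt_0_compat; nra).
destruct (as_continuous _ _ _ _ HE x t b Ht Hb) as [e1 [He1 K1]]. destruct (as_continuous _ _ _ _ HE y t b Ht Hb) as [e2 [He2 K2]].
destruct (as_continuous _ _ _ _ HE x 0 b ltac:(lra) Hb) as [e3 [He3 K3]]. destruct (as_continuous _ _ _ _ HE y 0 b ltac:(lra) Hb) as [e4 [He4 K4]].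
set (r0 := Rmin (t / 2) (Rmin (Rmin e1 e2) (Rmin e3 e4) / 2)).
assert (Hr0 : 0 < r0 <= t / 2 /\ r0 < e1 /\ r0 < e2 /\ r0 < e3 /\ r0 < e4).
{ assert (0 < Rmin (Rmin e1 e2) (Rmin e3 e4)) by (repeat apply Rmin_pos; auto).
  Rmin_bounds (Rmin e1 e2) (Rmin e3 e4).
  Rmin_bounds e1 e2. Rmin_bounds e3 e4.
  Rmin_bounds (t / 2) (Rmin (Rmin e1 e2) (Rmin e3 e4) / 2).
  assert (0 < r0) by (apply Rmin_pos; lra). fold r0 in H6, H7. repeat split; lra. }
destruct Hr0 as [Hr0 [L1 [L2 [L3 L4]]]]. specialize (Hmid r0 Hr0). unfold P in Hmid. replace (t - (t - r0)) with r0 in Hmid by ring.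
specialize (K1 (t - r0) ltac:(lra)). specialize (K2 (t - r0) ltac:(lra)). specialize (K3 r0 ltac:(lra)). specialize (K4 r0 ltac:(lra)).
rewrite Rabs_left in K1, K2 by lra. rewrite Rabs_pos_eq in K3, K4 by lra. rewrite (as_zero _ _ _ _ HE) in K3, K4.
specialize (K1 ltac:(lra)). specialize (K2 ltac:(lra)). specialize (K3 ltac:(lra)). specialize (K4 ltac:(lra)).
assert (F1 := Hcs2 (eA (t - r0) x) (eA r0 y) (eA t x) y). assert (F2 := Hcs2 (eA r0 x) (eA (t - r0) y) x (eA t y)).
assert (B1 := as_bound _ _ _ _ HE r0 y ltac:(lra)). assert (B2 := as_bound _ _ _ _ HE t x ltac:(lra)).
assert (B3 := as_bound _ _ _ _ HE (t - r0) y ltac:(lra)).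
change (Rabs (real_product (eA t x) y - real_product x (eA t y)) <= eps).
replace (real_product (eA t x) y - real_product x (eA t y)) with
  (- (real_product (eA (t - r0) x) (eA r0 y) - real_product (eA t x) y) + (real_product (eA r0 x) (eA (t - r0) y) - real_product x (eA t y))) by (rewrite Hmid; ring).
eapply Rle_trans. apply Rabs_triang. rewrite Rabs_Ropp.
assert (G : forall (u v : V) c, norm u < b -> norm v <= c -> norm u * norm v <= b * c).
{ intros u v c Hu Hv. apply Rmult_le_compat; auto; try apply norm_ge_0. lra. }
assert (G1 := G _ _ _ K1 B1). assert (G2 := G _ _ _ K4 B2). assert (G3 := G _ _ _ K3 B3).
assert (G4 := G _ _ _ K2 (Rle_refl (norm (x : V)))).
assert (Hfin : b * (8 * M * (norm (x : V) + norm (y : V) + 1)) = eps) by (unfold b; field; nra).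
assert (b * norm (x : V) <= b * (M * norm (x : V))) by (apply Rmult_le_compat_l; nra).
assert (0 <= b * M) by nra.
lra.
Qed.
End Hilbert.

(* [f] is a polynomial function of degree less than [n]; the arbitrary centre makes division by a root immediate. *)
Fixpoint deg_lt (n : nat) (f : R -> R) : Prop :=
  match n with
  | O => forall x, f x = 0
  | S n' => forall a, exists g, deg_lt n' g /\ forall x, f x = f a + (x - a) * g x
  end.

Lemma deg_lt_ext n f g : (forall x, f x = g x) -> deg_lt n f -> deg_lt n g.
Proof.
intros H. destruct n; simpl. intros Hf x. now rewrite <- H.
intros Hf a. destruct (Hf a) as [q [H1 H2]]. exists q. split; auto. intros x. rewrite <- !H. apply H2.
Qed.

Lemma deg_lt_lin n f g u v : deg_lt n f -> deg_lt n g -> deg_lt n (fun x => u * f x + v * g x).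
Proof.
revert f g. induction n as [|n IH]; simpl; intros f g Hf Hg. intros x. rewrite Hf, Hg. ring.
intros a. destruct (Hf a) as [f' [H1 H2]]. destruct (Hg a) as [g' [H3 H4]].
exists (fun x => u * f' x + v * g' x). split; auto. intros x. rewrite H2, (H4 x). ring.
Qed.

Lemma deg_lt_S n f : deg_lt n f -> deg_lt (S n) f.
Proof.
revert f. induction n as [|n IH]; intros f Hf a.
- exists (fun _ => 0). simpl in *. split; auto. intros x. rewrite !Hf. ring.
- destruct (Hf a) as [g [H1 H2]]. exists g. auto.
Qed.

Lemma deg_lt_const u : deg_lt 1 (fun _ => u).
Proof. intros a. exists (fun _ => 0). split. simpl; auto. intros; ring. Qed.

Lemma deg_lt_mult n f a b : deg_lt n f -> deg_lt (S n) (fun x => (a * x + b) * f x).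
Proof.
intros Hf c. destruct n as [|n].
- exists (fun _ => 0). simpl in *. split; auto. intros x. rewrite !Hf. ring.
- destruct (Hf c) as [g [H1 H2]]. exists (fun x => a * f x + (a * c + b) * g x). split.
  apply deg_lt_lin; auto. now apply deg_lt_S. intros x. rewrite (H2 x). ring.
Qed.

Lemma deg_lt_pow k : deg_lt (S k) (fun x => x ^ k).
Proof.
induction k as [|k IH]. exact (deg_lt_const 1).
apply (deg_lt_ext _ (fun x => (1 * x + 0) * x ^ k)). intros; simpl; ring. now apply deg_lt_mult.
Qed.

Lemma deg_lt_le n k f : (n <= k)%nat -> deg_lt n f -> deg_lt k f.
Proof. induction 1; auto. intros Hf. now apply deg_lt_S, IHle. Qed.

Lemma deg_lt_bsum n q (f : nat -> R -> R) : (forall i, (i < q)%nat -> deg_lt n (f i)) -> deg_lt n (fun x => bsum q (fun i => f i x)).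
Proof.
induction q as [|q IH]; intros H.
- apply (deg_lt_le 0). lia. intros x. apply bsum_R0.
- apply (deg_lt_ext _ (fun x => 1 * bsum q (fun i => f i x) + 1 * f q x)). intros x. rewrite bsum_RS. ring.
  apply deg_lt_lin; auto.
Qed.

Lemma deg_lt_roots n f (c : nat -> R) : deg_lt n f -> (forall i, (i < n)%nat -> f (c i) = 0) ->
  (forall i j, (i < n)%nat -> (j < n)%nat -> i <> j -> c i <> c j) -> forall x, f x = 0.
Proof.
revert f. induction n as [|n IH]; intros f Hf Hr Hd x. apply Hf.
destruct (Hf (c n)) as [g [H1 H2]]. rewrite H2, Hr by lia. rewrite (IH g); auto. ring.
intros i Hi. specialize (H2 (c i)). rewrite !Hr in H2 by lia. specialize (Hd i n ltac:(lia) ltac:(lia) ltac:(lia)).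
apply Rmult_eq_reg_l with (c i - c n); lra.
Qed.

(** * Lagrange interpolation *)

Section Lagrange.
Variables (s : nat) (c : nat -> R).
Hypothesis Hs : (1 <= s)%nat.
Hypothesis Hdist : forall i j, (i < s)%nat -> (j < s)%nat -> i <> j -> c i <> c j.

(** A partial product gains one degree per factor except at the skipped index j; the conditional in
    [H] records whether that index has been passed. *)
Lemma lagrange_deg j : (j < s)%nat -> deg_lt s (lagrange s c j).
Proof.
intros Hj.
assert (H : forall n, deg_lt (S n + if le_dec j n then 0 else 1)%nat (fun x => prod_f_R0 (fun q => if Nat.eqb q j then 1 else (x - c q) / (c j - c q)) n)).
{ induction n as [|n IH]; simpl prod_f_R0.
  - destruct (le_dec j 0) as [h|h].
    + replace j with 0%nat by lia. apply deg_lt_const.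
    + destruct j as [|j]. lia. apply (deg_lt_ext _ (fun x => (/ (c (S j) - c 0%nat) * x + - c 0%nat / (c (S j) - c 0%nat)) * 1)).
    intros; unfold Rdiv; ring. apply deg_lt_mult, deg_lt_const.
  - change (match j with 0%nat => false | S m' => Nat.eqb n m' end) with (Nat.eqb (S n) j).
    destruct (Nat.eqb_spec (S n) j) as [h|h].
    + destruct (le_dec j n); [lia|]. destruct (le_dec j (S n)); [|lia].
    replace (S (S n) + 0)%nat with (S n + 1)%nat by lia. eapply deg_lt_ext. 2: exact IH. intros; simpl; ring.
    + replace (S (S n) + (if le_dec j (S n) then 0 else 1))%nat with (S (S n + if le_dec j n then 0 else 1)).
    2:{ destruct (le_dec j n), (le_dec j (S n)); lia. }
    eapply deg_lt_ext. 2: exact (deg_lt_mult _ _ (/ (c j - c (S n))) (- c (S n) / (c j - c (S n))) IH).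
    intros x. unfold Rdiv. ring. }
specialize (H (pred s)). destruct (le_dec j (pred s)); [|lia]. replace (S (pred s) + 0)%nat with s in H by lia. exact H.
Qed.

Lemma lagrange_node_same j : (j < s)%nat -> lagrange s c j (c j) = 1.
Proof.
intros Hj.
assert (H : forall n, (n < s)%nat -> prod_f_R0 (fun q => if Nat.eqb q j then 1 else (c j - c q) / (c j - c q)) n = 1).
{ assert (H1 : forall q, (q < s)%nat -> (if Nat.eqb q j then 1 else (c j - c q) / (c j - c q)) = 1).
  { intros q Hq. destruct (Nat.eqb_spec q j); auto. field. specialize (Hdist q j Hq Hj n). lra. }
  induction n as [|n IH]; intros Hn. apply H1; lia.
  etransitivity. exact (f_equal2 Rmult (IH ltac:(lia)) (H1 (S n) Hn)). ring. }
apply H. lia.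
Qed.

Lemma lagrange_node_other j k : (k < s)%nat -> k <> j -> lagrange s c j (c k) = 0.
Proof.
intros Hk Hkj.
assert (H : forall n, (k <= n)%nat -> prod_f_R0 (fun q => if Nat.eqb q j then 1 else (c k - c q) / (c j - c q)) n = 0).
{ assert (H1 : (if Nat.eqb k j then 1 else (c k - c k) / (c j - c k)) = 0).
  { destruct (Nat.eqb_spec k j); [lia|]. unfold Rdiv; ring. }
  induction n as [|n IH]; intros Hn. assert (k = 0%nat) by lia. subst k. apply H1.
  destruct (Nat.eq_dec k (S n)) as [->|h].
  etransitivity. exact (f_equal (Rmult _) H1). ring.
  etransitivity. exact (f_equal (fun y => y * _) (IH ltac:(lia))). ring. }
apply H. lia.
Qed.

(** The difference of the two sides is a polynomial of degree less than s that vanishes at s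
    distinct nodes. *)
Lemma lagrange_exact k x : (k < s)%nat -> bsum s (fun i => lagrange s c i x * c i ^ k) = x ^ k.
Proof.
intros Hk.
assert (H : forall x, 1 * bsum s (fun i => lagrange s c i x * c i ^ k) + (-1) * x ^ k = 0).
{ apply (deg_lt_roots s (fun x => 1 * bsum s (fun i => lagrange s c i x * c i ^ k) + (-1) * x ^ k) c); auto.
  - apply deg_lt_lin.
    + apply deg_lt_bsum. intros i Hi. apply (deg_lt_ext _ (fun x => c i ^ k * lagrange s c i x + 0 * lagrange s c i x)). intros; ring.
    apply deg_lt_lin; now apply lagrange_deg.
    + apply (deg_lt_le (S k)). lia. apply deg_lt_pow.
  - intros j Hj. rewrite (bsum_single (G := R_AbelianMonoid) s _ j Hj).
    + rewrite lagrange_node_same by auto. ring.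
    + intros i Hi Hij. rewrite lagrange_node_other by auto. apply Rmult_0_l. }
specialize (H x). lra.
Qed.

Lemma lagrange_continuous j x : continuous (lagrange s c j) x.
Proof.
unfold lagrange. induction (pred s) as [|n IH]; simpl prod_f_R0.
- change (match j with 0%nat => true | S _ => false end) with (Nat.eqb 0 j). destruct (Nat.eqb 0 j). apply continuous_const.
  apply (continuous_ext (fun x => / (c j - c 0%nat) * x + - c 0%nat / (c j - c 0%nat))). intros; unfold Rdiv; simpl; ring. apply continuous_affine.
-
  apply (continuous_mult (fun x => prod_f_R0 (fun q => if Nat.eqb q j then 1 else (x - c q) / (c j - c q)) n)
    (fun x => if Nat.eqb (S n) j then 1 else (x - c (S n)) / (c j - c (S n)))). exact IH.
  destruct (Nat.eqb (S n) j). apply continuous_const.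
  apply (continuous_ext (fun x => / (c j - c (S n)) * x + - c (S n) / (c j - c (S n)))). intros; unfold Rdiv; simpl; ring. apply continuous_affine.
Qed.

Lemma continuous_bounded_01 (f : R -> R) : (forall x, continuous f x) -> exists B, forall x, 0 <= x <= 1 -> Rabs (f x) <= B.
Proof.
intros H. destruct (bounded_continuity (V := R_NormedModule) f 0 1) as [B HB]. intros x _. apply H.
exists B. intros x Hx. left. apply (HB x Hx).
Qed.

Lemma lagrange_bounded : exists Lam, 0 <= Lam /\ forall i r, (i < s)%nat -> 0 <= r <= 1 -> Rabs (lagrange s c i r) <= Lam.
Proof.
assert (H : forall n, exists Lam, 0 <= Lam /\ forall i r, (i < n)%nat -> 0 <= r <= 1 -> Rabs (lagrange s c i r) <= Lam).
{ induction n as [|n [L [HL IH]]]. exists 0. split. lra. intros; lia.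
  destruct (continuous_bounded_01 (lagrange s c n) (lagrange_continuous n)) as [B HB].
  exists (Rmax L B). Rmax_bounds L B. split. lra.
  intros i r Hi Hr. destruct (Nat.eq_dec i n) as [->|h]. specialize (HB r Hr). lra. specialize (IH i r ltac:(lia) Hr). lra. }
apply H.
Qed.

(** The error for xi^s, the first monomial not reproduced by interpolation at s nodes. *)
Definition interpolation_error (x : R) : R := x ^ s - bsum s (fun i => lagrange s c i x * c i ^ s).

Lemma interpolation_error_continuous x : continuous interpolation_error x.
Proof.
apply (continuous_minus (fun x => x ^ s) (fun x => bsum s (fun i => lagrange s c i x * c i ^ s))).
- apply (ex_derive_continuous (V := R_NormedModule)). auto_derive. auto.
- assert (H : forall n, continuous (fun x => bsum n (fun i => lagrange s c i x * c i ^ s)) x); [|apply H].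
  induction n as [|n IH]. apply continuous_const.
  apply (continuous_plus (fun x => bsum n (fun i => lagrange s c i x * c i ^ s)) (fun x => lagrange s c n x * c n ^ s)). exact IH.
  apply (continuous_mult (lagrange s c n) (fun _ => c n ^ s)). apply lagrange_continuous. apply continuous_const.
Qed.

(** The quadrature weights are the integrals of the Lagrange polynomials, so exactness of the
    quadrature for xi^s says precisely that this mean vanishes. *)
Lemma interpolation_error_mean : sum_n (fun i => RInt (lagrange s c i) 0 1 * c i ^ s) (pred s) = / INR (s + 1) ->
  is_RInt interpolation_error 0 1 0.
Proof.
intros Hord. rewrite bsum_sum_n in Hord by lia.
assert (Hex : forall i, ex_RInt (lagrange s c i) 0 1).
{ intros i. apply (ex_RInt_continuous (V := R_CompleteNormedModule)). intros; apply lagrange_continuous. }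
assert (Hsum : forall n, is_RInt (fun x => bsum n (fun i => lagrange s c i x * c i ^ s)) 0 1 (bsum n (fun i => RInt (lagrange s c i) 0 1 * c i ^ s))).
{ induction n as [|n IH].
  { assert (H0 := is_RInt_const (V := R_NormedModule) 0 1 (0 : R)).
    replace (scal (1 - 0 : R) (0 : R_NormedModule)) with (0 : R) in H0 by (unfold scal; simpl; unfold mult; simpl; as_R; ring). exact H0. }
  apply (is_RInt_plus (V := R_NormedModule) (fun x => bsum n (fun i => lagrange s c i x * c i ^ s)) (fun x => lagrange s c n x * c n ^ s)). exact IH.
  apply (is_RInt_ext (fun x => scal (c n ^ s) (lagrange s c n x))). intros; unfold scal; simpl; unfold mult; simpl; as_R; ring.
  replace (RInt (lagrange s c n) 0 1 * c n ^ s) with (scal (c n ^ s) (RInt (lagrange s c n) 0 1) : R) by (unfold scal; simpl; unfold mult; simpl; as_R; ring).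
  apply (is_RInt_scal (V := R_NormedModule)). apply (RInt_correct (V := R_CompleteNormedModule)), Hex. }
assert (Hpow : is_RInt (fun x => x ^ s) 0 1 (/ INR (s + 1))).
{ replace (/ INR (s + 1)) with (minus (1 ^ (s + 1) / INR (s + 1)) (0 ^ (s + 1) / INR (s + 1))).
  2:{ unfold minus, plus, opp; simpl. rewrite pow1, pow_i by lia. field. apply not_0_INR. lia. }
  apply (is_RInt_derive (V := R_CompleteNormedModule) (fun x => x ^ (s + 1) / INR (s + 1))).
  - intros x _. auto_derive. auto. rewrite Nat.add_1_r. simpl pred. field. apply not_0_INR. lia.
  - intros x _. apply (ex_derive_continuous (V := R_NormedModule)). auto_derive. auto. }
replace 0 with (minus (/ INR (s + 1)) (bsum s (fun i => RInt (lagrange s c i) 0 1 * c i ^ s)) : R) at 2.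
- apply (is_RInt_minus (V := R_NormedModule)). exact Hpow. apply Hsum.
- rewrite <- Hord. unfold minus, plus, opp; simpl. as_R. ring.
Qed.
End Lagrange.

(** * Taylor expansion of vector functions *)

Section Derivative.
Variable V : NormedModule R_AbsRing.

(** Pointwise differentiability in first-order Taylor form, one-sided at the ends because [y] stays
    in [a, b]; no continuity of [f'] is required. *)
Definition vderiv (a b : R) (f f' : R -> V) : Prop := forall t eps, a <= t <= b -> 0 < eps ->
  exists d, 0 < d /\ forall y, a <= y <= b -> Rabs (y - t) < d ->
    norm (minus (minus (f y) (f t)) (scal (y - t) (f' t))) <= eps * Rabs (y - t).

Lemma vderiv_sub a b a' b' f f' : a <= a' -> b' <= b -> vderiv a b f f' -> vderiv a' b' f f'.
Proof.
intros Ha Hb H t eps Ht He. destruct (H t eps) as [d [Hd K]]. lra. auto. exists d. split; auto. intros y Hy. apply K. lra.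
Qed.

Lemma vderiv_increment a b f f' t : vderiv a b f f' -> a <= t <= b -> exists d, 0 < d /\
  forall y, a <= y <= b -> Rabs (y - t) < d -> norm (minus (f y) (f t)) <= (norm (f' t) + 1) * Rabs (y - t).
Proof.
intros H Ht. destruct (H t 1 Ht ltac:(lra)) as [d [Hd K]]. exists d. split; auto. intros y Hy Hyt.
specialize (K y Hy Hyt). assert (H1 := norm_le_minus (minus (f y) (f t)) (scal (y - t) (f' t))).
eapply Rle_trans. exact H1. rewrite Rmult_plus_distr_r. apply Rplus_le_compat.
rewrite Rmult_comm. apply norm_scal_Rabs. exact K.
Qed.

(** Near [t] the function moves with slope at most norm (f' t) + 1, which is the slope that the
    monotone majorant of an integrable function provides around every point. *)
Lemma straddle_increment a b (f f' : R -> V) (W : R -> R) y0 z0 : vderiv a b f f' -> a <= y0 <= z0 -> z0 <= b ->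
  (forall t, a <= t <= b -> exists d, 0 < d /\ forall y z, t - d < y -> y <= t -> t <= z -> z < t + d ->
    (norm (f' t) + 1) * (z - y) <= W z - W y) ->
  norm (minus (f z0) (f y0)) <= W z0 - W y0.
Proof.
intros Hf Hy Hz HW. apply (straddle_bound f W y0 z0). lra. intros t Ht.
destruct (HW t ltac:(lra)) as [d1 [Hd1 K1]]. destruct (vderiv_increment a b f f' t Hf ltac:(lra)) as [d2 [Hd2 K2]].
exists (Rmin d1 d2). split. now apply Rmin_pos. intros y z Hyt Hzt Hyd Hzd. Rmin_bounds d1 d2.
eapply Rle_trans. 2: apply (K1 y z); lra.
eapply Rle_trans. apply (norm_minus_triangle _ (f t)).
assert (H1 := K2 z ltac:(lra)). rewrite Rabs_pos_eq in H1 by lra.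
assert (H2 := K2 y ltac:(lra)). rewrite Rabs_left1 in H2 by lra. rewrite norm_minus_sym in H2.
lra.
Qed.

Lemma vderiv_mean_value a b f f' B : vderiv a b f f' -> a <= b -> (forall t, a <= t <= b -> norm (f' t) <= B) ->
  norm (minus (f b) (f a)) <= B * (b - a).
Proof.
intros Hf Hab HB. apply norm_bound_limit. intros eps He.
set (e := eps / (b - a + 1)). assert (He0 : 0 < e) by (apply Rdiv_lt_0_compat; lra).
assert (e * (b - a) <= eps). { unfold e. replace (eps / (b - a + 1) * (b - a)) with (eps * (b - a) / (b - a + 1)) by (field; lra). apply Rle_div_l; nra. }
apply Rle_trans with ((B + e) * b - (B + e) * a). 2: lra.
apply (straddle_bound f (fun r => (B + e) * r) a b Hab). intros t Ht.
destruct (Hf t e Ht He0) as [d [Hd K]]. exists d. split; auto. intros y z Hy Hz Hyd Hzd.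
assert (Hinc : forall y, a <= y <= b -> Rabs (y - t) < d -> norm (minus (f y) (f t)) <= (B + e) * Rabs (y - t)).
{ intros q Hq Hqt. specialize (K q Hq Hqt). assert (H1 := norm_le_minus (minus (f q) (f t)) (scal (q - t) (f' t))).
  eapply Rle_trans. exact H1. rewrite Rmult_plus_distr_r. apply Rplus_le_compat. 2: exact K.
  eapply Rle_trans. apply norm_scal_Rabs. rewrite Rmult_comm. apply Rmult_le_compat_r. apply Rabs_pos. now apply HB. }
eapply Rle_trans. apply (norm_minus_triangle _ (f t)).
assert (H1 := Hinc z ltac:(lra)). rewrite Rabs_pos_eq in H1 by lra.
assert (H2 := Hinc y ltac:(lra)). rewrite Rabs_left1 in H2 by lra. rewrite norm_minus_sym in H2.
lra.
Qed.

Lemma vderiv_minus a b f f' g g' : vderiv a b f f' -> vderiv a b g g' ->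
  vderiv a b (fun t => minus (f t) (g t)) (fun t => minus (f' t) (g' t)).
Proof.
intros Hf Hg t eps Ht He. destruct (Hf t (eps / 2) Ht ltac:(lra)) as [d1 [Hd1 K1]]. destruct (Hg t (eps / 2) Ht ltac:(lra)) as [d2 [Hd2 K2]].
exists (Rmin d1 d2). split. now apply Rmin_pos. intros y Hy Hyt. Rmin_bounds d1 d2.
specialize (K1 y Hy ltac:(lra)). specialize (K2 y Hy ltac:(lra)).
replace (minus (minus (minus (f y) (g y)) (minus (f t) (g t))) (scal (y - t) (minus (f' t) (g' t)))) with
 (minus (minus (minus (f y) (f t)) (scal (y - t) (f' t))) (minus (minus (g y) (g t)) (scal (y - t) (g' t)))) by rmodule V.
eapply Rle_trans. apply norm_minus_le. lra.
Qed.

Lemma vderiv_plus a b f f' g g' : vderiv a b f f' -> vderiv a b g g' ->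
  vderiv a b (fun t => plus (f t) (g t)) (fun t => plus (f' t) (g' t)).
Proof.
intros Hf Hg t eps Ht He. destruct (Hf t (eps / 2) Ht ltac:(lra)) as [d1 [Hd1 K1]]. destruct (Hg t (eps / 2) Ht ltac:(lra)) as [d2 [Hd2 K2]].
exists (Rmin d1 d2). split. now apply Rmin_pos. intros y Hy Hyt. Rmin_bounds d1 d2.
specialize (K1 y Hy ltac:(lra)). specialize (K2 y Hy ltac:(lra)).
replace (minus (minus (plus (f y) (g y)) (plus (f t) (g t))) (scal (y - t) (plus (f' t) (g' t)))) with
 (plus (minus (minus (f y) (f t)) (scal (y - t) (f' t))) (minus (minus (g y) (g t)) (scal (y - t) (g' t)))) by rmodule V.
eapply Rle_trans. apply norm_triangle. lra.
Qed.

Lemma vderiv_const a b x : vderiv a b (fun _ => x) (fun _ => zero).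
Proof.
intros t eps Ht He. exists 1. split. lra. intros y _ _.
assert (E : minus (minus x x) (scal (y - t) zero) = @zero V) by rmodule V.
apply Rle_trans with 0. right. etransitivity. exact (f_equal norm E). exact (norm_zero (V := V)). pose proof (Rabs_pos (y - t)). nra.
Qed.

Lemma vderiv_scal a b (phi phi' : R -> R) x : (forall t, is_derive phi t (phi' t)) ->
  vderiv a b (fun t => scal (phi t) x) (fun t => scal (phi' t) x).
Proof.
intros H t eps Ht He. destruct (H t) as [_ Hd].
assert (Hx := norm_ge_0 x). assert (He2 : 0 < eps / (norm x + 1)) by (apply Rdiv_lt_0_compat; lra).
destruct (Hd t (fun P HP => HP) (mkposreal _ He2)) as [d K].
exists d. split. apply cond_pos. intros y _ Hy. specialize (K y Hy).
assert (E : minus (minus (scal (phi y) x) (scal (phi t) x)) (scal (y - t) (scal (phi' t) x)) = scal (phi y - phi t - (y - t) * phi' t) x) by rmodule V.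
eapply Rle_trans. right. exact (f_equal norm E). eapply Rle_trans. apply norm_scal_Rabs.
change (Rabs (phi y - phi t - (y - t) * phi' t) <= eps / (norm x + 1) * Rabs (y - t)) in K.
eapply Rle_trans. apply Rmult_le_compat_r. auto. exact K.
replace (eps / (norm x + 1) * Rabs (y - t) * norm x) with (eps * Rabs (y - t) * (norm x / (norm x + 1))) by (field; lra).
rewrite <- (Rmult_1_r (eps * Rabs (y - t))) at 2. apply Rmult_le_compat_l. pose proof (Rabs_pos (y - t)). nra.
apply Rle_div_l; lra.
Qed.

Lemma vderiv_bsum a b n (f f' : nat -> R -> V) : (forall j, (j < n)%nat -> vderiv a b (f j) (f' j)) ->
  vderiv a b (fun t => bsum n (fun j => f j t)) (fun t => bsum n (fun j => f' j t)).
Proof.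
induction n as [|n IH]; intros H. exact (vderiv_const a b zero).
apply (vderiv_plus a b (fun t => bsum n (fun j => f j t)) (fun t => bsum n (fun j => f' j t)) (f n) (f' n)); auto.
Qed.

Definition taylor_poly (F : nat -> R -> V) (a : R) (n : nat) (z : R) : V :=
  bsum n (fun j => scal ((z - a) ^ j / INR (fact j)) (F j a)).

Lemma taylor_bound n (F : nat -> R -> V) a b v : a <= b ->
  (forall j, (j < n)%nat -> vderiv a b (F j) (F (S j))) ->
  (forall z, a <= z <= b -> norm (minus (F n z) (F n a)) <= v) ->
  forall z, a <= z <= b -> norm (minus (F 0%nat z) (taylor_poly F a (S n) z)) <= v * (z - a) ^ n.
Proof.
revert F b. induction n as [|n IH]; intros F b Hab HF Hv z Hz.
- unfold taylor_poly. simpl bsum.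
  replace (plus zero (scal (1 / 1) (F 0%nat a))) with (F 0%nat a) by rmodule V. rewrite Rmult_1_r. auto.
- set (G := fun j => F (S j)).
  assert (Hrem : forall y, a <= y <= z -> norm (minus (G 0%nat y) (taylor_poly G a (S n) y)) <= v * (z - a) ^ n).
  { intros y Hy. assert (Hv0 : 0 <= v). { eapply Rle_trans. 2: apply (Hv a); lra. apply norm_ge_0. }
    eapply Rle_trans. apply (IH G b Hab); try lra. intros j Hj. apply HF. lia. exact Hv.
    apply Rmult_le_compat_l; auto. apply pow_incr. lra. }
  assert (Hd : vderiv a z (fun y => minus (F 0%nat y) (taylor_poly F a (S (S n)) y)) (fun y => minus (G 0%nat y) (taylor_poly G a (S n) y))).
  { apply vderiv_minus. apply (vderiv_sub a b); try lra. apply HF; lia.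
    assert (Hpd : vderiv a z (fun y => plus (scal ((y - a) ^ 0 / INR (fact 0)) (F 0%nat a)) (bsum (S n) (fun j => scal ((y - a) ^ (S j) / INR (fact (S j))) (F (S j) a))))
    (fun y => plus zero (taylor_poly G a (S n) y))).
    { apply (vderiv_plus a z (fun y => scal ((y - a) ^ 0 / INR (fact 0)) (F 0%nat a)) (fun _ => zero)
    (fun y => bsum (S n) (fun j => scal ((y - a) ^ (S j) / INR (fact (S j))) (F (S j) a))) (taylor_poly G a (S n))).
    exact (vderiv_const a z (scal (1 / INR (fact 0)) (F 0%nat a))).
    apply (vderiv_bsum a z (S n) (fun j y => scal ((y - a) ^ (S j) / INR (fact (S j))) (F (S j) a)) (fun j y => scal ((y - a) ^ j / INR (fact j)) (G j a))).
    intros j Hj. apply (vderiv_scal a z (fun y => (y - a) ^ (S j) / INR (fact (S j))) (fun y => (y - a) ^ j / INR (fact j))). intros y.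
    replace (INR (fact (S j))) with (INR (S j) * INR (fact j)) by (rewrite <- mult_INR; reflexivity).
    pose proof (INR_fact_neq_0 j). assert (INR (S j) <> 0) by (apply not_0_INR; lia).
    auto_derive. auto. change (y - a) with (y + - a). field. auto. }
    intros y eps Hy He. destruct (Hpd y eps Hy He) as [d [Hd0 Hd1]]. exists d. split; auto. intros y' H1 H2. specialize (Hd1 y' H1 H2).
    rewrite plus_zero_l in Hd1. unfold taylor_poly at 1 2. rewrite !(bsum_shift (S n)). exact Hd1. }
  assert (H := vderiv_mean_value a z _ _ _ Hd ltac:(lra) Hrem). cbv beta in H.
  replace (minus (F 0%nat a) (taylor_poly F a (S (S n)) a)) with (@zero V) in H.
  + simpl pow. replace (v * ((z - a) * (z - a) ^ n)) with (v * (z - a) ^ n * (z - a)) by ring.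
    eapply Rle_trans. 2: exact H. right. apply (f_equal norm). rmodule V.
  + unfold taylor_poly. rewrite bsum_shift. rewrite bsum_zero.
    * simpl. rmodule V.
    * intros j _. rewrite Rminus_diag. simpl. rewrite Rmult_0_l. unfold Rdiv. rewrite Rmult_0_l. exact (scal_zero_l (F (S j) a)).
Qed.
End Derivative.

(** Extends a function on a segment continuously to the line, so that integrands can be treated as
    continuous everywhere. *)
Definition clamp01 (x : R) : R := Rmax 0 (Rmin 1 x).

Lemma clamp01_range x : 0 <= clamp01 x <= 1.
Proof. unfold clamp01, Rmax, Rmin. repeat destruct Rle_dec; lra. Qed.

Lemma clamp01_id x : 0 <= x <= 1 -> clamp01 x = x.
Proof. intros H. unfold clamp01. rewrite Rmin_right, Rmax_right; lra. Qed.

Lemma clamp01_lipschitz x y : Rabs (clamp01 x - clamp01 y) <= Rabs (x - y).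
Proof. unfold clamp01, Rmax, Rmin, Rabs. repeat destruct Rle_dec; repeat destruct Rcase_abs; lra. Qed.

Lemma continuous_clamped_segment {V : NormedModule R_AbsRing} (f f' : R -> V) a h x : 0 < h ->
  vderiv V a (a + h) f f' -> continuous (fun xi => f (a + clamp01 xi * h)) x.
Proof.
intros Hh Hf. apply continuous_norm. intros eps He.
assert (Hx := clamp01_range x). set (r := a + clamp01 x * h).
destruct (vderiv_increment V a (a + h) f f' r Hf) as [d [Hd K]]. unfold r; nra.
assert (Hn := norm_ge_0 (f' r)).
set (B := h * (norm (f' r) + 1)). assert (HB : 0 < B) by (unfold B; nra).
exists (Rmin (d / h) (eps / B)). split. apply Rmin_pos; apply Rdiv_lt_0_compat; lra.
intros y Hy. Rmin_bounds (d / h) (eps / B).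
assert (Hy' := clamp01_range y). assert (Hl := clamp01_lipschitz y x).
assert (Hdist : Rabs (a + clamp01 y * h - r) <= Rabs (y - x) * h).
{ replace (a + clamp01 y * h - r) with ((clamp01 y - clamp01 x) * h) by (unfold r; ring). rewrite Rabs_mult, (Rabs_pos_eq h) by lra.
  apply Rmult_le_compat_r; lra. }
assert (Rabs (y - x) * h < d). { apply Rlt_div_r; lra. }
assert (H3 : Rabs (y - x) * B < eps). { apply Rlt_div_r; lra. }
eapply Rle_lt_trans. apply K. nra. lra.
apply Rle_lt_trans with ((norm (f' r) + 1) * (Rabs (y - x) * h)). apply Rmult_le_compat_l; lra.
replace ((norm (f' r) + 1) * (Rabs (y - x) * h)) with (Rabs (y - x) * B) by (unfold B; ring). auto.
Qed.

(** Interpolation reproduces the Taylor terms of degree below s, and the term of degree s leaves a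
    multiple of [interpolation_error]. The Taylor remainder enters once directly and once through
    each of the s Lagrange weights, hence 1 + s Lam. *)
Lemma interpolation_remainder (V : NormedModule R_AbsRing) s c Lam (F : nat -> R -> V) a h v :
  (1 <= s)%nat -> (forall i j, (i < s)%nat -> (j < s)%nat -> i <> j -> c i <> c j) ->
  (forall i, (i < s)%nat -> 0 <= c i <= 1) ->
  (forall i r, (i < s)%nat -> 0 <= r <= 1 -> Rabs (lagrange s c i r) <= Lam) ->
  0 < h -> (forall j, (j < s)%nat -> vderiv V a (a + h) (F j) (F (S j))) ->
  (forall z, a <= z <= a + h -> norm (minus (F s z) (F s a)) <= v) ->
  forall xi, 0 <= xi <= 1 ->
  norm (minus (minus (F 0%nat (a + xi * h)) (bsum s (fun i => scal (lagrange s c i xi) (F 0%nat (a + c i * h)))))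
    (scal (h ^ s / INR (fact s) * interpolation_error s c xi) (F s a))) <= (1 + INR s * Lam) * (h ^ s * v).
Proof.
intros Hs Hdist Hc HL Hh HF Hv xi Hxi.
assert (Hv0 : 0 <= v). { eapply Rle_trans. 2: apply (Hv a); lra. apply norm_ge_0. }
set (T := fun z => minus (F 0%nat z) (taylor_poly V F a (S s) z)).
assert (HT : forall x, 0 <= x <= 1 -> norm (T (a + x * h)) <= h ^ s * v).
{ intros x Hx. eapply Rle_trans. apply (taylor_bound V s F a (a + h) v); auto. lra. nra.
  rewrite Rmult_comm. apply Rmult_le_compat_r; auto. apply pow_incr. nra. }
assert (Htay : forall x, taylor_poly V F a (S s) (a + x * h) = bsum (S s) (fun j => scal (x ^ j) (scal (h ^ j / INR (fact j)) (F j a)))).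
{ intros x. apply bsum_ext. intros j _. replace (a + x * h - a) with (x * h) by ring. rewrite Rpow_mult_distr.
  pose proof (INR_fact_neq_0 j). rmodule V. }
assert (Hint : bsum s (fun i => scal (lagrange s c i xi) (taylor_poly V F a (S s) (a + c i * h))) =
   bsum (S s) (fun j => scal (bsum s (fun i => lagrange s c i xi * c i ^ j)) (scal (h ^ j / INR (fact j)) (F j a)))).
{ rewrite (bsum_ext s _ (fun i => bsum (S s) (fun j => scal (lagrange s c i xi * c i ^ j) (scal (h ^ j / INR (fact j)) (F j a))))).
  2:{ intros i Hi. rewrite Htay. etransitivity. symmetry. exact (bsum_scal (V := V) (S s) (lagrange s c i xi) _).
    apply bsum_ext. intros j _. rmodule V. }
  rewrite (bsum_swap s (S s)). apply bsum_ext. intros j _.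
  exact (bsum_scal_l (V := V) s (fun i => lagrange s c i xi * c i ^ j) _). }
assert (Hdiff : minus (taylor_poly V F a (S s) (a + xi * h)) (bsum s (fun i => scal (lagrange s c i xi) (taylor_poly V F a (S s) (a + c i * h))))
  = scal (h ^ s / INR (fact s) * interpolation_error s c xi) (F s a)).
{ rewrite Hint, Htay.
  change (minus (plus (bsum s (fun j => scal (xi ^ j) (scal (h ^ j / INR (fact j)) (F j a)))) (scal (xi ^ s) (scal (h ^ s / INR (fact s)) (F s a))))
    (plus (bsum s (fun j => scal (bsum s (fun i => lagrange s c i xi * c i ^ j)) (scal (h ^ j / INR (fact j)) (F j a))))
    (scal (bsum s (fun i => lagrange s c i xi * c i ^ s)) (scal (h ^ s / INR (fact s)) (F s a))))
    = scal (h ^ s / INR (fact s) * interpolation_error s c xi) (F s a)).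
  rewrite (bsum_ext s (fun j => scal (bsum s (fun i => lagrange s c i xi * c i ^ j)) (scal (h ^ j / INR (fact j)) (F j a)))
    (fun j => scal (xi ^ j) (scal (h ^ j / INR (fact j)) (F j a)))).
  2:{ intros j Hj. rewrite (lagrange_exact s c Hs Hdist j xi Hj). reflexivity. }
  unfold interpolation_error.
  rmodule V. }
assert (Heq : minus (minus (F 0%nat (a + xi * h)) (bsum s (fun i => scal (lagrange s c i xi) (F 0%nat (a + c i * h)))))
    (scal (h ^ s / INR (fact s) * interpolation_error s c xi) (F s a)) =
  minus (T (a + xi * h)) (bsum s (fun i => scal (lagrange s c i xi) (T (a + c i * h))))).
{ rewrite <- Hdiff.
  assert (H1 : bsum s (fun i => scal (lagrange s c i xi) (T (a + c i * h))) =
    minus (bsum s (fun i => scal (lagrange s c i xi) (F 0%nat (a + c i * h)))) (bsum s (fun i => scal (lagrange s c i xi) (taylor_poly V F a (S s) (a + c i * h))))).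
  { etransitivity. 2: exact (bsum_minus (V := V) s _ _). apply bsum_ext. intros i _. unfold T. rmodule V. }
  rewrite H1. unfold T. rmodule V. }
eapply Rle_trans. right. exact (f_equal norm Heq).
eapply Rle_trans. apply norm_minus_le. rewrite Rmult_plus_distr_r, Rmult_1_l. apply Rplus_le_compat. now apply HT.
eapply Rle_trans. exact (norm_bsum (V := V) s _).
rewrite Rmult_assoc, <- bsum_const. apply bsum_le. intros i Hi. eapply Rle_trans. apply norm_scal_Rabs.
apply Rmult_le_compat. apply Rabs_pos. apply norm_ge_0. now apply HL. now apply HT, Hc.
Qed.

(** * Consistency *)

Section Defect.
Variable V : CompleteNormedModule R_AbsRing.
Variables (E AE : R -> nm V -> nm V) (M : R).
Hypothesis HE : analytic_semigroup (nm V) E AE M.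
Variables (s : nat) (c : nat -> R) (Lam Wb : R).
Hypothesis Hs : (1 <= s)%nat.
Hypothesis Hmean : is_RInt (interpolation_error s c) 0 1 0.
Hypothesis HWb : forall x, 0 <= x <= 1 -> Rabs (interpolation_error s c x) <= Wb.
Hypothesis HLam : 0 <= Lam.
Variables (N : nat) (t : nat -> R) (hm : R).
Hypothesis Ht0 : t 0%nat = 0.
Hypothesis Hinc : forall k, (k < N)%nat -> t k < t (S k).
Hypothesis Hhm : forall k, (k < N)%nat -> step t k <= hm.
Local Notation h k := (step t k).
Variables (f : R -> nm V) (Fs : nat -> nm V) (v : nat -> R) (Fb Vt : R).
Hypothesis Hf : forall k x, (k < N)%nat -> continuous (fun xi => f (t k + clamp01 xi * h k)) x.
Hypothesis Hrem : forall k xi, (k < N)%nat -> 0 <= xi <= 1 ->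
  norm (minus (minus (f (t k + xi * h k)) (bsum s (fun i => scal (lagrange s c i xi) (f (node t c k i)))))
    (scal (h k ^ s / INR (fact s) * interpolation_error s c xi) (Fs k))) <= (1 + INR s * Lam) * (h k ^ s * v k).
Hypothesis HFb : forall k, (k < N)%nat -> norm (Fs k) <= Fb.
Hypothesis Hv : forall k, (k < N)%nat -> 0 <= v k.
Hypothesis HVt : bsum N v <= Vt.

Local Notation werr := (interpolation_error s c).
Local Notation cl := (clamped V E).

Let Hstep k : (k < N)%nat -> 0 < h k.
Proof. intros H. specialize (Hinc k H). unfold step. lra. Qed.

Definition interpolation_residual k xi : nm V :=
  minus (f (t k + clamp01 xi * h k)) (bsum s (fun i => scal (lagrange s c i xi) (f (node t c k i)))).

Definition local_defect k theta : nm V :=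
  scal (h k) (rint (fun xi => cl ((theta - xi) * h k) (interpolation_residual k xi)) 0 theta).

(** Contribution of the s-th Taylor term. What remains of the local defect is of size h^(s+1) times
    the oscillation of f^(s) on the step, and this can be summed over the steps. *)
Definition main_defect k theta : nm V :=
  scal (h k ^ S s / INR (fact s)) (rint (fun xi => scal (werr xi) (cl ((theta - xi) * h k) (Fs k))) 0 theta).

Lemma continuous_reversed theta hk (x : R) : continuous (fun xi => (theta - xi) * hk) x.
Proof. apply (continuous_ext (fun xi => (- hk) * xi + theta * hk)). intros; simpl; ring. apply continuous_affine. Qed.

Lemma continuous_bsum n (g : nat -> R -> nm V) x : (forall i, (i < n)%nat -> continuous (g i) x) ->
  continuous (fun xi => bsum n (fun i => g i xi)) x.
Proof.
induction n as [|n IH]; intros H. exact (continuous_const (V := nm V) zero x).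
apply (continuous_plus (V := nm V) (fun xi => bsum n (fun i => g i xi)) (g n)); auto.
Qed.

Lemma interpolant_continuous k x : continuous (fun xi => bsum s (fun i => scal (lagrange s c i xi) (f (node t c k i)))) x.
Proof.
apply (continuous_bsum s (fun i xi => scal (lagrange s c i xi) (f (node t c k i)))). intros i _.
apply (continuous_scal (V := nm V) (lagrange s c i) (fun _ => f (node t c k i))). apply lagrange_continuous. apply continuous_const.
Qed.

Lemma residual_continuous k x : (k < N)%nat -> continuous (interpolation_residual k) x.
Proof.
intros Hk. apply (continuous_minus (V := nm V) (fun xi => f (t k + clamp01 xi * h k)) (fun xi => bsum s (fun i => scal (lagrange s c i xi) (f (node t c k i))))).
now apply Hf. apply interpolant_continuous.
Qed.

Lemma rint_bsum n (g : nat -> R -> nm V) a b : (forall i, (i < n)%nat -> ex_RInt (g i) a b) ->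
  ex_RInt (fun xi => bsum n (fun i => g i xi)) a b /\
  rint (fun xi => bsum n (fun i => g i xi)) a b = bsum n (fun i => rint (g i) a b).
Proof.
induction n as [|n IH]; intros H.
- split. exact (ex_RInt_const (V := nm V) a b zero).
  transitivity (scal (b - a) (@zero (nm V))). exact (RInt_const (V := V) a b zero). exact (scal_zero_r (V := nm V) _).
- destruct IH as [H1 H2]. intros; apply H; lia. split.
  apply (ex_RInt_plus (V := nm V) (fun xi => bsum n (fun i => g i xi)) (g n)); auto.
  simpl. rewrite <- H2. apply (rint_plus (fun xi => bsum n (fun i => g i xi)) (g n)); auto.
Qed.

Lemma local_defect_split k theta : (k < N)%nat -> 0 <= theta <= 1 ->
  local_defect k theta = minus (scal (h k) (rint (fun xi => cl ((theta - xi) * h k) (f (t k + clamp01 xi * h k))) 0 theta))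
    (bsum s (fun i => stage_integral V E (lagrange s c i) theta (h k) (f (node t c k i)))).
Proof.
intros Hk Hth. assert (Hh := Hstep k Hk). unfold local_defect.
rewrite (bsum_ext s (fun i => stage_integral V E (lagrange s c i) theta (h k) (f (node t c k i)))
  (fun i => scal (h k) (rint (fun xi => scal (lagrange s c i xi) (cl ((theta - xi) * h k) (f (node t c k i)))) 0 theta))).
2:{ intros i Hi. apply (stage_integral_clamped V E); lra. }
assert (Hex0 : forall i, (i < s)%nat -> ex_RInt (fun xi => scal (lagrange s c i xi) (cl ((theta - xi) * h k) (f (node t c k i)))) 0 theta).
{ intros i _. apply (stage_integrable V E AE M HE). intros; apply lagrange_continuous. }
destruct (rint_bsum s (fun i xi => scal (lagrange s c i xi) (cl ((theta - xi) * h k) (f (node t c k i)))) 0 theta Hex0) as [Hex Hsum].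
assert (Hb := bsum_scal (V := nm V) s (h k) (fun i => rint (fun xi => scal (lagrange s c i xi) (cl ((theta - xi) * h k) (f (node t c k i)))) 0 theta)).
etransitivity. 2: exact (f_equal (minus _) (eq_sym Hb)).
set (g1 := fun xi => cl ((theta - xi) * h k) (f (t k + clamp01 xi * h k))).
set (g2 := fun xi => bsum s (fun i => scal (lagrange s c i xi) (cl ((theta - xi) * h k) (f (node t c k i))))).
assert (Hg1 : ex_RInt g1 0 theta).
{ apply ex_rint_continuous. intros xi _. apply (clamped_continuous V E AE M HE (fun xi => (theta - xi) * h k) (fun xi => f (t k + clamp01 xi * h k))).
  apply continuous_reversed. now apply Hf. }
transitivity (scal (h k) (minus (rint g1 0 theta) (rint g2 0 theta))).
2:{ transitivity (minus (scal (h k) (rint g1 0 theta)) (scal (h k) (rint g2 0 theta))). rmodule (nm V).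
  apply (f_equal (fun y => minus (scal (h k) (rint g1 0 theta)) (scal (h k) y))). exact Hsum. }
f_equal. etransitivity. 2: exact (RInt_minus (V := V) g1 g2 0 theta Hg1 Hex).
apply rint_ext. intros xi _. unfold interpolation_residual, g1, g2.
rewrite (linear_minus _ _ _ (clamped_linear V E AE M HE _)).
apply (f_equal (fun y => minus (cl ((theta - xi) * h k) (f (t k + clamp01 xi * h k))) y)).
rewrite (bsum_linear (V := nm V) (W := nm V) (cl ((theta - xi) * h k))) by apply (clamped_linear V E AE M HE).
apply bsum_ext. intros i _. apply (linear_scal _ (clamped_linear V E AE M HE _)).
Qed.

Lemma remainder_bound k theta : (k < N)%nat -> 0 <= theta <= 1 ->
  norm (minus (local_defect k theta) (main_defect k theta)) <= M * (1 + INR s * Lam) * hm ^ S s * v k.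
Proof.
intros Hk Hth. assert (Hh := Hstep k Hk). assert (HM := as_const _ _ _ _ HE).
set (g1 := fun xi => cl ((theta - xi) * h k) (interpolation_residual k xi)).
set (g2 := fun xi => scal (h k ^ s / INR (fact s)) (scal (werr xi) (cl ((theta - xi) * h k) (Fs k)))).
assert (Hc2 : forall xi, continuous (fun xi => scal (werr xi) (cl ((theta - xi) * h k) (Fs k))) xi).
{ intros xi. apply (continuous_scal (V := nm V) werr (fun xi => cl ((theta - xi) * h k) (Fs k))). apply interpolation_error_continuous.
  apply (clamped_continuous V E AE M HE (fun xi => (theta - xi) * h k) (fun _ => Fs k)). apply continuous_reversed. apply continuous_const. }
assert (Hg1 : ex_RInt g1 0 theta).
{ apply ex_rint_continuous. intros xi _. apply (clamped_continuous V E AE M HE (fun xi => (theta - xi) * h k) (interpolation_residual k)).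
  apply continuous_reversed. now apply residual_continuous. }
assert (Hg2' : ex_RInt (fun xi => scal (werr xi) (cl ((theta - xi) * h k) (Fs k))) 0 theta) by (apply ex_rint_continuous; intros; apply Hc2).
assert (Hg2 : ex_RInt g2 0 theta) by (apply (ex_RInt_scal (V := nm V)); auto).
assert (Heq : minus (local_defect k theta) (main_defect k theta) = scal (h k) (rint (fun xi => minus (g1 xi) (g2 xi)) 0 theta)).
{ etransitivity. 2:{ apply f_equal. symmetry. exact (RInt_minus (V := V) g1 g2 0 theta Hg1 Hg2). }
  assert (H2 : rint g2 0 theta = scal (h k ^ s / INR (fact s)) (rint (fun xi => scal (werr xi) (cl ((theta - xi) * h k) (Fs k))) 0 theta)).
  { exact (RInt_scal (V := V) _ 0 theta (h k ^ s / INR (fact s)) Hg2'). }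
  change (minus (scal (h k) (rint g1 0 theta)) (scal (h k ^ S s / INR (fact s)) (rint (fun xi => scal (werr xi) (cl ((theta - xi) * h k) (Fs k))) 0 theta))
    = scal (h k) (minus (rint g1 0 theta) (rint g2 0 theta))).
  rewrite H2. simpl pow. pose proof (INR_fact_neq_0 s).
  rmodule (nm V). }
rewrite Heq. eapply Rle_trans. apply (norm_scal_pos V). lra.
assert (Hpk : 0 <= h k ^ s <= hm ^ s). { specialize (Hhm k Hk). split. apply pow_le; lra. apply pow_incr; lra. }
assert (HsL : 0 <= 1 + INR s * Lam). { pose proof (pos_INR s). assert (0 <= INR s * Lam) by (apply Rmult_le_pos; auto). lra. }
set (B := M * ((1 + INR s * Lam) * (h k ^ s * v k))).
assert (HB0 : 0 <= B). { specialize (Hv k Hk). repeat apply Rmult_le_pos; lra. }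
assert (Hn : norm (rint (fun xi => minus (g1 xi) (g2 xi)) 0 theta) <= (theta - 0) * B).
{ apply (norm_rint_bound V). lra. apply (ex_RInt_minus (V := nm V)); auto.
  intros xi Hxi.
  assert (Hcl : minus (g1 xi) (g2 xi) = cl ((theta - xi) * h k) (minus (interpolation_residual k xi) (scal (h k ^ s / INR (fact s) * werr xi) (Fs k)))).
  { unfold g1, g2. rewrite (linear_minus _ _ _ (clamped_linear V E AE M HE _)). rewrite (linear_scal _ (clamped_linear V E AE M HE _)). rmodule (nm V). }
  rewrite Hcl. eapply Rle_trans. apply (clamped_bound V E AE M HE). apply Rmult_le_compat_l. lra.
  unfold interpolation_residual. rewrite clamp01_id by lra. apply Hrem; auto. lra. }
apply Rle_trans with (hm * B). pose proof (norm_ge_0 (rint (fun xi => minus (g1 xi) (g2 xi)) 0 theta)).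
apply Rmult_le_compat; auto; try lra. nra.
unfold B. simpl pow. specialize (Hv k Hk). specialize (Hhm k Hk).
replace (hm * (M * ((1 + INR s * Lam) * (h k ^ s * v k)))) with (hm * (M * (1 + INR s * Lam) * v k) * h k ^ s) by ring.
replace (M * (1 + INR s * Lam) * (hm * hm ^ s) * v k) with (hm * (M * (1 + INR s * Lam) * v k) * hm ^ s) by ring.
apply Rmult_le_compat_l. repeat apply Rmult_le_pos; lra. lra.
Qed.

Lemma fact_inv_le_1 n : 0 < / INR (fact n) <= 1.
Proof.
assert (1 <= INR (fact n)) by (apply (le_INR 1); pose proof (lt_O_fact n); lia).
split. apply Rinv_0_lt_compat; lra. rewrite <- Rinv_1. apply Rinv_le_contravar; lra.
Qed.

Lemma Wb_nonneg : 0 <= Wb.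
Proof. eapply Rle_trans. 2: apply (HWb 0); lra. apply Rabs_pos. Qed.

Lemma main_defect_bound k theta : (k < N)%nat -> 0 <= theta <= 1 -> norm (main_defect k theta) <= Wb * M * hm ^ S s * Fb.
Proof.
intros Hk Hth. assert (Hh := Hstep k Hk). assert (HM := as_const _ _ _ _ HE). pose proof Wb_nonneg as HW.
assert (Hfi := fact_inv_le_1 s).
assert (Hpk : 0 <= h k ^ S s <= hm ^ S s). { specialize (Hhm k Hk). split. apply pow_le; lra. apply pow_incr; lra. }
eapply Rle_trans. apply (norm_scal_pos V). apply Rmult_le_pos; lra.
assert (HF0 := norm_ge_0 (Fs k)). specialize (HFb k Hk).
assert (HB : 0 <= Wb * (M * Fb)). { apply Rmult_le_pos; auto. apply Rmult_le_pos; lra. }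
assert (Hn : norm (rint (fun xi => scal (werr xi) (cl ((theta - xi) * h k) (Fs k))) 0 theta) <= (theta - 0) * (Wb * (M * Fb))).
{ apply (norm_rint_bound V). lra. apply (clamped_integrable V E AE M HE werr (fun xi => (theta - xi) * h k) (fun _ => Fs k)).
  intros; apply interpolation_error_continuous. intros; apply continuous_reversed. intros; apply continuous_const.
  intros xi Hxi. eapply Rle_trans. apply norm_scal_Rabs. apply Rmult_le_compat. apply Rabs_pos. apply norm_ge_0. apply HWb; lra.
  eapply Rle_trans. apply (clamped_bound V E AE M HE). apply Rmult_le_compat_l; lra. }
apply Rle_trans with (hm ^ S s * (Wb * (M * Fb))). 2: right; ring.
apply Rmult_le_compat. apply Rmult_le_pos; lra. apply norm_ge_0.
rewrite <- (Rmult_1_r (hm ^ S s)). apply Rmult_le_compat; lra.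
eapply Rle_trans. exact Hn. nra.
Qed.

(** As the interpolation error has mean zero, the constant operator E(a) may be subtracted under the
    integral, and a semigroup difference appears. *)
Lemma main_defect_propagated a k : (k < N)%nat -> 0 <= a ->
  E a (main_defect k 1) = scal (- / INR (fact s)) (rint (fun xi => scal (werr xi)
    (scal (h k ^ S s) (minus (cl a (Fs k)) (cl (a + (1 - xi) * h k) (Fs k))))) 0 1).
Proof.
intros Hk Ha. assert (Hh := Hstep k Hk). unfold main_defect.
assert (La := as_linear _ _ _ _ HE a Ha).
rewrite (linear_scal _ La).
set (g := fun rho xi => scal (werr xi) (cl (rho + (1 - xi) * h k) (Fs k))).
assert (Hg : forall rho, ex_RInt (g rho) 0 1).
{ intros rho. apply (clamped_integrable V E AE M HE werr (fun xi => rho + (1 - xi) * h k) (fun _ => Fs k)).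
  intros; apply interpolation_error_continuous. intros r. apply (continuous_plus (fun _ => rho)). apply continuous_const. apply continuous_reversed. intros; apply continuous_const. }
assert (H1 : E a (rint (fun xi => scal (werr xi) (cl ((1 - xi) * h k) (Fs k))) 0 1) = rint (g a) 0 1).
{ rewrite <- rint_linear; auto.
  - apply rint_ext. intros xi Hxi. rewrite Rmin_left, Rmax_right in Hxi by lra. unfold g. rewrite (linear_scal _ La). f_equal.
    rewrite !clamped_eq by nra. symmetry. apply (as_add _ _ _ _ HE); nra.
  - apply (ex_RInt_ext (g 0)). intros; unfold g. rewrite Rplus_0_l. reflexivity. apply Hg. }
rewrite H1.
assert (H2 : rint (fun xi => scal (werr xi) (cl a (Fs k))) 0 1 = zero).
{ apply rint_unique.
  assert (H0 := is_RInt_linear (V := R_NormedModule) (W := nm V) (fun r : R => scal r (cl a (Fs k))) werr 0 1 0 (is_linear_scal_l (V := nm V) (cl a (Fs k))) Hmean).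
  cbv beta in H0. replace (scal 0 (cl a (Fs k))) with (@zero (nm V)) in H0 by rmodule (nm V). exact H0. }
assert (Hex0 : ex_RInt (fun xi => scal (werr xi) (cl a (Fs k))) 0 1).
{ apply (clamped_integrable V E AE M HE werr (fun _ => a) (fun _ => Fs k)). intros; apply interpolation_error_continuous. intros; apply continuous_const. intros; apply continuous_const. }
assert (H3 : rint (fun xi => scal (werr xi) (scal (h k ^ S s) (minus (cl a (Fs k)) (cl (a + (1 - xi) * h k) (Fs k))))) 0 1 =
  scal (h k ^ S s) (minus (rint (fun xi => scal (werr xi) (cl a (Fs k))) 0 1) (rint (g a) 0 1))).
{ transitivity (rint (fun xi => scal (h k ^ S s) (minus (scal (werr xi) (cl a (Fs k))) (g a xi))) 0 1).
  - apply rint_ext. intros xi _. unfold g. rmodule (nm V).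
  - etransitivity. exact (RInt_scal (V := V) _ 0 1 (h k ^ S s) (ex_RInt_minus (V := nm V) _ _ 0 1 Hex0 (Hg a))).
    apply f_equal. exact (RInt_minus (V := V) _ _ 0 1 Hex0 (Hg a)). }
rewrite H3, H2. unfold Rdiv. rmodule (nm V).
Qed.

(** After exchanging sum and integral, the integrand at xi is a scalar multiple of the drop sum with
    theta = 1 - xi. *)
Lemma main_sum_bound n Gam : (n <= N)%nat -> (forall theta, 0 <= theta <= 1 -> norm (drop_sum V E t (S s) Fs n theta) <= Gam) ->
  norm (bsum n (fun k => E (t n - t (S k)) (main_defect k 1))) <= Wb * Gam.
Proof.
intros Hn HG. assert (Hfi := fact_inv_le_1 s).
set (g := fun k xi => scal (werr xi) (scal (h k ^ S s) (minus (cl (t n - t (S k)) (Fs k)) (cl (t n - t (S k) + (1 - xi) * h k) (Fs k))))).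
assert (Hg : forall k, (k < n)%nat -> ex_RInt (g k) 0 1).
{ intros k Hk. apply ex_rint_continuous. intros xi _. apply (continuous_scal (V := nm V) werr). apply interpolation_error_continuous.
  apply (continuous_scal (V := nm V) (fun _ => h k ^ S s)). apply continuous_const.
  apply (continuous_minus (V := nm V) (fun _ => cl (t n - t (S k)) (Fs k)) (fun xi => cl (t n - t (S k) + (1 - xi) * h k) (Fs k))). apply continuous_const.
  apply (clamped_continuous V E AE M HE (fun xi => t n - t (S k) + (1 - xi) * h k) (fun _ => Fs k)).
  apply (continuous_plus (fun _ => t n - t (S k))). apply continuous_const. apply continuous_reversed. apply continuous_const. }
destruct (rint_bsum n g 0 1 Hg) as [Hex Hsum].
assert (Heq : bsum n (fun k => E (t n - t (S k)) (main_defect k 1)) = scal (- / INR (fact s)) (rint (fun xi => bsum n (fun k => g k xi)) 0 1)).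
{ etransitivity. 2: exact (f_equal (fun y : nm V => scal (- / INR (fact s)) y) (eq_sym Hsum)). etransitivity. 2: exact (bsum_scal (V := nm V) n (- / INR (fact s)) (fun k => rint (g k) 0 1)).
  apply bsum_ext. intros k Hk. apply main_defect_propagated. lia. assert (t (S k) <= t n) by (mesh_order t N). lra. }
rewrite Heq. eapply Rle_trans. apply norm_scal_Rabs. rewrite Rabs_Ropp, Rabs_pos_eq by lra.
assert (Hint : norm (rint (fun xi => bsum n (fun k => g k xi)) 0 1) <= (1 - 0) * (Wb * Gam)).
{ apply (norm_rint_bound V). lra. exact Hex. intros xi Hxi.
  assert (Hd : bsum n (fun k => g k xi) = scal (werr xi) (drop_sum V E t (S s) Fs n (1 - xi))).
  { etransitivity. 2: exact (bsum_scal (V := nm V) n (werr xi) _).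
    apply bsum_ext. intros k Hk. unfold g, semigroup_drop. assert (t (S k) <= t n) by (mesh_order t N).
    pose proof (Hstep k ltac:(lia)). rewrite !clamped_eq by nra. reflexivity. }
  rewrite Hd. eapply Rle_trans. apply norm_scal_Rabs. apply Rmult_le_compat. apply Rabs_pos. apply norm_ge_0. apply HWb; lra. apply HG; lra. }
pose proof (norm_ge_0 (rint (fun xi => bsum n (fun k => g k xi)) 0 1)).
apply Rle_trans with (1 * (Wb * Gam)). apply Rmult_le_compat; lra. lra.
Qed.

(** Three contributions: the main defects of the past, with their cancellation; the remainders of
    all steps, summed by the variation; and the main defect of the current step, a single term that
    is already of order h^(s+1). *)
Lemma defect_bound Gam : 0 <= hm ->
  (forall n theta, (n <= N)%nat -> 0 <= theta <= 1 -> norm (drop_sum V E t (S s) Fs n theta) <= Gam) ->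
  forall k theta, (k < N)%nat -> 0 <= theta <= 1 ->
  norm (defect V E t local_defect k theta) <= M * Wb * Gam + 2 * M ^ 3 * (1 + INR s * Lam) * hm ^ S s * Vt + Wb * M * hm ^ S s * Fb.
Proof.
intros Hhm0 HG k theta Hk Hth. assert (HM := as_const _ _ _ _ HE). assert (Hh := Hstep k Hk).
assert (HsL : 0 <= 1 + INR s * Lam). { pose proof (pos_INR s). assert (0 <= INR s * Lam) by (apply Rmult_le_pos; auto). lra. }
assert (Hp : 0 <= hm ^ S s) by (apply pow_le; lra).
set (B := M * (1 + INR s * Lam) * hm ^ S s).
assert (HB : 0 <= B). { apply Rmult_le_pos; auto. apply Rmult_le_pos; lra. }
assert (Hvsum : bsum k v + v k <= Vt).
{ eapply Rle_trans. 2: exact HVt. rewrite <- bsum_RS. clear - Hk Hv. induction N as [|n IH]. lia.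
  destruct (Nat.eq_dec (S k) (S n)) as [->|Hne]. lra. rewrite (bsum_RS n). specialize (IH ltac:(auto) ltac:(lia)). specialize (Hv n ltac:(lia)). lra. }
assert (Hvk : 0 <= bsum k v) by (apply bsum_nonneg; intros; apply Hv; lia).
unfold defect.
set (Sm := bsum k (fun l => E (t k - t (S l)) (main_defect l 1))). set (Sr := bsum k (fun l => E (t k - t (S l)) (minus (local_defect l 1) (main_defect l 1)))).
assert (Hpast : past_defect V E t local_defect k theta = E (theta * h k) (plus Sm Sr)).
{ unfold past_defect. rewrite <- (propagate_sum V E AE M HE N t Hinc k theta (fun l => local_defect l 1) Hk Hth). f_equal.
  unfold Sm, Sr. rewrite <- (bsum_plus (G := NormedModule.AbelianMonoid R_AbsRing (nm V))). apply bsum_ext. intros l Hl.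
  assert (t (S l) <= t k) by (mesh_order t N).
  replace (t k + 0 * h k - t (S l)) with (t k - t (S l)) by ring.
  assert (Ll := as_linear _ _ _ _ HE (t k - t (S l)) ltac:(lra)).
  rewrite (linear_minus _ _ _ Ll). rmodule (nm V). }
rewrite Hpast.
assert (H1 : norm Sm <= Wb * Gam).
{ apply main_sum_bound. lia. intros; apply HG; auto; lia. }
assert (H2 : norm Sr <= M * B * bsum k v).
{ eapply Rle_trans. exact (norm_bsum (V := nm V) k _). rewrite <- bsum_mult. apply bsum_le. intros l Hl.
  assert (t (S l) <= t k) by (mesh_order t N).
  eapply Rle_trans. apply (as_bound _ _ _ _ HE). lra. rewrite Rmult_assoc. apply Rmult_le_compat_l. lra. apply remainder_bound. lia. lra. }
assert (H3 := remainder_bound k theta Hk Hth). fold B in H3. assert (H4 := main_defect_bound k theta Hk Hth).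
eapply Rle_trans. apply norm_triangle.
assert (H5 := as_bound _ _ _ _ HE (theta * h k) (plus Sm Sr) ltac:(nra)).
assert (H6 := norm_triangle Sm Sr ).
assert (H7 := norm_le_minus (local_defect k theta) (main_defect k theta)).
specialize (Hv k Hk).
assert (H8 : M * norm (plus Sm Sr) <= M * (Wb * Gam + M * B * bsum k v)).
{ apply Rmult_le_compat_l. lra. lra. }
assert (H9 : B * v k <= M ^ 2 * B * Vt).
{ assert (1 <= M ^ 2) by nra. apply Rmult_le_compat; try lra. nra. }
assert (H10 : M * (M * B * bsum k v) <= M ^ 2 * B * Vt).
{ replace (M * (M * B * bsum k v)) with (M ^ 2 * B * bsum k v) by ring. apply Rmult_le_compat_l. apply Rmult_le_pos; auto. apply pow2_ge_0. lra. }
assert (M ^ 2 * B * Vt = M ^ 3 * (1 + INR s * Lam) * hm ^ S s * Vt) by (unfold B; ring).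
lra.
Qed.
End Defect.

(** * Variation across the discontinuity points *)

Section Segments.
Variables (T tau0 : R) (tau : R -> R) (xi : nat -> R) (m : nat).
Hypothesis HT : 0 < T.
Hypothesis Htau : admissible_delay tau tau0.
Hypothesis Hxi : discontinuity_points tau T xi m.
Local Notation sg := (seg T xi m).

Lemma seg_increasing mu : (mu <= m)%nat -> sg mu < sg (S mu).
Proof.
intros Hmu. destruct Hxi as [H0 [H1 [H2 _]]]. destruct Htau as [Ht0 [Ht _]]. unfold seg.
destruct (Nat.leb_spec mu m); [|lia]. destruct (Nat.leb_spec (S mu) m) as [h|h]. 2: now apply H2.
destruct (H1 mu ltac:(lia)) as [H3 H4]. specialize (Ht _ H3). lra.
Qed.

Lemma seg_0 : sg 0 = 0.
Proof. destruct Hxi as [H0 _]. exact H0. Qed.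

Lemma seg_last : sg (S m) = T.
Proof. unfold seg. destruct (Nat.leb_spec (S m) m); [lia|reflexivity]. Qed.

Lemma seg_le mu nu : (mu <= nu)%nat -> (nu <= S m)%nat -> sg mu <= sg nu.
Proof.
intros H Hn. induction H as [|nu H IH]. lra. pose proof (seg_increasing nu ltac:(lia)). specialize (IH ltac:(lia)). lra.
Qed.

Lemma seg_range mu : (mu <= S m)%nat -> 0 <= sg mu <= T.
Proof.
intros H. assert (H1 := seg_le 0 mu ltac:(lia) H). assert (H2 := seg_le mu (S m) H (le_n _)).
rewrite seg_0 in H1. rewrite seg_last in H2. lra.
Qed.

(** The mesh contains the breakpoints, so no step crosses one; the induction moves the candidate
    segment to the right until it holds the step. *)
Lemma step_segment N t k : admissible_mesh T xi m N t -> (k < N)%nat ->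
  exists mu, (mu <= m)%nat /\ sg mu <= t k /\ t (S k) <= sg (S mu).
Proof.
intros [Ht0 [HtN [Hinc Hcont]]] Hk.
assert (H : forall n, (n <= m)%nat -> (exists mu, (mu <= n)%nat /\ sg mu <= t k /\ t (S k) <= sg (S mu)) \/ sg (S n) <= t k).
{ induction n as [|n IH]; intros Hn.
  - destruct (Rle_dec (sg 1) (t k)) as [h|h]. now right. left. exists 0%nat. split; auto.
    rewrite seg_0. split. rewrite <- Ht0. mesh_order t N.
    unfold seg in *. destruct (Nat.leb_spec 1 m) as [h1|h1].
    + destruct (Hcont 1%nat h1) as [j [Hj1 Hj2]]. rewrite <- Hj2 in *. apply (mesh_le t N); auto.
    destruct (le_lt_dec j k) as [h2|h2]; auto. exfalso. apply h. mesh_order t N.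
    + rewrite <- HtN. mesh_order t N.
  - destruct (IH ltac:(lia)) as [[mu [H1 H2]]|H1]. left. exists mu. split; auto; lia.
    destruct (Rle_dec (sg (S (S n))) (t k)) as [h|h]. now right. left. exists (S n). split; auto. split; auto.
    unfold seg in h |- *. destruct (Nat.leb_spec (S (S n)) m) as [h1|h1].
    + destruct (Hcont (S (S n)) h1) as [j [Hj1 Hj2]]. rewrite <- Hj2 in *. apply (mesh_le t N); auto.
    destruct (le_lt_dec j k) as [h2|h2]; auto. exfalso. apply h. mesh_order t N.
    + rewrite <- HtN. mesh_order t N. }
destruct (H m (le_n _)) as [H1|H1]; auto. rewrite seg_last in H1.
pose proof (mesh_le t N Hinc (S k) N ltac:(lia) ltac:(lia)). specialize (Hinc k Hk). lra.
Qed.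

Variables (V : NormedModule R_AbsRing) (F : nat -> R -> V) (W : nat -> R -> R) (Fb : R).
Hypothesis HFb : forall mu r, (mu <= m)%nat -> sg mu <= r <= sg (S mu) -> norm (F mu r) <= Fb.
Hypothesis HWinc : forall mu y z, y <= z -> W mu y <= W mu z.
Hypothesis HW : forall mu y z, (mu <= m)%nat -> sg mu <= y <= z -> z <= sg (S mu) -> norm (minus (F mu z) (F mu y)) <= W mu z - W mu y.

(** Increase of the majorants on the segments, plus 2 Fb per segment to cover a jump at its left
    end. *)
Definition total_variation : R := bsum (S m) (fun mu => W mu (sg (S mu)) - W mu (sg mu) + 2 * Fb).

Let clampseg mu r := Rmax (sg mu) (Rmin (sg (S mu)) r).
Let jump mu r := if Rle_dec (sg mu) r then 2 * Fb else 0.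
Let Z r := bsum (S m) (fun mu => W mu (clampseg mu r) + jump mu r).

Let HFb0 : 0 <= Fb.
Proof. eapply Rle_trans. 2: apply (HFb 0 (sg 0)); [lia|]. apply norm_ge_0. pose proof (seg_increasing 0 ltac:(lia)). lra. Qed.

Let jump_inc mu y z : y <= z -> jump mu y <= jump mu z.
Proof. intros H. unfold jump. repeat destruct Rle_dec; lra. Qed.

Let clamp_inc mu y z : y <= z -> clampseg mu y <= clampseg mu z.
Proof. intros H. apply Rle_max_compat_l, Rle_min_compat_l, H. Qed.

Let Z_term mu y z : (mu <= m)%nat -> y <= z ->
  W mu (clampseg mu z) - W mu (clampseg mu y) + (jump mu z - jump mu y) <= Z z - Z y.
Proof.
intros Hmu Hyz.
assert (H : forall n, (mu < n)%nat -> W mu (clampseg mu z) - W mu (clampseg mu y) + (jump mu z - jump mu y) <=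
  bsum n (fun mu => W mu (clampseg mu z) + jump mu z) - bsum n (fun mu => W mu (clampseg mu y) + jump mu y)).
{ assert (H0 : forall n, bsum n (fun mu => W mu (clampseg mu y) + jump mu y) <= bsum n (fun mu => W mu (clampseg mu z) + jump mu z)).
  { intros n. apply bsum_le. intros k _. pose proof (HWinc k _ _ (clamp_inc k y z Hyz)). pose proof (jump_inc k y z Hyz). lra. }
  induction n as [|n IH]; intros Hn. lia. rewrite !bsum_RS. destruct (Nat.eq_dec mu n) as [->|Hne].
  - specialize (H0 n). lra.
  - specialize (IH ltac:(lia)). pose proof (HWinc n _ _ (clamp_inc n y z Hyz)). pose proof (jump_inc n y z Hyz). lra. }
apply H. lia.
Qed.

Lemma mesh_variation N t : admissible_mesh T xi m N t -> exists (mu : nat -> nat) (v : nat -> R),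
  (forall k, (k < N)%nat -> (mu k <= m)%nat /\ sg (mu k) <= t k /\ t (S k) <= sg (S (mu k)) /\ 0 <= v k /\
    forall z, t k <= z <= t (S k) -> norm (minus (F (mu k) z) (F (mu k) (t k))) <= v k) /\
  bsum N v <= total_variation /\
  (forall k, (S k < N)%nat -> norm (minus (F (mu (S k)) (t (S k))) (F (mu k) (t k))) <= v k).
Proof.
intros Hmesh. pose proof Hmesh as [Ht0 [HtN [Hinc _]]].
assert (Hch : forall k, exists mu, (k < N)%nat -> (mu <= m)%nat /\ sg mu <= t k /\ t (S k) <= sg (S mu)).
{ intros k. destruct (lt_dec k N) as [h|h]. 2: exists 0%nat; intros; contradiction.
  destruct (step_segment N t k Hmesh h) as [mu Hmu]. now exists mu. }
(* [Z] is one monotone function that adds all majorants, frozen outside their segments, and the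
   jumps; its increments over the steps serve as [v] and telescope. *)
destruct (choice _ Hch) as [mu Hmu]. exists mu, (fun k => Z (t (S k)) - Z (t k)).
assert (HWk : forall k, (k < N)%nat -> forall z, t k <= z <= t (S k) -> norm (minus (F (mu k) z) (F (mu k) (t k))) <= Z (t (S k)) - Z (t k)).
{ intros k Hk z Hz. destruct (Hmu k Hk) as [H1 [H2 H3]].
  eapply Rle_trans. apply HW; auto; lra.
  assert (H4 := Z_term (mu k) (t k) (t (S k)) H1 ltac:(lra)).
  assert (H5 := jump_inc (mu k) (t k) (t (S k)) ltac:(lra)).
  assert (E1 : clampseg (mu k) (t k) = t k) by (unfold clampseg; rewrite Rmin_right, Rmax_right; lra).
  assert (E2 : clampseg (mu k) (t (S k)) = t (S k)) by (unfold clampseg; rewrite Rmin_right, Rmax_right; lra).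
  rewrite E1, E2 in H4. pose proof (HWinc (mu k) z (t (S k)) ltac:(lra)). lra. }
split; [|split].
- intros k Hk. destruct (Hmu k Hk) as [H1 [H2 H3]]. repeat split; auto.
  eapply Rle_trans. 2: apply (HWk k Hk (t k)). apply norm_ge_0. specialize (Hinc k Hk). lra.
- assert (Hsum : forall n, bsum n (fun k => Z (t (S k)) - Z (t k)) = Z (t n) - Z (t 0%nat)).
  { induction n as [|n IH]. as_R. rewrite bsum_R0. ring. as_R. rewrite bsum_RS, IH. ring. }
  rewrite Hsum, HtN, Ht0.
  assert (H : forall n, (n <= S m)%nat -> bsum n (fun mu => W mu (clampseg mu T) + jump mu T) - bsum n (fun mu => W mu (clampseg mu 0) + jump mu 0) <=
    bsum n (fun mu => W mu (sg (S mu)) - W mu (sg mu) + 2 * Fb)).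
  { induction n as [|n IH]; intros Hn. rewrite !bsum_R0. lra. rewrite !bsum_RS. specialize (IH ltac:(lia)).
    pose proof (seg_range n ltac:(lia)). pose proof (seg_range (S n) ltac:(lia)). pose proof (seg_increasing n ltac:(lia)).
    assert (E1 : clampseg n T = sg (S n)) by (unfold clampseg; rewrite Rmin_left, Rmax_right; lra).
    assert (E2 : clampseg n 0 = sg n) by (unfold clampseg; rewrite Rmin_right, Rmax_left; lra).
    rewrite E1, E2. assert (jump n T - jump n 0 <= 2 * Fb) by (unfold jump; repeat destruct Rle_dec; lra). lra. }
  apply H. lia.
- intros k Hk. destruct (Hmu k ltac:(lia)) as [H1 [H2 H3]]. destruct (Hmu (S k) Hk) as [H4 [H5 H6]].
  assert (Hi := Hinc k ltac:(lia)). assert (Hi2 := Hinc (S k) Hk).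
  destruct (Nat.eq_dec (mu (S k)) (mu k)) as [E|Hne].
  + rewrite E. apply HWk. lia. lra.
  (* If the segment changes between steps k and k + 1, then t_(k+1) is the left end of the new one,
     whose jump therefore falls into the increment of [Z] over step k. *)
  + assert (Hlt : (mu k < mu (S k))%nat).
    { destruct (lt_dec (mu k) (mu (S k))); auto. exfalso. pose proof (seg_le (S (mu (S k))) (mu k) ltac:(lia) ltac:(lia)). lra. }
    pose proof (seg_le (S (mu k)) (mu (S k)) ltac:(lia) ltac:(lia)).
    assert (H7 := Z_term (mu (S k)) (t k) (t (S k)) H4 ltac:(lra)).
    pose proof (HWinc (mu (S k)) _ _ (clamp_inc (mu (S k)) (t k) (t (S k)) ltac:(lra))).
    assert (jump (mu (S k)) (t (S k)) = 2 * Fb) by (unfold jump; destruct Rle_dec; lra).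
    assert (jump (mu (S k)) (t k) = 0) by (unfold jump; destruct Rle_dec; lra).
    eapply Rle_trans. apply norm_minus_le.
    pose proof (HFb (mu (S k)) (t (S k)) H4 ltac:(lra)). pose proof (HFb (mu k) (t k) H1 ltac:(lra)). lra.
Qed.
End Segments.

(** * Translation between V and the coordinate space *)

Section Coordinates.
Variables (X : CompleteNormedModule C_AbsRing) (eA : R -> X -> X) (alpha : R).
Local Notation V := (nm (realify X)).
Local Notation K := (neg_power X eA alpha : V -> V).
Variables (AE : R -> V -> V) (M : R) (Q : R -> V -> V) (Cf : R).
Hypothesis HE : analytic_semigroup V eA AE M.
Hypothesis HF : fractional_power V eA K Q alpha Cf.
Hypothesis Halpha : 0 <= alpha < 1.

Let LK := fp_linear _ _ _ _ _ _ HF.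

Lemma coord_inj (x y : V) : K x = K y -> x = y.
Proof. exact (K_inj (realify X) eA K Q alpha Cf HF x y). Qed.

Lemma V_dom_coord (x : V) : V_dom eA alpha (K x).
Proof. exists x. reflexivity. Qed.

(** Injectivity of [K] makes the description [iota] in the definition of A^alpha return [x]
    itself. *)
Lemma V_norm_coord (x : V) : V_norm eA alpha (K x) = norm x.
Proof.
apply (f_equal (norm (V := X))).
apply iota_unique; auto. intros y Hy. apply coord_inj. exact Hy.
Qed.

Lemma V_norm_minus_coord (x y : V) : V_norm eA alpha (minus (K x : X) (K y : X)) = norm (minus x y).
Proof.
rewrite <- V_norm_coord. f_equal. symmetry. exact (linear_minus K x y LK).
Qed.

Lemma coord_exists (P : R -> Prop) (u : R -> X) : (forall r, P r -> V_dom eA alpha (u r)) ->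
  exists U : R -> V, forall r, P r -> K (U r) = u r.
Proof.
intros H. apply (choice (fun r w => P r -> K w = u r)). intros r.
destruct (classic (P r)) as [h|h]. destruct (H r h) as [w Hw]. exists w. auto. exists (@zero V). intros; contradiction.
Qed.

Lemma V_derivative_coord a b (F F' : R -> X) (Fc Fc' : R -> V) :
  (forall r, a <= r <= b -> K (Fc r) = F r) -> (forall r, a <= r <= b -> K (Fc' r) = F' r) ->
  V_derivative eA alpha a b F F' -> vderiv V a b Fc Fc'.
Proof.
intros H1 H2 HD t eps Ht He. destruct (HD t Ht) as [_ [_ Hlim]].
assert (Hl := proj1 (filterlim_norm (V := R_NormedModule) (within (fun y => a <= y <= b /\ y <> t) (locally t)) _ 0) Hlim eps He).
destruct Hl as [d Hd]. exists d. split. apply cond_pos. intros y Hy Hyt.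
destruct (Req_dec y t) as [->|Hne].
{ rewrite Rminus_diag, Rabs_R0, Rmult_0_r. right.
  transitivity (norm (@zero V)). f_equal. rmodule (nm (realify X)). exact (norm_zero (V := V)). }
specialize (Hd y Hyt (conj Hy Hne)).
set (z := minus (scal (/ (y - t)) (minus (Fc y) (Fc t))) (Fc' t) : V).
assert (Hz : V_norm eA alpha (minus (rscal (/ (y - t)) (minus (F y) (F t))) (F' t)) = norm z).
{ rewrite <- V_norm_coord. f_equal. rewrite <- H1, <- H1, <- H2 by auto. unfold z.
  rewrite (linear_minus K _ _ LK), (linear_scal K LK), (linear_minus K _ _ LK). reflexivity. }
rewrite Hz in Hd. rewrite Rminus_0_r, Rabs_pos_eq in Hd by apply norm_ge_0.
assert (E : minus (minus (Fc y) (Fc t)) (scal (y - t) (Fc' t)) = scal (y - t) z).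
{ unfold z. rmodule (nm (realify X)). }
eapply Rle_trans. right. exact (f_equal norm E). eapply Rle_trans. apply norm_scal_Rabs. rewrite Rmult_comm.
apply Rmult_le_compat_r. apply Rabs_pos. lra.
Qed.

Variables (g : R -> X -> X -> X) (tau : R -> R) (tau0 T : R) (phi : R -> X) (u : R -> X) (U : R -> V).
Variables (s : nat) (c : nat -> R) (Rg : R).
Hypothesis Hs : (1 <= s)%nat.
Hypothesis Hc01 : forall i, (i < s)%nat -> 0 <= c i <= 1.
Hypothesis HU : forall r, r <= T -> K (U r) = u r.
Hypothesis Hpast : forall r, r <= 0 -> u r = phi r.
Hypothesis Htau0 : 0 < tau0.
Hypothesis Htau : forall r, 0 <= r -> tau0 <= tau r.
Variables (N : nat) (t : nat -> R).
Hypothesis Ht0 : t 0%nat = 0.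
Hypothesis HtN : t N = T.
Hypothesis Hinc : forall k, (k < N)%nat -> t k < t (S k).
Hypothesis Hhm : forall k, (k < N)%nat -> step t k <= tau0.
Local Notation h k := (step t k).
Local Notation nd k i := (node t c k i).
(** The nonlinearity as a function of the coordinates of its arguments; its values remain in X and
    are not transformed. *)
Definition coord_source r (v w : V) : V := g r (K v) (K w).
Local Notation solution := (discrete_solution (realify X) eA K s c (lagrange s c) U coord_source tau Rg t).

Lemma method_sum theta hk (x : nat -> X) :
  rscal hk (sum_n (fun i => coef_b X eA s c i theta hk (x i)) (pred s)) =
  bsum s (fun i => stage_integral (realify X) eA (lagrange s c i) theta hk (x i) : V).
Proof.
etransitivity. apply (f_equal (rscal hk)). apply bsum_sum_n. lia.
symmetry. exact (bsum_scal (V := V) s hk (fun i => coef_b X eA s c i theta hk (x i))).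
Qed.

Let node_le_T k i : (k < N)%nat -> (i < s)%nat -> t k <= nd k i <= T /\ nd k i - tau (nd k i) <= t k.
Proof.
intros Hk Hi. assert (Hi1 := Hinc k Hk). specialize (Hc01 i Hi). specialize (Hhm k Hk).
assert (t (S k) <= T) by (rewrite <- HtN; apply (mesh_le t N); auto).
assert (0 <= t k) by (rewrite <- Ht0; mesh_order t N).
unfold node, step in *. assert (0 <= c i * (t (S k) - t k) <= t (S k) - t k) by (split; nra).
specialize (Htau (t k + c i * (t (S k) - t k)) ltac:(lra)). lra.
Qed.

Let tk_le_T k : (k <= N)%nat -> 0 <= t k <= T.
Proof. intros H. rewrite <- Ht0, <- HtN. split; mesh_order t N. Qed.

Lemma solution_method (w : R -> V) : solution N w ->
  ERKCC_solution eA g tau phi s c N t (fun n => K (w (t n))) (fun n i => K (w (nd n i))) (fun r => K (w r)) /\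
  stages_near eA alpha u s c N t Rg (fun n i => K (w (nd n i))).
Proof.
intros [H1 [H2 H3]].
assert (H0T : 0 <= T). { rewrite <- HtN, <- Ht0. apply (mesh_le t N); auto. lia. }
split.
- constructor.
  + rewrite H1, HU, Hpast by lra. now rewrite Ht0.
  + intros n Hn. assert (H := H2 n 1 Hn ltac:(lra)).
    replace (t n + 1 * h n) with (t (S n)) in H by (unfold step; ring). rewrite Rmult_1_l in H.
    rewrite H. exact (f_equal (plus (G := V) _) (eq_sym (method_sum 1 (h n) (fun i => g (nd n i) (K (w (nd n i))) (K (w (nd n i - tau (nd n i)))))))).
  + intros n i Hn Hi. assert (H := H2 n (c i) Hn (Hc01 i Hi)). change (t n + c i * h n) with (nd n i) in H. rewrite H.
    exact (f_equal (plus (G := V) _) (eq_sym (method_sum (c i) (h n) (fun i => g (nd n i) (K (w (nd n i))) (K (w (nd n i - tau (nd n i)))))))).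
  + intros r Hr. rewrite H1, HU, Hpast by lra. reflexivity.
  + intros k theta Hk Hth. rewrite H2 by (auto; lra).
    exact (f_equal (plus (G := V) _) (eq_sym (method_sum theta (h k) (fun i => g (nd k i) (K (w (nd k i))) (K (w (nd k i - tau (nd k i)))))))).
- intros n i Hn Hi. split. apply V_dom_coord. destruct (node_le_T n i Hn Hi). rewrite <- HU by lra.
  rewrite V_norm_minus_coord. now apply H3.
Qed.

(** For this direction W must be shown to take values in V at all times. This follows step by step:
    the semigroup preserves V, and stage integrals of arbitrary vectors lie in the range of [K]. *)
Lemma method_solution Wn Ws W : ERKCC_solution eA g tau phi s c N t Wn Ws W ->
  stages_near eA alpha u s c N t Rg Ws ->
  exists w : R -> V, solution N w /\ (forall r, r <= T -> W r = K (w r)) /\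
    forall n i, (n < N)%nat -> (i < s)%nat -> Ws n i = K (w (nd n i)).
Proof.
intros [Sinit Sstep Sstage Spast Sout] Hnear.
assert (H0T : 0 <= T). { rewrite <- HtN, <- Ht0. apply (mesh_le t N); auto. lia. }
destruct (lagrange_bounded s c Hs) as [Lam [HLam HLb]].
assert (Hgrid : forall n, (n <= N)%nat -> W (t n) = Wn n).
{ intros [|n] Hn. rewrite Ht0, Spast, Sinit by lra. reflexivity.
  replace (t (S n)) with (t n + 1 * h n) by (unfold step; ring). rewrite Sout by (try lia; lra).
  rewrite Sstep by lia. rewrite Rmult_1_l. reflexivity. }
(* The output formula is extended to theta = 0, where the integrals are empty and the node value
   remains. *)
assert (Hall : forall k theta, (k < N)%nat -> 0 <= theta <= 1 -> (W (t k + theta * h k) : V) = plus (eA (theta * h k) (W (t k)) : V)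
   (bsum s (fun i => stage_integral (realify X) eA (lagrange s c i) theta (h k) (g (nd k i) (Ws k i) (W (nd k i - tau (nd k i)))) : V))).
{ intros k theta Hk Hth. destruct (Req_dec theta 0) as [->|Hne].
  - rewrite !Rmult_0_l, Rplus_0_r, (as_zero _ _ _ _ HE). symmetry. rewrite bsum_zero. apply plus_zero_r.
    intros i Hi. unfold stage_integral. transitivity (scal (h k) (@zero V)). f_equal. exact (RInt_point (V := realify X) 0 _). exact (scal_zero_r (V := V) _).
  - rewrite Sout by (auto; lra). rewrite Hgrid by lia.
    exact (f_equal (plus (G := V) _) (method_sum theta (h k) (fun i => g (nd k i) (Ws k i) (W (nd k i - tau (nd k i)))))). }
assert (Hstage : forall k i, (k < N)%nat -> (i < s)%nat -> Ws k i = W (nd k i)).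
{ intros k i Hk Hi. rewrite Sstage by auto. symmetry. unfold node. rewrite Hall by auto. rewrite Hgrid by lia.
  exact (f_equal (plus (G := V) _) (eq_sym (method_sum (c i) (h k) (fun i => g (nd k i) (Ws k i) (W (nd k i - tau (nd k i))))))). }
assert (Hdom : forall n, (n <= N)%nat -> forall r, r <= t n -> V_dom eA alpha (W r)).
{ induction n as [|n IH]; intros Hn r Hr.
  - rewrite Spast, <- Hpast, <- HU by lra. apply V_dom_coord.
  - destruct (Rle_dec r (t n)) as [hr|hr]. apply IH; auto; lia.
    assert (Hnn : (n < N)%nat) by lia. assert (Hh : 0 < h n) by (unfold step; lra).
    set (theta := (r - t n) / h n). assert (Hth : 0 <= theta <= 1).
    { split. apply Rdiv_le_0_compat; lra. apply Rle_div_l; unfold step; lra. }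
    replace r with (t n + theta * h n) by (unfold theta; field; lra).
    destruct (IH ltac:(lia) (t n) ltac:(lra)) as [y Hy].
    destruct (K_bsum_lift (realify X) eA K Q alpha Cf HF s
    (fun i => stage_integral (realify X) eA (lagrange s c i) theta (h n) (g (nd n i) (Ws n i) (W (nd n i - tau (nd n i)))))
    (fun i => Lam * (Cf / (1 - alpha)) * (omega (1 - alpha) (0 + theta * h n) - omega (1 - alpha) 0) * norm (g (nd n i) (Ws n i) (W (nd n i - tau (nd n i))) : V))) as [z [Hz _]].
    { intros i Hi. destruct (stage_integral_lift (realify X) eA AE M HE K Q alpha Cf HF Halpha (lagrange s c i) Lam 0 theta (h n)
    (g (nd n i) (Ws n i) (W (nd n i - tau (nd n i))))) as [z [Hz1 Hz2]]; auto; try lra.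
    intros; apply lagrange_continuous. exists z. rewrite (as_zero _ _ _ _ HE) in Hz1. auto. }
    exists (plus (eA (theta * h n) (y : V) : V) z).
    etransitivity. exact (linear_plus K LK (eA (theta * h n) (y : V) : V) z).
    rewrite (fp_commute _ _ _ _ _ _ HF) by nra. rewrite Hz. etransitivity. 2: symmetry; apply (Hall n theta Hnn Hth).
    apply (f_equal (fun q : V => plus (eA (theta * h n) q : V) _)). exact Hy. }
destruct (coord_exists (fun r => r <= T) W) as [w Hw].
{ intros r Hr. apply (Hdom N). lia. lra. }
exists w. split.
- split; [|split].
  + intros r Hr. apply coord_inj. rewrite Hw, HU by lra. rewrite Spast, Hpast by lra. reflexivity.
  + intros k theta Hk Hth. assert (Hi := Hinc k Hk). pose proof (tk_le_T (S k) Hk). assert (t k + theta * h k <= T) by (unfold step; nra).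
    rewrite !Hw by lra. rewrite Hall by auto. apply f_equal. apply bsum_ext. intros i Hii. apply f_equal.
    unfold coord_source. destruct (node_le_T k i Hk Hii). rewrite !Hw by lra. rewrite Hstage by auto. reflexivity.
  + intros k i Hk Hi. destruct (node_le_T k i Hk Hi). destruct (Hnear k i Hk Hi) as [_ Hn].
    rewrite Hstage, <- Hw, <- HU in Hn by (auto; lra). rewrite V_norm_minus_coord in Hn. exact Hn.
- split. intros r Hr. symmetry. now apply Hw.
  intros n i Hn Hi. rewrite Hstage by auto. symmetry. apply Hw. destruct (node_le_T n i Hn Hi). lra.
Qed.
End Coordinates.

(** * Largest and smallest step *)

Lemma fold_Rmax_ge (l : list R) x : In x l -> x <= fold_right Rmax 0 l.
Proof.
induction l as [|y l IH]; simpl; intros H. contradiction.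
destruct H as [->|H]. apply Rmax_l. eapply Rle_trans. now apply IH. apply Rmax_r.
Qed.

Lemma fold_Rmin_le (l : list R) x0 x : In x l -> fold_right Rmin x0 l <= x.
Proof.
induction l as [|y l IH]; simpl; intros H. contradiction.
destruct H as [->|H]. apply Rmin_l. eapply Rle_trans. apply Rmin_r. now apply IH.
Qed.

Lemma fold_Rmin_pos (l : list R) x0 : 0 < x0 -> (forall x, In x l -> 0 < x) -> 0 < fold_right Rmin x0 l.
Proof.
intros H0. induction l as [|y l IH]; simpl; intros H; auto. apply Rmin_pos; auto.
Qed.

Lemma step_le_max_step N t k : (k < N)%nat -> step t k <= max_step N t.
Proof. intros H. apply fold_Rmax_ge, in_map, in_seq. lia. Qed.

Lemma max_step_nonneg N t : 0 <= max_step N t.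
Proof. unfold max_step. induction (map (step t) (List.seq 0 N)) as [|y l IH]; simpl. lra. eapply Rle_trans. exact IH. apply Rmax_r. Qed.

Lemma min_step_le_step N t k : (k < N)%nat -> min_step N t <= step t k.
Proof. intros H. apply fold_Rmin_le, in_map, in_seq. lia. Qed.

Lemma min_step_positive N t : (0 < N)%nat -> (forall k, (k < N)%nat -> t k < t (S k)) -> 0 < min_step N t.
Proof.
intros HN H. apply fold_Rmin_pos. specialize (H 0%nat HN). unfold step; lra.
intros x Hx. apply in_map_iff in Hx. destruct Hx as [k [<- Hk]]. apply in_seq in Hk. specialize (H k ltac:(lia)). unfold step; lra.
Qed.

(** * Convergence with constants independent of the mesh *)

Section Convergence.
Variable V : CompleteNormedModule R_AbsRing.
Variables (E AE : R -> nm V -> nm V) (M : R).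
Hypothesis HE : analytic_semigroup (nm V) E AE M.
Variables (K : nm V -> nm V) (Q : R -> nm V -> nm V) (alpha C : R).
Hypothesis HF : fractional_power (nm V) E K Q alpha C.
Hypothesis Halpha : 0 <= alpha < 1.
Let beta := 1 - alpha.
Variables (s : nat) (c : nat -> R).
Hypothesis Hs : (1 <= s)%nat.
Hypothesis Hc : forall i, (i < s)%nat -> 0 <= c i <= 1.
Hypothesis Hdist : forall i j, (i < s)%nat -> (j < s)%nat -> i <> j -> c i <> c j.
Hypothesis Hord : sum_n (fun i => RInt (lagrange s c i) 0 1 * c i ^ s) (pred s) = / INR (s + 1).
Variables (T tau0 : R) (tau : R -> R) (xi : nat -> R) (m : nat).
Hypothesis HT : 0 < T.
Hypothesis Htau : admissible_delay tau tau0.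
Hypothesis Hxi : discontinuity_points tau T xi m.
Variables (U : R -> nm V) (G : R -> nm V -> nm V -> nm V) (Rg L : R).
Hypothesis HRg : 0 < Rg.
Hypothesis HL : 0 <= L.
Hypothesis HLip : forall r v1 v2 w1 w2, 0 <= r <= T ->
  norm (minus v1 (U r)) <= Rg -> norm (minus v2 (U r)) <= Rg ->
  norm (minus w1 (U (r - tau r))) <= Rg -> norm (minus w2 (U (r - tau r))) <= Rg ->
  norm (minus (G r v1 w1) (G r v2 w2)) <= L * (norm (minus v1 v2) + norm (minus w1 w2)).
Variables (f : R -> nm V) (F : nat -> nat -> R -> nm V) (W : nat -> R -> R) (Fb : R).
Hypothesis HfG : forall r, 0 <= r <= T -> G r (U r) (U (r - tau r)) = K (f r).
Hypothesis Hvoc : forall r q, 0 <= r -> r <= q -> q <= T ->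
  is_RInt (fun sigma => E (q - sigma) (G sigma (U sigma) (U (sigma - tau sigma)))) r q (minus (K (U q)) (E (q - r) (K (U r)))).
Local Notation sg := (seg T xi m).
Hypothesis HfF : forall mu r, (mu <= m)%nat -> sg mu <= r <= sg (S mu) -> f r = F mu 0%nat r.
Hypothesis HFd : forall mu k, (mu <= m)%nat -> (k < s)%nat -> vderiv (nm V) (sg mu) (sg (S mu)) (F mu k) (F mu (S k)).
Hypothesis HFb : forall mu r, (mu <= m)%nat -> sg mu <= r <= sg (S mu) -> norm (F mu s r) <= Fb.
Hypothesis HWinc : forall mu y z, y <= z -> W mu y <= W mu z.
Hypothesis HW : forall mu y z, (mu <= m)%nat -> sg mu <= y <= z -> z <= sg (S mu) -> norm (minus (F mu s z) (F mu s y)) <= W mu z - W mu y.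
Local Notation tv := (total_variation T xi m W Fb).

Lemma derivative_bound_nonneg : 0 <= Fb.
Proof.
eapply Rle_trans. 2: apply (HFb 0 (sg 0)); [lia|]. apply norm_ge_0.
pose proof (seg_increasing T tau0 tau xi m Htau Hxi 0 ltac:(lia)). lra.
Qed.

Lemma total_variation_nonneg : 0 <= tv.
Proof.
apply bsum_nonneg. intros mu Hmu. pose proof (seg_increasing T tau0 tau xi m Htau Hxi mu ltac:(lia)).
pose proof (HWinc mu (sg mu) (sg (S mu)) ltac:(lra)). pose proof derivative_bound_nonneg. lra.
Qed.

(** The variation-of-constants formula over one step is rescaled to [0, theta]; replacing its
    integrand by the interpolant of f leaves exactly [K] of the local defect. *)
Lemma exact_solution_defect N t k theta :
  t 0%nat = 0 -> t N = T -> (forall k, (k < N)%nat -> t k < t (S k)) ->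
  (forall k x, (k < N)%nat -> continuous (fun xi => f (t k + clamp01 xi * step t k)) x) ->
  (k < N)%nat -> 0 <= theta <= 1 ->
  K (U (t k + theta * step t k)) = plus (plus (E (theta * step t k) (K (U (t k))))
    (bsum s (fun i => stage_integral V E (lagrange s c i) theta (step t k)
    (G (node t c k i) (U (node t c k i)) (U (node t c k i - tau (node t c k i)))))))
    (K (local_defect V E s c t f k theta)).
Proof.
intros Ht0 HtN Hinc Hcont Hk Hth. assert (LK := fp_linear _ _ _ _ _ _ HF).
set (h := step t k). assert (Hh : 0 < h) by (unfold h, step; specialize (Hinc k Hk); lra).
assert (Htk : 0 <= t k) by (rewrite <- Ht0; mesh_order t N).
assert (HtSk : t k + h <= T). { unfold h, step. replace (t k + (t (S k) - t k)) with (t (S k)) by ring. rewrite <- HtN. apply (mesh_le t N); auto. }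
set (r := t k + theta * h). assert (Hr : t k <= r <= T) by (unfold r; nra).
set (fc := fun x => f (t k + clamp01 x * h)).
rewrite (local_defect_split V E AE M HE s c Hs N t Hinc f Hcont k theta Hk Hth).
rewrite (linear_minus _ _ _ LK), (linear_scal _ LK), (bsum_linear K) by exact LK.
rewrite <- rint_linear; auto.
2:{ apply ex_rint_continuous. intros x _. apply (clamped_continuous V E AE M HE (fun x => (theta - x) * step t k) (fun x => f (t k + clamp01 x * step t k))).
    apply continuous_reversed. now apply Hcont. }
assert (Hst : bsum s (fun i => K (stage_integral V E (lagrange s c i) theta (step t k) (f (node t c k i)))) =
  bsum s (fun i => stage_integral V E (lagrange s c i) theta h (G (node t c k i) (U (node t c k i)) (U (node t c k i - tau (node t c k i)))))).
{ apply bsum_ext. intros i Hi. rewrite HfG.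
  - symmetry. apply (stage_integral_K V E AE M HE K Q alpha C HF). intros; apply lagrange_continuous. lra. auto.
  - specialize (Hc i Hi). unfold node. fold h. nra. }
assert (Hv := Hvoc (t k) r Htk (proj1 Hr) (proj2 Hr)).
replace (r - t k) with (theta * h) in Hv by (unfold r; ring).
set (gg := fun sigma => E (r - sigma) (G sigma (U sigma) (U (sigma - tau sigma)))) in Hv.
assert (Hv2 : rint (fun x => scal h (gg (h * x + t k))) 0 theta = minus (K (U r)) (E (theta * h) (K (U (t k))))).
{ replace (minus (K (U r)) (E (theta * h) (K (U (t k))))) with (rint gg (t k) r) by (apply rint_unique; exact Hv).
  etransitivity. apply rint_comp_lin. replace (h * 0 + t k) with (t k) by ring. replace (h * theta + t k) with r by (unfold r; ring).
  eexists; exact Hv. f_equal; unfold r; ring. }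
assert (Hv3 : rint (fun x => scal h (gg (h * x + t k))) 0 theta = scal h (rint (fun x => K (clamped V E ((theta - x) * h) (fc x))) 0 theta)).
{ etransitivity. 2: apply (RInt_scal (V := V) (fun x => K (clamped V E ((theta - x) * h) (fc x)))).
  - apply rint_ext. intros x Hx. rewrite Rmin_left, Rmax_right in Hx by lra. apply (f_equal (fun y : nm V => scal h y)).
    unfold gg, fc. rewrite clamp01_id by lra. replace (t k + x * h) with (h * x + t k) by ring.
    rewrite HfG by nra. rewrite (K_clamped V E K Q alpha C HF), clamped_eq by nra. f_equal. unfold r. ring.
  - apply ex_rint_continuous. intros x _. apply (is_linear_R_continuous K); auto.
    apply (clamped_continuous V E AE M HE (fun x => (theta - x) * h) fc). apply continuous_reversed. now apply Hcont. }
rewrite Hv2 in Hv3.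
set (B := bsum s (fun i => stage_integral V E (lagrange s c i) theta h (G (node t c k i) (U (node t c k i)) (U (node t c k i - tau (node t c k i)))))) in *.
transitivity (plus (plus (E (theta * h) (K (U (t k)))) B) (minus (minus (K (U r)) (E (theta * h) (K (U (t k))))) B)).
rmodule (nm V). exact (f_equal2 (fun a b : nm V => plus (plus (E (theta * h) (K (U (t k)))) B) (minus a b)) Hv3 (eq_sym Hst)).
Qed.

(** All constants are fixed before the mesh. The bound [Gam] on the drop sums stays open, so that
    the logarithmic, the constant-step and the self-adjoint case share this result; [Fs] consists of
    the values of f^(s) at the left ends of the steps, each taken in the segment of its step. *)
Theorem scheme_error : exists h0 C1, 0 < h0 /\ 0 < C1 /\ h0 <= tau0 /\
  forall N t, admissible_mesh T xi m N t -> max_step N t <= h0 ->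
  exists (Fs : nat -> nm V) (w : R -> nm V),
    (forall k, (k < N)%nat -> norm (Fs k) <= Fb) /\
    bsum (pred N) (fun k => norm (minus (Fs (S k)) (Fs k))) <= tv /\
    discrete_solution V E K s c (lagrange s c) U G tau Rg t N w /\
    (forall w', discrete_solution V E K s c (lagrange s c) U G tau Rg t N w' -> forall r, r <= T -> w' r = w r) /\
    forall Gam, (forall n theta, (n <= N)%nat -> 0 <= theta <= 1 -> norm (drop_sum V E t (S s) Fs n theta) <= Gam) ->
    forall r, 0 <= r <= T -> norm (minus (w r) (U r)) <= C1 * (Gam + max_step N t ^ S s * (tv + Fb)).
Proof.
assert (HM := as_const _ _ _ _ HE). assert (HC := fp_const _ _ _ _ _ _ HF).
pose proof derivative_bound_nonneg as HFb0. pose proof total_variation_nonneg as Htv.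
destruct Htau as [Htau0 [Htau_ge _]].
destruct (lagrange_bounded s c Hs) as [Lam [HLam HLb]].
destruct (continuous_bounded_01 (interpolation_error s c) (interpolation_error_continuous s c)) as [Wb HWb].
assert (HWb0 : 0 <= Wb). { eapply Rle_trans. 2: apply (HWb 0); lra. apply Rabs_pos. }
assert (Hbeta : 0 < beta) by (unfold beta; lra).
set (B0 := Lam * (C / beta) * INR s * L).
assert (HB0 : 0 <= B0).
{ apply Rmult_le_pos; auto. apply Rmult_le_pos. 2: apply pos_INR. apply Rmult_le_pos; auto. apply Rdiv_le_0_compat; lra. }
(* [eta] makes the recent part of the kernel small, then [kap] damps the older part. Each is at most
   1/(96 (B0 + 1)), so 6 B0 times their sum stays below 1/8. *)
destruct (omega_small beta (/ (96 * (B0 + 1))) Hbeta) as [eta [Heta Heta2]]. apply Rinv_0_lt_compat; lra.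
specialize (Heta2 eta (Rle_refl _)).
destruct (omega_small beta (/ (8 * (B0 + 1))) Hbeta) as [h1 [Hh1 Hh1b]]. apply Rinv_0_lt_compat; lra.
assert (HoT := omega_nonneg beta T).
set (kap := ln (96 * (B0 + 1) * (omega beta T + 1)) / eta).
assert (Harg : 1 <= 96 * (B0 + 1) * (omega beta T + 1)) by nra.
assert (Hkap : 0 <= kap). { apply Rdiv_le_0_compat; auto. rewrite <- ln_1. apply ln_le_compat; lra. }
assert (Hkexp : exp (- kap * eta) = / (96 * (B0 + 1) * (omega beta T + 1))).
{ replace (- kap * eta) with (- ln (96 * (B0 + 1) * (omega beta T + 1))) by (unfold kap; field; lra).
  rewrite exp_Ropp, exp_ln by lra. reflexivity. }
assert (Hsm2 : 6 * B0 * (exp (- kap * eta) * omega beta T + omega beta eta) <= 1 / 8).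
{ assert (H1 : exp (- kap * eta) * omega beta T <= / (96 * (B0 + 1))).
  { rewrite Hkexp. replace (/ (96 * (B0 + 1) * (omega beta T + 1)) * omega beta T) with (/ (96 * (B0 + 1)) * (omega beta T / (omega beta T + 1))) by (field; lra).
    rewrite <- (Rmult_1_r (/ (96 * (B0 + 1)))) at 2. apply Rmult_le_compat_l. left; apply Rinv_0_lt_compat; lra. apply Rle_div_l; lra. }
  apply Rle_trans with (6 * B0 * (2 * / (96 * (B0 + 1)))). apply Rmult_le_compat_l; lra.
  replace (6 * B0 * (2 * / (96 * (B0 + 1)))) with (1 / 8 * (B0 / (B0 + 1))) by (field; lra).
  rewrite <- (Rmult_1_r (1 / 8)) at 2. apply Rmult_le_compat_l. lra. apply Rle_div_l; lra. }
set (A2 := 2 * M ^ 3 * (1 + INR s * Lam)).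
assert (HM3 : 0 <= M ^ 3) by (apply pow_le; lra).
assert (HsL : 0 <= INR s * Lam) by (apply Rmult_le_pos; auto; apply pos_INR).
assert (HA2 : 0 <= A2). { apply Rmult_le_pos; lra. }
set (eT := exp (kap * T)). assert (HeT : 0 < eT) by apply exp_pos.
(* For hm <= 1 the defect is at most hm Cd, with [drop_sum_crude] in place of the sharp bounds. *)
set (Cd := M * Wb * (2 * M * Fb * T) + A2 * tv + Wb * M * Fb).
assert (HWM : 0 <= Wb * M) by (apply Rmult_le_pos; lra).
assert (HCd : 0 <= Cd).
{ unfold Cd. assert (0 <= M * Wb * (2 * M * Fb * T)). { apply Rmult_le_pos. lra. apply Rmult_le_pos; [apply Rmult_le_pos|]; lra. }
  assert (0 <= A2 * tv) by (apply Rmult_le_pos; auto). assert (0 <= Wb * M * Fb) by (apply Rmult_le_pos; auto). lra. }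
assert (HMCd : 0 <= 32 * M * Cd * eT). { apply Rmult_le_pos. apply Rmult_le_pos; lra. lra. }
set (h0 := Rmin (Rmin tau0 (/ (kap + 1))) (Rmin h1 (Rmin 1 (Rg / (32 * M * Cd * eT + 1))))).
assert (Hh0 : 0 < h0 /\ h0 <= tau0 /\ h0 <= / (kap + 1) /\ h0 <= h1 /\ h0 <= 1 /\ h0 <= Rg / (32 * M * Cd * eT + 1)).
{ assert (0 < / (kap + 1)) by (apply Rinv_0_lt_compat; lra). assert (0 < Rg / (32 * M * Cd * eT + 1)) by (apply Rdiv_lt_0_compat; lra).
  pose proof (Rmin_l (Rmin tau0 (/ (kap + 1))) (Rmin h1 (Rmin 1 (Rg / (32 * M * Cd * eT + 1))))).
  pose proof (Rmin_r (Rmin tau0 (/ (kap + 1))) (Rmin h1 (Rmin 1 (Rg / (32 * M * Cd * eT + 1))))).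
  Rmin_bounds tau0 (/ (kap + 1)).
  Rmin_bounds h1 (Rmin 1 (Rg / (32 * M * Cd * eT + 1))).
  Rmin_bounds 1 (Rg / (32 * M * Cd * eT + 1)).
  unfold h0 in *. split. repeat apply Rmin_pos; lra. repeat split; lra. }
destruct Hh0 as [Hh0 [Hb1 [Hb2 [Hb3 [Hb4 Hb5]]]]].
set (C1 := 4 * (M * Wb + A2 + Wb * M + 1) * eT).
assert (HC1 : 0 < C1) by (unfold C1; apply Rmult_lt_0_compat; lra).
exists h0, C1. split; auto. split; auto. split; auto.
intros N t Hmesh Hmax. pose proof Hmesh as [Ht0 [HtN [Hinc _]]].
set (hm := max_step N t) in *. assert (Hhm0 := max_step_nonneg N t). fold hm in Hhm0.
assert (Hhm : forall k, (k < N)%nat -> step t k <= hm) by (intros; now apply step_le_max_step).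
destruct (mesh_variation T tau0 tau xi m ltac:(assumption) Hxi (nm V) (fun mu => F mu s) W Fb HFb HWinc HW N t Hmesh) as [mu [v [Hmu [Hvs Hjump]]]].
set (Fs := fun k => F (mu k) s (t k)).
assert (Hsub : forall k, (k < N)%nat -> forall j, (j < s)%nat -> vderiv (nm V) (t k) (t k + step t k) (F (mu k) j) (F (mu k) (S j))).
{ intros k Hk j Hj. destruct (Hmu k Hk) as [H1 [H2 [H3 _]]]. apply (vderiv_sub (nm V) (sg (mu k)) (sg (S (mu k)))); auto. unfold step; lra. }
assert (Hstep : forall k, (k < N)%nat -> 0 < step t k) by (intros k Hk; unfold step; specialize (Hinc k Hk); lra).
assert (HfFk : forall k, (k < N)%nat -> forall x, 0 <= x <= 1 -> f (t k + x * step t k) = F (mu k) 0%nat (t k + x * step t k)).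
{ intros k Hk x Hx. destruct (Hmu k Hk) as [H1 [H2 [H3 _]]]. apply HfF; auto. pose proof (Hstep k Hk). unfold step in *. nra. }
assert (Hcont : forall k x, (k < N)%nat -> continuous (fun xi => f (t k + clamp01 xi * step t k)) x).
{ intros k x Hk. apply (continuous_ext (fun xi => F (mu k) 0%nat (t k + clamp01 xi * step t k))).
  intros y. symmetry. apply HfFk; auto. apply clamp01_range.
  apply (continuous_clamped_segment (V := nm V) (F (mu k) 0%nat) (F (mu k) 1%nat)). auto. apply Hsub; auto; lia. }
assert (Hrem : forall k x, (k < N)%nat -> 0 <= x <= 1 ->
  norm (minus (minus (f (t k + x * step t k)) (bsum s (fun i => scal (lagrange s c i x) (f (node t c k i)))))
    (scal (step t k ^ s / INR (fact s) * interpolation_error s c x) (Fs k))) <= (1 + INR s * Lam) * (step t k ^ s * v k)).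
{ intros k x Hk Hx. destruct (Hmu k Hk) as [H1 [H2 [H3 [H4 H5]]]].
  rewrite HfFk by auto. rewrite (bsum_ext s _ (fun i => scal (lagrange s c i x) (F (mu k) 0%nat (t k + c i * step t k)))).
  2:{ intros i Hi. unfold node. rewrite HfFk; auto. }
  apply (interpolation_remainder (nm V) s c Lam (F (mu k)) (t k) (step t k) (v k)); auto.
  intros z Hz. apply H5. unfold step in Hz. lra. }
assert (HFsb : forall k, (k < N)%nat -> norm (Fs k) <= Fb).
{ intros k Hk. destruct (Hmu k Hk) as [H1 [H2 [H3 _]]]. apply HFb; auto. specialize (Hinc k Hk). lra. }
assert (Hv0 : forall k, (k < N)%nat -> 0 <= v k) by (intros k Hk; apply (Hmu k Hk)).
assert (Hvar : bsum (pred N) (fun k => norm (minus (Fs (S k)) (Fs k))) <= tv).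
{ eapply Rle_trans. 2: exact Hvs. destruct N as [|N']. apply Rle_refl. rewrite bsum_RS.
  eapply Rle_trans. apply (bsum_le N' _ v). intros k Hk. apply Hjump. lia. specialize (Hv0 N' ltac:(lia)). lra. }
assert (Hmean := interpolation_error_mean s c Hs Hord).
set (d := local_defect V E s c t f).
assert (Hdef := fun Gam => defect_bound V E AE M HE s c Lam Wb Hs Hmean HWb HLam N t hm Hinc Hhm f Fs v Fb tv Hcont Hrem HFsb Hv0 Hvs Gam Hhm0).
fold A2 d in Hdef.
assert (Hd := fun k theta => exact_solution_defect N t k theta Ht0 HtN Hinc Hcont).
set (D := hm * Cd).
assert (Hpow : hm ^ S s <= hm).
{ simpl. rewrite <- (Rmult_1_r hm) at 3. apply Rmult_le_compat_l; auto. rewrite <- (pow1 s). apply pow_incr. lra. }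
assert (Hpow2 : hm ^ s <= hm).
{ destruct s as [|s']. lia. simpl. rewrite <- (Rmult_1_r hm) at 3. apply Rmult_le_compat_l; auto. rewrite <- (pow1 s'). apply pow_incr. lra. }
assert (Hpow0 : 0 <= hm ^ S s) by (apply pow_le; lra).
assert (HcrudeD : forall k theta, (k < N)%nat -> 0 <= theta <= 1 -> norm (defect V E t d k theta) <= D).
{ intros k theta Hk Hth. eapply Rle_trans.
  apply (Hdef (2 * M * Fb * T * hm ^ (S s - 1))); auto.
  intros n th Hn Hth'. apply (drop_sum_crude V E AE M HE t N T Ht0 HtN Hinc (S s) hm Fb Fs Hhm Hhm0 HFsb); auto; try lia; try lra.
  replace (S s - 1)%nat with s by lia. unfold D, Cd.
  assert (0 <= 2 * M * Fb * T). { apply Rmult_le_pos; [apply Rmult_le_pos|]; lra. }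
  assert (M * Wb * (2 * M * Fb * T * hm ^ s) <= hm * (M * Wb * (2 * M * Fb * T))).
  { replace (M * Wb * (2 * M * Fb * T * hm ^ s)) with (hm ^ s * (M * Wb * (2 * M * Fb * T))) by ring. apply Rmult_le_compat_r; auto. apply Rmult_le_pos; lra. }
  assert (A2 * hm ^ S s * tv <= hm * (A2 * tv)).
  { replace (A2 * hm ^ S s * tv) with (hm ^ S s * (A2 * tv)) by ring. apply Rmult_le_compat_r; auto. apply Rmult_le_pos; lra. }
  assert (Wb * M * hm ^ S s * Fb <= hm * (Wb * M * Fb)).
  { replace (Wb * M * hm ^ S s * Fb) with (hm ^ S s * (Wb * M * Fb)) by ring. apply Rmult_le_compat_r; auto. apply Rmult_le_pos; lra. }
  lra. }
assert (HD0 : 0 <= D) by (unfold D; apply Rmult_le_pos; lra).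
destruct (scheme_solvable V E AE M HE K Q alpha C HF Halpha s c (lagrange s c) Lam Hc (fun i r => lagrange_continuous s c i r) HLb HLam
  T U G tau tau0 Rg L HRg HL HLip Htau_ge N t hm Ht0 HtN Hinc Hhm ltac:(lra) d Hd kap eta D HD0 Hkap ltac:(lra) HcrudeD) as [w [Hw1 [Hw2 Hw3]]].
- fold eT. unfold D. assert (hm * (32 * M * Cd * eT + 1) <= Rg). { apply Rle_div_r. lra. lra. } lra.
- assert (hm * (kap + 1) <= 1). { apply Rle_div_r. lra. unfold Rdiv. lra. } lra.
- specialize (Hh1b hm ltac:(lra)). apply Rle_trans with (B0 * / (8 * (B0 + 1))). apply Rmult_le_compat_l; auto.
  replace (B0 * / (8 * (B0 + 1))) with (1 / 8 * (B0 / (B0 + 1))) by (field; lra).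
  rewrite <- (Rmult_1_r (1 / 8)) at 2. apply Rmult_le_compat_l. lra. apply Rle_div_l; lra.
- exact Hsm2.
- exists Fs, w. split; auto. split; auto. split; auto. split; auto.
  intros Gam HGam r Hr.
  assert (HGam0 : 0 <= Gam). { eapply Rle_trans. 2: apply (HGam 0%nat 0); [lia|lra]. apply norm_ge_0. }
  assert (Hfine := Hdef Gam HGam).
  set (D1 := M * Wb * Gam + A2 * hm ^ S s * tv + Wb * M * hm ^ S s * Fb) in Hfine.
  assert (0 <= M * Wb * Gam) by (apply Rmult_le_pos; lra).
  assert (0 <= hm ^ S s * tv) by (apply Rmult_le_pos; lra). assert (0 <= hm ^ S s * Fb) by (apply Rmult_le_pos; lra).
  assert (0 <= A2 * (hm ^ S s * tv)) by (apply Rmult_le_pos; lra). assert (0 <= Wb * M * (hm ^ S s * Fb)) by (apply Rmult_le_pos; lra).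
  assert (HD10 : 0 <= D1) by (unfold D1; lra).
  (* The sharp bound need not lie below the crude one, as [scheme_solvable] demands; the minimum of
     the two does, and it still bounds the defect. *)
  eapply Rle_trans. apply (Hw3 (Rmin D1 D)). apply Rmin_glb; auto. apply Rmin_r.
  intros k theta Hk Hth. apply Rmin_glb; auto. auto.
  apply Rle_trans with (4 * D1 * eT). { apply Rmult_le_compat_r. lra. apply Rmult_le_compat_l. lra. apply Rmin_l. }
  unfold C1. replace (4 * (M * Wb + A2 + Wb * M + 1) * eT * (Gam + hm ^ S s * (tv + Fb))) with
   (4 * ((M * Wb + A2 + Wb * M + 1) * (Gam + hm ^ S s * (tv + Fb))) * eT) by ring.
  apply Rmult_le_compat_r. lra. apply Rmult_le_compat_l. lra. unfold D1.
  set (x1 := hm ^ S s * tv) in *. set (x2 := hm ^ S s * Fb) in *.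
  replace (A2 * hm ^ S s * tv) with (A2 * x1) by (unfold x1; ring). replace (Wb * M * hm ^ S s * Fb) with (Wb * M * x2) by (unfold x2; ring).
  replace (hm ^ S s * (tv + Fb)) with (x1 + x2) by (unfold x1, x2; ring).
  assert (0 <= A2 * Gam) by (apply Rmult_le_pos; lra). assert (0 <= A2 * x2) by (apply Rmult_le_pos; lra).
  assert (0 <= Wb * M * x1) by (apply Rmult_le_pos; lra).
  lra.
Qed.
End Convergence.

(** * The error estimate for the method *)

Lemma finite_family_bound (P : nat -> R -> Prop) (f : nat -> R -> R) m :
  (forall mu, (mu <= m)%nat -> exists B, forall t, P mu t -> f mu t <= B) ->
  exists B, forall mu t, (mu <= m)%nat -> P mu t -> f mu t <= B.
Proof.
induction m as [|m IH]; intros H.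
- destruct (H 0%nat (le_n _)) as [B HB]. exists B. intros mu t Hmu. replace mu with 0%nat by lia. apply HB.
- destruct IH as [B1 HB1]. intros; apply H; lia. destruct (H (S m) (le_n _)) as [B2 HB2].
  exists (Rmax B1 B2). Rmax_bounds B1 B2. intros mu t Hmu Ht.
  destruct (Nat.eq_dec mu (S m)) as [->|Hne]. specialize (HB2 t Ht). lra. specialize (HB1 mu t ltac:(lia) Ht). lra.
Qed.

(** [real] returns 0 at the infinities, so a finite upper bound must be known before the supremum
    can be used as a bound. *)
Lemma Lub_real_upper (P : R -> Prop) y B : P y -> (forall z, P z -> z <= B) -> forall z, P z -> z <= real (Lub_Rbar P).
Proof.
intros Hy HB z Hz. destruct (Lub_Rbar_correct P) as [H1 H2].
assert (Hle : Rbar_le (Lub_Rbar P) B) by (apply H2; intros x Hx; exact (HB x Hx)).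
specialize (H1 z Hz). destruct (Lub_Rbar P) as [l| |]; simpl in *; auto; contradiction.
Qed.

Lemma sum_n_nonneg (f : nat -> R) m : (forall k, (k <= m)%nat -> 0 <= f k) -> 0 <= sum_n f m.
Proof.
intros H. change m with (pred (S m)). rewrite bsum_sum_n by lia. apply bsum_nonneg. intros k Hk. apply H. lia.
Qed.

Lemma vderiv_bounded (V : NormedModule R_AbsRing) a b (f f' : R -> V) : a < b -> vderiv V a b f f' ->
  exists B, forall t, a <= t <= b -> norm (f t) <= B.
Proof.
intros Hab Hf. destruct (bounded_continuity (V := V) (fun x => f (a + clamp01 x * (b - a))) 0 1) as [B HB].
{ intros x _. apply (continuous_clamped_segment f f'). lra. now replace (a + (b - a)) with b by ring. }
exists B. intros t Ht. set (x := (t - a) / (b - a)).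
assert (Hx : 0 <= x <= 1). { split. apply Rdiv_le_0_compat; lra. apply Rle_div_l; lra. }
specialize (HB x Hx). rewrite clamp01_id in HB by auto. replace (a + x * (b - a)) with t in HB by (unfold x; field; lra). lra.
Qed.

Theorem theorem5p2
  (X : CompleteNormedModule C_AbsRing) (T : R) (hT : 0 < T)
  (A : unbounded_operator X) (eA : R -> X -> X)
  (hsect : sectorial A)
  (hdense : dense_dom A)
  (hspec : forall lam : C, spectrum A lam -> 0 < Re lam)
  (hgen : semigroup_generated_by_opp A eA)
  (alpha : R) (halpha : 0 <= alpha < 1)
  (tau : R -> R) (tau0 : R) (htau : admissible_delay tau tau0)
  (phi : R -> X) (hphi : forall t, t <= 0 -> V_dom eA alpha (phi t))
  (g : R -> X -> X -> X) (u : R -> X)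
  (hu_past : forall t, t <= 0 -> u t = phi t)
  (hu_V : forall t, 0 <= t <= T -> V_dom eA alpha (u t))
  (hu_voc : forall r t, 0 <= r -> r <= t -> t <= T ->
     is_RInt (V := realify X)
       (fun sigma => eA (t - sigma) (g sigma (u sigma) (u (sigma - tau sigma))))
       r t (minus (u t) (eA (t - r) (u r))))
  (Rg L : R) (hRg : 0 < Rg)
  (hLip : forall (t : R) (v1 v2 w1 w2 : X), 0 <= t <= T ->
     V_dom eA alpha v1 -> V_dom eA alpha v2 ->
     V_dom eA alpha w1 -> V_dom eA alpha w2 ->
     V_norm eA alpha (minus v1 (u t)) <= Rg ->
     V_norm eA alpha (minus v2 (u t)) <= Rg ->
     V_norm eA alpha (minus w1 (u (t - tau t))) <= Rg ->
     V_norm eA alpha (minus w2 (u (t - tau t))) <= Rg ->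
     norm (minus (g t v1 w1) (g t v2 w2))
       <= L * (V_norm eA alpha (minus v1 v2) + V_norm eA alpha (minus w1 w2)))
  (xi : nat -> R) (m : nat) (hxi : discontinuity_points tau T xi m)
  (s : nat) (hs : (1 <= s)%nat) (c : nat -> R)
  (hc01 : forall i, (i < s)%nat -> 0 <= c i <= 1)
  (hcdist : forall i j, (i < s)%nat -> (j < s)%nat -> i <> j -> c i <> c j)
  (hord : sum_n (fun i => RInt (lagrange s c i) 0 1 * c i ^ s) (pred s)
            = / INR (s + 1))
  (rho : R) (hrho : 1 < rho)
  (* fd mu k is the k-th derivative of f on the (mu+1)-st segment *)
  (fd : nat -> nat -> R -> X)
  (hf0 : forall mu t, (mu <= m)%nat ->
     seg T xi m mu <= t <= seg T xi m (S mu) ->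
     fd mu 0%nat t = g t (u t) (u (t - tau t)))
  (hfder : forall mu k, (mu <= m)%nat -> (k <= s)%nat ->
     V_derivative eA alpha (seg T xi m mu) (seg T xi m (S mu))
       (fd mu k) (fd mu (S k)))
  (hfLinfty : forall mu, (mu <= m)%nat ->
     V_Linfty eA alpha (seg T xi m mu) (seg T xi m (S mu)) (fd mu s))
  (hfL1 : forall mu, (mu <= m)%nat ->
     V_L1 eA alpha (seg T xi m mu) (seg T xi m (S mu)) (fd mu (s + 1)%nat)) :
  exists h0 R0 C : R, 0 < h0 /\ 0 < R0 /\ 0 < C /\
    let mesh := fun (N : nat) (t : nat -> R) =>
      admissible_mesh T xi m N t /\ step_ratio_le rho N t /\
      max_step N t <= h0 in
    let CS_range := fun (N : nat) (t : nat -> R) (CS : R) =>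
      1 <= CS <= rho * ln (T / min_step N t) + 2 in
    let numerical := fun (N : nat) (t : nat -> R)
        (Wn : nat -> X) (Ws : nat -> nat -> X) (W : R -> X) =>
      ERKCC_solution eA g tau phi s c N t Wn Ws W /\
      stages_near eA alpha u s c N t R0 Ws in
    let estimate := fun (N : nat) (t : nat -> R) (CS : R) =>
      exists Wn Ws W, numerical N t Wn Ws W /\
        (forall Wn' Ws' W', numerical N t Wn' Ws' W' ->
           (forall n i, (n < N)%nat -> (i < s)%nat -> Ws' n i = Ws n i) /\
           (forall r, r <= T -> W' r = W r)) /\
        forall r, 0 <= r <= T ->
          V_dom eA alpha (W r) /\
          V_norm eA alpha (minus (W r) (u r))
            <= C * CS * max_step N t ^ (s + 1) *
               (pw_integral T xi m
                  (fun mu sigma => V_norm eA alpha (fd mu (s + 1)%nat sigma))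
                + pw_sup T xi m
                    (fun mu sigma => V_norm eA alpha (fd mu s sigma))) in
    (forall N t, mesh N t ->
       exists CS, CS_range N t CS /\ estimate N t CS) /\
    (exists CS, forall N t, mesh N t -> constant_steps N t ->
       CS_range N t CS /\ estimate N t CS) /\
    (hilbert_setting A ->
       exists CS, forall N t, mesh N t ->
         CS_range N t CS /\ estimate N t CS).
Proof.
destruct (analytic_semigroup_realify X A eA hsect hspec hgen) as [M HE].
destruct (neg_power_fractional X eA _ M alpha HE halpha) as [Q [Cf HF]].
set (V := nm (realify X)). set (K := neg_power X eA alpha : V -> V).
assert (HM := as_const _ _ _ _ HE).
pose proof htau as [Htau0 [Htau_ge _]].
destruct (coord_exists X eA alpha (fun r => r <= T) u) as [U HU].
{ intros r Hr. destruct (Rle_dec r 0) as [h|h]. rewrite hu_past by auto. now apply hphi. apply hu_V. lra. }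
assert (Hnm := V_norm_minus_coord X eA alpha Q Cf HF). assert (Hvd := V_dom_coord X eA alpha).
set (G := coord_source X eA alpha g).
(* [Rmax L 0] makes the Lipschitz constant nonnegative, since [L] carries no sign condition. *)
assert (HLip : forall r v1 v2 w1 w2, 0 <= r <= T ->
  norm (minus v1 (U r)) <= Rg -> norm (minus v2 (U r)) <= Rg ->
  norm (minus w1 (U (r - tau r))) <= Rg -> norm (minus w2 (U (r - tau r))) <= Rg ->
  norm (minus (G r v1 w1 : V) (G r v2 w2)) <= Rmax L 0 * (norm (minus v1 v2) + norm (minus w1 w2))).
{ intros r v1 v2 w1 w2 Hr H1 H2 H3 H4. pose proof (Htau_ge r ltac:(lra)).
  rewrite <- (Hnm v1), HU in H1 by lra. rewrite <- (Hnm v2), HU in H2 by lra. rewrite <- (Hnm w1), HU in H3 by lra. rewrite <- (Hnm w2), HU in H4 by lra.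
  eapply Rle_trans. apply (hLip r (K v1) (K v2) (K w1) (K w2)); auto; apply Hvd.
  rewrite !Hnm. apply Rmult_le_compat_r. apply Rplus_le_le_0_compat; apply norm_ge_0. apply Rmax_l. }
assert (Hseg : forall mu, (mu <= m)%nat -> seg T xi m mu < seg T xi m (S mu)) by (intros; now apply (seg_increasing T tau0 tau xi m htau hxi)).
destruct (choice (fun (q : nat * nat) (Fc : R -> V) => (fst q <= m)%nat -> (snd q <= S s)%nat ->
   forall r, seg T xi m (fst q) <= r <= seg T xi m (S (fst q)) -> K (Fc r) = fd (fst q) (snd q) r)) as [Fq HFq].
{ intros [mu k]. destruct (classic ((mu <= m)%nat /\ (k <= S s)%nat)) as [[h1 h2]|h].
  2: exists (fun _ => zero); intros; tauto.
  destruct (coord_exists X eA alpha (fun r => seg T xi m mu <= r <= seg T xi m (S mu)) (fd mu k)) as [Fc HFc].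
  { intros r Hr. destruct (Nat.eq_dec k (S s)) as [->|Hne]. apply (hfder mu s h1 (le_n _) r Hr). apply (hfder mu k h1 ltac:(lia) r Hr). }
  exists Fc. auto. }
set (F := fun mu k => Fq (mu, k)).
assert (HFK : forall mu k, (mu <= m)%nat -> (k <= S s)%nat -> forall r, seg T xi m mu <= r <= seg T xi m (S mu) -> K (F mu k r) = fd mu k r).
{ intros mu k h1 h2. exact (HFq (mu, k) h1 h2). }
assert (HFd : forall mu k, (mu <= m)%nat -> (k <= s)%nat -> vderiv V (seg T xi m mu) (seg T xi m (S mu)) (F mu k) (F mu (S k))).
{ intros mu k h1 h2. apply (V_derivative_coord X eA alpha Q Cf HF _ _ (fd mu k) (fd mu (S k))). apply HFK; auto; lia. apply HFK; auto; lia. now apply hfder. }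
assert (Hcover : forall r, 0 <= r <= T -> exists mu, (mu <= m)%nat /\ seg T xi m mu <= r <= seg T xi m (S mu)).
{ intros r Hr. assert (H : forall n, (n <= m)%nat -> (exists mu, (mu <= n)%nat /\ seg T xi m mu <= r <= seg T xi m (S mu)) \/ seg T xi m (S n) < r).
  { induction n as [|n IH]; intros Hn.
    - destruct (Rlt_dec (seg T xi m 1) r) as [h|h]. now right. left. exists 0%nat. rewrite (seg_0 T tau xi m hxi). split; auto. lra.
    - destruct (IH ltac:(lia)) as [[mu [H1 H2]]|H1]. left. exists mu. split; auto; lia.
      destruct (Rlt_dec (seg T xi m (S (S n))) r) as [h|h]. now right. left. exists (S n). split; auto. lra. }
  destruct (H m (le_n _)) as [H1|H1]; auto. rewrite seg_last in H1. lra. }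
destruct (coord_exists X eA alpha (fun r => 0 <= r <= T) (fun r => g r (u r) (u (r - tau r)))) as [f Hf].
{ intros r Hr. destruct (Hcover r Hr) as [mu [H1 H2]]. rewrite <- (hf0 mu r H1 H2), <- (HFK mu 0%nat H1 ltac:(lia) r H2). apply Hvd. }
assert (HfF : forall mu r, (mu <= m)%nat -> seg T xi m mu <= r <= seg T xi m (S mu) -> f r = F mu 0%nat r).
{ intros mu r Hmu Hr. apply (coord_inj X eA alpha Q Cf HF). 
  pose proof (seg_range T tau0 tau xi m htau hxi mu ltac:(lia)). pose proof (seg_range T tau0 tau xi m htau hxi (S mu) ltac:(lia)).
  etransitivity. apply Hf; lra. rewrite <- (hf0 mu r Hmu Hr). symmetry. apply HFK; auto; lia. }
set (Int := pw_integral T xi m (fun mu sigma => V_norm eA alpha (fd mu (s + 1)%nat sigma))).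
set (Sup := pw_sup T xi m (fun mu sigma => V_norm eA alpha (fd mu s sigma))).
assert (HInt : 0 <= Int). { apply sum_n_nonneg. intros mu Hmu. apply integral_on_ge0. intros r. apply norm_ge_0. }
assert (Hnorm : forall mu k, (mu <= m)%nat -> (k <= S s)%nat -> forall r, seg T xi m mu <= r <= seg T xi m (S mu) -> V_norm eA alpha (fd mu k r) = norm (F mu k r)).
{ intros mu k H1 H2 r Hr. rewrite <- (HFK mu k H1 H2 r Hr). apply (V_norm_coord X eA alpha Q Cf HF). }
(* The supremum is finite: f^(s) is differentiable, hence bounded, on each of finitely many closed
   segments. *)
assert (HSup : forall mu r, (mu <= m)%nat -> seg T xi m mu <= r <= seg T xi m (S mu) -> norm (F mu s r) <= Sup).
{ destruct (finite_family_bound (fun mu r => seg T xi m mu <= r <= seg T xi m (S mu)) (fun mu r => norm (F mu s r)) m) as [B HB].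
  { intros mu Hmu. apply (vderiv_bounded V _ _ (F mu s) (F mu (S s)) (Hseg mu Hmu) (HFd mu s Hmu (le_n _))). }
  intros mu r Hmu Hr. rewrite <- (Hnorm mu s Hmu ltac:(lia) r Hr).
  apply (Lub_real_upper _ (V_norm eA alpha (fd mu s r)) B).
  - exists mu, r. auto.
  - intros z [nu [q [H1 [H2 ->]]]]. rewrite (Hnorm nu s H1 ltac:(lia) q H2). now apply HB.
  - exists mu, r. auto. }
assert (HSup0 : 0 <= Sup).
{ eapply Rle_trans. 2: apply (HSup 0%nat (seg T xi m 0)); [lia|]. apply norm_ge_0. specialize (Hseg 0%nat ltac:(lia)). lra. }
(* If the right-hand side vanishes then so does [f^(s)], hence the variation can be taken to be zero. *)
assert (HWex : exists W : nat -> R -> R, (forall mu y z, y <= z -> W mu y <= W mu z) /\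
  (forall mu y z, (mu <= m)%nat -> seg T xi m mu <= y <= z -> z <= seg T xi m (S mu) -> norm (minus (F mu s z) (F mu s y)) <= W mu z - W mu y) /\
  exists Cv, 0 <= Cv /\ total_variation T xi m W Sup <= Cv * (Int + Sup)).
{ destruct (Req_dec Sup 0) as [h|h].
  - exists (fun _ _ => 0). split. intros; lra. split.
    + intros mu y z Hmu Hy Hz. eapply Rle_trans. apply norm_minus_le.
      pose proof (HSup mu y Hmu ltac:(lra)). pose proof (HSup mu z Hmu ltac:(lra)). lra.
    + exists 0. split. lra. unfold total_variation. rewrite h. rewrite bsum_const. right. ring.
  - destruct (choice (fun mu (W : R -> R) => (mu <= m)%nat -> (forall x y, x <= y -> W x <= W y) /\
      forall r, seg T xi m mu <= r <= seg T xi m (S mu) -> exists d, 0 < d /\ forall y z, r - d < y -> y <= r -> r <= z -> z < r + d ->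
        (V_norm eA alpha (fd mu (s + 1)%nat r) + 1) * (z - y) <= W z - W y)) as [W HW].
    { intros mu. destruct (le_dec mu m) as [hm|hm]. 2: exists (fun _ => 0); intros; contradiction.
      destruct (integrable_majorant (seg T xi m mu) (seg T xi m (S mu)) (fun r => V_norm eA alpha (fd mu (s + 1)%nat r))) as [W [W1 W2]].
      intros r. apply norm_ge_0. apply (hfL1 mu hm). exists W. auto. }
    exists (fun mu r => if le_dec mu m then W mu r else 0). split; [|split].
    + intros mu y z Hyz. destruct (le_dec mu m) as [hm|hm]. now apply HW. lra.
    + intros mu y z Hmu Hy Hz. destruct (le_dec mu m) as [hm|hm]; [|contradiction].
      apply (straddle_increment V (seg T xi m mu) (seg T xi m (S mu)) (F mu s) (F mu (S s)) (W mu) y z); auto.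
      intros r Hr. destruct (proj2 (HW mu hm) r Hr) as [d [Hd Hd2]]. exists d. split; auto.
      rewrite Nat.add_1_r in Hd2. rewrite (Hnorm mu (S s) hm ltac:(lia) r Hr) in Hd2. exact Hd2.
    (* [W] comes from open coverings, and its increase is not compared with the integral itself. As
       f is fixed before the mesh, the ratio to the positive number Int + Sup is an admissible
       constant. *)
    + set (tv := total_variation T xi m _ Sup). exists (Rabs tv / (Int + Sup)). split.
      apply Rdiv_le_0_compat. apply Rabs_pos. lra.
      replace (Rabs tv / (Int + Sup) * (Int + Sup)) with (Rabs tv) by (field; lra). apply Rle_abs. }
destruct HWex as [W [HWinc [HW [Cv [HCv Htv]]]]].
assert (Hvoc : forall r q, 0 <= r -> r <= q -> q <= T ->
  is_RInt (V := V) (fun sigma => eA (q - sigma) (G sigma (U sigma) (U (sigma - tau sigma)))) r q (minus (K (U q) : V) (eA (q - r) (K (U r)) : V))).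
{ intros r q H1 H2 H3. rewrite !HU by lra.
  apply (is_RInt_ext (V := V) (fun sigma => eA (q - sigma) (g sigma (u sigma) (u (sigma - tau sigma))))).
  - intros sigma Hsig. rewrite Rmin_left, Rmax_right in Hsig by lra. unfold G, coord_source.
    pose proof (Htau_ge sigma ltac:(lra)). rewrite !HU by lra. reflexivity.
  - exact (hu_voc r q H1 H2 H3). }
destruct (scheme_error (realify X) eA _ M HE K Q alpha Cf HF halpha s c hs hc01 hcdist hord T tau0 tau xi m hT htau hxi U G Rg (Rmax L 0) hRg
  (Rmax_r L 0) HLip f F W Sup) as [h0 [C1 [Hh0 [HC1 [Hh0t Hmain]]]]]; auto.
{ intros r Hr. unfold G, coord_source. pose proof (Htau_ge r ltac:(lra)). rewrite !HU by lra. symmetry. now apply Hf. }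
{ intros mu k H1 H2. apply HFd; auto; lia. }
set (tv := total_variation T xi m W Sup) in *. set (Sm := Int + Sup) in *.
assert (HSupS : Sup <= Sm) by (unfold Sm; lra).
assert (Htv0 : 0 <= tv) by (apply (total_variation_nonneg (realify X) s hs T tau0 tau xi m htau hxi F W Sup); auto).
(* The first term serves the logarithmic bound, the second the partial sums of Abel summation; the
   third collects their spare unit and the direct contribution of tv + Sup, which is at most (1 +
   Cv)(Int + Sup). *)
set (Cg := 2 * M * (1 + rho) + 18 * M * (1 + Cv) + 2 * (1 + Cv)).
assert (HCg : 0 < Cg). { unfold Cg. assert (0 < M * (1 + rho)) by (apply Rmult_lt_0_compat; lra). assert (0 <= M * (1 + Cv)) by (apply Rmult_le_pos; lra). lra. }
exists h0, Rg, (C1 * Cg). split; auto. split; auto. split. apply Rmult_lt_0_compat; auto.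
intros mesh CS_range numerical estimate.
assert (Hlnpos : forall N t, admissible_mesh T xi m N t -> 0 < min_step N t /\ min_step N t <= T /\ 0 <= ln (T / min_step N t)).
{ intros N t [Ht0 [HtN [Hinc _]]]. assert (HN : (0 < N)%nat). { destruct N; [|lia]. lra. }
  assert (H1 := min_step_positive N t HN Hinc). assert (H2 := min_step_le_step N t 0 HN).
  assert (t 1%nat <= T) by (rewrite <- HtN; mesh_order t N).
  assert (H3 : min_step N t <= T) by (unfold step in H2; lra).
  split; auto. split; auto. rewrite <- ln_1. apply ln_le_compat. lra. apply Rle_div_r; lra. }
(* The logarithmic bound and the Abel bound both fit under one right-hand side, so the estimate is
   derived from the drop sums only once. *)
assert (Hest : forall N t CS, mesh N t -> 1 <= CS ->
  (forall Fs : nat -> V, (forall k, (k < N)%nat -> norm (Fs k) <= Sup) ->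
     bsum (pred N) (fun k => norm (minus (Fs (S k)) (Fs k))) <= tv ->
     forall n theta, (n <= N)%nat -> 0 <= theta <= 1 ->
       norm (drop_sum (realify X) eA t (S s) Fs n theta) <= max_step N t ^ S s * (2 * M * (1 + rho) * CS * Sup + (18 * M + 1) * (Sup + tv))) ->
  estimate N t CS).
{ intros N t CS [Hmesh [Hratio Hmax]] HCS Hdrop.
  pose proof Hmesh as [Ht0 [HtN [Hinc _]]].
  destruct (Hmain N t Hmesh Hmax) as [Fs [w [HFs [Hvar [Hw1 [Hw2 Hw3]]]]]].
  assert (Hhm : forall k, (k < N)%nat -> step t k <= tau0).
  { intros k Hk. pose proof (step_le_max_step N t k Hk). lra. }
  destruct (solution_method X eA alpha Q Cf HF g tau tau0 T phi u U s c Rg hs hc01 HU hu_past Htau_ge N t Ht0 HtN Hinc Hhm w Hw1) as [Hm1 Hm2].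
  exists (fun n => K (w (t n))), (fun n i => K (w (node t c n i))), (fun r => K (w r)). split. split; assumption. split.
  - intros Wn' Ws' W' [Hn1 Hn2].
    destruct (method_solution X eA alpha _ M Q Cf HE HF halpha g tau tau0 T phi u U s c Rg hs hc01 HU hu_past Htau_ge N t Ht0 HtN Hinc Hhm Wn' Ws' W' Hn1 Hn2) as [w' [Hw'1 [Hw'2 Hw'3]]].
    assert (Heq := Hw2 w' Hw'1). split.
    + intros n i Hn Hi. rewrite Hw'3 by auto. apply (f_equal K). apply Heq.
      specialize (hc01 i Hi). specialize (Hinc n Hn). assert (t (S n) <= T) by (rewrite <- HtN; apply (mesh_le t N); auto; apply Hmesh).
      unfold node, step. nra.
    + intros r Hr. rewrite Hw'2 by auto. apply (f_equal K). now apply Heq.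
  - intros r Hr. split. apply Hvd. rewrite <- HU by lra. etransitivity. right. apply Hnm.
    assert (H := Hw3 _ (Hdrop Fs HFs Hvar) r Hr). eapply Rle_trans. exact H.
    assert (Hm0 := max_step_nonneg N t). rewrite Nat.add_1_r.
    set (hp := max_step N t ^ S s). assert (Hhp : 0 <= hp) by (apply pow_le; lra).
    replace (C1 * Cg * CS * hp * Sm) with (C1 * (hp * (Cg * CS * Sm))) by ring. apply Rmult_le_compat_l. lra.
    rewrite <- Rmult_plus_distr_l. apply Rmult_le_compat_l; auto.
    assert (H1 : 2 * M * (1 + rho) * CS * Sup <= 2 * M * (1 + rho) * CS * Sm).
    { apply Rmult_le_compat_l; auto. apply Rmult_le_pos. apply Rmult_le_pos; lra. lra. }
    assert (H2 : (18 * M + 1) * (Sup + tv) <= (18 * M + 1) * ((1 + Cv) * Sm)) by (apply Rmult_le_compat_l; lra).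
    assert (H3 : (18 * M + 2) * ((1 + Cv) * Sm) <= (18 * M + 2) * ((1 + Cv) * Sm) * CS).
    { rewrite <- (Rmult_1_r ((18 * M + 2) * ((1 + Cv) * Sm))) at 1. apply Rmult_le_compat_l; auto. apply Rmult_le_pos; lra. }
    unfold Cg. lra. }
assert (Habel : forall N t B, mesh N t -> 0 <= B <= (18 * M + 1) ->
  (forall k n theta (x : V), (k <= n)%nat -> (n <= N)%nat -> 0 <= theta <= 1 ->
     norm (bsum k (fun l => scal (step t l ^ S s) (semigroup_drop (realify X) eA t n theta l x))) <= max_step N t ^ S s * B * norm x) ->
  CS_range N t 1 /\ estimate N t 1).
{ intros N t B Hm HB HP. pose proof Hm as [Hmesh _]. destruct (Hlnpos N t Hmesh) as [_ [_ Hl]]. split.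
  { unfold CS_range. assert (0 <= rho * ln (T / min_step N t)) by (apply Rmult_le_pos; lra). lra. }
  apply Hest; auto. lra. intros Fs HFs Hvar n theta Hn Hth.
  assert (Hm0 := max_step_nonneg N t). assert (Hhp : 0 <= max_step N t ^ S s) by (apply pow_le; lra).
  eapply Rle_trans. apply (drop_sum_abel (realify X) eA _ M HE t N (proj1 (proj2 (proj2 Hmesh))) (S s) Sup Fs HFs n theta (max_step N t ^ S s * B) tv Hn (proj1 Hth)); auto.
  - apply Rmult_le_pos; lra.
  - eapply Rle_trans. 2: exact Hvar. apply bsum_le_more. lia. intros; apply norm_ge_0.
  - rewrite Rmult_assoc. apply Rmult_le_compat_l; auto.
    assert (0 <= 2 * M * (1 + rho) * 1 * Sup). { apply Rmult_le_pos; auto. rewrite Rmult_1_r. apply Rmult_le_pos; lra. }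
    assert (B * (Sup + tv) <= (18 * M + 1) * (Sup + tv)) by (apply Rmult_le_compat_r; lra). lra. }
split; [|split].
- intros N t Hm. pose proof Hm as [Hmesh [Hratio Hmax]]. pose proof Hmesh as [Ht0 [HtN [Hinc _]]].
  destruct (Hlnpos N t Hmesh) as [Hl1 [Hl2 Hl3]].
  assert (Hrl : 0 <= rho * ln (T / min_step N t)) by (apply Rmult_le_pos; lra).
  (* The upper end of the admissible range absorbs the full logarithm: with l = rho ln(T / hmin),
     the factor of [drop_sum_log] satisfies l + rho + 1 <= (1 + rho)(l + 2). *)
  exists (rho * ln (T / min_step N t) + 2). split. split; lra.
  apply Hest; auto. lra. intros Fs HFs Hvar n theta Hn Hth.
  assert (Hm0 := max_step_nonneg N t). assert (Hhp : 0 <= max_step N t ^ S s) by (apply pow_le; lra).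
  eapply Rle_trans. apply (drop_sum_log (realify X) eA _ M HE t N T Ht0 HtN Hinc (S s) (max_step N t) Sup Fs (step_le_max_step N t) Hm0 HFs n theta rho (min_step N t) Hn Hth HSup0); auto.
  lra. apply min_step_le_step.
  set (l := rho * ln (T / min_step N t)) in *.
  replace (2 * M * Sup * max_step N t ^ S s * (l + rho + 1)) with (max_step N t ^ S s * (2 * M * Sup * (l + rho + 1))) by ring.
  apply Rmult_le_compat_l; auto.
  assert (0 <= (18 * M + 1) * (Sup + tv)) by (apply Rmult_le_pos; lra).
  assert (0 <= 2 * M * Sup) by (apply Rmult_le_pos; lra).
  assert (2 * M * Sup * (l + rho + 1) <= 2 * M * Sup * ((1 + rho) * (l + 2))).
  { apply Rmult_le_compat_l; auto. assert (0 <= rho * l) by (apply Rmult_le_pos; lra). lra. }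
  lra.
(* The value 1 is admissible because the logarithm is nonnegative; the factor 18 M of the partial
   sums goes into the constant [C]. *)
- exists 1. intros N t Hm Hconst. apply (Habel N t (18 * M)); auto. lra.
  intros k n theta x Hk Hn Hth. pose proof Hm as [[Ht0 [HtN [Hinc _]]] _].
  assert (HN : (0 < N)%nat). { destruct N; [|lia]. lra. }
  assert (Hst : 0 < step t 0) by (unfold step; specialize (Hinc 0%nat HN); lra).
  eapply Rle_trans. apply (constant_step_partial_sums (realify X) eA _ M HE t N Ht0 Hinc (S s) (step t 0) n k theta x); auto.
  apply Rmult_le_compat_r. apply norm_ge_0. rewrite Rmult_comm. apply Rmult_le_compat_r. lra. apply pow_incr.
  pose proof (step_le_max_step N t 0 HN). lra.
(* Here the partial sums are bounded by the largest h^(s+1) itself, so B = 1; positivity of the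
   differences makes varying steps harmless. *)
- intros [ip [Hip [_ [_ [Hsa _]]]]]. exists 1. intros N t Hm. apply (Habel N t 1); auto. lra.
  intros k n theta x Hk Hn Hth. pose proof Hm as [[Ht0 [HtN [Hinc _]]] _].
  assert (HN : (0 < N)%nat). { destruct N; [|lia]. lra. }
  assert (Hst : forall l, (l < N)%nat -> 0 < step t l <= max_step N t).
  { intros l Hl. specialize (Hinc l Hl). pose proof (step_le_max_step N t l Hl). unfold step in *. lra. }
  rewrite Rmult_1_r.
  apply (symmetric_partial_sums (realify X) eA _ M HE t N Hinc (real_product X ip) (real_product_plus X ip Hip) (real_product_scal X ip Hip)
    (real_product_sym X ip Hip) (real_product_norm X ip Hip) (fun r x y => semigroup_symmetric X A eA M HE hgen ip Hip Hsa r x y)); auto.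
  + apply pow_lt. pose proof (Hst 0%nat HN). lra.
  + intros l Hl. destruct (Hst l Hl). split. apply pow_le; lra. apply pow_incr; lra.
Qed.
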